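(* Consider the VRJP on $\mathcal G=(V,E,W)$ started from $a\in V$ with initial local time $1$ at every vertex. For any $s\neq0$, with $\tau(\gamma)=\inf\{t>0:L_a(t)\ge\gamma\}$, for any suitable function $g$, $$\mathbb E^{W}_{a,1}\big(g(L(\tau(\cosh s)))\big)=\big\langle g(\theta_sz)\big\rangle_{W,\Phi_a=0},$$ where $\theta_sz=(z_i\cosh s+x_i\sinh s)_{i\in V}$.
   Context: **Graph.** $\mathcal G=(V,E)$ is a finite connected non-oriented graph with weights $W_{i,j}=W_{j,i}>0$ on edges and $W_{i,j}=0$ otherwise. **VRJP.** The Vertex Reinforced Jump Process on $\mathcal G$ with initial local times $1$ is the continuous-time jump process $Y$ which, being at $i$ at time $t$, jumps to $j$ at rate $W_{i,j}L_j(t)$, where $L_j(t)=1+\int_0^t\mathds 1_{Y_r=j}dr$. $\mathbb E_{a,1}^{W}$ is the expectation for the process started at $a$; $L(t)=(L_i(t))_{i\in V}$. **Superfunctions and integration.** To each vertex $i$ are attached real variables $x_i,y_i$ and Grassmann variables $\xi_i,\eta_i$ (all Grassmann variables anticommute). A superfunction is a polynomial in the Grassmann variables with smooth coefficients in the real variables; a smooth function of even superfunctions is defined by Taylor expansion in the nilpotent parts. Set $z_i=\sqrt{1+x_i^2+y_i^2+2\xi_i\eta_i}=\sqrt{1+x_i^2+y_i^2}+\xi_i\eta_i/\sqrt{1+x_i^2+y_i^2}$. Integration against $\prod_idx_idy_id\xi_id\eta_i$ is Berezin integration followed by Lebesgue integration, with sign normalized so that $\int e^{-\sum_{i,j}\xi_iA_{ij}\eta_j}\prod_id\xi_id\eta_i=\det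 A$. **$H^{2|2}$ field.** $\Phi_i=(x_i,y_i,z_i,\xi_i,\eta_i)$, $\Phi_i\cdot\Phi_j=x_ix_j+y_iy_j-z_iz_j+\xi_i\eta_j+\xi_j\eta_i$, and $$\langle F\rangle_{W,\Phi_a=0}=\int F\,\mathds 1_{\Phi_a=0}\,e^{\sum_{\{i,j\}\in E}W_{i,j}(\Phi_i\cdot\Phi_j+1)}\prod_{i\in V\setminus\{a\}}\frac{dx_idy_id\xi_id\eta_i}{2\pi z_i},$$ where $\Phi_a=0$ means that the variables at $a$ are set to $(x,y,z,\xi,\eta)=(0,0,1,0,0)$. **Suitable functions.** ''Suitable'' $g$ means a smooth function of $|V|$ real variables decaying fast enough that both sides are well defined; the class includes the Laplace-transform test functions $g(\ell)=e^{-\sum_{i\in V}k_i\ell_i}$, $k_i>0$, which suffice for the paper's purposes. *)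

(* Defs.v *)
From HB Require Import structures.
From mathcomp Require Import all_boot all_order all_algebra ring.

Set Implicit Arguments.
Unset Strict Implicit.
Unset Printing Implicit Defensive.

Import Order.TTheory GRing.Theory Num.Theory.
Local Open Scope ring_scope.

(** * Grassmann algebras *)

(* An element is the family of its coefficients on the monomials e_A, A a set
   of generators, where e_A is the product of the elements of A in the order
   of [enum_rank]. *)
Record grassmann (R : comNzRingType) (G : finType) :=
  Grassmann { gcoef : {ffun {set G} -> R} }.
Arguments Grassmann {R G}.

Section GrassmannAlgebra.
Context (R : comNzRingType) (G : finType).
Local Notation gr := (grassmann R G).
Implicit Types (A B C S : {set G}) (u v w : gr) (x : G).

HB.instance Definition _ := [isNew for @gcoef R G].
HB.instance Definition _ := [Choice of gr by <:].

Definition inversions A B : nat :=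
  (\sum_(x in A) \sum_(y in B) (enum_rank y < enum_rank x))%N.

Definition grassmann_zero : gr := Grassmann 0.
Definition grassmann_add u v : gr := Grassmann (gcoef u + gcoef v).
Definition grassmann_opp u : gr := Grassmann (- gcoef u).
Definition grassmann_one : gr := Grassmann [ffun A => (A == set0)%:R].
Definition grassmann_mul u v : gr :=
  Grassmann [ffun S : {set G} => \sum_(A : {set G} | A \subset S)
    (-1) ^+ inversions A (S :\: A) * gcoef u A * gcoef v (S :\: A)].
Definition grassmann_scale (c : R) u : gr :=
  Grassmann [ffun A => c * gcoef u A].

Lemma grassmannP u v : (forall A, gcoef u A = gcoef v A) -> u = v.
Proof. by move=> uv; apply: val_inj; apply/ffunP. Qed.

Fact grassmann_addA : associative grassmann_add.
Proof. by move=> u v w; apply: val_inj; rewrite /= addrA. Qed.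
Fact grassmann_addC : commutative grassmann_add.
Proof. by move=> u v; apply: val_inj; rewrite /= addrC. Qed.
Fact grassmann_add0 : left_id grassmann_zero grassmann_add.
Proof. by move=> u; apply: val_inj; rewrite /= add0r. Qed.
Fact grassmann_addN : left_inverse grassmann_zero grassmann_opp grassmann_add.
Proof. by move=> u; apply: val_inj; rewrite /= addNr. Qed.

HB.instance Definition _ := GRing.isZmodule.Build gr
  grassmann_addA grassmann_addC grassmann_add0 grassmann_addN.

Lemma inversions0l B : inversions set0 B = 0%N.
Proof. by rewrite /inversions big_set0. Qed.

Lemma inversions0r A : inversions A set0 = 0%N.
Proof. by rewrite /inversions big1// => x _; rewrite big_set0. Qed.

Lemma inversionsUl A B C : [disjoint A & B] ->
  inversions (A :|: B) C = (inversions A C + inversions B C)%N.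
Proof.
move=> dAB; rewrite /inversions -bigU//.
by apply: eq_bigl => x; rewrite !inE.
Qed.

Lemma inversionsUr A B C : [disjoint B & C] ->
  inversions A (B :|: C) = (inversions A B + inversions A C)%N.
Proof.
move=> dBC; rewrite /inversions -big_split/=; apply: eq_bigr => x _.
by rewrite -bigU//; apply: eq_bigl => y; rewrite !inE.
Qed.

Fact grassmann_mulA : associative grassmann_mul.
Proof.
move=> u v w; apply: grassmannP => S; rewrite !ffunE.
transitivity (\sum_(A : {set G} | A \subset S)
    \sum_(B : {set G} | B \subset S :\: A)
    (-1) ^+ (inversions A B + inversions A (S :\: A :\: B)
             + inversions B (S :\: A :\: B)) *
    (gcoef u A * gcoef v B * gcoef w (S :\: A :\: B))).
  apply: eq_bigr => A AS; rewrite ffunE mulr_sumr; apply: eq_bigr => B BSA.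
  rewrite -{1}(setID (S :\: A) B) (setIidPr BSA) inversionsUr; last first.
    by rewrite disjoint_sym disjoints_subset subDset setUCr subsetT.
  by rewrite !exprD; ring.
apply/esym; under eq_bigr => C CS do rewrite ffunE mulr_sumr mulr_suml.
rewrite (exchange_big_dep (fun A : {set G} => A \subset S))/=; last first.
  by move=> C A CS AC; exact: subset_trans CS.
apply: eq_bigr => A AS.
rewrite (reindex_onto (fun B => A :|: B) (fun C => C :\: A))/=; last first.
  by move=> C /andP[_ sAC]; rewrite -[RHS](setID C A) (setIidPr sAC).
have dAP (B : {set G}) : [disjoint A & B] = ((A :|: B) :\: A == B).
  rewrite setDUl setDv set0U; apply/idP/eqP => [dAB|<-].
    by apply/setDidPl; rewrite disjoint_sym.
  by rewrite disjoint_sym disjoints_subset subDset setUCr subsetT.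
apply: eq_big => [B|B].
  by rewrite subsetUl andbT -dAP subUset AS/= subsetD disjoint_sym.
move=> /andP[_ BE]; move: (BE); rewrite -dAP => dAB.
rewrite (eqP BE) -setDDl.
by rewrite inversionsUl// !exprD; ring.
Qed.

Fact grassmann_mul1 : left_id grassmann_one grassmann_mul.
Proof.
move=> u; apply: grassmannP => S; rewrite !ffunE (bigD1 set0) ?sub0set//=.
rewrite big1 ?addr0 => [|A /andP[_ /negPf A0]].
  by rewrite ffunE eqxx setD0 inversions0l expr0 !mul1r.
by rewrite ffunE A0 mulr0 mul0r.
Qed.

Fact grassmann_mulr1 : right_id grassmann_one grassmann_mul.
Proof.
move=> u; apply: grassmannP => S; rewrite !ffunE (bigD1 S)//=.
rewrite big1 ?addr0 => [|A /andP[AS AnS]].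
  by rewrite ffunE setDv eqxx inversions0r expr0 mul1r mulr1.
rewrite ffunE setD_eq0 (_ : S \subset A = false) ?mulr0//.
by apply: contraNF AnS => SA; rewrite eqEsubset AS.
Qed.

Fact grassmann_mulDl : left_distributive grassmann_mul +%R.
Proof.
move=> u v w; apply: grassmannP => S; rewrite !ffunE -big_split/=.
by apply: eq_bigr => A _; rewrite !ffunE mulrDr mulrDl.
Qed.

Fact grassmann_mulDr : right_distributive grassmann_mul +%R.
Proof.
move=> u v w; apply: grassmannP => S; rewrite !ffunE -big_split/=.
by apply: eq_bigr => A _; rewrite !ffunE mulrDr.
Qed.

Fact grassmann_1neq0 : grassmann_one != 0.
Proof.
apply/eqP => /(congr1 (fun u : gr => gcoef u set0)) /eqP.
by rewrite !ffunE eqxx oner_eq0.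
Qed.

HB.instance Definition _ := GRing.Zmodule_isNzRing.Build gr grassmann_mulA
  grassmann_mul1 grassmann_mulr1 grassmann_mulDl grassmann_mulDr
  grassmann_1neq0.

Fact grassmann_scaleA b c u :
  grassmann_scale b (grassmann_scale c u) = grassmann_scale (b * c) u.
Proof. by apply: grassmannP => A; rewrite !ffunE mulrA. Qed.
Fact grassmann_scale1 : left_id 1 grassmann_scale.
Proof. by move=> u; apply: grassmannP => A; rewrite !ffunE mul1r. Qed.
Fact grassmann_scaleDr : right_distributive grassmann_scale +%R.
Proof. by move=> c u v; apply: grassmannP => A; rewrite !ffunE mulrDr. Qed.
Fact grassmann_scaleDl u :
  {morph grassmann_scale^~ u : b c / b + c >-> b + c}.
Proof. by move=> b c; apply: grassmannP => A; rewrite !ffunE mulrDl. Qed.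

HB.instance Definition _ := GRing.Zmodule_isLmodule.Build R gr
  grassmann_scaleA grassmann_scale1 grassmann_scaleDr grassmann_scaleDl.

Fact grassmann_scalerAl c u v : c *: (u * v) = (c *: u) * v.
Proof.
apply: grassmannP => S; rewrite !ffunE mulr_sumr; apply: eq_bigr => A _.
by rewrite !ffunE; ring.
Qed.

HB.instance Definition _ :=
  GRing.Lmodule_isLalgebra.Build R gr grassmann_scalerAl.

Fact grassmann_scalerAr c u v : c *: (u * v) = u * (c *: v).
Proof.
apply: grassmannP => S; rewrite !ffunE mulr_sumr; apply: eq_bigr => A _.
by rewrite !ffunE; ring.
Qed.

HB.instance Definition _ :=
  GRing.Lalgebra_isAlgebra.Build R gr grassmann_scalerAr.

Definition generator x : gr := Grassmann [ffun A => (A == [set x])%:R].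

Definition body u : R := gcoef u set0.

(* The left derivative: x e_A |-> e_A if x is not in A. *)
Definition gderiv x u : gr :=
  Grassmann [ffun A : {set G} => if x \in A then 0
                       else (-1) ^+ inversions [set x] A * gcoef u (x |: A)].

End GrassmannAlgebra.
Arguments generator {R G}.


From mathcomp Require Import all_classical all_reals all_analysis
  measurable_realfun.
Import numFieldNormedType.Exports.
Local Open Scope classical_set_scope.

(** * Smooth functions of real variables indexed by V *)

Section SmoothFunctions.
Context (R : realType) (V : finType).
Implicit Types (g : (V -> R) -> R) (i : V) (s : seq V) (l : V -> R).

Definition partial i g l : R := derive1 (fun t : R => g (dfwith l i t)) (l i).

Definition partials s g : (V -> R) -> R := foldr partial g s.

Definition smooth g : Prop :=
  forall s, continuous (partials s g : {ptws V -> R} -> R) /\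
    (forall i l, derivable (fun t : R => partials s g (dfwith l i t)) (l i) 1).

(* The expectations below evaluate g and its derivatives on [1, +oo[^V only,
   against weights that decay faster than any polynomial; growing at most
   polynomially there is thus decay enough for them to be well defined.  In
   particular, all rapidly decreasing smooth functions are suitable. *)
Definition suitable g : Prop :=
  smooth g /\
  forall s, exists C : R, exists N : nat,
    forall l, (forall i, 1 <= l i) ->
      `|partials s g l| <= C * (1 + \sum_i l i) ^+ N.

Lemma linear_continuous (T : topologicalType) (r : seq V) (k : V -> R)
    (f : V -> T -> R) : (forall i, continuous (f i)) ->
  continuous (fun x => \sum_(i <- r) k i * f i x).
Proof.
move=> cf x; elim: r => [|i r IHr].
  rewrite (_ : (fun x => _) = cst 0); first exact: cvg_cst.
  by apply/funext => y; rewrite big_nil.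
rewrite (_ : (fun x => _) =
  ((fun x => k i * f i x) \+ (fun x => \sum_(j <- r) k j * f j x))).
  by apply: cvgD => //; apply: cvgMl_tmp; exact: cf.
by apply/funext => y; rewrite big_cons.
Qed.

Section Laplace.
Variable k : V -> R.
Hypothesis k_gt0 : forall i, 0 < k i.

Definition laplace (l : V -> R) : R := expR (- \sum_i k i * l i).

Lemma laplace_dfwith i l :
  (fun t => laplace (dfwith l i t)) =
  (fun t => expR (- (k i * t + \sum_(j | j != i) k j * l j))).
Proof.
apply/funext => t; rewrite /laplace (bigD1 i)//= dfwithin.
congr (expR (- (_ + _))); apply: eq_bigr => j ji.
by rewrite dfwithout// eq_sym.
Qed.

Lemma is_derive_laplace i l (c : R) :
  is_derive (l i) 1 (fun t => c * laplace (dfwith l i t))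
    (- k i * c * laplace l).
Proof.
rewrite (_ : laplace l = laplace (dfwith l i (l i))); last first.
  congr laplace; apply/funext => j; have [<-|ij] := eqVneq i j.
    by rewrite dfwithin.
  by rewrite dfwithout.
rewrite (congr1 (fun f => f (l i)) (laplace_dfwith i l)).
set b := \sum_(j | _) _; rewrite (_ : (fun t => _) =
    (c \*: (expR \o (fun t => - (k i * t + b))) : R -> R)); last first.
  by apply/funext => t; rewrite (congr1 (fun f => f t) (laplace_dfwith i l)).
have dk : is_derive (l i) (1 : R) (fun t : R => - (k i * t + b)) (- k i).
  apply: is_derive_eq (is_deriveN (is_deriveD (is_deriveZ (k i)
    (is_derive_id (l i) 1)) (is_derive_cst b (l i) 1))) _.
  by rewrite addr0 /GRing.scale/= mulr1.
apply: is_derive_eq.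
by rewrite /GRing.scale/=; ring.
Qed.

Lemma partials_laplace s l :
  partials s laplace l = (\prod_(i <- s) - k i) * laplace l.
Proof.
elim: s l => [|i s IHs] l /=; first by rewrite big_nil mul1r.
rewrite /partial big_cons derive1E.
under eq_fun do rewrite IHs.
by rewrite (@derive_val _ _ _ _ _ _ _ (is_derive_laplace i l _)).
Qed.

Lemma suitable_laplace : suitable laplace.
Proof.
split=> s.
  split=> [|i l]; last first.
    under eq_fun do rewrite partials_laplace.
    by case: (is_derive_laplace i l (\prod_(j <- s) - k j)).
  have lin_cts : continuous ((fun l => \sum_i k i * l i) : {ptws V -> R} -> R).
    exact: (@linear_continuous {ptws V -> R} (index_enum V) k (fun i l => l i)
      (fun i => @proj_continuous V (fun=> R) i)).
  have exp_cts : continuous (fun x : R => (\prod_(i <- s) - k i) * expR (- x)).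
    move=> x; apply: cvgM; first exact: cvg_cst.
    apply: (@continuous_comp R R R -%R expR).
      exact: opp_continuous.
    exact: continuous_expR.
  rewrite (funext (partials_laplace s)) => l.
  exact: (continuous_comp (lin_cts l) (exp_cts _)).
exists `|\prod_(i <- s) - k i|, 0%N => l l1.
rewrite partials_laplace expr0 mulr1 normrM ler_piMr// ger0_norm ?expR_ge0//.
rewrite -expR0 ler_expR oppr_le0 sumr_ge0// => i _.
by rewrite mulr_ge0 ?(ltW (k_gt0 i))// (le_trans ler01).
Qed.

End Laplace.

End SmoothFunctions.

(** * Lebesgue measure on R^n *)

Section LebesgueRn.
Context (R : realType).
Local Notation mR := (measurableTypeR R).

Definition cons_pair n (p : mR * n.-tuple mR) : n.+1.-tuple mR :=
  [tuple of p.1 :: p.2].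

Lemma measurable_cons_pair n : measurable_fun setT (@cons_pair n).
Proof. exact: measurable_cons. Qed.

HB.instance Definition _ n := @isMeasurableFun.Build _ _ _ _ (@cons_pair n)
  (@measurable_cons_pair n).

Section Step.
Context (n : nat) (mu : {sigma_finite_measure set (n.-tuple mR) -> \bar R}).

Definition lebesgue_cons : set (n.+1.-tuple mR) -> \bar R :=
  pushforward (@lebesgue_measure R \x mu)%E (@cons_pair n).

Let lebesgue_cons0 : lebesgue_cons set0 = 0%E.
Proof. exact: measure0. Qed.
Let lebesgue_cons_ge0 A : (0 <= lebesgue_cons A)%E.
Proof. exact: measure_ge0. Qed.
Let lebesgue_cons_sigma_additive : semi_sigma_additive lebesgue_cons.
Proof. exact: measure_semi_sigma_additive. Qed.
HB.instance Definition _ := isMeasure.Build _ _ _ lebesgue_cons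
  lebesgue_cons0 lebesgue_cons_ge0 lebesgue_cons_sigma_additive.

Let lebesgue_cons_sigma_finite : sigma_finite setT lebesgue_cons.
Proof.
have /sigma_finiteP[F [FT ndF Foo]] := sigma_finiteT (@lebesgue_measure R).
have /sigma_finiteP[G [GT ndG Goo]] := sigma_finiteT mu.
pose split_tuple (t : n.+1.-tuple mR) : mR * n.-tuple mR :=
  (thead t, [tuple of behead t]).
have splitK : cancel split_tuple (@cons_pair n).
  by move=> t; rewrite [RHS]tuple_eta; exact: val_inj.
have consK : cancel (@cons_pair n) split_tuple.
  by case=> x t; congr pair => //; exact: val_inj.
have msplit : measurable_fun setT split_tuple.
  apply: measurable_fun_pair; first exact: measurable_tnth.
  exact: measurable_behead.
exists (fun i => split_tuple @^-1` (F i `*` G i)) => [|i].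
  apply/seteqP; split=> // t _.
  have [i _ Fi] : (\bigcup_i F i) (split_tuple t).1 by rewrite -FT.
  have [j _ Gj] : (\bigcup_i G i) (split_tuple t).2 by rewrite -GT.
  exists (maxn i j) => //; split.
  - by move: Fi; exact/subsetPset/ndF/leq_maxl.
  - by move: Gj; exact/subsetPset/ndG/leq_maxr.
have [[mF Fi] [mG Gi]] := (Foo i, Goo i); split.
  by rewrite -[X in measurable X]setTI; apply: msplit => //; exact: measurableX.
rewrite /lebesgue_cons /pushforward -comp_preimage.
rewrite (_ : _ \o _ = id) ?preimage_id; last exact/funext/consK.
by rewrite product_measure1E// lte_mul_pinfty// ge0_fin_numE.
Qed.
HB.instance Definition _ := Measure_isSigmaFinite.Build _ _ _ lebesgue_cons
  lebesgue_cons_sigma_finite.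

End Step.

Fixpoint lebesgue_Rn n : {sigma_finite_measure set (n.-tuple mR) -> \bar R} :=
  match n return {sigma_finite_measure set (n.-tuple mR) -> \bar R} with
  | 0 => \d_([tuple] : 0.-tuple mR)
  | n.+1 => lebesgue_cons (lebesgue_Rn n)
  end.

End LebesgueRn.

(** * Superfunctions *)

(* The value of a superfunction at a point of the real variables is an element
   of the Grassmann algebra. *)
Section Superfunctions.
Context (R : realType) (G : finType).
Local Notation gr := (grassmann R G).

(* Taylor expansions around the body; the exponents may be bounded by #|G|, as
   the (#|G|+1)-st power of an element with no body vanishes. *)
Definition superfun1 (f : R -> R) (u : gr) : gr :=
  \sum_(n < #|G|.+1)
    (derive1n n f (body u) / n`!%:R) *: (u - (body u)%:A) ^+ n.

Definition superfun (V : finType) (g : (V -> R) -> R) (u : V -> gr) : gr :=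
  \sum_(alpha : {ffun V -> 'I_#|G|.+1})
    (partials (flatten [seq nseq (alpha i) i | i <- enum V]) g
       (fun i => body (u i)) / \prod_i (alpha i)`!%:R) *:
    \prod_i (u i - (body (u i))%:A) ^+ alpha i.

End Superfunctions.

(** * The H^{2|2} field *)

Section H22.
Context (R : realType) (V : finType).

(* [inl i] is the generator xi_i and [inr i] the generator eta_i. *)
Local Notation gr := (grassmann R (V + V)%type).
Implicit Types (a i j : V) (x y : V -> R) (e : rel V) (W : V -> V -> R).

(* The integral with respect to \prod_(i in s) d xi_i d eta_i, for which
   \int xi_i eta_i d xi_i d eta_i = -1, that is to say
   \int exp (- \sum_(i, j) xi_i A_ij eta_j) = \det A. *)
Definition berezin (s : seq V) (u : gr) : R :=
  body (foldr (fun i w => gderiv (inl i) (gderiv (inr i) w)) u s).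

Record spin := Spin { sx : gr; sy : gr; sz : gr; sxi : gr; seta : gr }.

Definition spin_dot (p q : spin) : gr :=
  sx p * sx q + sy p * sy q - sz p * sz q + sxi p * seta q + sxi q * seta p.

Definition free_spin (x y : R) i : spin :=
  let xi := generator (inl i) in let eta := generator (inr i) in
  Spin x%:A y%:A
    (superfun1 Num.sqrt ((1 + x ^+ 2 + y ^+ 2)%:A + (xi * eta) *+ 2)) xi eta.

Definition pinned_field a x y i : spin :=
  if i == a then Spin 0 0 1 0 0 else free_spin (x i) (y i) i.

(* The sum over the edges {i, j}, each unordered pair being taken once. *)
Definition h22_energy e W (Phi : V -> spin) : gr :=
  \sum_i \sum_(j | e i j && (enum_rank i < enum_rank j)%N)
    W i j *: (spin_dot (Phi i) (Phi j) + 1).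

Definition h22_density e W a (Phi : V -> spin) : gr :=
  superfun1 expR (h22_energy e W Phi) *
  \prod_(i | i != a) ((2 * pi)^-1 *: superfun1 GRing.inv (sz (Phi i))).

Definition unpinned a : seq V := enum (predC1 a).

Definition coord a (t : #|predC1 a|.-tuple R) i : R :=
  nth 0 t (index i (unpinned a)).

Definition h22_expectation e W a (F : (V -> spin) -> gr) : \bar R :=
  (\int[lebesgue_Rn R #|predC1 a| \x lebesgue_Rn R #|predC1 a|]_p
     let Phi := pinned_field a (coord p.1) (coord p.2) in
     (berezin (unpinned a) (F Phi * h22_density e W a Phi))%:E)%E.

End H22.

(** * The vertex reinforced jump process *)

Definition weighted_graph (R : realType) (V : finType) (e : rel V)
    (W : V -> V -> R) : Prop :=
  [/\ symmetric e, irreflexive e, (forall i j, connect e i j),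
      (forall i j, W i j = W j i) &
      (forall i j, (e i j -> 0 < W i j) /\ (~~ e i j -> W i j = 0))].

Section VRJP.
Context (R : realType) (V : finType) (d : measure_display)
        (Omega : measurableType d).
Implicit Types (W : V -> V -> R) (a i j : V) (Y : R -> Omega -> V)
  (X : nat -> Omega -> V) (S : nat -> Omega -> \bar R).

Definition local_time Y j (t : R) (w : Omega) : R :=
  1 + \int[lebesgue_measure]_(r in `[0, t]) (Y r w == j)%:R.

(* The infimum is that of a nonempty set for almost every w. *)
Definition inverse_local_time Y a (gamma : R) (w : Omega) : R :=
  inf [set t | 0 < t /\ gamma <= local_time Y a t w].

(* Here X_n is the n-th vertex visited and S_n the time spent there, which is
   +oo if the process jumps no more. *)
Definition jump_time S n (w : Omega) : \bar R := (\sum_(m < n) S m w)%E.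

Definition jump_local_time X S n j (w : Omega) : R :=
  1 + \sum_(m < n | X m w == j) fine (S m w).

Definition history X S n (v : nat -> V) (r : nat -> R) : set Omega :=
  [set w | (forall m, (m <= n)%N -> X m w = v m) /\
           (forall m, (m < n)%N -> (S m w <= (r m)%:E)%E)].

(* A jump from i to j at rate W_ij L_j: conditionally on the past up to the
   n-th jump, which leads to i, the next jump occurs after an additional time
   in [u, u + du] and leads to j with probability
   W_ij L_j exp(- u \sum_k W_ik L_k) du.  As W_ii = 0 only the L_k with k != i
   matter, and these keep until the next jump their value at the n-th one.
   Histories as above form a pi-system.  On a one-vertex graph all rates vanish
   and S_0 = +oo a.s. *)
Definition VRJP (P : probability Omega R) W a Y : Prop :=
  exists (X : nat -> Omega -> V) (S : nat -> Omega -> \bar R),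
  [/\ (forall n, measurable_fun setT (S n)) /\
        (forall n i, measurable [set w | X n w = i]),
      (forall n w, (0 < S n w)%E) /\
        (forall w, jump_time S n w @[n --> \oo] --> +oo%E),
      (forall w n t, (jump_time S n w <= t%:E < jump_time S n.+1 w)%E ->
         Y t w = X n w),
      (forall w, X 0 w = a) &
      forall n v r j (t : R), 0 <= t ->
        P (history X S n v r `&`
             [set w | (S n w <= t%:E)%E /\ X n.+1 w = j]) =
        (\int[P]_(w in history X S n v r)
           (\int[lebesgue_measure]_(u in `[0, t])
              (W (v n) j * jump_local_time X S n j w *
               expR (- (\sum_k W (v n) k * jump_local_time X S n k w) * u))
           )%R%:E)%E].

End VRJP.

Definition cosh (R : realType) (s : R) : R := (expR s + expR (- s)) / 2.
Definition sinh (R : realType) (s : R) : R := (expR s - expR (- s)) / 2.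

(* Main.v *)
Require Import Defs.
From HB Require Import structures.
From mathcomp Require Import all_boot all_order all_algebra ring lra.
Require Import Defs.
Set Implicit Arguments.
Unset Strict Implicit.
Unset Printing Implicit Defensive.
Import Order.TTheory GRing.Theory Num.Theory.
Local Open Scope ring_scope.

(** Both sides of the identity are linear in the observable, so it is enough
    to know them on a large family of observables, and to show that this family
    determines them.

    The family consists of the Gaussian observables
    G_k(l) = (\prod_i l_i) exp (- 1/2 \sum_i k_i l_i^2 + 1/2 \sum_(i, j) W_ij l_i l_j)
    with k_i > \sum_j W_ij.  With such an observable the interaction of the
    field cancels against the quadratic form once the latter is promoted to
    superfunctions: what is left is a supersymmetric Gaussian integral, whose
    determinants cancel, and whose value depends on the hyperbolic angle only
    through the Schur complement at the pinned vertex ([Lam_gauss]).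

    For the process, fix k and let c be the solution of (k - W) c = 0 off a
    with c_a = 1.  The function
    h(i, l) = c_i (\prod_(j != i) l_j) exp (- 1/2 quadratic form), where the
    form has been corrected at a so that (k - W) c = 0 there as well, is
    harmonic for the pair formed by the current vertex and the local times:
    along the flow that increases l_i the weighted sum of its values after a
    jump integrates to the difference of its values at the two ends
    ([integral_fh], [integral_fh_infty]).  Applying this between two
    consecutive jumps, with the joint law of the holding times ([joint_law]),
    gives a conservation law ([history_step], [step]); as the local times grow
    to infinity, all the mass ends up on the inverse local time ([final_sum]),
    where h is proportional to G_k.  The two values agree ([ST_gauss]).

    For the determination, freeze the vertices one after the other.  As G_k
    times exp (- (l_i^2 - 1) / 2) is proportional to another Gaussian
    observable, the identity for all k extends to G_k times any polynomial in
    that variable, and Bernstein polynomials approximate a smooth function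
    together with its first derivative; the field expectation of an observable
    involves each variable to first order only, as the nilpotent part of a
    coordinate has square zero.  So one derivative in each variable suffices
    ([dens_step]).  Damped observables are reached this way, the damping is
    removed by monotone and then dominated convergence ([moments], [E_poly]).

    The mass of the event that the inverse local time is finite is then the
    field expectation of 1, which does not depend on the angle; letting the
    angle go to 0, it is 1 ([Lam_one], [ST_lower], [cosh_near1]). *)

(** * Grassmann calculus of Gaussian integrals *)
Section GrassmannTheory.
Context (R : comNzRingType) (G : finType).
Local Notation gr := (grassmann R G).
Implicit Types (A B C S : {set G}) (u v w : gr) (x : G) (c : R).

Lemma gcoef0 A : gcoef (0 : gr) A = 0. Proof. by rewrite ffunE. Qed.
Lemma gcoef1 A : gcoef (1 : gr) A = (A == set0)%:R. Proof. by rewrite ffunE. Qed.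
Lemma gcoefD u v A : gcoef (u + v) A = gcoef u A + gcoef v A.
Proof. by rewrite ffunE. Qed.
Lemma gcoefN u A : gcoef (- u) A = - gcoef u A.
Proof. by rewrite ffunE. Qed.
Lemma gcoefB u v A : gcoef (u - v) A = gcoef u A - gcoef v A.
Proof. by rewrite gcoefD gcoefN. Qed.
Lemma gcoefZ c u A : gcoef (c *: u) A = c * gcoef u A.
Proof. by rewrite ffunE. Qed.
Lemma gcoefM u v S : gcoef (u * v) S = \sum_(A : {set G} | A \subset S)
  (-1) ^+ inversions A (S :\: A) * gcoef u A * gcoef v (S :\: A).
Proof. by rewrite ffunE. Qed.
Lemma gcoef_sum I (r : seq I) (P : pred I) (F : I -> gr) A :
  gcoef (\sum_(i <- r | P i) F i) A = \sum_(i <- r | P i) gcoef (F i) A.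
Proof.
by apply: (big_morph (fun u => gcoef u A)) => [u v|]; rewrite ?gcoefD ?gcoef0.
Qed.

Lemma body0 : body (0 : gr) = 0. Proof. exact: gcoef0. Qed.
Lemma body1 : body (1 : gr) = 1. Proof. by rewrite /body gcoef1 eqxx. Qed.
Lemma bodyD u v : body (u + v) = body u + body v. Proof. exact: gcoefD. Qed.
Lemma bodyB u v : body (u - v) = body u - body v. Proof. exact: gcoefB. Qed.
Lemma bodyZ c u : body (c *: u) = c * body u. Proof. exact: gcoefZ. Qed.
Lemma body_scalar c : body (c%:A : gr) = c.
Proof. by rewrite bodyZ body1 mulr1. Qed.
Lemma body_sum I (r : seq I) (P : pred I) (F : I -> gr) :
  body (\sum_(i <- r | P i) F i) = \sum_(i <- r | P i) body (F i).
Proof. exact: gcoef_sum. Qed.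
Lemma bodyM u v : body (u * v) = body u * body v.
Proof.
rewrite /body gcoefM (big_pred1 set0) => [|A]; last by rewrite subset0.
by rewrite setD0 inversions0l expr0 mul1r.
Qed.
Lemma body_gen x : body (generator x : gr) = 0.
Proof.
rewrite /body ffunE; case: eqP => // /setP /(_ x).
by rewrite !inE eqxx.
Qed.

(** Elements of order at least [k] are combinations of monomials of degree at
    least [k]; order [#|G|.+1] means zero, which makes Taylor expansions
    finite. *)
Definition gord (k : nat) u := forall A, (#|A| < k)%N -> gcoef u A = 0.

Lemma gordM j k u v : gord j u -> gord k v -> gord (j + k) (u * v).
Proof.
move=> hu hv S hS; rewrite gcoefM big1// => A AS.
have [hA|hA] := ltnP #|A| j; first by rewrite hu// mulr0 mul0r.
rewrite hv ?mulr0//; move: hS; rewrite -(cardsID A S) (setIidPr AS).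
by move=> hS; rewrite -(ltn_add2l j) (leq_ltn_trans _ hS)// leq_add2r.
Qed.
Lemma gordW j k u : (j <= k)%N -> gord k u -> gord j u.
Proof. by move=> jk hu A hA; apply: hu; exact: leq_trans jk. Qed.
Lemma gord_body u : gord 1 u <-> body u = 0.
Proof.
split=> [hu|hu A]; first by apply: hu; rewrite cards0.
by rewrite ltnS leqn0 cards_eq0 => /eqP ->.
Qed.
Lemma gordX k u n : gord k u -> gord (k * n) (u ^+ n).
Proof.
move=> hu; elim: n => [|n IHn]; first by rewrite muln0 => A.
by rewrite mulnS exprS; exact: gordM.
Qed.
Lemma gord_max u : gord #|G|.+1 u -> u = 0.
Proof. by move=> hu; apply: grassmannP => A; rewrite gcoef0 hu// ltnS max_card. Qed.
Lemma gord_nil k u : (#|G| < k)%N -> gord k u -> u = 0.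
Proof. by move=> hk hu; apply: gord_max; exact: gordW hu. Qed.

Definition geven u := forall A, odd #|A| -> gcoef u A = 0.

Lemma inversionsC A B : [disjoint A & B] ->
  (inversions A B + inversions B A = #|A| * #|B|)%N.
Proof.
move=> dAB; rewrite {2}/inversions exchange_big/= /inversions -big_split/=.
rewrite -sum_nat_const; apply: eq_bigr => x xA.
rewrite -[#|B|]sum1_card -big_split/=; apply: eq_bigr => y yB.
case: (ltngtP (enum_rank y) (enum_rank x)) => // /val_inj/enum_rank_inj xy.
by move: (disjointFr dAB xA); rewrite -xy yB.
Qed.

Lemma geven_comm u v : geven u -> u * v = v * u.
Proof.
move=> hu; apply: grassmannP => S; rewrite !gcoefM.
rewrite (reindex_onto (fun A : {set G} => S :\: A) (fun A => S :\: A))/=; last first.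
  by move=> A AS; rewrite setDDr setDv set0U; exact/setIidPr.
apply: eq_big => [A|A].
  rewrite subsetDl/= setDDr setDv set0U.
  by apply/eqP/idP => [<-|/setIidPr//]; exact: subsetIl.
move=> /andP[_ /eqP SA]; rewrite SA.
have [hA|hA] := boolP (odd #|S :\: A|); first by rewrite hu// !(mulr0,mul0r).
rewrite -(mulrA _ (gcoef u _)) (mulrC (gcoef u _)) mulrA.
congr (_ * _ * _); rewrite -signr_odd -[RHS]signr_odd; congr (_ ^+ _).
have dA : [disjoint S :\: A & A].
  by rewrite disjoints_subset subDset setUCr subsetT.
have /(congr1 odd) := inversionsC dA.
rewrite oddD oddM (negPf hA) /= => /eqP.
by case: (odd _); case: (odd _).
Qed.

Lemma geven0 : geven 0. Proof. by move=> A _; rewrite gcoef0. Qed.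
Lemma geven1 : geven 1.
Proof. by move=> A oA; rewrite gcoef1; case: eqP oA => // ->; rewrite cards0. Qed.
Lemma gevenD u v : geven u -> geven v -> geven (u + v).
Proof. by move=> hu hv A hA; rewrite gcoefD hu ?hv ?addr0. Qed.
Lemma gevenZ c u : geven u -> geven (c *: u).
Proof. by move=> hu A hA; rewrite gcoefZ hu ?mulr0. Qed.
Lemma gevenN u : geven u -> geven (- u).
Proof. by move=> hu A hA; rewrite gcoefN hu ?oppr0. Qed.
Lemma gevenB u v : geven u -> geven v -> geven (u - v).
Proof. by move=> hu hv; apply: gevenD => //; exact: gevenN. Qed.
Lemma gevenM u v : geven u -> geven v -> geven (u * v).
Proof.
move=> hu hv S hS; rewrite gcoefM big1// => A AS.
have [hA|hA] := boolP (odd #|A|); first by rewrite hu// mulr0 mul0r.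
rewrite hv ?mulr0//; move: hS; rewrite -(cardsID A S) (setIidPr AS).
by rewrite oddD (negPf hA).
Qed.
Lemma geven_sum I (r : seq I) (P : pred I) (F : I -> gr) :
  (forall i, P i -> geven (F i)) -> geven (\sum_(i <- r | P i) F i).
Proof. by move=> h; elim/big_ind: _ => //; [exact: geven0|exact: gevenD]. Qed.
Lemma gevenX u n : geven u -> geven (u ^+ n).
Proof.
by move=> hu; elim: n => [|n IHn]; [exact: geven1|rewrite exprS; exact: gevenM].
Qed.
Lemma geven_scalar c : geven c%:A. Proof. exact/gevenZ/geven1. Qed.

(* An even element without body has order 2. *)
Lemma geven_gord2 u : geven u -> body u = 0 -> gord 2 u.
Proof.
move=> hu bu A; rewrite ltnS leq_eqVlt ltnS leqn0 => /orP[/eqP A1|].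
  by apply: hu; rewrite A1.
by rewrite cards_eq0 => /eqP ->.
Qed.

(** ** Odd elements *)
Definition godd u := forall A, ~~ odd #|A| -> gcoef u A = 0.
Lemma godd_gen x : godd (generator x).
Proof. by move=> A oA; rewrite ffunE; case: eqP oA => // ->; rewrite cards1. Qed.
Lemma goddD u v : godd u -> godd v -> godd (u + v).
Proof. by move=> hu hv A hA; rewrite gcoefD hu ?hv ?addr0. Qed.
Lemma godd0 : godd 0. Proof. by move=> A _; rewrite gcoef0. Qed.
Lemma goddZ c u : godd u -> godd (c *: u).
Proof. by move=> hu A hA; rewrite gcoefZ hu ?mulr0. Qed.
Lemma godd_sum I (r : seq I) (P : pred I) (F : I -> gr) :
  (forall i, P i -> godd (F i)) -> godd (\sum_(i <- r | P i) F i).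
Proof. by move=> h; elim/big_ind: _ => //; [exact: godd0|exact: goddD]. Qed.
Lemma goddM u v : godd u -> godd v -> geven (u * v).
Proof.
move=> hu hv S hS; rewrite gcoefM big1// => A AS.
have [hA|hA] := boolP (odd #|A|); last by rewrite hu// mulr0 mul0r.
rewrite hv ?mulr0//; move: hS; rewrite -(cardsID A S) (setIidPr AS).
by rewrite oddD hA/= => ->.
Qed.
Lemma godd_anticomm u v : godd u -> godd v -> u * v = - (v * u).
Proof.
move=> hu hv; apply: grassmannP => S; rewrite gcoefN !gcoefM -sumrN.
rewrite (reindex_onto (fun A : {set G} => S :\: A) (fun A => S :\: A))/=; last first.
  by move=> A AS; rewrite setDDr setDv set0U; exact/setIidPr.
apply: eq_big => [A|A].
  rewrite subsetDl/= setDDr setDv set0U.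
  by apply/eqP/idP => [<-|/setIidPr//]; exact: subsetIl.
move=> /andP[_ /eqP SA]; rewrite SA.
have [hA|hA] := boolP (odd #|S :\: A|); last by rewrite hu// !(mulr0,mul0r,oppr0).
have [hB|hB] := boolP (odd #|A|); last by rewrite hv// !(mulr0,mul0r,oppr0).
rewrite -(mulrA _ (gcoef u _)) (mulrC (gcoef u _)) mulrA -!mulNr.
congr (_ * _ * _); rewrite -signr_odd -[in RHS]signr_odd.
have dA : [disjoint S :\: A & A].
  by rewrite disjoints_subset subDset setUCr subsetT.
have /(congr1 odd) := inversionsC dA.
rewrite oddD oddM hA hB/= => /eqP.
by case: (odd _); case: (odd _); rewrite //= ?expr1 ?expr0 ?opprK.
Qed.
Lemma godd_body u : godd u -> body u = 0.
Proof. by move=> hu; rewrite /body hu// cards0. Qed.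

(** ** Derivations *)
Definition gpar u : gr := Grassmann [ffun A : {set G} => (-1) ^+ #|A| * gcoef u A].

Lemma gpar_even u : geven u -> gpar u = u.
Proof.
move=> hu; apply: grassmannP => A; rewrite ffunE.
have [hA|hA] := boolP (odd #|A|); first by rewrite hu// mulr0.
by rewrite -signr_odd (negPf hA) mul1r.
Qed.
Lemma gpar_odd u : godd u -> gpar u = - u.
Proof.
move=> hu; apply: grassmannP => A; rewrite ffunE gcoefN.
have [hA|hA] := boolP (odd #|A|); last by rewrite hu// mulr0 oppr0.
by rewrite -signr_odd hA mulN1r.
Qed.

Lemma gderivD x u v : gderiv x (u + v) = gderiv x u + gderiv x v.
Proof.
apply: grassmannP => A; rewrite gcoefD !ffunE; case: ifP => _; first by rewrite addr0.
by rewrite mulrDr.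
Qed.
Lemma gderivZ x c u : gderiv x (c *: u) = c *: gderiv x u.
Proof.
apply: grassmannP => A; rewrite gcoefZ !ffunE; case: ifP => _; first by rewrite mulr0.
by rewrite mulrCA.
Qed.
Lemma gderiv0 x : gderiv x (0 : gr) = 0.
Proof. by rewrite -[X in gderiv x X](scale0r (0 : gr)) gderivZ scale0r. Qed.
Lemma gderivN x u : gderiv x (- u) = - gderiv x u.
Proof. by rewrite -scaleN1r gderivZ scaleN1r. Qed.
Lemma gderiv_sum x I (r : seq I) (P : pred I) (F : I -> gr) :
  gderiv x (\sum_(i <- r | P i) F i) = \sum_(i <- r | P i) gderiv x (F i).
Proof. by apply: (big_morph _ (gderivD x) (gderiv0 x)). Qed.
Lemma gderiv1 x : gderiv x (1 : gr) = 0.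
Proof.
apply: grassmannP => A; rewrite gcoef0 !ffunE; case: ifP => // _.
by rewrite setU_eq0 -cards_eq0 cards1 mulr0.
Qed.
Lemma gderiv_gen x y : gderiv x (generator y : gr) = (x == y)%:R%:A.
Proof.
apply: grassmannP => A; rewrite !ffunE; case: ifP => [xA|/negbT xA].
  rewrite (_ : A == set0 = false) ?mulr0//.
  by apply/eqP => A0; rewrite A0 inE in xA.
have [->|A0] := eqVneq A set0.
  rewrite inversions0r setU0 expr0 !mul1r mulr1; congr (_%:R); congr nat_of_bool.
  by apply/eqP/eqP => [/setP/(_ x)|->//]; rewrite !inE eqxx => /esym/eqP.
rewrite mulr0; case: eqP; rewrite ?mulr0// => xAy.
have /set0Pn[z zA] := A0.
have /setP/(_ x) := xAy; rewrite !inE eqxx/= => /esym/eqP xy.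
have /setP/(_ z) := xAy; rewrite !inE zA orbT => /esym/eqP zy.
by rewrite xy -zy zA in xA.
Qed.

(** The left derivative is an odd derivation. *)
Lemma gderivM x u v :
  gderiv x (u * v) = gderiv x u * v + gpar u * gderiv x v.
Proof.
apply: grassmannP => S; rewrite gcoefD !gcoefM ffunE.
case: ifP => [xS|/negbT xS].
  apply/esym; rewrite (bigID (fun A : {set G} => x \in A))/= big1 ?add0r; last first.
    by move=> A /andP[_ xA]; rewrite ffunE xA mulr0 mul0r.
  rewrite addrC (bigID (fun A : {set G} => x \in A))/= [X in _ + X + _]big1 ?addr0; last first.
    by move=> A /andP[_ xA]; rewrite !ffunE in_setD xA xS mulr0.
  rewrite (reindex_onto (fun A : {set G} => x |: A) (fun A => A :\ x))/=; last first.
    by move=> A /andP[_ xA]; rewrite setD1K.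
  rewrite -[X in _ + X]opprK -sumrN; apply/eqP; rewrite subr_eq0; apply/eqP.
  apply: eq_big => [A|A].
    rewrite subUset sub1set !inE eqxx xS/= andbT; congr (_ && _).
    apply/eqP/idP => [<-|xA]; first by rewrite !inE eqxx.
    by rewrite setU1K.
  move=> /andP[/andP[_ _] /eqP AE].
  have xA : x \notin A by rewrite -AE !inE eqxx.
  rewrite !ffunE in_setD !inE eqxx/= (negPf xA) cardsU1 xA exprD expr1.
  have SE : S :\: A = x |: (S :\: (x |: A)).
    apply/setP => y; rewrite !inE; case: eqVneq => [->|]//=.
    by rewrite xS xA.
  have xB : x \notin S :\: (x |: A) by rewrite !inE eqxx.
  rewrite SE inversionsUl ?disjoints1// inversionsUr ?disjoints1//.
  have : (inversions A [set x] + inversions [set x] A = #|A|)%N.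
    by rewrite inversionsC ?cards1 ?muln1// disjoint_sym disjoints1.
  move=> <-; rewrite !exprD; set B := S :\: _.
  set i1 := inversions _ _; set i2 := inversions _ _; set i3 := inversions _ _.
  set i4 := inversions _ _.
  have : (-1) ^+ i1 * (-1) ^+ i1 = 1 :> R by rewrite -expr2 sqrr_sign.
  have : (-1) ^+ i2 * (-1) ^+ i2 = 1 :> R by rewrite -expr2 sqrr_sign.
  have : (-1) ^+ i3 * (-1) ^+ i3 = 1 :> R by rewrite -expr2 sqrr_sign.
  have : (-1) ^+ i4 * (-1) ^+ i4 = 1 :> R by rewrite -expr2 sqrr_sign.
  move: ((-1) ^+ i1) ((-1) ^+ i2) ((-1) ^+ i3) ((-1) ^+ i4) => e1 e2 e3 e4.
  move=> h4 h3 h2 h1.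
  ring: h1 h2 h3 h4.
have dxS : [disjoint [set x] & S] by rewrite disjoints1.
rewrite gcoefM (bigID (fun A : {set G} => x \in A))/= mulrDr; congr (_ + _).
  rewrite (reindex_onto (fun A : {set G} => x |: A) (fun A => A :\ x))/=; last first.
    by move=> A /andP[_ xA]; rewrite setD1K.
  rewrite mulr_sumr; apply: eq_big => [A|A].
    rewrite subUset sub1set !inE eqxx/= andbT.
    apply/andP/idP => [[AS /eqP AE]|AS].
      by rewrite -AE subDset subUset AS sub1set !inE eqxx.
    split; first exact: subset_trans (subsetUr _ _).
    rewrite setU1K//; exact: contra (subsetP AS x) xS.
  move=> /andP[/andP[AS _] /eqP AE].
  have xA : x \notin A by rewrite -AE !inE eqxx.
  have {}AS : A \subset S.
    by rewrite -AE subDset.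
  have SE : S = A :|: (S :\: A) by rewrite -{1}(setID S A) (setIidPr AS).
  have -> : (x |: S) :\: (x |: A) = S :\: A.
    apply/setP => y; rewrite !inE; have [->|] := eqVneq y x => //=.
    by rewrite (negPf xS) andbF.
  rewrite ffunE (negPf xA) inversionsUl; last by rewrite disjoints1.
  have -> : inversions [set x] S = (inversions [set x] A + inversions [set x] (S :\: A))%N.
    rewrite {1}SE inversionsUr//.
    by rewrite disjoint_sym disjoints_subset subDset setUCr subsetT.
  set i1 := inversions _ _; set i2 := inversions _ _; set i3 := inversions _ _.
  rewrite !exprD (_ : _ * _ = ((-1) ^+ i2 * (-1) ^+ i2) *
     ((-1) ^+ i3 * ((-1) ^+ i1 * gcoef u (x |: A)) * gcoef v (S :\: A))).
    by rewrite -expr2 sqrr_sign mul1r.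
  by ring.
rewrite mulr_sumr; apply: eq_big => [A|A].
  apply/andP/idP => [[AS xA]|AS].
    apply/fintype.subsetP => y yA; have := subsetP AS y yA; rewrite !inE.
    by case/orP => // /eqP yx; rewrite -yx yA in xA.
  split; first exact: subset_trans (subsetUr _ _).
  exact: contra (subsetP AS x) xS.
move=> /andP[AS xA]; rewrite !ffunE in_setD (negPf xS) andbF.
have {}AS : A \subset S.
  apply/fintype.subsetP => y yA; have := subsetP AS y yA; rewrite !inE.
  by case/orP => // /eqP yx; rewrite -yx yA in xA.
have SE : S = A :|: (S :\: A) by rewrite -{1}(setID S A) (setIidPr AS).
have -> : (x |: S) :\: A = x |: (S :\: A).
  apply/setP => y; rewrite !inE; have [->|] := eqVneq y x => //=.
  by rewrite xA.
have dAS : [disjoint A & S :\: A].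
  by rewrite disjoint_sym disjoints_subset subDset setUCr subsetT.
rewrite inversionsUr; last by rewrite disjoints1 in_setD (negPf xS) andbF.
rewrite {1}SE inversionsUr//.
have /(congr1 (fun n => (-1) ^+ n : R)) : (inversions A [set x] + inversions [set x] A = #|A|)%N.
  by rewrite inversionsC ?cards1 ?muln1// disjoint_sym disjoints1.
rewrite exprD => <-; rewrite !exprD.
set i1 := inversions _ _; set i2 := inversions _ _; set i3 := inversions _ _.
set i4 := inversions _ _.
by ring.
Qed.
End GrassmannTheory.

From mathcomp Require Import all_classical all_reals all_analysis measurable_realfun.
Require Import Defs.
Import numFieldNormedType.Exports.
Local Open Scope classical_set_scope.
Local Open Scope ring_scope.

(** * Berezin integration *)
Section GExp.
Context (R : realType) (G : finType).
Local Notation gr := (grassmann R G).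
Implicit Types (u v q : gr) (x : G) (c : R).

Lemma derive1_expR : derive1 (expR : R -> R) = expR.
Proof. by apply/funext => t; rewrite derive1E derive_val. Qed.

Lemma derive1n_expR n : derive1n n (expR : R -> R) = expR.
Proof. by elim: n => //= n IHn; rewrite /derive1n/= -/(derive1n n expR) IHn derive1_expR. Qed.

Lemma godd_sq0 u : godd u -> u * u = 0.
Proof.
move=> hu; have /eqP := godd_anticomm hu hu.
rewrite -addr_eq0 -mulr2n -scaler_nat => /eqP/(congr1 (fun w => 2^-1 *: w)).
by rewrite scalerA mulVf ?pnatr_eq0// scale1r scaler0.
Qed.

Definition texp u : gr := \sum_(n < #|G|.+1) (n`!%:R)^-1 *: u ^+ n.
Definition gexp u : gr := superfun1 expR u.

Lemma gexpE u : gexp u = expR (body u) *: texp (u - (body u)%:A).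
Proof.
rewrite /gexp /superfun1 /texp scaler_sumr; apply: eq_bigr => n _.
by rewrite derive1n_expR scalerA.
Qed.

Lemma texpD u v : GRing.comm u v -> body u = 0 -> body v = 0 ->
  texp (u + v) = texp u * texp v.
Proof.
move=> uv bu bv; pose F i j : gr := (i`!%:R)^-1 * (j`!%:R)^-1 *: (u ^+ i * v ^+ j).
have F0 i j : (#|G|.+1 <= i + j)%N -> F i j = 0.
  move=> hij; rewrite /F (@gord_nil _ _ (1 * i + 1 * j) (u ^+ i * v ^+ j)) ?scaler0//.
    by rewrite !mul1n.
  by apply: gordM; apply: gordX; exact/gord_body.
rewrite /texp; move: #|G| F0 => M F0.
transitivity (\sum_(n < M.+1) \sum_(i < M.+1 | (i <= n)%N) F i (n - i)%N).
  apply: eq_bigr => n _; rewrite exprDn_comm// scaler_sumr.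
  rewrite (big_ord_widen_cond M.+1 (fun _ => true) (fun i =>
    (n`!%:R)^-1 *: (u ^+ (n - i) * v ^+ i *+ 'C(n, i))))//=.
  rewrite (eq_bigl (fun i : 'I_M.+1 => (i <= n)%N)); last by move=> i; rewrite ltnS.
  rewrite (reindex_onto (fun i : 'I_M.+1 => inord (n - i) : 'I_M.+1)
                        (fun i : 'I_M.+1 => inord (n - i) : 'I_M.+1))/=; last first.
    move=> i hi; have hn : (n - i < M.+1)%N by rewrite (leq_ltn_trans (leq_subr _ _)).
    by apply: val_inj => /=; rewrite (inordK hn) subKn// inordK.
  have ino (i : 'I_M.+1) : (inord (n - i) : 'I_M.+1) = (n - i)%N :> nat.
    by rewrite inordK// (leq_ltn_trans (leq_subr _ _)).
  apply: eq_big => [i|i].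
    rewrite ino leq_subr/=; apply/eqP/idP => [<-|hi].
      by rewrite inordK ?leq_subr// (leq_ltn_trans (leq_subr _ _)).
    by rewrite subKn// inord_val.
  rewrite ino leq_subr/= => /eqP iE.
  have hi : (i <= n)%N.
    by rewrite -iE inordK ?leq_subr// (leq_ltn_trans (leq_subr _ _)).
  rewrite subKn// /F -[X in _ *: X = _]scaler_nat scalerA; congr (_ *: _).
  rewrite bin_sub//; have := bin_fact hi; move=> /(congr1 (fun k => k%:R : R)).
  rewrite !natrM => h.
  have i0 : (i`!)%:R != 0 :> R by rewrite pnatr_eq0 -lt0n fact_gt0.
  have j0 : ((n - i)`!)%:R != 0 :> R by rewrite pnatr_eq0 -lt0n fact_gt0.
  have n0 : (n`!)%:R != 0 :> R by rewrite pnatr_eq0 -lt0n fact_gt0.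
  rewrite -h; field; rewrite i0 j0/=.
  by apply: contra n0 => /eqP c0; rewrite -h c0 mul0r.
rewrite (exchange_big_dep xpredT)//= mulr_suml; apply: eq_bigr => i _.
rewrite mulr_sumr.
transitivity (\sum_(j < M.+1 | (i + j < M.+1)%N) F i j); last first.
  rewrite [RHS](bigID (fun j : 'I_M.+1 => (i + j < M.+1)%N))/= [X in _ = _ + X]big1 ?addr0.
    by apply: eq_bigr => j _; rewrite -scalerAl -scalerAr scalerA.
  move=> j; rewrite -leqNgt => hj.
  by rewrite -scalerAl -scalerAr scalerA; exact: F0.
rewrite (reindex_onto (fun j : 'I_M.+1 => inord (i + j) : 'I_M.+1)
                      (fun j : 'I_M.+1 => inord (j - i) : 'I_M.+1))/=; last first.
  move=> j hj; apply: val_inj => /=; rewrite (@inordK _ (j - i)); last first.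
    by rewrite (leq_ltn_trans (leq_subr _ _)).
  by rewrite subnKC// inordK.
apply: eq_big => [j|j /andP[_ /eqP hj]].
  apply/andP/idP => [[h1 /eqP h2]|hj]; last first.
    by rewrite inordK// leq_addr addKn inord_val.
  have := congr1 (@nat_of_ord _) h2; rewrite inordK => [h3|]; last first.
    by rewrite (leq_ltn_trans (leq_subr _ _)).
  rewrite ltnNge; apply/negP => hM.
  have := ltn_ord (inord (i + j) : 'I_M.+1).
  by rewrite -(subnKC h1) h3 ltnNge hM.
have := congr1 (@nat_of_ord _) hj; rewrite inordK => [->//|].
by rewrite (leq_ltn_trans (leq_subr _ _)).
Qed.

Lemma texp0 : texp 0 = 1.
Proof.
rewrite /texp big_ord_recl/= expr0 fact0 invr1 scale1r big1 ?addr0// => i _.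
by rewrite expr0n/= scaler0.
Qed.

Lemma body_texp u : body u = 0 -> body (texp u) = 1.
Proof.
move=> bu; rewrite /texp body_sum big_ord_recl/= bodyZ expr0 fact0 invr1 body1 mulr1.
rewrite big1 ?addr0// => i _; rewrite bodyZ exprS bodyM bu mul0r mulr0//.
Qed.

Lemma body_sub u : body (u - (body u)%:A) = 0.
Proof. by rewrite bodyB body_scalar subrr. Qed.

Lemma gexpD u v : geven u -> gexp (u + v) = gexp u * gexp v.
Proof.
move=> hu; rewrite !gexpE bodyD expRD scalerDl opprD addrACA (@texpD (u - _)) ?body_sub//.
  by rewrite -scalerAl -scalerAr scalerA.
by apply: geven_comm; apply: gevenB => //; exact: geven_scalar.
Qed.

Lemma gexp_scalar c : gexp c%:A = (expR c)%:A.
Proof. by rewrite gexpE body_scalar subrr texp0. Qed.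

Lemma body_gexp u : body (gexp u) = expR (body u).
Proof. by rewrite gexpE bodyZ body_texp ?mulr1// body_sub. Qed.

Lemma superfun1_sq0 (f : R -> R) c u : body u = 0 -> u * u = 0 ->
  superfun1 f (c%:A + u) = (f c)%:A + derive1 f c *: u.
Proof.
move=> bu uu; rewrite /superfun1 bodyD body_scalar bu addr0.
have -> : c%:A + u - c%:A = u by rewrite addrAC subrr add0r.
have h n : u ^+ n.+2 = 0 by rewrite 2!exprS mulrA uu mul0r.
move eqN : #|G| => [|N].
  rewrite big_ord1/= expr0 fact0 divr1 (_ : u = 0) ?scaler0 ?addr0//.
  by apply: (@gord_nil _ _ 1); rewrite ?eqN//; exact/gord_body.
rewrite 2!big_ord_recl big1 ?addr0/=; last by move=> i _; rewrite h scaler0.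
by rewrite /bump/= expr0 expr1 fact0 !divr1.
Qed.

Lemma gexp_sq0 u : body u = 0 -> u * u = 0 -> gexp u = 1 + u.
Proof.
move=> bu uu; have := superfun1_sq0 expR 0 bu uu.
by rewrite scale0r add0r /gexp => ->; rewrite derive1_expR expR0 !scale1r.
Qed.

Lemma geven_texp u : geven u -> geven (texp u).
Proof. by move=> hu; apply: geven_sum => i _; apply/gevenZ/gevenX. Qed.

Lemma geven_gexp u : geven u -> geven (gexp u).
Proof.
move=> hu; rewrite gexpE; apply/gevenZ/geven_texp/gevenB => //.
exact: geven_scalar.
Qed.

Lemma gderivX x q n : geven q -> gderiv x (q ^+ n.+1) = n.+1%:R *: (gderiv x q * q ^+ n).
Proof.
move=> hq; elim: n => [|n IHn]; first by rewrite scale1r mulr1.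
rewrite exprS gderivM IHn gpar_even// -scalerAr mulrA (geven_comm _ hq) -mulrA -exprS.
by rewrite -[X in X + _]scale1r -scalerDl -(mulrS 1 n.+1).
Qed.

Lemma gderiv_gexp x q : geven q -> gderiv x (gexp q) = gderiv x q * gexp q.
Proof.
move=> hq; rewrite gexpE gderivZ -scalerAr; congr (_ *: _).
set p := q - _; have hp : geven p by apply: gevenB => //; exact: geven_scalar.
have -> : gderiv x q = gderiv x p.
  by rewrite /p gderivD gderivN gderivZ gderiv1 scaler0 subr0.
have E0 : gderiv x p * p ^+ #|G| = 0.
  have [G0|G0] := leqP #|G| 0.
    rewrite (@gord_nil _ _ 1 p) ?ltnS// ?gderiv0 ?mul0r//.
    exact/gord_body/body_sub.
  rewrite (@gord_nil _ _ (2 * #|G|) (p ^+ _)) ?mulr0//.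
    by rewrite mul2n -addnn -addn1 leq_add2l.
  exact/gordX/geven_gord2/body_sub.
rewrite /texp gderiv_sum big_ord_recl big_ord_recr/= mulrDr -scalerAr E0.
rewrite expr0 gderivZ gderiv1 !scaler0 add0r addr0 mulr_sumr.
apply: eq_bigr => i _.
rewrite gderivZ /bump/= add1n gderivX// scalerA -scalerAr; congr (_ *: _).
by rewrite factS natrM invfM mulrAC mulVf ?mul1r// pnatr_eq0.
Qed.

End GExp.

(** ** Berezin integration of Gaussians *)

(* Eliminating the variable i from the quadratic form of matrix A. *)
Definition schur (R : realType) (V : finType) (A : V -> V -> R) (i : V) :
  V -> V -> R := fun j k => A j k - A j i * A i k / A i i.

Fixpoint elim_on (R : realType) (V : finType) (s : seq V) (A : V -> V -> R) :
  V -> V -> R := if s is i :: s' then schur (elim_on s' A) i else A.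

Fixpoint pivots (R : realType) (V : finType) (s : seq V) (A : V -> V -> R) : seq R :=
  if s is i :: s' then elim_on s' A i i :: pivots s' A else [::].

Section BerezinGauss.
Context (R : realType) (V : finType).
Local Notation gr := (grassmann R (V + V)%type).
Implicit Types (A B : V -> V -> R) (i j k : V) (s : seq V) (u v : gr).

Definition gxi i : gr := generator (inl i).
Definition geta i : gr := generator (inr i).
Definition gquad A : gr := - \sum_i \sum_j A i j *: (gxi i * geta j).

Lemma geven_xieta i j : geven (gxi i * geta j).
Proof. by apply: goddM; exact: godd_gen. Qed.

Lemma geven_gquad A : geven (gquad A).
Proof.
by apply/gevenN/geven_sum => i _; apply: geven_sum => j _; exact/gevenZ/geven_xieta.
Qed.

Lemma body_xieta i j : body (gxi i * geta j) = 0.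
Proof. by rewrite bodyM body_gen mul0r. Qed.

Lemma body_gquad A : body (gquad A) = 0.
Proof.
rewrite /gquad -scaleN1r bodyZ body_sum big1 ?mulr0// => i _.
by rewrite body_sum big1// => j _; rewrite bodyZ body_xieta mulr0.
Qed.

(** Integrating out one vertex of a fermionic Gaussian leaves the Gaussian of
    the Schur complement, exactly as for real Gaussian variables. *)
Lemma gderiv_gquad B i : B i i != 0 ->
  gderiv (inl i) (gderiv (inr i) (gexp (gquad B))) =
  B i i *: gexp (gquad (schur B i)).
Proof.
move=> Bii; have eB := geven_gquad B.
pose zeta : gr := \sum_j B j i *: gxi j.
pose etah : gr := \sum_k B i k *: geta k.
have ozeta : godd zeta by apply: godd_sum => j _; exact/goddZ/godd_gen.
have oetah : godd etah by apply: godd_sum => j _; exact/goddZ/godd_gen.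
have d1 : gderiv (inr i) (gquad B) = zeta.
  rewrite gderivN gderiv_sum -sumrN; apply: eq_bigr => j _.
  rewrite gderiv_sum (bigD1 i)//= big1 ?addr0; last first.
    move=> k ki; rewrite gderivZ gderivM !gderiv_gen/= scale0r mul0r add0r.
    by rewrite (inj_eq (@inr_inj _ _)) eq_sym (negPf ki) scale0r mulr0 scaler0.
  rewrite gderivZ gderivM !gderiv_gen/= scale0r mul0r add0r eqxx scale1r mulr1.
  by rewrite gpar_odd ?scalerN ?opprK//; exact: godd_gen.
have d2 : gderiv (inl i) (gquad B) = - etah.
  rewrite gderivN gderiv_sum (bigD1 i)//= [X in _ + X]big1 ?addr0; last first.
    move=> j ji; rewrite gderiv_sum big1// => k _.
    rewrite gderivZ gderivM !gderiv_gen/= scale0r mulr0 addr0.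
    by rewrite (inj_eq (@inl_inj _ _)) eq_sym (negPf ji) scale0r mul0r scaler0.
  congr (- _); rewrite gderiv_sum; apply: eq_bigr => k _.
  by rewrite gderivZ gderivM !gderiv_gen/= scale0r mulr0 addr0 eqxx scale1r mul1r.
have d3 : gderiv (inl i) zeta = (B i i)%:A.
  rewrite gderiv_sum (bigD1 i)//= big1 ?addr0; last first.
    move=> j ji; rewrite gderivZ gderiv_gen.
    by rewrite (inj_eq (@inl_inj _ _)) eq_sym (negPf ji) scale0r scaler0.
  by rewrite gderivZ gderiv_gen eqxx scale1r.
rewrite gderiv_gexp// d1 gderivM d3 gderiv_gexp// d2 gpar_odd//.
rewrite mulNr mulNr mulrN opprK mulrA -mulrDl.
pose p : gr := (B i i)^-1 *: (zeta * etah).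
have ep : geven p by exact/gevenZ/goddM.
have bp : body p = 0 by rewrite bodyZ bodyM godd_body// mul0r mulr0.
have pp : p * p = 0.
  rewrite /p -scalerAl -scalerAr mulrA -(mulrA zeta) (godd_anticomm oetah ozeta).
  by rewrite mulrN mulNr !mulrA godd_sq0// !mul0r oppr0 !scaler0.
have -> : (B i i)%:A + zeta * etah = B i i *: (1 + p).
  by rewrite scalerDr /p scalerA mulfV// scale1r.
rewrite -gexp_sq0// -scalerAl -gexpD//; congr (_ *: gexp _).
rewrite /p /zeta /etah /gquad -!sumrN mulr_suml scaler_sumr -big_split/=.
apply: eq_bigr => j _; rewrite -!sumrN mulr_sumr scaler_sumr -big_split/=.
apply: eq_bigr => k _; rewrite -scalerAl -scalerAr !scalerA -scaleNr -scalerDl -scaleNr.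
by congr (_ *: _); rewrite /schur; ring.
Qed.

Lemma berezinD s u v : berezin s (u + v) = berezin s u + berezin s v.
Proof.
rewrite /berezin -bodyD; congr body; elim: s => //= i s ->.
by rewrite !gderivD.
Qed.
Lemma berezinZ s (c : R) u : berezin s (c *: u) = c * berezin s u.
Proof.
rewrite /berezin -bodyZ; congr body; elim: s => //= i s ->.
by rewrite !gderivZ.
Qed.
Lemma berezin0 s : berezin s (0 : gr) = 0.
Proof. by rewrite -(scale0r (0 : gr)) berezinZ mul0r. Qed.

Lemma berezin_gexp s A : (forall p, p \in pivots s A -> p != 0) ->
  berezin s (gexp (gquad A)) = \prod_(p <- pivots s A) p.
Proof.
move=> hp; rewrite /berezin.
have -> : foldr (fun i w => gderiv (inl i) (gderiv (inr i) w)) (gexp (gquad A)) s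
    = (\prod_(p <- pivots s A) p) *: gexp (gquad (elim_on s A)).
  elim: s hp => [|i s IHs] hp /=; first by rewrite big_nil scale1r.
  rewrite IHs => [|p ps]; last by apply: hp; rewrite /= inE ps orbT.
  rewrite !gderivZ gderiv_gquad; last by apply: hp; rewrite /= inE eqxx.
  by rewrite scalerA big_cons mulrC.
by rewrite bodyZ body_gexp body_gquad expR0 mulr1.
Qed.

End BerezinGauss.

(** * Bounds on Grassmann-valued functions *)
Section GNorm.
Context (R : realType) (G : finType).
Local Notation gr := (grassmann R G).
Implicit Types (u v q : gr) (x : G) (c : R).

Definition gnorm u : R := \sum_A `|gcoef u A|.

Lemma gnorm_ge0 u : 0 <= gnorm u. Proof. by rewrite sumr_ge0. Qed.
Lemma gcoef_le u A : `|gcoef u A| <= gnorm u.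
Proof. by rewrite /gnorm (bigD1 A)//= lerDl sumr_ge0. Qed.
Lemma gnorm0 : gnorm 0 = 0.
Proof. by rewrite /gnorm big1// => A _; rewrite gcoef0 normr0. Qed.
Lemma gnormD u v : gnorm (u + v) <= gnorm u + gnorm v.
Proof.
by rewrite /gnorm -big_split/=; apply: ler_sum => A _; rewrite gcoefD ler_normD.
Qed.
Lemma gnormZ c u : gnorm (c *: u) = `|c| * gnorm u.
Proof.
by rewrite /gnorm mulr_sumr; apply: eq_bigr => A _; rewrite gcoefZ normrM.
Qed.
Lemma gnormN u : gnorm (- u) = gnorm u.
Proof. by rewrite -scaleN1r gnormZ normrN1 mul1r. Qed.
Lemma gnorm_mono (B : {set G}) u : (forall A, A != B -> gcoef u A = 0) ->
  gnorm u = `|gcoef u B|.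
Proof.
by move=> h; rewrite /gnorm (bigD1 B)//= big1 ?addr0// => A AB; rewrite h// normr0.
Qed.
Lemma gnorm1 : gnorm 1 = 1.
Proof.
rewrite (@gnorm_mono finset.set0) ?gcoef1 ?eqxx ?normr1// => A A0.
by rewrite gcoef1 (negPf A0).
Qed.
Lemma gnorm_sum I (r : seq I) (P : pred I) (F : I -> gr) :
  gnorm (\sum_(i <- r | P i) F i) <= \sum_(i <- r | P i) gnorm (F i).
Proof.
elim/big_ind2: _ => //; first by rewrite gnorm0.
by move=> u a v b ha hb; rewrite (le_trans (gnormD _ _))// lerD.
Qed.
Lemma gnormM u v : gnorm (u * v) <= gnorm u * gnorm v.
Proof.
rewrite /gnorm.
apply: (@le_trans _ _ (\sum_(S : {set G}) \sum_(A : {set G} | A \subset S)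
    `|gcoef u A| * `|gcoef v (finset.setD S A)|)).
  apply: ler_sum => S _; rewrite gcoefM (le_trans (ler_norm_sum _ _ _))//.
  by apply: ler_sum => A _; rewrite !normrM normrX normrN1 expr1n mul1r.
rewrite (exchange_big_dep xpredT)//= mulr_suml; apply: ler_sum => A _.
rewrite -mulr_sumr ler_wpM2l//.
rewrite (reindex_onto (fun B : {set G} => finset.setU A B)
                      (fun S : {set G} => finset.setD S A))/=; last first.
  by move=> S AS; rewrite -[RHS](finset.setID S A) (finset.setIidPr AS).
rewrite big_mkcond/=; apply: ler_sum => B _; case: ifP => // /andP[_ /eqP ->].
by [].
Qed.
Lemma gnormX u n : gnorm (u ^+ n) <= gnorm u ^+ n.
Proof.
elim: n => [|n IHn]; first by rewrite gnorm1.
by rewrite !exprS (le_trans (gnormM _ _))// ler_wpM2l// gnorm_ge0.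
Qed.
Lemma gnorm_prod I (r : seq I) (P : pred I) (F : I -> gr) :
  gnorm (\prod_(i <- r | P i) F i) <= \prod_(i <- r | P i) gnorm (F i).
Proof.
elim: r => [|i r IHr]; first by rewrite !big_nil gnorm1.
rewrite !big_cons; case: ifP => // Pi.
by rewrite (le_trans (gnormM _ _))// ler_wpM2l// gnorm_ge0.
Qed.

(** As [texp] is a polynomial, nilpotent parts only cost polynomial factors. *)
Lemma gnorm_texp u : gnorm (texp u) <= #|G|.+1%:R * (1 + gnorm u) ^+ #|G|.
Proof.
rewrite /texp (le_trans (gnorm_sum _ _ _))//.
rewrite mulr_natl -[X in _ *+ X]card_ord -sumr_const; apply: ler_sum => n _.
rewrite gnormZ ger0_norm ?invr_ge0// (@le_trans _ _ (gnorm (u ^+ n)))//.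
  by rewrite ler_piMl ?gnorm_ge0// invf_le1 ?ler1n ?fact_gt0// ltr0n fact_gt0.
rewrite (le_trans (gnormX _ _))// (@le_trans _ _ ((1 + gnorm u) ^+ n))//.
  by rewrite lerXn2r// ?nnegrE ?addr_ge0 ?gnorm_ge0// lerDr.
by rewrite ler_weXn2l ?lerDl ?gnorm_ge0// -ltnS.
Qed.

Lemma gnorm_gexp u : gnorm (gexp u) <=
  expR (body u) * (#|G|.+1%:R * (1 + gnorm (u - (body u)%:A)) ^+ #|G|).
Proof.
by rewrite gexpE gnormZ ger0_norm ?expR_ge0// ler_wpM2l ?expR_ge0// gnorm_texp.
Qed.

Lemma gnorm_gderiv x u : gnorm (gderiv x u) <= gnorm u.
Proof.
rewrite /gnorm [leRHS](bigID (fun A : {set G} => x \in A))/= ler_wpDr ?sumr_ge0//.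
rewrite [leRHS](reindex_onto (fun B : {set G} => finset.setU (finset.set1 x) B)
                      (fun S : {set G} => finset.setD S (finset.set1 x)))/=; last first.
  by move=> S AS; rewrite finset.setD1K.
rewrite [leRHS]big_mkcond/=; apply: ler_sum => A _; rewrite ffunE.
case: ifPn => [|xA]; first by rewrite normr0; case: ifP.
rewrite finset.in_setU finset.in_set1 eqxx/= finset.setU1K// eqxx.
by rewrite normrM normrX normrN1 expr1n mul1r.
Qed.

(** ** Coefficientwise differentiation *)
Definition gder (f : R -> gr) (t : R) (f' : gr) :=
  forall A, is_derive t (1 : R) (fun r => gcoef (f r) A) (gcoef f' A).

Lemma gder_ext f g t f' : (forall r, f r = g r) -> gder f t f' -> gder g t f'.
Proof. by move=> /funext ->. Qed.
Lemma gder_cst u t : gder (fun=> u) t 0.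
Proof. by move=> A; rewrite gcoef0; exact: is_derive_cst. Qed.
Lemma gderD f g t f' g' : gder f t f' -> gder g t g' ->
  gder (fun r => f r + g r) t (f' + g').
Proof.
move=> hf hg A; rewrite gcoefD.
rewrite (_ : (fun r => _) = (fun r => gcoef (f r) A) \+ (fun r => gcoef (g r) A)).
  exact: is_deriveD.
by apply/funext => r; rewrite gcoefD.
Qed.
Lemma gder_scale (c : R -> R) f t (c' : R) f' : is_derive t (1 : R) c c' ->
  gder f t f' -> gder (fun r => c r *: f r) t (c' *: f t + c t *: f').
Proof.
move=> hc hf A; rewrite gcoefD !gcoefZ; have hfA := hf A.
rewrite (_ : (fun r => _) = c * (fun r => gcoef (f r) A)).
  by apply: is_derive_eq; rewrite /GRing.scale/=; ring.
by apply/funext => r; rewrite gcoefZ.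
Qed.
Lemma gder_sum I (r : seq I) (P : pred I) (F : I -> R -> gr) t (F' : I -> gr) :
  (forall i, P i -> gder (F i) t (F' i)) ->
  gder (fun x : R => \sum_(i <- r | P i) F i x) t (\sum_(i <- r | P i) F' i).
Proof.
move=> h; elim: r => [|i r IHr].
  rewrite big_nil; apply: gder_ext (gder_cst 0 t) => x.
  by rewrite big_nil.
rewrite big_cons; case: ifP => Pi.
  apply: gder_ext (gderD (h i Pi) IHr) => x.
  by rewrite big_cons Pi.
by apply: gder_ext IHr => x; rewrite big_cons Pi.
Qed.
Lemma is_derive_sum_seq I (r : seq I) (P : pred I) (F : I -> R -> R) t (F' : I -> R) :
  (forall i, P i -> is_derive t (1 : R) (F i) (F' i)) ->
  is_derive t (1 : R) (fun x : R => \sum_(i <- r | P i) F i x) (\sum_(i <- r | P i) F' i).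
Proof.
move=> h; elim: r => [|i r IHr].
  rewrite big_nil (_ : (fun x : R => _) = cst 0); first exact: is_derive_cst.
  by apply/funext => x; rewrite big_nil.
rewrite big_cons; case: ifP => Pi.
  rewrite (_ : (fun x : R => _) = F i \+ (fun x : R => \sum_(i <- r | P i) F i x)).
    by apply: is_deriveD => //; exact: h.
  by apply/funext => x; rewrite big_cons Pi.
rewrite (_ : (fun x : R => _) = (fun x : R => \sum_(i <- r | P i) F i x))//.
by apply/funext => x; rewrite big_cons Pi.
Qed.
Lemma gderM f g t f' g' : gder f t f' -> gder g t g' ->
  gder (fun r => f r * g r) t (f' * g t + f t * g').
Proof.
move=> hf hg S; rewrite gcoefD !gcoefM -big_split/=.
rewrite (_ : (fun r => _) = fun r => \sum_(A : {set G} | A \subset S)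
  (-1) ^+ inversions A (finset.setD S A) * gcoef (f r) A * gcoef (g r) (finset.setD S A)).
  apply: is_derive_sum_seq => A _; set c := (-1) ^+ _.
  have hfA := hf A; have hgA := hg (finset.setD S A).
  rewrite (_ : (fun r => _) = c \*: ((fun r => gcoef (f r) A) *
      (fun r => gcoef (g r) (finset.setD S A)))).
    by apply: is_derive_eq; rewrite /GRing.scale/=; ring.
  by apply/funext => r; exact: esym (mulrA c _ _).
by apply/funext => r; rewrite gcoefM.
Qed.
Lemma gderX f t f' n : (forall r, geven (f r)) -> gder f t f' ->
  gder (fun r => f r ^+ n.+1) t (n.+1%:R *: (f' * f t ^+ n)).
Proof.
move=> ef hf; elim: n => [|n IHn]; first by rewrite scale1r mulr1.
have := gderM hf IHn; rewrite -scalerAr mulrA (geven_comm _ (ef t)) -mulrA -exprS.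
rewrite -[X in X + _]scale1r -scalerDl -(mulrS 1 n.+1).
by apply: gder_ext => r; rewrite -exprS.
Qed.

Lemma gder_texp f t f' : (forall r, geven (f r)) -> (forall r, body (f r) = 0) ->
  gder f t f' -> gder (fun r => texp (f r)) t (f' * texp (f t)).
Proof.
move=> ef bf hf.
have bf' : body f' = 0.
  have := hf finset.set0; rewrite (_ : (fun r => _) = cst 0); last first.
    by apply/funext => r; exact: bf.
  by move=> h; rewrite /body -(@derive_val _ _ _ _ _ _ _ h) derive_cst.
have E0 : f' * f t ^+ #|G| = 0.
  apply: gord_max; rewrite -add1n -[X in (_ + X)%N]mul1n.
  by apply: gordM; [exact/gord_body|apply: gordX; exact/gord_body].
rewrite {2}/texp big_ord_recr/= mulrDr -scalerAr E0 scaler0 addr0 mulr_sumr.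
pose F (n : 'I_#|G|.+1) : gr :=
  (n`!%:R)^-1 *: (if n == 0%N :> nat then 0 else n%:R *: (f' * f t ^+ n.-1)).
have -> : \sum_(i < #|G|) f' * (i`!%:R^-1 *: f t ^+ i) = \sum_n F n.
  rewrite big_ord_recl {1}/F/= scaler0 add0r; apply: eq_bigr => i _.
  rewrite /F !lift0/= scalerA -scalerAr factS natrM invfM; congr (_ *: _).
  by rewrite mulrAC mulVf ?mul1r// pnatr_eq0.
apply: gder_sum => -[n hn] _.
have h : gder (fun r => f r ^+ n) t (if n == 0%N :> nat then 0 else n%:R *: (f' * f t ^+ n.-1)).
  by case: n {hn} => [|n]; [exact: gder_cst|exact: gderX].
by have := gder_scale (is_derive_cst ((n`!)%:R^-1 : R) t 1) h; rewrite scale0r add0r.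
Qed.

Lemma gder_scalar (c : R -> R) t c' : is_derive t (1 : R) c c' ->
  gder (fun r => (c r)%:A) t c'%:A.
Proof.
by move=> h; have := gder_scale h (gder_cst 1 t); rewrite scaler0 addr0.
Qed.

Lemma gder_gexp f t f' : (forall r, geven (f r)) -> gder f t f' ->
  gder (fun r => gexp (f r)) t (f' * gexp (f t)).
Proof.
move=> ef hf; pose b r := body (f r); pose p r := f r - (b r)%:A.
have hb : is_derive t (1 : R) b (body f') by exact: (hf finset.set0).
have hp : gder p t (f' - (body f')%:A).
  have hs := gder_scalar (is_deriveN hb).
  rewrite -scaleNr; apply: gder_ext (gderD hf hs) => r.
  by rewrite -/(b r) /p -scaleNr.
have ep r : geven (p r) by apply: gevenB => //; exact: geven_scalar.
have bp r : body (p r) = 0 by exact: body_sub.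
have he : is_derive t (1 : R) (expR \o b) (expR (b t) * body f').
  by apply: is_derive_eq; rewrite /GRing.scale/= mulrC.
have := gder_scale he (gder_texp ep bp hp).
rewrite -/(b t) gexpE -/(b t) -/(p t).
have -> : (expR (b t) * body f') *: texp (p t) +
  expR (b t) *: ((f' - (body f')%:A) * texp (p t)) = f' * (expR (b t) *: texp (p t)).
  rewrite -scalerA -scalerDr -scalerAr; congr (_ *: _).
  by rewrite mulrBl -scalerAl mul1r addrC subrK.
by apply: gder_ext => r; rewrite gexpE.
Qed.

(** ** Coefficientwise measurability *)
Section Meas.
Context d (T : measurableType d).
Implicit Types (f g : T -> gr).
Definition gmeas f := forall A, measurable_fun setT (fun t => gcoef (f t) A).

Lemma gmeas_cst u : gmeas (fun=> u).
Proof. by move=> A; exact: measurable_cst. Qed.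
Lemma gmeasD f g : gmeas f -> gmeas g -> gmeas (fun t => f t + g t).
Proof.
move=> hf hg A; under eq_fun do rewrite gcoefD.
exact: measurable_funD (hf A) (hg A).
Qed.
Lemma gmeasZ (c : T -> R) f : measurable_fun setT c -> gmeas f ->
  gmeas (fun t => c t *: f t).
Proof.
move=> hc hf A; under eq_fun do rewrite gcoefZ.
exact: measurable_funM hc (hf A).
Qed.
Lemma gmeasN f : gmeas f -> gmeas (fun t => - f t).
Proof.
move=> hf A; under eq_fun do rewrite gcoefN.
exact: measurableT_comp (hf A).
Qed.
Lemma gmeas_sum I (r : seq I) (P : pred I) (F : I -> T -> gr) :
  (forall i, P i -> gmeas (F i)) -> gmeas (fun t => \sum_(i <- r | P i) F i t).
Proof.
move=> h; elim: r => [|i r IHr].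
  by under eq_fun do rewrite big_nil; exact: gmeas_cst.
case Pi: (P i); under eq_fun do rewrite big_cons Pi; last by [].
by apply: gmeasD => //; exact: h.
Qed.
Lemma measurable_sum_seq I (r : seq I) (P : pred I) (F : I -> T -> R) :
  (forall i, P i -> measurable_fun setT (F i)) ->
  measurable_fun setT (fun t => \sum_(i <- r | P i) F i t).
Proof.
move=> h; elim: r => [|i r IHr].
  by under eq_fun do rewrite big_nil; exact: measurable_cst.
case Pi: (P i); under eq_fun do rewrite big_cons Pi; last by [].
by apply: measurable_funD => //; exact: h.
Qed.
Lemma measurable_prod_seq I (r : seq I) (P : pred I) (F : I -> T -> R) :
  (forall i, P i -> measurable_fun setT (F i)) ->
  measurable_fun setT (fun t => \prod_(i <- r | P i) F i t).
Proof.
move=> h; elim: r => [|i r IHr].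
  by under eq_fun do rewrite big_nil; exact: measurable_cst.
case Pi: (P i); under eq_fun do rewrite big_cons Pi; last by [].
by apply: measurable_funM => //; exact: h.
Qed.
Lemma gmeasM f g : gmeas f -> gmeas g -> gmeas (fun t => f t * g t).
Proof.
move=> hf hg S; under eq_fun do rewrite gcoefM.
apply: measurable_sum_seq => A _; apply: measurable_funM => //.
by apply: measurable_funM => //; exact: measurable_cst.
Qed.
Lemma gmeas_prod I (r : seq I) (P : pred I) (F : I -> T -> gr) :
  (forall i, P i -> gmeas (F i)) -> gmeas (fun t => \prod_(i <- r | P i) F i t).
Proof.
move=> h; elim: r => [|i r IHr].
  by under eq_fun do rewrite big_nil; exact: gmeas_cst.
case Pi: (P i); under eq_fun do rewrite big_cons Pi; last by [].
by apply: gmeasM => //; exact: h.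
Qed.
Lemma gmeasX f n : gmeas f -> gmeas (fun t => f t ^+ n).
Proof.
move=> hf; elim: n => [|n IHn]; first exact: gmeas_cst.
by under eq_fun do rewrite exprS; exact: gmeasM.
Qed.
Lemma gmeas_gexp f : gmeas f -> gmeas (fun t => gexp (f t)).
Proof.
move=> hf; under eq_fun do rewrite gexpE.
have hb : measurable_fun setT (fun t => body (f t)) by exact: hf.
apply: gmeasZ; first exact: measurableT_comp hb.
apply: gmeas_sum => n _; apply: (gmeasZ (measurable_cst _)); apply: gmeasX.
apply: gmeasD => //; apply: gmeasN; apply: gmeasZ => //; exact: gmeas_cst.
Qed.
End Meas.
End GNorm.

Section BerezinNorm.
Context (R : realType) (V : finType).
Local Notation gr := (grassmann R (V + V)%type).
Lemma berezin_le (s : seq V) (u : gr) : `|berezin s u| <= gnorm u.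
Proof.
rewrite /berezin (le_trans (gcoef_le _ _))//.
by elim: s => //= i s IHs; do 2 rewrite (le_trans (gnorm_gderiv _ _))//.
Qed.

Lemma gcoef_gderiv_lin (x : (V + V)%type) (u : gr) A :
  gcoef (gderiv x u) A = (if x \in A then 0 else (-1) ^+ inversions (finset.set1 x) A)
    * gcoef u (finset.setU (finset.set1 x) A).
Proof. by rewrite ffunE; case: ifP; rewrite ?mul0r. Qed.

Lemma gmeas_gderiv d (T : measurableType d) (f : T -> gr) x :
  gmeas f -> gmeas (fun t => gderiv x (f t)).
Proof.
move=> hf A; under eq_fun do rewrite gcoef_gderiv_lin.
exact: measurable_funM (measurable_cst _) (hf _).
Qed.
Lemma measurable_berezin d (T : measurableType d) (f : T -> gr) s :
  gmeas f -> measurable_fun setT (fun t => berezin s (f t)).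
Proof.
move=> hf; rewrite /berezin; have : gmeas (fun t => foldr
    (fun i w => gderiv (inl i) (gderiv (inr i) w)) (f t) s).
  by elim: s => //= i s IHs; do 2 apply: gmeas_gderiv.
by apply.
Qed.
Lemma gder_gderiv (f : R -> gr) t f' x :
  gder f t f' -> gder (fun r => gderiv x (f r)) t (gderiv x f').
Proof.
move=> hf A; rewrite gcoef_gderiv_lin; under eq_fun do rewrite gcoef_gderiv_lin.
by have h := hf (finset.setU (finset.set1 x) A); exact: is_deriveZ.
Qed.
Lemma is_derive_berezin (f : R -> gr) t f' s :
  gder f t f' -> is_derive t (1 : R) (fun r => berezin s (f r)) (berezin s f').
Proof.
move=> hf; suff h : gder (fun r => foldr
    (fun i w => gderiv (inl i) (gderiv (inr i) w)) (f r) s) t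
    (foldr (fun i w => gderiv (inl i) (gderiv (inr i) w)) f' s) by exact: h.
by elim: s => //= i s IHs; do 2 apply: gder_gderiv.
Qed.
End BerezinNorm.

Section Expr.
Context (R : realType) (V : finType).

Inductive expr := ECst of R | EVar of V | EAdd of expr & expr
  | EMul of expr & expr | EExp of expr.

Implicit Types (e : expr) (i j : V) (l : V -> R).

Fixpoint eval e l : R := match e with
  | ECst c => c | EVar i => l i
  | EAdd e1 e2 => eval e1 l + eval e2 l
  | EMul e1 e2 => eval e1 l * eval e2 l
  | EExp e1 => expR (eval e1 l) end.

Fixpoint ediff i e : expr := match e with
  | ECst c => ECst 0 | EVar j => ECst (i == j)%:R
  | EAdd e1 e2 => EAdd (ediff i e1) (ediff i e2)
  | EMul e1 e2 => EAdd (EMul (ediff i e1) e2) (EMul e1 (ediff i e2))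
  | EExp e1 => EMul (ediff i e1) (EExp e1) end.

Lemma dfwith_id l i : dfwith l i (l i) = l.
Proof.
by apply/funext => j; have [<-|ij] := eqVneq i j; [rewrite dfwithin|rewrite dfwithout].
Qed.

Lemma is_derive_eval e i l t :
  is_derive t (1 : R) (fun t => eval e (dfwith l i t)) (eval (ediff i e) (dfwith l i t)).
Proof.
elim: e => [c|j|e1 h1 e2 h2|e1 h1 e2 h2|e1 h1] /=.
- exact: is_derive_cst.
- have [<-|ij] := eqVneq i j.
    by under eq_fun do rewrite dfwithin; exact: is_derive_id.
  by under eq_fun do rewrite dfwithout//; exact: is_derive_cst.
- exact: is_deriveD.
- by apply: is_derive_eq; rewrite /GRing.scale/=; ring.
- apply: (@is_derive_eq _ _ _ (expR \o (fun t => eval e1 (dfwith l i t)))).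
  by rewrite /GRing.scale/=; ring.
Qed.

Lemma is_derive_eval1 e i l :
  is_derive (l i) (1 : R) (fun t => eval e (dfwith l i t)) (eval (ediff i e) l).
Proof. by have := is_derive_eval e i l (l i); rewrite dfwith_id. Qed.

Lemma partial_eval e i : partial i (eval e) = eval (ediff i e).
Proof.
apply/funext => l; rewrite /partial derive1E.
by rewrite (@derive_val _ _ _ _ _ _ _ (is_derive_eval1 e i l)).
Qed.

Section Super.
Context (G : finType).
Local Notation gr := (grassmann R G).
Implicit Types (u nu : V -> gr).

Fixpoint geval e u : gr := match e with
  | ECst c => c%:A | EVar i => u i
  | EAdd e1 e2 => geval e1 u + geval e2 u
  | EMul e1 e2 => geval e1 u * geval e2 u
  | EExp e1 => gexp (geval e1 u) end.

Lemma geven_geval e u : (forall i, geven (u i)) -> geven (geval e u).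
Proof.
move=> hu; elim: e => [c|j|e1 h1 e2 h2|e1 h1 e2 h2|e1 h1] //=.
- exact: geven_scalar.
- exact: gevenD.
- exact: gevenM.
- exact: geven_gexp.
Qed.

(** A first order Taylor expansion is exact along a direction of square zero. *)
Lemma geval_shift e u i (n : gr) : (forall i, geven (u i)) -> geven n ->
  body n = 0 -> n * n = 0 ->
  geval e (fun j => u j + (i == j)%:R *: n) = geval e u + n * geval (ediff i e) u.
Proof.
move=> hu en bn nn; have cn := geven_comm _ en.
elim: e => [c|j|e1 h1 e2 h2|e1 h1 e2 h2|e1 h1] /=.
- by rewrite scale0r mulr0 addr0.
- by rewrite -scalerAr mulr1.
- by rewrite h1 h2 mulrDr addrACA.
- rewrite h1 h2; set a1 := geval e1 u; set a2 := geval e2 u.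
  set d1 := geval _ u; set d2 := geval _ u.
  have E1 : a1 * (n * d2) = n * (a1 * d2) by rewrite mulrA -(cn a1) mulrA.
  have E2 : (n * d1) * (n * d2) = 0.
    by rewrite mulrA -(mulrA n) -(cn d1) mulrA nn !mul0r.
  by rewrite mulrDl !mulrDr E1 E2 addr0 -!addrA -mulrA; congr (_ + _); rewrite addrC.
- rewrite h1 gexpD; last exact: geven_geval.
  rewrite [X in _ * X = _]gexp_sq0; last 2 first.
  + by rewrite bodyM bn mul0r.
  + by rewrite mulrA -(mulrA n) -(cn (geval _ _)) !mulrA nn !mul0r.
  rewrite mulrDr mulr1; congr (_ + _).
  by rewrite (geven_comm _ (geven_gexp (geven_geval e1 hu))) mulrA.
Qed.

Lemma prod_zero (I : eqType) (r : seq I) (P : pred I) (F : I -> gr) (k : I) :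
  k \in r -> P k -> F k = 0 -> \prod_(j <- r | P j) F j = 0.
Proof.
move=> kr Pk Fk; elim: r kr => // j r IHr; rewrite inE big_cons => /orP[/eqP <-|kr].
  by rewrite Pk Fk mul0r.
by rewrite IHr//; case: ifP; rewrite ?mulr0.
Qed.

Lemma superfunE (g : (V -> R) -> R) (b : V -> R) nu : (0 < #|G|)%N ->
  (forall i, body (nu i) = 0) -> (forall i, nu i * nu i = 0) ->
  superfun g (fun i => (b i)%:A + nu i) =
  \sum_(A : {set V}) partials [seq i <- enum V | i \in A] g b *:
    \prod_(i <- enum V | i \in A) nu i.
Proof.
move=> G0 bn nn; rewrite /superfun.
have -> : (fun i => body ((b i)%:A + nu i)) = b.
  by apply/funext => i; rewrite bodyD body_scalar bn addr0.
have sub i : (b i)%:A + nu i - (body ((b i)%:A + nu i))%:A = nu i.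
  by rewrite bodyD body_scalar bn addr0 addrAC subrr add0r.
rewrite (eq_bigr (fun al : {ffun V -> 'I_#|G|.+1} =>
    (partials (flatten [seq nseq (al i) i | i <- enum V]) g b / \prod_i (al i)`!%:R) *:
    \prod_i nu i ^+ al i)); last first.
  by move=> al _; congr (_ *: _); apply: eq_bigr => i _; rewrite sub.
rewrite (bigID (fun al : {ffun V -> 'I_#|G|.+1} => [forall i, (al i <= 1)%N]))/=.
rewrite addrC big1 ?add0r; last first.
  move=> al; rewrite negb_forall => /existsP[i]; rewrite -ltnNge => hi.
  rewrite (@prod_zero _ _ _ _ i) ?scaler0 ?mem_index_enum//.
  by case: (al i : nat) hi => // -[|n _]//; rewrite 2!exprS mulrA nn mul0r.
have M1 : (1 < #|G|.+1)%N by [].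
rewrite (reindex_onto
  (fun A : {set V} => [ffun i => if i \in A then Ordinal M1 else ord0] : {ffun V -> 'I_#|G|.+1})
  (fun al : {ffun V -> 'I_#|G|.+1} => finset (fun i => al i == 1%N :> nat)))/=; last first.
  move=> al /forallP hal; apply/ffunP => i; rewrite ffunE inE; have := hal i.
  case: eqP => [h _|h]; first exact: val_inj.
  by rewrite leq_eqVlt ltnS leqn0 => /orP[/eqP//|/eqP h0]; exact: val_inj.
apply: eq_big => [A|A _].
  rewrite (_ : [forall i, _] = true); last first.
    by apply/forallP => i; rewrite ffunE; case: ifP.
  apply/eqP/finset.setP => i; rewrite inE ffunE; by case: (i \in A).
rewrite (_ : \prod_i _ = 1); last first.
  by rewrite big1// => i _; rewrite ffunE; case: ifP.
rewrite divr1; congr (partials _ _ _ *: _).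
  elim: (enum V) => //= i r ->; rewrite ffunE; by case: ifP.
rewrite enumT -/(index_enum V) [RHS]big_mkcond/=; apply: eq_bigr => i _.
by rewrite ffunE; case: ifP.
Qed.

Lemma geval_taylor e (b : V -> R) nu s : uniq s ->
  (forall i, geven (nu i)) ->
  (forall i, body (nu i) = 0) -> (forall i, nu i * nu i = 0) ->
  geval e (fun i => (b i)%:A + (i \in s)%:R *: nu i) =
  \sum_(A : {set V} | [forall i in A, i \in s])
    partials [seq i <- s | i \in A] (eval e) b *: \prod_(i <- s | i \in A) nu i.
Proof.
move=> us en bn nn; elim/last_ind: s us e => [_ e|s i IHs].
  rewrite (big_pred1 finset.set0) /= => [|A].
    rewrite big_nil; under [X in geval e X]eq_fun do rewrite scale0r addr0.
    elim: e => [c|j|e1 h1 e2 h2|e1 h1 e2 h2|e1 h1] //=.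
    - by rewrite h1 h2 -scalerDl.
    - by rewrite h1 h2 -scalerAl mul1r scalerA.
    - by rewrite h1 gexp_scalar.
  apply/forall_inP/eqP => [h|-> j]; last by rewrite inE.
  by apply/finset.setP => j; rewrite inE; apply/negP => /h.
rewrite rcons_uniq => /andP[si us] e.
have -> : (fun j => (b j)%:A + (j \in rcons s i)%:R *: nu j) =
  (fun j => ((b j)%:A + (j \in s)%:R *: nu j) + (i == j)%:R *: nu i).
  apply/funext => j; rewrite mem_rcons inE.
  have [->|ij] := eqVneq j i; first by rewrite (negPf si) scale0r addr0.
  by rewrite scale0r addr0.
rewrite geval_shift//; last first.
  by move=> j; apply: gevenD; [exact: geven_scalar|exact: gevenZ].
rewrite !IHs// [RHS](bigID (fun A : {set V} => i \in A))/= [RHS]addrC; congr (_ + _); last first.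
  rewrite mulr_sumr [RHS](reindex_onto (fun A : {set V} => finset.setU (finset.set1 i) A)
     (fun A : {set V} => finset.setD A (finset.set1 i)))/=; last first.
    by move=> A /andP[_ iA]; rewrite finset.setD1K.
  apply: eq_big => [A|A hA].
    rewrite !inE eqxx/= andbT; apply/idP/andP => [/forall_inP h|[/forall_inP h /eqP hE]].
      split.
        apply/forall_inP => j; rewrite !inE mem_rcons inE => /orP[/eqP ->|/h ->].
          by rewrite eqxx.
        by rewrite orbT.
      by apply/eqP/finset.setU1K; apply: contra si => /h.
    apply/forall_inP => j jA; have := h j; rewrite !inE jA orbT mem_rcons inE => /(_ isT).
    case/orP => // /eqP ji; have := jA; rewrite -hE !inE ji eqxx//.
  have hs : {in s, forall j, (j \in finset.setU (finset.set1 i) A) = (j \in A)}.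
    by move=> j js; rewrite !inE; case: eqP => // ji; rewrite -ji js in si.
  rewrite filter_rcons !inE eqxx/= -!cats1 big_cat/= big_cons big_nil !inE eqxx/= mulr1.
  have pc r : partials (r ++ [:: i]) (eval e) = partials r (eval (ediff i e)).
    by rewrite /partials foldr_cat/= partial_eval.
  rewrite (eq_in_filter hs) -scalerAr pc; congr (_ *: _); rewrite (geven_comm _ (en i)); congr (_ * _).
  by rewrite big_seq_cond [RHS]big_seq_cond; apply: eq_bigl => j; case js: (j \in s) => //=; rewrite hs.
apply: eq_big => [A|A hA].
  apply/forall_inP/andP => [h|[/forall_inP h iA] j jA].
    split; last by apply: contra si => /h.
    by apply/forall_inP => j /h js; rewrite mem_rcons inE js orbT.
  have := h j jA; rewrite mem_rcons inE => /orP[/eqP ji|//].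
  by rewrite -ji jA in iA.
have iA : i \notin A by apply: contra si => iA; move/forall_inP: hA; exact.
by rewrite filter_rcons (negPf iA) -!cats1 big_cat/= [X in _ * X]big_cons (negPf iA) big_nil mulr1.
Qed.

Lemma superfun_eval e (b : V -> R) nu : (0 < #|G|)%N ->
  (forall i, geven (nu i)) ->
  (forall i, body (nu i) = 0) -> (forall i, nu i * nu i = 0) ->
  superfun (eval e) (fun i => (b i)%:A + nu i) = geval e (fun i => (b i)%:A + nu i).
Proof.
move=> G0 en bn nn; rewrite superfunE//.
have := geval_taylor e b (enum_uniq V) en bn nn.
rewrite (_ : (fun i => _ + _) = (fun i => (b i)%:A + nu i)); last first.
  by apply/funext => i; rewrite mem_enum scale1r.
move=> ->; apply: eq_bigl => A; apply/esym/forall_inP => i _.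
by rewrite mem_enum.
Qed.
End Super.
End Expr.

Section IntegralRn.
Context (R : realType).
Local Notation mR := (measurableTypeR R).
Local Notation leb := (@lebesgue_measure R).

Lemma lebesgue_RnS_ge0 n (f : n.+1.-tuple mR -> \bar R) :
  measurable_fun setT f -> (forall t, 0 <= f t)%E ->
  (\int[lebesgue_Rn R n.+1]_t f t =
   \int[leb]_r \int[lebesgue_Rn R n]_t f (cons_pair (r, t)))%E.
Proof.
move=> mf f0.
rewrite [LHS](_ : _ = (\int[(leb \x lebesgue_Rn R n)%E]_p f (cons_pair p))%E).
  rewrite (@fubini_tonelli1 _ _ _ _ _ _ _ (fun p => f (cons_pair p)))//.
  by apply: measurableT_comp => //; exact: measurable_cons_pair.
by rewrite -(@ge0_integral_pushforward _ _ _ _ _ (@cons_pair R n)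
  (@measurable_cons_pair R n) (leb \x lebesgue_Rn R n)%E setT f).
Qed.

Lemma lebesgue_RnS n (f : n.+1.-tuple mR -> \bar R) :
  (lebesgue_Rn R n.+1).-integrable setT f ->
  (leb \x lebesgue_Rn R n)%E.-integrable setT (fun p => f (cons_pair p)) /\
  (\int[lebesgue_Rn R n.+1]_t f t =
   \int[(leb \x lebesgue_Rn R n)%E]_p f (cons_pair p))%E.
Proof.
move=> intf.
have mf : measurable_fun setT f by case/integrableP : intf.
have i2 : (leb \x lebesgue_Rn R n)%E.-integrable setT (fun p => f (cons_pair p)).
  apply/integrableP; split.
    by apply: measurableT_comp => //; exact: measurable_cons_pair.
  case/integrableP : intf => _; apply: le_lt_trans.
  rewrite -(@ge0_integral_pushforward _ _ _ _ _ (@cons_pair R n)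
    (@measurable_cons_pair R n) (leb \x lebesgue_Rn R n)%E setT (fun t => `|f t|%E))//.
  exact: measurableT_comp.
split => //.
by rewrite -(@integral_pushforward _ _ _ _ _ (@cons_pair R n)
  (@measurable_cons_pair R n) (leb \x lebesgue_Rn R n)%E setT f).
Qed.
End IntegralRn.
Section OneDim.
Context (R : realType).
Local Notation mR := (measurableTypeR R).
Local Notation leb := (@lebesgue_measure R).

Lemma gauss1 (p b : R) : 0 < p ->
  (\int[leb]_r (expR (- (p / 2) * (r + b) ^+ 2))%:E = (Num.sqrt (2 * pi / p))%:E)%E.
Proof.
move=> p0; pose s := (Num.sqrt p)^-1.
have s0 : s != 0 by rewrite invr_eq0 sqrtr_eq0 -ltNge.
have s2 : s ^+ 2 = p^-1 by rewrite exprVn sqr_sqrtr// ltW.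
have pk : normal_peak s = (Num.sqrt (2 * pi / p))^-1.
  rewrite /normal_peak s2; congr (Num.sqrt _)^-1; rewrite -mulr_natl; field.
  by rewrite gt_eqF.
have pk0 : normal_peak s != 0 by rewrite gt_eqF// normal_peak_gt0.
have := integral_normal_pdf (- b) s; rewrite normal_pdfE//.
under eq_integral do rewrite EFinM.
have mf : measurable_fun setT (fun r => (normal_fun (- b) s r)%:E).
  by apply/measurable_EFinP; exact: measurable_normal_fun.
rewrite ge0_integralZl//; last 2 first.
- by move=> r _; rewrite lee_fin normal_fun_ge0.
- by rewrite lee_fin normal_peak_ge0.
move=> h; have E r : expR (- (p / 2) * (r + b) ^+ 2) = normal_fun (- b) s r.
  rewrite /normal_fun opprK s2 -mulr_natl; congr expR; field.
  by rewrite gt_eqF.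
under eq_integral do rewrite E.
have := congr1 (fun z => ((normal_peak s)^-1%:E * z)%E) h.
by rewrite /= muleA -EFinM mulVf// mul1e mule1 pk invrK.
Qed.

Lemma cauchy1 : (\int[leb]_r ((1 + r ^+ 2)^-1)%:E < +oo)%E.
Proof.
pose f (r : R) : R := (1 + r ^+ 2)^-1.
have cf : continuous f by exact: continuous_oneDsqrV.
have m D : measurable_fun D (fun r : mR => (f r)%:E).
  by apply/measurable_EFinP; apply: measurable_funTS; exact: continuous_measurable_fun.
have E : [set: R] = `]-oo, 0%R] `|` `]0%R, +oo[.
  apply/seteqP; split => // x _ /=; rewrite !in_itv/= andbT.
  by case: (leP x 0) => h; [left|right].
have p r : (0 <= (f r)%:E :> \bar R)%E.
  by rewrite lee_fin invr_ge0 addr_ge0// sqr_ge0.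
have p0 r : 0 <= f r by rewrite -lee_fin.
have hp : (\int[leb]_(x in `[0%R, +oo[) (f x)%:E < +oo)%E.
  by rewrite integral0y_oneDsqr ltry.
change (\int[leb]_r (f r)%:E < +oo)%E.
rewrite E ge0_integral_setU//; last first.
  rewrite disj_set2E; apply/eqP/seteqP; split => // x [] /=.
  by rewrite !in_itv/= andbT => x0; rewrite ltNge x0.
apply: lte_add_pinfty; last first.
  apply: le_lt_trans hp; apply: ge0_subset_integral => //.
  by apply: subset_itvr; rewrite bnd_simp.
rewrite -[0%R]oppr0 ge0_integration_by_substitutionNy//.
  under eq_integral do rewrite /= /f sqrrN.
  exact: hp.
by apply: continuous_subspaceT.
Qed.

Lemma integrable_cauchy : leb.-integrable setT (fun r : mR => ((1 + r ^+ 2)^-1)%:E).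
Proof.
apply/integrableP; split.
  apply/measurable_EFinP; apply: continuous_measurable_fun.
  exact: (@continuous_oneDsqrV R).
under eq_integral do rewrite gee0_abs ?lee_fin ?invr_ge0 ?addr_ge0 ?sqr_ge0//.
exact: cauchy1.
Qed.

Lemma integral_derive0 (f f' : R -> R) (C : R) :
  (forall r, is_derive r (1 : R) f (f' r)) -> continuous f' ->
  (forall r, `|f r| <= C / (1 + r ^+ 2)) ->
  (forall r, `|f' r| <= C / (1 + r ^+ 2)) ->
  (\int[leb]_r (f' r)%:E = 0)%E.
Proof.
move=> df cf' bf bf'.
have p r : 0 < 1 + r ^+ 2 :> R by rewrite ltr_wpDr ?sqr_ge0.
pose I (n : nat) : set R := `[(- n%:R), n%:R]%classic.
have C0 : 0 <= C.
  have := le_trans (normr_ge0 _) (bf 0).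
  by rewrite expr0n/= addr0 divr1.
have mf' : measurable_fun setT (fun r : mR => (f' r)%:E).
  by apply/measurable_EFinP; apply: continuous_measurable_fun; exact: cf'.
have mI n : measurable (I n : set mR) by exact: measurable_itv.
have h : (\int[leb]_r ((EFin \o f') \_ (I n)) r @[n --> \oo] --> \int[leb]_r (f' r)%:E)%E.
  apply: (@dominated_cvg _ mR R leb setT measurableT _ _ (fun r => (C / (1 + r ^+ 2))%:E)) => //.
  - by move=> n; apply/(measurable_restrictT _ _).1 => //; exact: measurable_funTS.
  - move=> r _ /=; apply: cvg_near_cst; near=> n.
    rewrite patchT// inE /I/= in_itv/= -ler_norml.
    by near: n; exact: nbhs_infty_ger.
  - by under eq_fun do rewrite EFinM; exact/integrableZl/integrable_cauchy.
  - move=> n r _; rewrite patchE; case: ifP => _.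
      by rewrite /= lee_fin.
    by rewrite abse0 lee_fin divr_ge0// ltW.
have {}h := cvg_lim _ h; rewrite -h//.
apply/cvg_lim => //.
have E (n : nat) : (\int[leb]_r ((EFin \o f') \_ (I n.+1)) r = (f n.+1%:R - f (- n.+1%:R))%:E)%E.
  rewrite -integral_mkcond (continuous_FTC2 (F := f))//.
  - by rewrite (@lt_trans _ _ 0)// ?oppr_lt0 ltr0n.
  - exact: continuous_subspaceT.
  - have cf x : {for x, continuous f} by apply/differentiable_continuous/derivable1_diffP; case: (df x).
    split; first by move=> x _; case: (df x).
      exact/cvg_at_right_filter/cf.
    exact/cvg_at_left_filter/cf.
  - by move=> x _; rewrite derive1E (@derive_val _ _ _ _ _ _ _ (df x)).
rewrite -(cvg_shiftS (fun n => \int[leb]_r _)%E).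
rewrite (_ : (fun n => _) = (fun n => (f n.+1%:R - f (- n.+1%:R))%:E)); last exact/funext.
apply: cvg_EFin; first by near=> n.
have q (n : nat) : n.+1%:R <= 1 + n.+1%:R ^+ 2 :> R.
  have : 1 <= n.+1%:R :> R by rewrite ler1n.
  by move: (n.+1%:R : R) => x; nra.
have hc : (C *+ 2) * (n.+1%:R)^-1 @[n --> \oo] --> (0 : R).
  rewrite -[X in _ --> X](mulr0 (C *+ 2)); apply: cvgMl_tmp; exact: cvg_harmonic.
have hc' : - ((C *+ 2) * (n.+1%:R)^-1) @[n --> \oo] --> (0 : R).
  by rewrite -[X in _ --> X]oppr0; exact: cvgN.
apply: (squeeze_cvgr _ hc' hc); near=> n; rewrite -ler_norml /comp/=.
rewrite (le_trans (ler_normB _ _))//.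
by rewrite mulrnAl mulr2n lerD// (le_trans (bf _))// ?sqrrN ler_wpM2l// lef_pV2 ?posrE// q.
Unshelve. all: by end_near.
Qed.
End OneDim.
Section Put.
Context (R : realType) (V : finType).
Local Notation mR := (measurableTypeR R).
Local Notation leb := (@lebesgue_measure R).
Implicit Types (x y : V -> R) (s : seq V) (i j : V) (A B : V -> V -> R).

(* The point of R^V with coordinates t on s and x outside s. *)
Definition put s x (t : seq R) : V -> R :=
  fun i => if i \in s then nth 0 t (index i s) else x i.

Lemma put_cons i s x r (t : seq R) : i \notin s ->
  put (i :: s) x (r :: t) = put s (dfwith x i r) t.
Proof.
move=> si; apply/funext => j; rewrite /put in_cons /= eq_sym.
have [<-|ij] /= := eqVneq i j; first by rewrite (negPf si) dfwithin.
by rewrite dfwithout.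
Qed.

Lemma put_dfwith i s x r (t : seq R) : i \notin s ->
  dfwith (put s x t) i r = put s (dfwith x i r) t.
Proof.
move=> si; apply/funext => j; rewrite /put.
have [<-|ij] := eqVneq i j; first by rewrite (negPf si) !dfwithin.
by rewrite dfwithout//; case: ifP => // _; rewrite dfwithout.
Qed.

Lemma measurable_put d (T : measurableType d) s (x : T -> V -> R)
    (t : T -> (size s).-tuple mR) i :
  (forall i, measurable_fun setT (fun w => x w i)) -> measurable_fun setT t ->
  measurable_fun setT (fun w => put s (x w) (t w) i).
Proof.
move=> mx mt; rewrite /put; case si : (i \in s); last exact: mx.
have hi : (index i s < size s)%N by rewrite index_mem.
rewrite (_ : (fun w => _) = (fun w => tnth (t w) (Ordinal hi))); last first.
  by apply/funext => w; rewrite (tnth_nth 0).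
by apply: (measurableT_comp (measurable_tnth (Ordinal hi)) mt).
Qed.

Lemma measurable_dfwith d (T : measurableType d) (x : T -> V -> R) (r : T -> R) i j :
  (forall i, measurable_fun setT (fun w => x w i)) -> measurable_fun setT r ->
  measurable_fun setT (fun w => dfwith (x w) i (r w) j).
Proof.
move=> mx mr; have [<-|ij] := eqVneq i j.
  by under eq_fun do rewrite dfwithin; exact: mr.
by under eq_fun do rewrite dfwithout//; exact: mx.
Qed.

(** Functions of finitely many variables that are measurable after composition
    with any measurable family. *)
Definition measurableV (F : (V -> R) -> R) := forall d (T : measurableType d) (x : T -> V -> R),
  (forall i, measurable_fun setT (fun w => x w i)) -> measurable_fun setT (fun w => F (x w)).

Lemma integral_put_cons_ge0 i s x (F : (V -> R) -> R) : i \notin s ->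
  measurableV F -> (forall y, 0 <= F y) ->
  (\int[lebesgue_Rn R (size (i :: s))]_t (F (put (i :: s) x t))%:E =
   \int[leb]_r \int[lebesgue_Rn R (size s)]_t (F (put s (dfwith x i r) t))%:E)%E.
Proof.
move=> si mF F0; rewrite lebesgue_RnS_ge0/=; last 2 first.
- apply/measurable_EFinP; apply: mF => j.
  by apply: (@measurable_put _ _ (i :: s) (fun=> x) id) => // k; exact: measurable_cst.
- by move=> t; rewrite lee_fin.
by apply: eq_integral => r _; apply: eq_integral => t _; rewrite put_cons.
Qed.

(** ** Gaussian integrals *)
Definition quadf A x : R := \sum_i \sum_j A i j * x i * x j.

Lemma measurableV_quad A c : measurableV (fun y => expR (c * quadf A y)).
Proof.
move=> d T x mx; apply: measurableT_comp => //; apply: measurable_funM => //.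
apply: measurable_sum_seq => i _; apply: measurable_sum_seq => j _.
by do 2 apply: measurable_funM => //.
Qed.

Lemma quadf_schur B i y : (forall j k, B j k = B k j) -> B i i != 0 ->
  quadf B y = quadf (schur B i) y + (\sum_j B i j * y j) ^+ 2 / B i i.
Proof.
move=> sB Bii; rewrite /quadf /schur expr2 mulr_suml mulr_suml -big_split/=.
apply: eq_bigr => j _; rewrite mulr_sumr mulr_suml -big_split/=.
apply: eq_bigr => k _; rewrite (sB j i); field; exact: Bii.
Qed.

Lemma schur_sym B i : (forall j k, B j k = B k j) ->
  forall j k, schur B i j k = schur B i k j.
Proof. by move=> sB j k; rewrite /schur (sB j k) (sB j i) (sB i k); ring. Qed.

Lemma elim_sym s A : (forall j k, A j k = A k j) ->
  forall j k, elim_on s A j k = elim_on s A k j.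
Proof. by move=> sA; elim: s => //= i s IHs; exact: schur_sym. Qed.

Lemma schur_row B i k : B i i != 0 -> schur B i i k = 0.
Proof. by move=> Bii; rewrite /schur mulrAC mulfV// mul1r subrr. Qed.
Lemma schur_col B i k : B i i != 0 -> schur B i k i = 0.
Proof. by move=> Bii; rewrite /schur mulfK// subrr. Qed.

Lemma quadf_dfwith B i y r : (forall k, B i k = 0) -> (forall k, B k i = 0) ->
  quadf B (dfwith y i r) = quadf B y.
Proof.
move=> Bi Bi'; apply: eq_bigr => j _; apply: eq_bigr => k _.
have [<-|ij] := eqVneq i j; first by rewrite Bi !mul0r.
have [<-|ik] := eqVneq i k; first by rewrite Bi' !mul0r.
by rewrite !dfwithout.
Qed.

Lemma integral_gauss_put s A x : uniq s -> (forall j k, A j k = A k j) ->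
  (forall p, p \in pivots s A -> 0 < p) ->
  (\int[lebesgue_Rn R (size s)]_t (expR (- 2^-1 * quadf A (put s x t)))%:E =
   ((\prod_(p <- pivots s A) Num.sqrt (2 * pi / p)) *
     expR (- 2^-1 * quadf (elim_on s A) x))%:E)%E.
Proof.
move=> us sA; elim: s us x => [_ x _|i s IHs /= /andP[si us] x hp].
  by rewrite big_nil mul1r /= integral_dirac// ?diracT ?mul1e;
    last exact: (measurable_cst (expR (- 2^-1 * quadf A x))%:E).
rewrite (@integral_put_cons_ge0 i s x (fun y => expR (- 2^-1 * quadf A y)))//; last first.
  exact: measurableV_quad.
have hp' : forall p, p \in pivots s A -> 0 < p by move=> p ps; apply: hp; rewrite inE ps orbT.
under eq_integral do rewrite (IHs us _ hp').
set B := elim_on s A; have sB := elim_sym s sA; rewrite -/B in sB.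
have pB : 0 < B i i by apply: hp; rewrite inE eqxx.
have pB0 : B i i != 0 by rewrite gt_eqF.
pose b := (\sum_(j | j != i) B i j * x j) / B i i.
have E r : quadf B (dfwith x i r) = quadf (schur B i) x + B i i * (r + b) ^+ 2.
  rewrite (quadf_schur _ sB pB0) quadf_dfwith; last 2 first.
  - by move=> k; exact: schur_row.
  - by move=> k; exact: schur_col.
  congr (_ + _); rewrite (bigD1 i)//= dfwithin.
  rewrite (eq_bigr (fun j => B i j * x j)); last first.
    by move=> j ji; rewrite dfwithout// eq_sym.
  by rewrite /b; field.
set q0 := \prod_(p <- pivots s A) _.
rewrite (eq_integral (fun r : mR => ((q0 * expR (- 2^-1 * quadf (schur B i) x))%:E *
    (expR (- (B i i / 2) * (r + b) ^+ 2))%:E)%E)); last first.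
  move=> r _; rewrite -EFinM -mulrA -expRD E; by congr (q0 * expR _)%:E; field.
rewrite ge0_integralZl//; last 2 first.
- apply/measurable_EFinP; apply: measurableT_comp => //; apply: measurable_funM => //.
  by apply: measurable_funX; exact: measurable_funD.
- by rewrite lee_fin mulr_ge0 ?expR_ge0// prodr_ge0// => p _; exact: sqrtr_ge0.
rewrite gauss1// -EFinM big_cons -/q0; congr EFin; ring.
Qed.

(** ** A dominating function *)
Definition cauchyd s (y : V -> R) : R := \prod_(i <- s) (1 + y i ^+ 2)^-1.

Lemma cauchyd_ge0 s y : 0 <= cauchyd s y.
Proof. by rewrite prodr_ge0// => i _; rewrite invr_ge0 addr_ge0// sqr_ge0. Qed.

Lemma cauchyd_le1 s y : cauchyd s y <= 1.
Proof.
elim: s => [|i s IHs]; first by rewrite /cauchyd big_nil.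
rewrite /cauchyd big_cons mulr_ile1 ?cauchyd_ge0//.
  by rewrite invr_ge0 addr_ge0// sqr_ge0.
by rewrite invf_le1 ?lerDl ?sqr_ge0// ltr_wpDr ?sqr_ge0.
Qed.

Lemma measurableV_cauchyd s : measurableV (cauchyd s).
Proof.
move=> d T x mx; apply: measurable_prod_seq => i _.
apply: (measurableT_comp (f := fun r : mR => (1 + r ^+ 2)^-1)); last exact: mx.
by apply: continuous_measurable_fun; exact: (@continuous_oneDsqrV R).
Qed.

Lemma cauchyd_cons i s x r t : i \notin s ->
  cauchyd (i :: s) (put (i :: s) x (r :: t)) =
  (1 + r ^+ 2)^-1 * cauchyd s (put s (dfwith x i r) t).
Proof.
by move=> si; rewrite put_cons// /cauchyd big_cons {1}/put (negPf si) dfwithin.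
Qed.

Lemma cauchyd_put s x y (t : seq R) : cauchyd s (put s x t) = cauchyd s (put s y t).
Proof. by apply: eq_big_seq => i si; rewrite /put si. Qed.

Lemma integrable_cauchyd s x : uniq s ->
  (lebesgue_Rn R (size s)).-integrable setT (fun t => (cauchyd s (put s x t))%:E).
Proof.
move=> us; apply/integrableP; split.
  apply/measurable_EFinP; apply: measurableV_cauchyd => j.
  by apply: (@measurable_put _ _ s (fun=> x) id) => // k; exact: measurable_cst.
under eq_integral do rewrite gee0_abs ?lee_fin ?cauchyd_ge0//.
elim: s us x => [_ x|i s IHs /= /andP[si us] x].
  by rewrite /= integral_dirac// ?diracT ?mul1e ?ltry//;
    exact: (measurable_cst (cauchyd [::] x)%:E).
rewrite (integral_put_cons_ge0 _ si (@measurableV_cauchyd (i :: s)))//; last first.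
  by move=> y; exact: cauchyd_ge0.
have := IHs us x; set c := (X in (X < _)%E) => hc.
have c0 : (0 <= c)%E by apply: integral_ge0 => t _; rewrite lee_fin cauchyd_ge0.
rewrite (eq_integral (fun r : mR => c * ((1 + r ^+ 2)^-1)%:E)%E); last first.
  move=> r _; rewrite /c muleC -ge0_integralZl//; last 3 first.
  - apply/measurable_EFinP; apply: measurableV_cauchyd => j.
    by apply: (@measurable_put _ _ s (fun=> x) id) => // k; exact: measurable_cst.
  - by move=> t _; rewrite lee_fin cauchyd_ge0.
  - by rewrite lee_fin invr_ge0 addr_ge0// sqr_ge0.
  apply: eq_integral => t _.
  have := cauchyd_cons x r t si; rewrite put_cons// => ->.
  by rewrite (cauchyd_put _ (dfwith x i r) x).
rewrite ge0_integralZl//; last 2 first.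
- apply/measurable_EFinP; apply: continuous_measurable_fun; exact: (@continuous_oneDsqrV R).
- by move=> r _; rewrite lee_fin invr_ge0 addr_ge0// sqr_ge0.
by apply: lte_mul_pinfty => //; [rewrite ge0_fin_numE|exact: cauchy1].
Qed.

(** ** Integrals of derivatives vanish *)
Lemma integral_partial0 s i (F F' : (V -> R) -> R) (C : R) x : uniq s -> i \in s ->
  measurableV F' ->
  (forall y r, is_derive r (1 : R) (fun r => F (dfwith y i r)) (F' (dfwith y i r))) ->
  (forall y, continuous (fun r => F' (dfwith y i r))) ->
  (forall y, `|F y| <= C * cauchyd s y) ->
  (forall y, `|F' y| <= C * cauchyd s y) ->
  (\int[lebesgue_Rn R (size s)]_t (F' (put s x t))%:E = 0)%E.
Proof.
move=> us si mF' dF cF'.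
have mput (s' : seq V) (y : V -> R) :
    measurable_fun setT (fun t : (size s').-tuple mR => (F' (put s' y t))%:E).
  apply/measurable_EFinP; apply: mF' => j.
  by apply: (@measurable_put _ _ s' (fun=> y) id) => // k; exact: measurable_cst.
suff H (G : (V -> R) -> R) : (forall y, 0 <= G y) ->
    (forall y, `|F y| <= G y * cauchyd s y) ->
    (forall y, `|F' y| <= G y * cauchyd s y) ->
    (forall y (t : seq R), G (put s y t) = G y) ->
    forall x, (\int[lebesgue_Rn R (size s)]_t (F' (put s x t))%:E = 0)%E.
  move=> bF bF'; apply: (H (fun=> C)) => // y; have := le_trans (normr_ge0 _) (bF y).
  rewrite pmulr_lge0// /cauchyd; elim: (s) => [|j r]; first by rewrite big_nil.
  by rewrite big_cons => h; rewrite mulr_gt0// invr_gt0 ltr_wpDr ?sqr_ge0.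
elim: s us si G => // j s IHs /= /andP[sj us]; rewrite inE => ijs G G0 bF bF' Gput {}x.
have intF : (lebesgue_Rn R (size s).+1).-integrable setT
    (fun t => (F' (put (j :: s) x t))%:E).
  apply: (le_integrable measurableT (g := fun t : (size s).+1.-tuple mR => ((G x)%:E * (cauchyd (j :: s) (put (j :: s) x t))%:E)%E)).
  - exact: (mput (j :: s) x).
  - move=> t _; rewrite -EFinM /= lee_fin [leRHS]ger0_norm ?mulr_ge0 ?cauchyd_ge0//.
    by rewrite -(Gput x t); exact: bF'.
  - by apply/integrableZl => //; apply: (@integrable_cauchyd (j :: s)); rewrite /= sj.
have [intF2 ->] := lebesgue_RnS intF.
move: ijs => /orP[/eqP ij|si].
- rewrite -integral21_prod_meas1//=; apply: integral0_eq => t _.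
  rewrite /fubini_G; under eq_integral do rewrite /= put_cons// -put_dfwith//.
  set y := put s x t.
  apply: (@integral_derive0 _ (fun r => F (dfwith y j r)) _ (G x)).
  + by move=> r; rewrite -ij; exact: dF.
  + by move=> r; rewrite -ij; exact: cF'.
  + move=> r; have := bF (dfwith y j r); rewrite /y put_dfwith// -put_cons// Gput.
    move=> /le_trans; apply; rewrite ler_wpM2l// cauchyd_cons// ler_piMr//.
      by rewrite invr_ge0 addr_ge0// sqr_ge0.
    exact: cauchyd_le1.
  + move=> r; have := bF' (dfwith y j r); rewrite /y put_dfwith// -put_cons// Gput.
    move=> /le_trans; apply; rewrite ler_wpM2l// cauchyd_cons// ler_piMr//.
      by rewrite invr_ge0 addr_ge0// sqr_ge0.
    exact: cauchyd_le1.
- rewrite -integral12_prod_meas1//=; apply: integral0_eq => r _.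
  rewrite /fubini_F; under eq_integral do rewrite /= put_cons//.
  have bG (y : V -> R) : 0 <= (1 + y j ^+ 2)^-1 by rewrite invr_ge0 addr_ge0// sqr_ge0.
  apply: (IHs us si (fun y => G y * (1 + y j ^+ 2)^-1)).
  + by move=> y; rewrite mulr_ge0.
  + by move=> y; have := bF y; rewrite /cauchyd big_cons mulrA.
  + by move=> y; have := bF' y; rewrite /cauchyd big_cons mulrA.
  + move=> y t; rewrite {2}/put (negPf sj); congr (_ * _).
    rewrite -(Gput (put s y t) [seq put s y t k | k <- j :: s]).
    rewrite -[RHS](Gput y [seq put s y t k | k <- j :: s]); congr G.
    apply/funext => k; rewrite /put; case: ifP => // ks.
    by move: ks; rewrite inE => /negbT; rewrite negb_or => /andP[_ /negPf ->].
Qed.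
End Put.

(** * The field at a point *)
Section Field.
Context (R : realType) (V : finType) (a : V).
Local Notation gr := (grassmann R (V + V)%type).
Implicit Types (x y : V -> R) (i j : V) (W : V -> V -> R).

Definition nn i : gr := if i == a then 0 else gxi R i * geta R i.

Lemma nn_a : nn a = 0. Proof. by rewrite /nn eqxx. Qed.
Lemma geven_nn i : geven (nn i).
Proof. by rewrite /nn; case: ifP => _; [exact: geven0|exact: geven_xieta]. Qed.
Lemma body_nn i : body (nn i) = 0.
Proof. by rewrite /nn; case: ifP => _; [exact: body0|exact: body_xieta]. Qed.
Lemma xieta_sq0 i : (gxi R i * geta R i) * (gxi R i * geta R i) = 0 :> gr.
Proof.
have og : godd (gxi R i : gr) by exact: godd_gen.
have oh : godd (geta R i : gr) by exact: godd_gen.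
rewrite mulrA -(mulrA (gxi R i)) (godd_anticomm oh og).
by rewrite mulrN mulNr !mulrA (godd_sq0 og) !mul0r oppr0.
Qed.
Lemma nn_sq0 i : nn i * nn i = 0.
Proof. by rewrite /nn; case: ifP => _; [rewrite mul0r|exact: xieta_sq0]. Qed.

Definition rr x y i : R := Num.sqrt (1 + x i ^+ 2 + y i ^+ 2).

Lemma rr_arg x y i : 0 < 1 + x i ^+ 2 + y i ^+ 2.
Proof. by rewrite -addrA ltr_wpDr ?addr_ge0 ?sqr_ge0. Qed.
Lemma rr_gt0 x y i : 0 < rr x y i. Proof. by rewrite sqrtr_gt0 rr_arg. Qed.
Lemma rr_neq0 x y i : rr x y i != 0. Proof. by rewrite gt_eqF ?rr_gt0. Qed.
Lemma rr_sq x y i : rr x y i ^+ 2 = 1 + x i ^+ 2 + y i ^+ 2.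
Proof. by rewrite sqr_sqrtr// ltW// rr_arg. Qed.
Lemma rr_ge1 x y i : 1 <= rr x y i.
Proof.
rewrite -(@ler_pXn2r _ 2)// ?nnegrE ?(ltW (rr_gt0 _ _ _))//.
by rewrite expr1n rr_sq -addrA lerDl addr_ge0 ?sqr_ge0.
Qed.

(* The component z and its inverse. *)
Definition zf x y i : gr := (rr x y i)%:A + (rr x y i)^-1 *: nn i.
Definition zi x y i : gr := (rr x y i)^-1%:A - (rr x y i) ^- 3 *: nn i.

Lemma geven_zf x y i : geven (zf x y i).
Proof. by apply: gevenD; [exact: geven_scalar|exact/gevenZ/geven_nn]. Qed.
Lemma geven_zi x y i : geven (zi x y i).
Proof. by apply: gevenB; [exact: geven_scalar|exact/gevenZ/geven_nn]. Qed.
Lemma zf_zi x y i : zf x y i * zi x y i = 1.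
Proof.
have r0 := rr_neq0 x y i; rewrite /zf /zi; set r := rr x y i in r0 *.
rewrite mulrDl !mulrBr -!scalerAl -!scalerAr !mul1r !mulr1 nn_sq0 !scaler0 subr0.
rewrite !scalerA mulfV// scale1r -addrA [- _ + _]addrC -scalerBl.
by rewrite (_ : _ - _ = 0) ?scale0r ?addr0//; field.
Qed.
Lemma zf_sq x y i : zf x y i * zf x y i = (1 + x i ^+ 2 + y i ^+ 2)%:A + nn i *+ 2.
Proof.
have r0 := rr_neq0 x y i; rewrite -rr_sq /zf; set r := rr x y i in r0 *.
rewrite mulrDl !mulrDr -!scalerAl -!scalerAr !mul1r !mulr1 nn_sq0 !scaler0 addr0.
rewrite !scalerA mulfV// mulVf// scale1r -addrA -expr2 mulr2n.
by [].
Qed.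

Lemma derive1_sqrt (r : R) : 0 < r -> derive1 Num.sqrt r = (2 * Num.sqrt r)^-1.
Proof. by move=> r0; rewrite derive1E derive_sqrt. Qed.

Lemma derive1_inv (r : R) : r != 0 -> derive1 GRing.inv r = - r ^- 2.
Proof.
move=> r0; have h : is_derive r (1 : R) (fun y : R => y^-1) (- r ^- 2 *: (1 : R)).
  exact: (@is_deriveV R id r 1 1 r0 (is_derive_id r 1)).
by rewrite derive1E (@derive_val _ _ _ _ _ _ _ h) /GRing.scale/= mulr1.
Qed.

Lemma sz_pinned x y i : x a = 0 -> y a = 0 -> sz (pinned_field a x y i) = zf x y i.
Proof.
move=> xa ya; rewrite /pinned_field /zf /nn; case: ifP => [/eqP ->|ia] /=.
  by rewrite /rr xa ya expr0n/= !addr0 sqrtr1 scaler0 addr0 scale1r.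
rewrite superfun1_sq0; last 2 first.
- by rewrite -scaler_nat bodyZ body_xieta mulr0.
- by rewrite mulrnAl mulrnAr xieta_sq0 !mul0rn.
rewrite derive1_sqrt ?rr_arg// -(scaler_nat 2 (_ * _)) scalerA -/(rr x y i); congr (_ + _ *: _).
by have := rr_neq0 x y i; move: (rr x y i) => r r0; field.
Qed.

Lemma inv_sz x y i : superfun1 GRing.inv (zf x y i) = zi x y i.
Proof.
have r0 := rr_neq0 x y i.
rewrite superfun1_sq0; last 2 first.
- by rewrite bodyZ body_nn mulr0.
- by rewrite -scalerAl -scalerAr nn_sq0 !scaler0.
rewrite derive1_inv// scalerA /zi -scaleNr; congr (_ + _ *: _).
by move: (rr x y i) r0 => r r0; field.
Qed.

Lemma sx_pinned x y i : x a = 0 -> sx (pinned_field a x y i) = (x i)%:A.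
Proof. by move=> xa; rewrite /pinned_field; case: ifP => [/eqP ->|] //=; rewrite xa scale0r. Qed.
Lemma sy_pinned x y i : y a = 0 -> sy (pinned_field a x y i) = (y i)%:A.
Proof. by move=> xa; rewrite /pinned_field; case: ifP => [/eqP ->|] //=; rewrite xa scale0r. Qed.
Lemma sxi_pinned x y i : sxi (pinned_field a x y i) = (i != a)%:R *: gxi R i.
Proof. by rewrite /pinned_field; case: eqP => _ //=; rewrite ?scale0r ?scale1r. Qed.
Lemma seta_pinned x y i : seta (pinned_field a x y i) = (i != a)%:R *: geta R i.
Proof. by rewrite /pinned_field; case: eqP => _ //=; rewrite ?scale0r ?scale1r. Qed.

(* The restriction of a matrix to the complement of a. *)
Definition restr (A : V -> V -> R) i j : R := ((i != a) && (j != a))%:R * A i j.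

Section Energy.
Variables (e : rel V) (W : V -> V -> R).
Hypothesis hG : weighted_graph e W.

Lemma Wsym i j : W i j = W j i. Proof. by case: hG. Qed.
Lemma Wdiag i : W i i = 0.
Proof. by case: hG => _ irr _ _ /(_ i i)[_]; apply; rewrite irr. Qed.
Lemma Wge0 i j : 0 <= W i j.
Proof.
case: hG => _ _ _ _ /(_ i j)[h1 h2].
by have [/h1/ltW|/h2 ->] := boolP (e i j).
Qed.

Lemma edge_sum (F : V -> V -> gr) : (forall i j, F i j = F j i) ->
  \sum_i \sum_(j | e i j && (enum_rank i < enum_rank j)%N) W i j *: F i j =
  2^-1 *: \sum_i \sum_j W i j *: F i j.
Proof.
move=> sF; have [syme irr _ sW W0] := hG.
have -> : \sum_i \sum_j W i j *: F i j =
    \sum_i \sum_(j | e i j && (enum_rank i < enum_rank j)%N) W i j *: F i j +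
    \sum_i \sum_(j | e i j && (enum_rank j < enum_rank i)%N) W i j *: F i j.
  rewrite -big_split/=; apply: eq_bigr => i _.
  rewrite (bigID (fun j => e i j && (enum_rank i < enum_rank j)%N))/=; congr (_ + _).
  rewrite (bigID (fun j => e i j && (enum_rank j < enum_rank i)%N))/= addrC big1 ?add0r.
    apply: eq_bigl => j; case: (e i j) => //=.
    by case: (ltngtP (enum_rank i) (enum_rank j)).
  move=> j /andP[]; have [eij|nij _ _] := boolP (e i j); last first.
    by rewrite (W0 i j).2 ?scale0r.
  case: (ltngtP (enum_rank i) (enum_rank j)) => //= /val_inj/enum_rank_inj ij.
  by rewrite ij irr in eij.
rewrite [X in _ *: (_ + X)](_ : _ =
    \sum_i \sum_(j | e i j && (enum_rank i < enum_rank j)%N) W i j *: F i j).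
  by rewrite -mulr2n -[X in _ *: X]scaler_nat scalerA mulVf ?pnatr_eq0// scale1r.
rewrite [LHS](exchange_big_dep xpredT)//=; apply: eq_bigr => i _.
by apply: eq_big => [j|j _]; rewrite 1?syme// sF sW.
Qed.

Lemma h22_energyE x y : x a = 0 -> y a = 0 ->
  h22_energy e W (pinned_field a x y) =
  (2^-1 * \sum_i \sum_j W i j * (x i * x j + y i * y j + 1))%:A
  - 2^-1 *: \sum_i \sum_j W i j *: (zf x y i * zf x y j)
  + gquad (restr (fun i j => - W i j)).
Proof.
move=> xa ya; rewrite /h22_energy.
pose d i : R := (i != a)%:R.
have -> : \sum_i \sum_(j | e i j && (enum_rank i < enum_rank j)%N)
    W i j *: (spin_dot (pinned_field a x y i) (pinned_field a x y j) + 1) =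
  \sum_i \sum_(j | e i j && (enum_rank i < enum_rank j)%N)
    W i j *: ((x i * x j + y i * y j + 1)%:A - zf x y i * zf x y j
      + ((d i * d j) *: (gxi R i * geta R j) + (d i * d j) *: (gxi R j * geta R i))).
  apply: eq_bigr => i _; apply: eq_bigr => j _; congr (_ *: _).
  rewrite /spin_dot !sx_pinned// !sy_pinned// !sz_pinned// !sxi_pinned !seta_pinned.
  rewrite -!scalerAl -!scalerAr !mul1r !scalerA -/(d i) -/(d j) [d j * d i]mulrC.
  rewrite !scalerDl scale1r.
  set A := (_ *: 1); set B := (_ *: 1); set C := zf _ _ _ * _.
  rewrite [LHS]addrC !addrA; congr (_ - _ + _ + _).
  by rewrite -addrA addrC.
rewrite edge_sum; last first.
  move=> i j; rewrite [x j * x i]mulrC [y j * y i]mulrC (geven_comm _ (geven_zf x y j)).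
  by rewrite [d j * d i]mulrC; congr (_ + _); rewrite addrC.
have -> : \sum_i \sum_j W i j *: ((x i * x j + y i * y j + 1)%:A - zf x y i * zf x y j
      + ((d i * d j) *: (gxi R i * geta R j) + (d i * d j) *: (gxi R j * geta R i))) =
  (\sum_i \sum_j W i j * (x i * x j + y i * y j + 1))%:A
  - \sum_i \sum_j W i j *: (zf x y i * zf x y j)
  + (\sum_i \sum_j (W i j * (d i * d j)) *: (gxi R i * geta R j)) *+ 2.
  rewrite mulr2n; rewrite [X in _ + (_ + X)](_ : _ =
    \sum_i \sum_j (W i j * (d i * d j)) *: (gxi R j * geta R i)); last first.
    rewrite exchange_big/=; apply: eq_bigr => i _; apply: eq_bigr => j _.
    by rewrite Wsym [d j * d i]mulrC.
  rewrite scaler_suml -sumrN -!big_split/=; apply: eq_bigr => i _.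
  rewrite scaler_suml -sumrN -!big_split/=; apply: eq_bigr => j _.
  by rewrite !scalerDr scalerN !scalerA.
have half (S : gr) : 2^-1 *: (S *+ 2) = S.
  by rewrite -[S *+ 2]scaler_nat scalerA mulVf ?pnatr_eq0// scale1r.
rewrite scalerDr scalerBr half scalerA.
congr (_ + _); rewrite /gquad -sumrN; apply: eq_bigr => i _; rewrite -sumrN.
apply: eq_bigr => j _; rewrite -scaleNr; congr (_ *: _).
by rewrite /restr /d; case: (i != a); case: (j != a) => /=; ring.
Qed.
End Energy.
End Field.

(** * Domination *)

Section PolyBound.
Context (R : realType) (T : Type) (D : T -> Prop) (rho : T -> R).
Hypothesis rho_ge1 : forall t, D t -> 1 <= rho t.

(* F is at most polynomial in rho on D. *)
Definition pbd (F : T -> R) := exists (K : R) (N : nat), 0 <= K /\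
  forall t, D t -> `|F t| <= K * rho t ^+ N.

Lemma rhoX_ge0 t N : D t -> 0 <= rho t ^+ N.
Proof. by move=> /rho_ge1 h; rewrite exprn_ge0// (le_trans ler01). Qed.
Lemma pbd_cst c : pbd (fun=> c).
Proof. by exists `|c|, 0%N; split => // t _; rewrite expr0 mulr1. Qed.
Lemma pbd_le F G : (forall t, D t -> `|F t| <= `|G t|) -> pbd G -> pbd F.
Proof.
by move=> h [K [N [K0 hG]]]; exists K, N; split => // t Dt; rewrite (le_trans (h t Dt))// hG.
Qed.
Lemma pbd_rho : pbd rho.
Proof.
exists 1, 1%N; split => // t Dt; rewrite mul1r expr1 ger0_norm//.
by rewrite (le_trans ler01)// rho_ge1.
Qed.
Lemma pbdD F G : pbd F -> pbd G -> pbd (fun t => F t + G t).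
Proof.
move=> [K [N [K0 hF]]] [L [M [L0 hG]]]; exists (K + L), (N + M)%N.
split => [|t Dt]; first exact: addr_ge0.
have r1 := rho_ge1 Dt; rewrite (le_trans (ler_normD _ _))// mulrDl lerD//.
  by rewrite (le_trans (hF t Dt))// ler_wpM2l// ler_weXn2l// leq_addr.
by rewrite (le_trans (hG t Dt))// ler_wpM2l// ler_weXn2l// leq_addl.
Qed.
Lemma pbdM F G : pbd F -> pbd G -> pbd (fun t => F t * G t).
Proof.
move=> [K [N [K0 hF]]] [L [M [L0 hG]]]; exists (K * L), (N + M)%N.
split => [|t Dt]; first exact: mulr_ge0.
by rewrite normrM exprD mulrACA ler_pM// ?hF ?hG.
Qed.
Lemma pbdX F n : pbd F -> pbd (fun t => F t ^+ n).
Proof.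
move=> hF; elim: n => [|n IHn]; first exact: pbd_cst.
by under eq_fun do rewrite exprS; exact: pbdM.
Qed.
Lemma pbd_sum I (r : seq I) (P : pred I) (F : I -> T -> R) :
  (forall i, P i -> pbd (F i)) -> pbd (fun t => \sum_(i <- r | P i) F i t).
Proof.
move=> h; elim: r => [|i r IHr].
  by under eq_fun do rewrite big_nil; exact: pbd_cst.
case Pi: (P i); under eq_fun do rewrite big_cons Pi; last by [].
by apply: pbdD => //; exact: h.
Qed.
Lemma pbd_prod I (r : seq I) (P : pred I) (F : I -> T -> R) :
  (forall i, P i -> pbd (F i)) -> pbd (fun t => \prod_(i <- r | P i) F i t).
Proof.
move=> h; elim: r => [|i r IHr].
  by under eq_fun do rewrite big_nil; exact: pbd_cst.
case Pi: (P i); under eq_fun do rewrite big_cons Pi; last by [].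
by apply: pbdM => //; exact: h.
Qed.

Section Grassmann.
Context (G : finType).
Local Notation gr := (grassmann R G).
Implicit Types (f g : T -> gr).
Definition gpbd f := pbd (fun t => gnorm (f t)).
Let gle (F : T -> R) f : (forall t, D t -> gnorm (f t) <= F t) -> pbd F -> gpbd f.
Proof.
move=> h; apply: pbd_le => t Dt; rewrite ger0_norm ?gnorm_ge0//.
by rewrite (le_trans (h t Dt))// ler_norm.
Qed.
Lemma gpbd_cst u : gpbd (fun=> u). Proof. exact: pbd_cst. Qed.
Lemma gpbdD f g : gpbd f -> gpbd g -> gpbd (fun t => f t + g t).
Proof. by move=> hf hg; apply: gle (pbdD hf hg) => t _; exact: gnormD. Qed.
Lemma gpbdM f g : gpbd f -> gpbd g -> gpbd (fun t => f t * g t).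
Proof. by move=> hf hg; apply: gle (pbdM hf hg) => t _; exact: gnormM. Qed.
Lemma gpbdZ (c : T -> R) f : pbd c -> gpbd f -> gpbd (fun t => c t *: f t).
Proof.
move=> hc hf; apply: pbd_le (pbdM hc hf) => t _.
by rewrite gnormZ !normrM normr_id.
Qed.
Lemma gpbd_scalar (c : T -> R) : pbd c -> gpbd (fun t => (c t)%:A).
Proof. by move=> hc; apply: gpbdZ => //; exact: gpbd_cst. Qed.
Lemma gpbdN f : gpbd f -> gpbd (fun t => - f t).
Proof. by move=> hf; apply: pbd_le hf => t _; rewrite gnormN. Qed.
Lemma gpbd_sum I (r : seq I) (P : pred I) (F : I -> T -> gr) :
  (forall i, P i -> gpbd (F i)) -> gpbd (fun t => \sum_(i <- r | P i) F i t).
Proof.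
move=> h; apply: gle (pbd_sum r h) => t _; exact: gnorm_sum.
Qed.
Lemma gpbd_prod I (r : seq I) (P : pred I) (F : I -> T -> gr) :
  (forall i, P i -> gpbd (F i)) -> gpbd (fun t => \prod_(i <- r | P i) F i t).
Proof.
move=> h; apply: gle (pbd_prod r h) => t _; exact: gnorm_prod.
Qed.
Lemma pbd_body f : gpbd f -> pbd (fun t => body (f t)).
Proof.
by apply: pbd_le => t _; rewrite [leRHS]ger0_norm ?gnorm_ge0// gcoef_le.
Qed.
(* The nilpotent part of the exponent costs a polynomial factor only. *)
Lemma gpbd_gexp f : gpbd f -> exists F, pbd F /\
  forall t, D t -> gnorm (gexp (f t)) <= expR (body (f t)) * `|F t|.
Proof.
move=> hf; exists (fun t => #|G|.+1%:R * (1 + gnorm (f t - (body (f t))%:A)) ^+ #|G|).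
split.
  apply: pbdM; first exact: pbd_cst.
  apply: pbdX; apply: pbdD; first exact: pbd_cst.
  by apply: (gpbdD hf); apply: gpbdN; apply: gpbd_scalar; exact: pbd_body.
by move=> t _; rewrite (le_trans (gnorm_gexp _))// ler_wpM2l ?expR_ge0// ler_norm.
Qed.
End Grassmann.
End PolyBound.

(* A stretched exponential beats every power. *)
Lemma expR_beats (R : realType) (w : R) (k : nat) : 0 < w ->
  exists K : R, 0 <= K /\ forall E, 0 <= E -> (1 + E / w) ^+ k * expR (- E) <= K.
Proof.
move=> w0; case: k => [|k].
  by exists 1; split => // E E0; rewrite expr0 mul1r -expR0 ler_expR oppr_le0.
exists ((1 + k.+1%:R / w) ^+ k.+1); split.
  by rewrite exprn_ge0// addr_ge0// divr_ge0// ltW.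
move=> E E0; have k0 : 0 < k.+1%:R :> R by rewrite ltr0n.
have h1 : 1 + E / w <= (1 + k.+1%:R / w) * (1 + E / k.+1%:R).
  move: (k.+1%:R : R) k0 => c c0; rewrite -subr_ge0.
  have -> : (1 + c / w) * (1 + E / c) - (1 + E / w) = E / c + c / w.
    by field; rewrite !gt_eqF ?w0 ?c0.
  by rewrite addr_ge0// divr_ge0// ltW.
have h2 : (1 + E / k.+1%:R) ^+ k.+1 <= expR E.
  have -> : expR E = expR (E / k.+1%:R) ^+ k.+1.
    by rewrite -expRM_natl mulrC divfK// gt_eqF.
  rewrite lerXn2r ?nnegrE ?expR_ge0 ?addr_ge0 ?divr_ge0//.
  exact: expR_ge1Dx.
have n1 : 0 <= 1 + E / w by rewrite addr_ge0// divr_ge0// ltW.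
have n2 : 0 <= 1 + k.+1%:R / w by rewrite addr_ge0// divr_ge0// ltW.
have n3 : 0 <= 1 + E / k.+1%:R by rewrite addr_ge0// divr_ge0// ltW.
apply: (@le_trans _ _ ((1 + k.+1%:R / w) ^+ k.+1 * (expR E * expR (- E)))).
  rewrite mulrA ler_wpM2r ?expR_ge0//.
  apply: (@le_trans _ _ (((1 + k.+1%:R / w) * (1 + E / k.+1%:R)) ^+ k.+1)).
    by rewrite lerXn2r// nnegrE mulr_ge0.
  by rewrite exprMn ler_wpM2l// exprn_ge0.
by rewrite -expRD subrr expR0 mulr1.
Qed.

Section EnergyBound.
Context (R : realType) (V : finType) (a : V) (e : rel V) (W : V -> V -> R).
Hypothesis hG : weighted_graph e W.
Implicit Types (x y : V -> R) (i j : V).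
Local Notation U := (unpinned a).

Definition rhoU (p : (V -> R) * (V -> R)) : R :=
  \prod_(i <- U) (1 + p.1 i ^+ 2 + p.2 i ^+ 2).

Lemma rhoU_ge1 p : 1 <= rhoU p.
Proof.
rewrite /rhoU; elim: U => [|i s IHs]; first by rewrite big_nil.
by rewrite big_cons mulr_ege1// -addrA lerDl addr_ge0 ?sqr_ge0.
Qed.

Lemma rr_le_rhoU x y i : x a = 0 -> y a = 0 -> rr x y i <= rhoU (x, y).
Proof.
move=> xa ya; apply: (@le_trans _ _ (rr x y i ^+ 2)).
  by rewrite expr2 ler_peMl ?rr_ge1// (le_trans ler01)// rr_ge1.
rewrite rr_sq; have [->|ia] := eqVneq i a.
  by rewrite xa ya expr0n/= !addr0 rhoU_ge1.
rewrite /rhoU (bigD1_seq i)/= ?enum_uniq ?mem_enum//.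
rewrite ler_peMr//; first by rewrite ltW// rr_arg.
rewrite big_mkcond/=; elim: U => [|j s IHs]; first by rewrite big_nil.
rewrite big_cons; case: ifP => _; last by rewrite mul1r.
by rewrite mulr_ege1// -addrA lerDl addr_ge0 ?sqr_ge0.
Qed.

Lemma rhoU_le_rr x y (m : R) : 0 <= m -> (forall i, rr x y i <= m) ->
  rhoU (x, y) <= m ^+ (2 * size U).
Proof.
move=> m0 hm; rewrite /rhoU exprM; elim: U => [|i s IHs]; first by rewrite big_nil.
rewrite big_cons/= [leRHS]exprS ler_pM//; first by rewrite ltW// rr_arg.
  by rewrite prodr_ge0// => j _; rewrite ltW// rr_arg.
by rewrite -rr_sq lerXn2r// nnegrE ltW// rr_gt0.
Qed.

Lemma rhoU_cauchyd x y : (rhoU (x, y)) ^- 2 <= cauchyd U x * cauchyd U y.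
Proof.
rewrite /rhoU /cauchyd -big_split/= -prodrXl -prodfV.
apply: ler_prod => i _; have p := rr_arg x y i.
have hx := sqr_ge0 (x i); have hy := sqr_ge0 (y i).
rewrite invr_ge0 exprn_ge0 ?(ltW p)//= -invfM lef_pV2 ?posrE ?exprn_gt0//; last first.
  by rewrite mulr_gt0// ltr_wpDr.
by move: (x i ^+ 2) (y i ^+ 2) hx hy => u v; nra.
Qed.

(* Minus the inner product of the bodies: the cosh of a hyperbolic distance. *)
Definition wij x y i j : R := rr x y i * rr x y j - x i * x j - y i * y j.
Definition benergy x y : R := 2^-1 * \sum_i \sum_j W i j * (wij x y i j - 1).

Lemma wij_ge1 x y i j : 1 <= wij x y i j.
Proof.
rewrite /wij; have r1 := rr_sq x y i; have r2 := rr_sq x y j.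
have p1 := rr_gt0 x y i; have p2 := rr_gt0 x y j.
move: (rr x y i) (rr x y j) (x i) (x j) (y i) (y j) r1 r2 p1 p2 => r s x1 x2 y1 y2 r1 r2 p1 p2.
have h : (1 + x1 * x2 + y1 * y2) ^+ 2 <= (r * s) ^+ 2.
  rewrite exprMn r1 r2 -subr_ge0.
  have -> : (1 + x1 ^+ 2 + y1 ^+ 2) * (1 + x2 ^+ 2 + y2 ^+ 2) - (1 + x1 * x2 + y1 * y2) ^+ 2 =
    (x1 - x2) ^+ 2 + (y1 - y2) ^+ 2 + (x1 * y2 - y1 * x2) ^+ 2 by ring.
  by rewrite !addr_ge0 ?sqr_ge0.
have : 1 + x1 * x2 + y1 * y2 <= r * s.
  rewrite (le_trans (ler_norm _))// -(ger0_norm (ltW (mulr_gt0 p1 p2))).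
  by rewrite -ler_sqr ?nnegrE// !real_normK ?num_real.
lra.
Qed.

Lemma rr_step x y i j : rr x y j <= 2 * wij x y i j * rr x y i.
Proof.
rewrite /wij; have r1 := rr_sq x y i; have r2 := rr_sq x y j.
have p1 := rr_gt0 x y i; have p2 := rr_gt0 x y j.
move: (rr x y i) (rr x y j) (x i) (x j) (y i) (y j) r1 r2 p1 p2 => r s x1 x2 y1 y2 r1 r2 p1 p2.
pose A := x1 * x2 + y1 * y2.
have hA : A ^+ 2 <= (r ^+ 2 - 1) * (s ^+ 2 - 1).
  rewrite r1 r2 -subr_ge0.
  have -> : (1 + x1 ^+ 2 + y1 ^+ 2 - 1) * (1 + x2 ^+ 2 + y2 ^+ 2 - 1) - A ^+ 2 =
    (x1 * y2 - y1 * x2) ^+ 2 by rewrite /A; ring.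
  exact: sqr_ge0.
have hr1 : 1 <= r ^+ 2 by rewrite r1; nra.
have hs1 : 1 <= s ^+ 2 by rewrite r2; nra.
(* 2 r (r s - A) >= s amounts to (2 r^2 - 1) s >= 2 r A *)
suff : 2 * r * A <= (2 * r ^+ 2 - 1) * s by rewrite /A; nra.
rewrite (le_trans (ler_norm _))// -[leRHS]ger0_norm; last first.
  by rewrite mulr_ge0 ?(ltW p2)//; nra.
rewrite -ler_sqr ?nnegrE// !real_normK ?num_real// !exprMn.
have : 0 <= A ^+ 2 by exact: sqr_ge0.
move: (r ^+ 2) (s ^+ 2) (A ^+ 2) hA hr1 hs1 => u v b; nra.
Qed.

Lemma benergy_edge : exists w, 0 < w /\ forall x y i j, e i j ->
  wij x y i j <= 1 + benergy x y / w.
Proof.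
have [syme irr _ sW W0] := hG.
pose w : R := \big[Num.min/1]_(p : V * V | e p.1 p.2) W p.1 p.2.
have w0 : 0 < w.
  rewrite /w; elim/big_ind: _ => //.
    by move=> u v hu hv; rewrite lt_min hu.
  by move=> p ep; exact: (W0 _ _).1.
exists w; split => // x y i j eij.
have wW : w <= W i j by rewrite /w; exact: (@bigmin_le_cond _ _ _ _ (i, j)).
rewrite addrC -lerBlDr ler_pdivlMr// mulrC.
have F0 k l : 0 <= W k l * (wij x y k l - 1).
  by rewrite mulr_ge0 ?(Wge0 hG)// subr_ge0 wij_ge1.
apply: (@le_trans _ _ (W i j * (wij x y i j - 1))).
  by rewrite ler_wpM2r// subr_ge0 wij_ge1.
have ij : i != j by apply: contraTneq eij => ->; rewrite irr.
rewrite /benergy ler_pdivlMl// mulr_natl mulr2n.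
rewrite (bigD1 i)//= [X in _ <= _ + X](bigD1 j)/=; last by rewrite eq_sym.
rewrite addrA ler_wpDr//.
  by rewrite sumr_ge0// => k _; rewrite sumr_ge0.
apply: lerD; first by rewrite (bigD1 j)//= ler_wpDr// sumr_ge0.
rewrite (bigD1 i)//= ler_wpDr ?sumr_ge0// sW.
by rewrite /wij (mulrC (rr x y i)) (mulrC (x i)) (mulrC (y i)).
Qed.

Lemma benergy_ge0 x y : 0 <= benergy x y.
Proof.
rewrite mulr_ge0 ?invr_ge0// sumr_ge0// => i _; rewrite sumr_ge0// => j _.
by rewrite mulr_ge0 ?(Wge0 hG)// subr_ge0 wij_ge1.
Qed.

(** The energy controls the distances between neighbours, hence by
    connectedness the distances to the pinned vertex. *)
Lemma benergy_decay (M : nat) : exists K : R, 0 <= K /\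
  forall x y, x a = 0 -> y a = 0 -> expR (- benergy x y) * rhoU (x, y) ^+ M <= K.
Proof.
have [w [w0 hw]] := benergy_edge.
have [_ _ conn _ _] := hG.
have hk i : exists k, forall x y, x a = 0 -> y a = 0 ->
    rr x y i <= (2 * (1 + benergy x y / w)) ^+ k.
  have /connectP[p pp ->] := conn a i; exists (size p) => x y xa ya.
  have h0 := benergy_ge0 x y.
  set m := 2 * _; have m0 : 0 <= m by rewrite mulr_ge0// addr_ge0// divr_ge0// ltW.
  have H b (q : seq V) c : rr x y b <= m ^+ c -> path e b q ->
      rr x y (last b q) <= m ^+ (c + size q).
    elim: q b c => [|j q IHq] b c hb; first by rewrite addn0.
    move=> /= /andP[ebj hq]; rewrite addnS -addSn; apply: IHq => //.
    rewrite (le_trans (rr_step x y b j))// exprS ler_pM ?(ltW (rr_gt0 _ _ _))//.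
      by rewrite mulr_ge0// (le_trans ler01)// wij_ge1.
    by rewrite ler_wpM2l// hw.
  rewrite -(add0n (size p)); apply: H => //.
  by rewrite /rr xa ya expr0n/= !addr0 sqrtr1.
have /choice[k hk'] := hk.
pose kk := (\sum_i k i)%N.
have [K [K0 hK]] := expR_beats (kk * (2 * size U) * M) w0.
exists (2 ^+ (kk * (2 * size U) * M) * K); split; first by rewrite mulr_ge0// exprn_ge0.
move=> x y xa ya; have h0 := benergy_ge0 x y.
have m1 : 1 <= 2 * (1 + benergy x y / w).
  have : 0 <= benergy x y / w by rewrite divr_ge0// ltW.
  lra.
have hr i : rr x y i <= (2 * (1 + benergy x y / w)) ^+ kk.
  rewrite (le_trans (hk' i x y xa ya))// ler_weXn2l// /kk (bigD1 i)//=.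
  exact: leq_addr.
have m0 := le_trans ler01 m1.
apply: (@le_trans _ _ (expR (- benergy x y) * (2 * (1 + benergy x y / w)) ^+ (kk * (2 * size U) * M))).
  rewrite ler_wpM2l ?expR_ge0// exprM lerXn2r ?nnegrE ?exprn_ge0//.
    by rewrite (le_trans ler01)// rhoU_ge1.
  by rewrite exprM; apply: rhoU_le_rr => //; rewrite exprn_ge0.
rewrite exprMn mulrCA ler_wpM2l ?exprn_ge0// mulrC; exact: hK.
Qed.
End EnergyBound.

Section Lam.
Context (R : realType) (V : finType) (a : V) (e : rel V) (W : V -> V -> R).
Hypothesis hG : weighted_graph e W.
Variables (c sg : R).
Hypotheses (c_ge1 : 1 <= c) (cs1 : c ^+ 2 - sg ^+ 2 = 1).
Local Notation gr := (grassmann R (V + V)%type).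
Local Notation mR := (measurableTypeR R).
Local Notation U := (unpinned a).
Implicit Types (x y : V -> R) (i j : V).

Definition en x y : gr :=
  (2^-1 * \sum_i \sum_j W i j * (x i * x j + y i * y j + 1))%:A
  - 2^-1 *: \sum_i \sum_j W i j *: (zf a x y i * zf a x y j)
  + gquad (restr a (fun i j => - W i j)).

Definition dens x y : gr := gexp (en x y) * \prod_(i | i != a) ((2 * pi)^-1 *: zi a x y i).

Lemma h22_densityE x y : x a = 0 -> y a = 0 ->
  h22_density e W a (pinned_field a x y) = dens x y.
Proof.
move=> xa ya; rewrite /h22_density (h22_energyE hG)//; congr (_ * _).
by apply: eq_bigr => i _; rewrite sz_pinned// inv_sz.
Qed.

Lemma body_zf x y i : body (zf a x y i) = rr x y i.
Proof. by rewrite bodyD body_scalar bodyZ body_nn mulr0 addr0. Qed.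

Lemma geven_en x y : geven (en x y).
Proof.
apply: gevenD; last exact: geven_gquad.
apply: gevenB; first exact: geven_scalar.
apply/gevenZ/geven_sum => i _; apply: geven_sum => j _; apply/gevenZ/gevenM; exact: geven_zf.
Qed.

Lemma body_en x y : body (en x y) = - benergy W x y.
Proof.
rewrite /en bodyD bodyB body_scalar bodyZ body_gquad addr0 body_sum /benergy.
rewrite -mulrBr -mulrN; congr (_ * _); rewrite -sumrB -sumrN; apply: eq_bigr => i _.
rewrite body_sum -sumrB -sumrN; apply: eq_bigr => j _.
by rewrite bodyZ bodyM !body_zf /wij; ring.
Qed.

Definition null_a (p : (V -> R) * (V -> R)) := p.1 a = 0 /\ p.2 a = 0.
Local Notation gp := (gpbd null_a (rhoU a)).
Local Notation pb := (pbd null_a (rhoU a)).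
Let r1 : forall p, null_a p -> 1 <= rhoU a p. Proof. by move=> p _; exact: rhoU_ge1. Qed.

Lemma pbd_rr i : pb (fun p => rr p.1 p.2 i).
Proof.
apply: pbd_le (pbd_rho r1) => -[x y] [xa ya].
rewrite /= [leRHS]ger0_norm ?(le_trans ler01 (rhoU_ge1 _ _))//.
by rewrite ger0_norm ?(ltW (rr_gt0 _ _ _))//; exact: rr_le_rhoU.
Qed.
Lemma pbd_rrV i n : pb (fun p => (rr p.1 p.2 i) ^- n).
Proof.
apply: pbd_le (pbd_cst _ _ 1) => -[x y] _ /=.
rewrite normr1 ger0_norm ?invr_ge0 ?exprn_ge0 ?(ltW (rr_gt0 _ _ _))//.
by rewrite invf_le1 ?exprn_gt0 ?rr_gt0// exprn_ege1// rr_ge1.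
Qed.
Lemma pbd_x i : pb (fun p => p.1 i).
Proof.
apply: pbd_le (pbd_rr i) => -[x y] _ /=; rewrite [leRHS]ger0_norm ?(ltW (rr_gt0 _ _ _))//.
rewrite -ler_sqr ?nnegrE ?(ltW (rr_gt0 _ _ _))// real_normK ?num_real// rr_sq.
by rewrite addrAC lerDr addr_ge0// sqr_ge0.
Qed.
Lemma pbd_y i : pb (fun p => p.2 i).
Proof.
apply: pbd_le (pbd_rr i) => -[x y] _ /=; rewrite [leRHS]ger0_norm ?(ltW (rr_gt0 _ _ _))//.
rewrite -ler_sqr ?nnegrE ?(ltW (rr_gt0 _ _ _))// real_normK ?num_real// rr_sq.
by rewrite lerDr addr_ge0// sqr_ge0.
Qed.
Lemma gpbd_zf i : gp (fun p => zf a p.1 p.2 i).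
Proof.
apply: (gpbdD r1); first exact/gpbd_scalar/pbd_rr.
by apply: gpbdZ (gpbd_cst _ _ _); apply: pbd_le (pbd_rrV i 1) => p _; rewrite expr1.
Qed.
Lemma gpbd_zi i : gp (fun p => zi a p.1 p.2 i).
Proof.
apply: (gpbdD r1).
  apply: gpbd_scalar; apply: pbd_le (pbd_rrV i 1) => p _; by rewrite expr1.
by apply: gpbdN; apply: gpbdZ (gpbd_cst _ _ _); exact: pbd_rrV.
Qed.

Lemma gpbd_en : gp (fun p => en p.1 p.2).
Proof.
apply: (gpbdD r1); last exact: gpbd_cst.
apply: (gpbdD r1).
  apply: gpbd_scalar; apply: pbdM; first exact: pbd_cst.
  apply: (pbd_sum r1) => i _; apply: (pbd_sum r1) => j _.
  apply: pbdM; first exact: pbd_cst.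
  apply: (pbdD r1); last exact: pbd_cst.
  by apply: (pbdD r1); apply: pbdM; rewrite ?(pbd_x, pbd_y)//;
    first [exact: pbd_x|exact: pbd_y].
apply: gpbdN; apply: gpbdZ; first exact: pbd_cst.
apply: (gpbd_sum r1) => i _; apply: (gpbd_sum r1) => j _.
apply: gpbdZ; first exact: pbd_cst.
by apply: gpbdM; exact: gpbd_zf.
Qed.

Lemma dens_bound (M : nat) : exists K : R, 0 <= K /\
  forall x y, x a = 0 -> y a = 0 -> gnorm (dens x y) * rhoU a (x, y) ^+ M <= K.
Proof.
have [F [[K1 [N1 [K10 hF]]] hgexp]] := gpbd_gexp r1 gpbd_en.
have hP : gp (fun p => \prod_(i | i != a) ((2 * pi)^-1 *: zi a p.1 p.2 i)).
  apply: gpbd_prod => i _; apply: gpbdZ; first exact: pbd_cst.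
  exact: gpbd_zi.
have [K2 [N2 [K20 hP2]]] := hP.
have [K [K0 hK]] := benergy_decay a hG (N1 + N2 + M).
exists (K1 * K2 * K); split; first by rewrite !mulr_ge0.
move=> x y xa ya; have nxy : null_a (x, y) by [].
set r := rhoU a (x, y); have r0 n : 0 <= r ^+ n by exact: rhoX_ge0 r1 _ _ nxy.
rewrite /dens; apply: (@le_trans _ _ ((expR (- benergy W x y) * (K1 * r ^+ N1)) * (K2 * r ^+ N2) * r ^+ M)).
  rewrite ler_wpM2r// (le_trans (gnormM _ _))// ler_pM ?gnorm_ge0//.
    rewrite (le_trans (hgexp (x, y) nxy))//= body_en ler_wpM2l ?expR_ge0//.
    exact: hF.
  by have := hP2 (x, y) nxy; rewrite ger0_norm ?gnorm_ge0.
rewrite (_ : _ * _ = K1 * K2 * (expR (- benergy W x y) * r ^+ (N1 + N2 + M))); last first.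
  by rewrite !exprD; ring.
by rewrite ler_wpM2l ?mulr_ge0// hK.
Qed.

(* The bodies of the boosted components. *)
Definition tb x y i : R := c * rr x y i + sg * x i.
Definition tn x y i : gr := (c / rr x y i) *: nn R a i.

Lemma theta_split x y i :
  c *: zf a x y i + sg *: (x i)%:A = (tb x y i)%:A + tn x y i.
Proof.
rewrite /zf /tb /tn scalerDr !scalerA scalerDl; rewrite -!addrA; congr (_ + _).
by rewrite addrC.
Qed.

Lemma tb_ge1 x y i : 1 <= tb x y i.
Proof.
rewrite /tb; have r2 := rr_sq x y i; have rg := rr_ge1 x y i.
move: (rr x y i) (x i) (y i) r2 rg => r u v r2 rg.
have hu : u ^+ 2 <= r ^+ 2 - 1 by rewrite r2; have := sqr_ge0 v; lra.
have hr2 : 1 <= r ^+ 2 by rewrite exprn_ege1.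
have hcu : (sg * u) ^+ 2 < (c * r) ^+ 2.
  rewrite !exprMn; have -> : sg ^+ 2 = c ^+ 2 - 1 by rewrite -cs1; ring.
  have : 1 <= c ^+ 2 by rewrite exprn_ege1.
  have : 0 <= u ^+ 2 by exact: sqr_ge0.
  move: (u ^+ 2) (r ^+ 2) (c ^+ 2) hu hr2 => A B C h1 h2 h3 h4.
  apply: (@le_lt_trans _ _ ((C - 1) * (B - 1))).
    by rewrite ler_wpM2l// subr_ge0.
  rewrite -subr_gt0; have -> : C * B - (C - 1) * (B - 1) = C + (B - 1) by ring.
  by rewrite ltr_wpDr ?subr_ge0// (lt_le_trans ltr01).
have cr0 : 0 < c * r by rewrite mulr_gt0// (lt_le_trans ltr01).
have h1 : `|sg * u| < c * r.
  by rewrite -(ger0_norm (ltW cr0)) -ltr_sqr ?nnegrE// !real_normK ?num_real.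
have h2 : 0 < c * r + sg * u by have := ler_norm (- (sg * u)); rewrite normrN; lra.
have h3 : (c * r + sg * u) ^+ 2 = (c * u + sg * r) ^+ 2 + (r ^+ 2 - u ^+ 2) * (c ^+ 2 - sg ^+ 2) by ring.
have h4 : 1 <= (c * r + sg * u) ^+ 2.
  by rewrite h3 cs1 mulr1; have := sqr_ge0 (c * u + sg * r); lra.
by rewrite -(@ler_pXn2r _ 2)// ?nnegrE ?(ltW h2)// expr1n.
Qed.

Lemma body_tn x y i : body (tn x y i) = 0.
Proof. by rewrite bodyZ body_nn mulr0. Qed.
Lemma tn_sq0 x y i : tn x y i * tn x y i = 0.
Proof. by rewrite -scalerAl -scalerAr nn_sq0 !scaler0. Qed.
Lemma geven_tn x y i : geven (tn x y i). Proof. exact/gevenZ/geven_nn. Qed.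
Lemma card_VV : (0 < #|((V + V)%type : finType)|)%N.
Proof. by apply/card_gt0P; exists (inl a). Qed.

(** The integrand of the field expectation, as a function of the mixed partial
    derivatives J of the observable. *)
Definition jint (J : {set V} -> (V -> R) -> R) x y : R :=
  berezin U ((\sum_(A : {set V}) J A (tb x y) *: \prod_(i <- enum V | i \in A) tn x y i) * dens x y).

Definition jet (g : (V -> R) -> R) (A : {set V}) : (V -> R) -> R :=
  partials [seq i <- enum V | i \in A] g.

Lemma jintE g x y :
  berezin U (superfun g (fun i => c *: zf a x y i + sg *: (x i)%:A) * dens x y) =
  jint (jet g) x y.
Proof.
rewrite (_ : (fun i => _) = (fun i => (tb x y i)%:A + tn x y i)); last first.
  by apply/funext => i; exact: theta_split.
rewrite superfunE//; [exact: card_VV|exact: body_tn|exact: tn_sq0].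
Qed.

Lemma jintB J J' x y : jint (fun A l => J A l - J' A l) x y = jint J x y - jint J' x y.
Proof.
rewrite /jint -[X in _ - X]mul1r -mulNr -berezinZ -berezinD scaleN1r -mulNr -mulrDl.
congr (berezin _ (_ * _)); rewrite -sumrB; apply: eq_bigr => A _.
by rewrite scalerBl.
Qed.

Lemma jint_bound (N : nat) : exists K : R, 0 <= K /\
  forall (C : R) J, 0 <= C ->
    (forall A l, (forall i, 1 <= l i) -> `|J A l| <= C * (\prod_i l i) ^+ N) ->
  forall x y, x a = 0 -> y a = 0 -> `|jint J x y| <= C * K * (cauchyd U x * cauchyd U y).
Proof.
have hb i : pb (fun p => tb p.1 p.2 i).
  apply: (pbdD r1); apply: pbdM; rewrite ?pbd_rr//;
  first [exact: pbd_cst|exact: pbd_rr|exact: pbd_x].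
have hn i : gp (fun p => tn p.1 p.2 i).
  apply: gpbdZ (gpbd_cst _ _ _); apply: pbdM; first exact: pbd_cst.
  by apply: pbd_le (pbd_rrV i 1) => p _; rewrite expr1.
pose F p := (\prod_i tb p.1 p.2 i) ^+ N *
  \sum_(A : {set V}) gnorm (\prod_(i <- enum V | i \in A) tn p.1 p.2 i).
have [K1 [N1 [K10 hF]]] : pb F.
  apply: pbdM; first by apply: pbdX; apply: pbd_prod => i _.
  by apply: (pbd_sum r1) => A _; apply: gpbd_prod => i _.
have [K [K0 hK]] := dens_bound (N1 + 2).
exists (K1 * K); split; first by rewrite mulr_ge0.
move=> C J C0 hJ x y xa ya; have nxy : null_a (x, y) by [].
rewrite (le_trans (berezin_le _ _))// (le_trans (gnormM _ _))//.
have hsum : gnorm (\sum_(A : {set V}) J A (tb x y) *: \prod_(i <- enum V | i \in A) tn x y i) <=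
    C * F (x, y).
  rewrite (le_trans (gnorm_sum _ _ _))// /F mulrA mulr_sumr; apply: ler_sum => A _.
  by rewrite gnormZ ler_wpM2r ?gnorm_ge0// hJ// => i; exact: tb_ge1.
set r := rhoU a (x, y); have r0 n : 0 <= r ^+ n by exact: rhoX_ge0 r1 _ _ nxy.
have rp : 0 < r by exact: lt_le_trans ltr01 (rhoU_ge1 _ _).
apply: (@le_trans _ _ (C * K1 * K * r ^- 2)); last first.
  by rewrite -!mulrA ler_wpM2l// ler_wpM2l// ler_wpM2l// rhoU_cauchyd.
apply: (@le_trans _ _ ((C * (K1 * r ^+ N1)) * gnorm (dens x y))).
  rewrite ler_wpM2r ?gnorm_ge0// (le_trans hsum)// ler_wpM2l//.
  by rewrite (le_trans (ler_norm _))// hF.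
rewrite ler_pdivlMr ?exprn_gt0// -!mulrA ler_wpM2l// ler_wpM2l//.
by have := hK x y xa ya; rewrite exprD mulrCA mulrA.
Qed.

(** ** Measurability and integrability *)
Section Measurability.
Context d (T : measurableType d) (x y : T -> V -> R).
Hypotheses (mx : forall i, measurable_fun setT (fun w => x w i))
           (my : forall i, measurable_fun setT (fun w => y w i)).

Lemma measurable_rr i : measurable_fun setT (fun w => rr (x w) (y w) i).
Proof.
apply: (@measurableT_comp _ _ _ _ _ _ (@Num.sqrt R)).
  by apply: continuous_measurable_fun; exact: sqrt_continuous.
apply: measurable_funD; last exact: measurable_funX.
by apply: measurable_funD; [exact: measurable_cst|exact: measurable_funX].
Qed.
Lemma measurable_rrV i n : measurable_fun setT (fun w => (rr (x w) (y w) i) ^- n).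
Proof.
rewrite (_ : (fun w => _) = (fun w => expR (- n%:R * ln (rr (x w) (y w) i)))); last first.
  apply/funext => w; rewrite mulNr expRN; congr (_^-1).
  by rewrite expRM_natl lnK// posrE rr_gt0.
apply: measurableT_comp => //; apply: measurable_funM => //.
by apply: measurableT_comp (measurable_rr i); exact: measurable_ln.
Qed.
Lemma gmeas_zf i : gmeas (fun w => zf a (x w) (y w) i).
Proof.
apply: gmeasD; apply: gmeasZ; rewrite ?measurable_rr//; try exact: gmeas_cst.
  exact: measurable_rr.
by have := measurable_rrV i 1; under eq_fun do rewrite expr1.
Qed.
Lemma gmeas_zi i : gmeas (fun w => zi a (x w) (y w) i).
Proof.
apply: gmeasD.
  apply: gmeasZ; last exact: gmeas_cst.
  by have := measurable_rrV i 1; under eq_fun do rewrite expr1.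
apply: gmeasN; apply: gmeasZ; last exact: gmeas_cst.
exact: measurable_rrV.
Qed.
Lemma gmeas_dens : gmeas (fun w => dens (x w) (y w)).
Proof.
apply: gmeasM; last first.
  by apply: gmeas_prod => i _; apply: gmeasZ => //; exact: gmeas_zi.
apply: gmeas_gexp; apply: gmeasD; last exact: gmeas_cst.
apply: gmeasD.
  apply: gmeasZ; last exact: gmeas_cst.
  apply: measurable_funM => //; apply: measurable_sum_seq => i _.
  apply: measurable_sum_seq => j _; apply: measurable_funM => //.
  by do 2 apply: measurable_funD => //; exact: measurable_funM.
apply: gmeasN; apply: gmeasZ => //.
apply: gmeas_sum => i _; apply: gmeas_sum => j _; apply: gmeasZ => //.
by apply: gmeasM; exact: gmeas_zf.
Qed.
Lemma measurable_tb i : measurable_fun setT (fun w => tb (x w) (y w) i).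
Proof.
apply: measurable_funD; apply: measurable_funM => //; exact: measurable_rr.
Qed.
Lemma measurable_jint J : (forall A, measurableV (J A)) ->
  measurable_fun setT (fun w => jint J (x w) (y w)).
Proof.
move=> mJ; apply: measurable_berezin; apply: gmeasM; last exact: gmeas_dens.
apply: gmeas_sum => A _; apply: gmeasZ.
  by apply: mJ => i; exact: measurable_tb.
apply: gmeas_prod => i _; apply: gmeasZ; last exact: gmeas_cst.
apply: measurable_funM => //.
by have := measurable_rrV i 1; under eq_fun do rewrite expr1.
Qed.
End Measurability.

Local Notation T2 := ((size U).-tuple mR * (size U).-tuple mR)%type.
Definition leb2 := (lebesgue_Rn R (size U) \x lebesgue_Rn R (size U))%E.
Definition px (p : T2) : V -> R := put U (fun=> 0) p.1.
Definition py (p : T2) : V -> R := put U (fun=> 0) p.2.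

Lemma a_notin : a \notin U. Proof. by rewrite mem_enum !inE eqxx. Qed.
Lemma px_a p : px p a = 0. Proof. by rewrite /px /put (negPf a_notin). Qed.
Lemma py_a p : py p a = 0. Proof. by rewrite /py /put (negPf a_notin). Qed.
Lemma measurable_px i : measurable_fun setT (fun p => px p i).
Proof. by apply: measurable_put => // j; exact: measurable_cst. Qed.
Lemma measurable_py i : measurable_fun setT (fun p => py p i).
Proof. by apply: measurable_put => // j; exact: measurable_cst. Qed.

Lemma integrable_cauchyd2 :
  leb2.-integrable setT (fun p : T2 => (cauchyd U (px p) * cauchyd U (py p))%:E).
Proof.
have m : measurable_fun setT (fun p : T2 => (cauchyd U (px p) * cauchyd U (py p))%:E).
  apply/measurable_EFinP; apply: measurable_funM.
    by apply: measurableV_cauchyd => i; exact: measurable_px.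
  by apply: measurableV_cauchyd => i; exact: measurable_py.
have /integrableP[_ h] := integrable_cauchyd (fun=> 0 : R) (enum_uniq (predC1 a)).
have h' : (\int[lebesgue_Rn R (size U)]_t (cauchyd U (put U (fun=> 0%R) t))%:E < +oo)%E.
  by under eq_integral do rewrite -[X in X%:E]ger0_norm ?cauchyd_ge0//.
set I := (X in (X < _)%E) in h'.
have I0 : (0 <= I)%E by apply: integral_ge0 => t _; rewrite lee_fin cauchyd_ge0.
have mc : measurable_fun setT (fun t : (size U).-tuple mR => (cauchyd U (put U (fun=> 0) t))%:E).
  apply/measurable_EFinP; apply: measurableV_cauchyd => i.
  by apply: (@measurable_put _ _ _ _ U (fun=> fun=> 0) id) => // j; exact: measurable_cst.
apply: (proj2 (@integrable12ltyP _ _ _ _ R (lebesgue_Rn R (size U)) (lebesgue_Rn R (size U)) _ m)).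
rewrite (eq_integral (fun t : (size U).-tuple mR => I * (cauchyd U (put U (fun=> 0%R) t))%:E)%E); last first.
  move=> t _; rewrite muleC -ge0_integralZl//; last 2 first.
  - by move=> u _; rewrite lee_fin cauchyd_ge0.
  - by rewrite lee_fin cauchyd_ge0.
  apply: eq_integral => u _; rewrite /= ger0_norm ?mulr_ge0 ?cauchyd_ge0//.
rewrite ge0_integralZl//; last by move=> u _; rewrite lee_fin cauchyd_ge0.
by apply: lte_mul_pinfty => //; rewrite ge0_fin_numE.
Qed.

Definition Lam (J : {set V} -> (V -> R) -> R) : \bar R :=
  (\int[leb2]_p (jint J (px p) (py p))%:E)%E.

Lemma h22_jint g x y : x a = 0 -> y a = 0 ->
  berezin U (superfun g (fun i => c *: sz (pinned_field a x y i) + sg *: sx (pinned_field a x y i))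
    * h22_density e W a (pinned_field a x y)) = jint (jet g) x y.
Proof.
move=> xa ya; rewrite (h22_densityE xa ya) -jintE.
rewrite (_ : (fun i => _) = (fun i => c *: zf a x y i + sg *: (x i)%:A))//.
by apply/funext => i; rewrite sz_pinned// sx_pinned.
Qed.

Lemma h22_Lam g :
  h22_expectation e W a (fun Phi => superfun g (fun i => c *: sz (Phi i) + sg *: sx (Phi i))) =
  Lam (jet g).
Proof.
rewrite /h22_expectation /Lam /leb2 /px /py.
have cE (t : #|predC1 a|.-tuple R) : coord t = put U (fun=> 0) t.
  apply/funext => i; rewrite /coord /put; case: ifPn => // iU.
  by rewrite nth_default// size_tuple cardE leqNgt index_mem.
transitivity (\int[lebesgue_Rn R #|predC1 a| \x lebesgue_Rn R #|predC1 a|]_p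
    (jint (jet g) (put U (fun=> 0) p.1) (put U (fun=> 0) p.2))%:E)%E; last first.
  by rewrite cardE.
have na t : put U (fun=> 0) t a = 0 :> R by rewrite /put (negPf a_notin).
apply: eq_integral => -[t u] _; cbv zeta beta; rewrite !cE [(t, u).1]/= [(t, u).2]/=.
by congr EFin; apply: h22_jint; exact: na.
Qed.

Lemma integrable_jint (N : nat) (C : R) J : 0 <= C -> (forall A, measurableV (J A)) ->
  (forall A l, (forall i, 1 <= l i) -> `|J A l| <= C * (\prod_i l i) ^+ N) ->
  leb2.-integrable setT (fun p : T2 => (jint J (px p) (py p))%:E).
Proof.
move=> C0 mJ hJ; have [K [K0 hK]] := jint_bound N.
apply: (le_integrable measurableT (g := fun p : T2 => ((C * K)%:E * (cauchyd U (px p) * cauchyd U (py p))%:E)%E)).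
- apply/measurable_EFinP; apply: measurable_jint => //; first exact: measurable_px.
  exact: measurable_py.
- move=> p _; rewrite -EFinM /= lee_fin [leRHS]ger0_norm ?mulr_ge0 ?cauchyd_ge0//.
  by apply: hK => //; [exact: px_a|exact: py_a].
- by apply: integrableZl => //; exact: integrable_cauchyd2.
Qed.

End Lam.

(** * Exact evaluation on Gaussian observables *)
Section MMatrix.
Context (R : realType) (V : finType).
Implicit Types (A B : V -> V -> R) (s : seq V) (i j k : V).

(* Off-diagonal entries are nonpositive and row sums positive, outside s. *)
Definition mmatrix_off s B :=
  (forall j k, j \notin s -> k != j -> B j k <= 0) /\
  (forall j, j \notin s -> 0 < \sum_k B j k).

Lemma mmatrix_diag s B i : mmatrix_off s B -> i \notin s -> 0 < B i i.
Proof.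
move=> [h1 h2] si; have := h2 i si; rewrite (bigD1 i)//=.
move=> /lt_le_trans; apply; rewrite gerDl sumr_le0// => k ki; exact: h1.
Qed.

Lemma mmatrix_schur s B i : i \notin s -> mmatrix_off s B -> mmatrix_off (i :: s) (schur B i).
Proof.
move=> si hB; have pB := mmatrix_diag hB si; have [h1 h2] := hB; split => [j k|j].
  rewrite inE negb_or => /andP[ji sj] kj; rewrite /schur.
  have [->|ki] := eqVneq k i; first by rewrite mulfK ?gt_eqF// subrr.
  have hji : B j i <= 0 by apply: h1; rewrite // eq_sym.
  have hik : B i k <= 0 by exact: h1.
  rewrite subr_le0 (le_trans (h1 j k sj kj))// divr_ge0 ?(ltW pB)//.
  by rewrite mulr_le0.
rewrite inE negb_or => /andP[ji sj]; rewrite /schur sumrB.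
under [X in _ - X]eq_bigr do rewrite mulrAC.
rewrite -mulr_sumr subr_gt0 (le_lt_trans _ (h2 j sj))//.
rewrite mulr_le0_ge0//; last exact/ltW/h2.
by rewrite mulr_le0_ge0 ?invr_ge0 ?(ltW pB)//; apply: h1; rewrite // eq_sym.
Qed.

Lemma mmatrix_elim s A : uniq s -> mmatrix_off [::] A -> mmatrix_off s (elim_on s A).
Proof.
move=> us hA; elim: s us => [//|i s IHs] /= /andP[si us].
by apply: mmatrix_schur => //; exact: IHs.
Qed.

Lemma mmatrix_pivots s A : uniq s -> mmatrix_off [::] A ->
  forall p, p \in pivots s A -> 0 < p.
Proof.
move=> us hA; elim: s us => [//|i s IHs] /= /andP[si us] p.
rewrite inE => /orP[/eqP ->|]; last exact: IHs.
exact: mmatrix_diag (mmatrix_elim us hA) si.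
Qed.

(* The vectors killed by the eliminated rows are the same for all the Schur
   complements. *)
Lemma elim_apply s A (v : V -> R) j : uniq s -> mmatrix_off [::] A ->
  (forall i, i \in s -> \sum_k A i k * v k = 0) ->
  \sum_k elim_on s A j k * v k = \sum_k A j k * v k.
Proof.
move=> us hA; elim: s us j => [//|i s IHs] /= /andP[si us] j hv.
have hv' i' : i' \in s -> \sum_k A i' k * v k = 0 by move=> h; apply: hv; rewrite inE h orbT.
rewrite -(IHs us j hv') /schur.
rewrite (eq_bigr (fun k => elim_on s A j k * v k -
   elim_on s A j i / elim_on s A i i * (elim_on s A i k * v k))); last by move=> k _; ring.
by rewrite sumrB -mulr_sumr (IHs us i hv') (hv i) ?inE ?eqxx// mulr0 subr0.
Qed.

Lemma elim_zero s A i k : uniq s -> mmatrix_off [::] A -> i \in s ->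
  elim_on s A k i = 0 /\ elim_on s A i k = 0.
Proof.
move=> us hA; elim: s us k => [//|j s IHs] /= /andP[sj us] k; rewrite inE.
have p := mmatrix_diag (mmatrix_elim us hA) sj.
case/orP => [/eqP ->|si]; first by rewrite schur_row ?schur_col ?gt_eqF.
have [h1 h2] := IHs us k si; have [h3 h4] := IHs us j si.
by rewrite /schur h1 h2 h3 h4 !(mulr0, mul0r) !subrr.
Qed.

(** Back substitution: the linear system has a nonnegative solution for any
    nonnegative boundary values. *)
Lemma mmatrix_solve s A (b : V -> R) : uniq s -> mmatrix_off [::] A ->
  (forall i, 0 <= b i) -> exists v : V -> R,
  [/\ forall i, 0 <= v i, forall i, i \notin s -> v i = b i &
      forall i, i \in s -> \sum_k A i k * v k = 0].
Proof.
move=> us hA; elim: s us b => [_ b b0|i s IHs /= /andP[si us] b b0]; first by exists b.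
have hm := mmatrix_elim us hA; have p := mmatrix_diag hm si.
pose x := - (\sum_(k | (k != i) && (k \notin s)) elim_on s A i k * b k) / elim_on s A i i.
have x0 : 0 <= x.
  rewrite divr_ge0 ?(ltW p)// oppr_ge0 sumr_le0// => k /andP[ki sk].
  by rewrite mulr_le0_ge0//; apply: hm.1.
have [v [v0 vb hv]] : exists v : V -> R,
  [/\ forall i, 0 <= v i, forall j, j \notin s -> v j = dfwith b i x j &
      forall i, i \in s -> \sum_k A i k * v k = 0].
  apply: IHs => // j; have [<-|ij] := eqVneq i j; first by rewrite dfwithin.
  by rewrite dfwithout.
exists v; split => // [j|j]; rewrite inE.
  by rewrite negb_or => /andP[ji sj]; rewrite vb// dfwithout// eq_sym.
case/orP => [/eqP ->|]; last exact: hv.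
rewrite -(@elim_apply s A v i us hA hv) (bigD1 i)//= vb// dfwithin.
rewrite (bigID (fun k => k \in s))/= big1 ?add0r; last first.
  by move=> k /andP[_ ks]; have [h _] := elim_zero i us hA ks; rewrite h mul0r.
rewrite /x mulrC divfK ?gt_eqF// addrC; apply/eqP; rewrite subr_eq0; apply/eqP.
by apply: eq_bigr => k /andP[ki sk]; rewrite vb// dfwithout// eq_sym.
Qed.

Lemma elim_ext s A B (P : pred V) : (forall i, i \in s -> P i) ->
  (forall j k, P j -> P k -> A j k = B j k) ->
  forall j k, P j -> P k -> elim_on s A j k = elim_on s B j k.
Proof.
move=> sP AB; elim: s sP => [//|i s IHs] sP /= j k Pj Pk.
have Pi : P i by apply: sP; rewrite inE eqxx.
have sP' : forall i, i \in s -> P i by move=> l ls; apply: sP; rewrite inE ls orbT.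
by rewrite /schur !(IHs sP').
Qed.
Lemma pivots_ext s A B (P : pred V) : (forall i, i \in s -> P i) ->
  (forall j k, P j -> P k -> A j k = B j k) -> pivots s A = pivots s B.
Proof.
move=> sP AB; elim: s sP => [//|i s IHs] sP /=.
have Pi : P i by apply: sP; rewrite inE eqxx.
have sP' : forall i, i \in s -> P i by move=> l ls; apply: sP; rewrite inE ls orbT.
by rewrite IHs// (elim_ext sP' AB).
Qed.
End MMatrix.

Section GderMore.
Context (R : realType) (G : finType).
Local Notation gr := (grassmann R G).

Lemma prod_even_D1 (I : eqType) (r : seq I) (F : I -> gr) (i : I) :
  uniq r -> i \in r -> (forall j, geven (F j)) ->
  \prod_(j <- r) F j = F i * \prod_(j <- r | j != i) F j.
Proof.
move=> ur ir eF; elim: r ur ir => [//|k r IHr] /= /andP[kr ur]; rewrite inE !big_cons.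
case/orP => [/eqP ->|ir].
  rewrite eqxx/=; congr (_ * _); rewrite big_seq_cond [RHS]big_seq_cond.
  apply: eq_bigl => j; case jr: (j \in r) => //=; rewrite ?andbT.
  by apply/esym/eqP => jk; rewrite -jk jr in kr.
have -> : k != i by apply: contraNneq kr => ->.
by rewrite IHr// !mulrA (geven_comm _ (eF k)).
Qed.

Lemma gder_prod (I : eqType) (r : seq I) (F : I -> R -> gr) t (F' : I -> gr) :
  uniq r -> (forall i, gder (F i) t (F' i)) -> (forall i x, geven (F i x)) ->
  gder (fun x => \prod_(i <- r) F i x) t
       (\sum_(i <- r) F' i * \prod_(j <- r | j != i) F j t).
Proof.
move=> ur dF eF; elim: r ur => [_|k r IHr /= /andP[kr ur]].
  by rewrite big_nil; apply: gder_ext (gder_cst 1 t) => x; rewrite big_nil.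
have -> : \sum_(i <- k :: r) F' i * \prod_(j <- k :: r | j != i) F j t =
    F' k * \prod_(i <- r) F i t + F k t * (\sum_(i <- r) F' i * \prod_(j <- r | j != i) F j t).
  rewrite big_cons; congr (_ + _).
    congr (_ * _); rewrite big_cons eqxx/= big_seq_cond [RHS]big_seq_cond.
    apply: eq_bigl => j; case jr: (j \in r) => //=.
    by apply/eqP => jk; rewrite -jk jr in kr.
  rewrite mulr_sumr big_seq [RHS]big_seq; apply: eq_bigr => i ir; rewrite big_cons.
  have -> : k != i by apply: contraNneq kr => ->.
  by rewrite !mulrA (geven_comm _ (eF k t)).
by apply: gder_ext (gderM (dF k) (IHr ur)) => x; rewrite big_cons.
Qed.

Definition gdiff (f : R -> gr) t := exists f', gder f t f'.
Lemma gdiffD f g t : gdiff f t -> gdiff g t -> gdiff (fun x => f x + g x) t.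
Proof. by move=> [f' hf] [g' hg]; eexists; exact: gderD. Qed.
Lemma gdiffM f g t : gdiff f t -> gdiff g t -> gdiff (fun x => f x * g x) t.
Proof. by move=> [f' hf] [g' hg]; eexists; exact: gderM. Qed.
Lemma gdiff_cst u t : gdiff (fun=> u) t.
Proof. by eexists; exact: gder_cst. Qed.
Lemma gdiffZ (c : R) f t : gdiff f t -> gdiff (fun x => c *: f x) t.
Proof. by move=> [f' hf]; eexists; exact: gder_scale (is_derive_cst c t 1) hf. Qed.
Lemma gdiffN f t : gdiff f t -> gdiff (fun x => - f x) t.
Proof. by move=> /(gdiffZ (-1)); under eq_fun do rewrite scaleN1r. Qed.
Lemma gdiff_sum I (r : seq I) (P : pred I) (F : I -> R -> gr) t :
  (forall i, P i -> gdiff (F i) t) -> gdiff (fun x => \sum_(i <- r | P i) F i x) t.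
Proof.
move=> h; elim: r => [|i r IHr].
  by under eq_fun do rewrite big_nil; exact: gdiff_cst.
case Pi: (P i); under eq_fun do rewrite big_cons Pi; last by [].
by apply: gdiffD => //; exact: h.
Qed.
Lemma gdiff_gexp f t : (forall x, geven (f x)) -> gdiff f t -> gdiff (fun x => gexp (f x)) t.
Proof. by move=> ef [f' hf]; eexists; exact: gder_gexp. Qed.

Lemma gder_quad (V : finType) (A : V -> V -> R) (X : V -> R -> gr) t (X' : V -> gr) :
  (forall j k, A j k = A k j) ->
  (forall i, gder (X i) t (X' i)) -> (forall i x, geven (X i x)) ->
  gder (fun x => - 2^-1 *: \sum_i \sum_j A i j *: (X i x * X j x)) t
    (- \sum_i X' i * \sum_j A i j *: X j t).
Proof.
move=> sA dX eX.
have h : gder (fun x => \sum_i \sum_j A i j *: (X i x * X j x)) t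
    (\sum_i \sum_j A i j *: (X' i * X j t + X i t * X' j)).
  apply: gder_sum => i _; apply: gder_sum => j _.
  have := gder_scale (is_derive_cst (A i j) t 1) (gderM (dX i) (dX j)).
  by rewrite scale0r add0r.
have := gder_scale (is_derive_cst (- 2^-1 : R) t 1) h; rewrite scale0r add0r.
rewrite [X in gder _ _ X -> _](_ : _ = - \sum_i X' i * \sum_j A i j *: X j t)//.
have -> : \sum_i \sum_j A i j *: (X' i * X j t + X i t * X' j) =
    (\sum_i X' i * \sum_j A i j *: X j t) + (\sum_i X' i * \sum_j A i j *: X j t).
  under eq_bigr => i _ do (under eq_bigr => j _ do rewrite scalerDr).
  under eq_bigr => i _ do rewrite big_split.
  rewrite big_split/=; congr (_ + _).
    apply: eq_bigr => i _; rewrite mulr_sumr; apply: eq_bigr => j _.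
    by rewrite scalerAr.
  rewrite exchange_big/=; apply: eq_bigr => i _; rewrite mulr_sumr; apply: eq_bigr => j _.
  by rewrite sA -scalerAr (geven_comm _ (eX j t)).
by rewrite -mulr2n -[X in _ *: X]scaler_nat scalerA mulNr mulVf ?pnatr_eq0// scaleN1r.
Qed.
End GderMore.

Section ExprSums.
Context (R : realType) (V : finType).
Definition ESum (s : seq V) (f : V -> expr R V) := foldr (fun i e => EAdd (f i) e) (ECst V 0) s.
Definition EProd (s : seq V) (f : V -> expr R V) := foldr (fun i e => EMul (f i) e) (ECst V 1) s.
Lemma eval_ESum s f l : eval (ESum s f) l = \sum_(i <- s) eval (f i) l.
Proof. by elim: s => [|i s IHs] /=; rewrite ?big_nil ?big_cons// IHs. Qed.
Lemma eval_EProd s f l : eval (EProd s f) l = \prod_(i <- s) eval (f i) l.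
Proof. by elim: s => [|i s IHs] /=; rewrite ?big_nil ?big_cons// IHs. Qed.
Lemma geval_ESum (G : finType) s f (u : V -> grassmann R G) :
  geval (ESum s f) u = \sum_(i <- s) geval (f i) u.
Proof. by elim: s => [|i s IHs] /=; rewrite ?big_nil ?big_cons ?scale0r// IHs. Qed.
Lemma geval_EProd (G : finType) s f (u : V -> grassmann R G) :
  geval (EProd s f) u = \prod_(i <- s) geval (f i) u.
Proof. by elim: s => [|i s IHs] /=; rewrite ?big_nil ?big_cons ?scale1r// IHs. Qed.

Definition Amat (W : V -> V -> R) (k : V -> R) i j : R := (i == j)%:R * k i - W i j.
Definition gauss_obs (W : V -> V -> R) (k : V -> R) : expr R V :=
  EMul (EProd (enum V) (@EVar R V))
   (EExp (ESum (enum V) (fun i => ESum (enum V) (fun j =>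
     EMul (ECst V (- 2^-1 * Amat W k i j)) (EMul (EVar R i) (EVar R j)))))).
Lemma eval_gauss_obs W k l :
  eval (gauss_obs W k) l = (\prod_i l i) * expR (- 2^-1 * quadf (Amat W k) l).
Proof.
rewrite /= eval_EProd eval_ESum big_enum/=; congr (_ * expR _).
rewrite big_enum/= /quadf mulr_sumr; apply: eq_bigr => i _.
rewrite eval_ESum big_enum/= mulr_sumr; apply: eq_bigr => j _ /=.
by rewrite !mulrA.
Qed.
End ExprSums.

Section Hyperbolic.
Context (R : realType).
Implicit Types u : R.
Lemma cosh2_sinh2 u : cosh u ^+ 2 - sinh u ^+ 2 = 1.
Proof.
have h : expR u * expR (- u) = 1 by rewrite -expRD subrr expR0.
by rewrite /cosh /sinh; move: (expR u) (expR (- u)) h => p q h; rewrite -[RHS]h; field.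
Qed.
Lemma cosh_gt0 u : 0 < cosh u.
Proof. by rewrite divr_gt0// addr_gt0 ?expR_gt0. Qed.
Lemma cosh_ge1 u : 1 <= cosh u.
Proof.
rewrite -(@ler_pXn2r _ 2)// ?nnegrE ?(ltW (cosh_gt0 _))// expr1n.
by rewrite -(cosh2_sinh2 u) gerBl sqr_ge0.
Qed.
Lemma cosh_gt1 u : u != 0 -> 1 < cosh u.
Proof.
move=> u0; rewrite lt_neqAle cosh_ge1 andbT; apply/eqP => c1.
have : sinh u ^+ 2 = 0.
  by have := cosh2_sinh2 u; rewrite -c1 expr1n; move: (sinh u ^+ 2) => q; lra.
move=> /eqP; rewrite sqrf_eq0 /sinh mulf_eq0 invr_eq0 pnatr_eq0 orbF subr_eq0.
by move=> /eqP/expR_inj/eqP; rewrite -subr_eq0 opprK -mulr2n mulrn_eq0/= (negPf u0).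
Qed.
Lemma cosh0 : cosh (0 : R) = 1. Proof. by rewrite /cosh oppr0 expR0; field. Qed.
Lemma sinh0 : sinh (0 : R) = 0. Proof. by rewrite /sinh oppr0 expR0 subrr mul0r. Qed.
Lemma is_derive_expN u : is_derive u (1 : R) (fun u => expR (- u)) (- expR (- u)).
Proof.
have h : is_derive u (1 : R) (fun u : R => - u) (- 1) by exact: is_deriveN.
have := is_derive1_comp (is_derive_expR (- u)) h.
by rewrite mulrN1.
Qed.
Lemma is_derive_cosh u : is_derive u (1 : R) (@cosh R) (sinh u).
Proof.
have h := is_derive_expN u.
rewrite (_ : @cosh R = (2^-1 \*: (expR + (fun u => expR (- u))))); last first.
  by apply/funext => r; rewrite /cosh mulrC.
by apply: is_derive_eq; rewrite /sinh /GRing.scale/= mulrC.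
Qed.
Lemma is_derive_sinh u : is_derive u (1 : R) (@sinh R) (cosh u).
Proof.
have h := is_derive_expN u.
rewrite (_ : @sinh R = (2^-1 \*: (expR - (fun u => expR (- u))))); last first.
  by apply/funext => r; rewrite /sinh mulrC.
by apply: is_derive_eq; rewrite /cosh /GRing.scale/= opprK mulrC.
Qed.
Lemma cosh_bound s u : `|u| <= s -> `|cosh u| <= expR s.
Proof.
rewrite ler_norml => /andP[h1 h2]; rewrite ger0_norm ?(ltW (cosh_gt0 _))// /cosh.
have a1 : expR u <= expR s by rewrite ler_expR.
have a2 : expR (- u) <= expR s by rewrite ler_expR lerNl.
by rewrite ler_pdivrMr//; lra.
Qed.
Lemma sinh_bound s u : `|u| <= s -> `|sinh u| <= expR s.
Proof.
move=> us; rewrite (le_trans _ (cosh_bound us))// -ler_sqr ?nnegrE//.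
by rewrite !real_normK ?num_real// -subr_ge0 cosh2_sinh2.
Qed.
End Hyperbolic.

Section Evaluation.
Context (R : realType) (V : finType) (a : V) (e : rel V) (W : V -> V -> R).
Hypothesis hG : weighted_graph e W.
Variables (k : V -> R) (sg : R).
Hypothesis hk : forall i, \sum_j W i j < k i.
Local Notation gr := (grassmann R (V + V)%type).
Local Notation mR := (measurableTypeR R).
Local Notation U := (unpinned a).
Local Notation A := (Amat W k).
Implicit Types (x y : V -> R) (i j : V) (u : R).

Lemma Amat_sym i j : A i j = A j i.
Proof. by rewrite /Amat (Wsym hG) eq_sym; case: eqP => [->|_] //; rewrite !mul0r. Qed.

Lemma Amat_mmatrix : mmatrix_off [::] A.
Proof.
split=> [i j _ ji|i _]; rewrite /Amat.
  by rewrite eq_sym (negPf ji) mul0r sub0r oppr_le0 (Wge0 hG).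
rewrite sumrB subr_gt0 (lt_le_trans (hk i))// (bigD1 i)//= eqxx mul1r big1 ?addr0//.
by move=> j ji; rewrite eq_sym (negPf ji) mul0r.
Qed.

Lemma quadf_Amat_ge : exists lam : R, 0 < lam /\ forall v, lam * \sum_i v i ^+ 2 <= quadf A v.
Proof.
pose lam : R := \big[Num.min/1]_i (k i - \sum_j W i j).
exists lam; split.
  rewrite /lam; elim/big_ind: _ => // [p q hp hq|i _]; first by rewrite lt_min hp.
  by rewrite subr_gt0.
move=> v.
have -> : quadf A v = \sum_i (k i - \sum_j W i j) * v i ^+ 2 +
    2^-1 * \sum_i \sum_j W i j * (v i - v j) ^+ 2.
  have -> : quadf A v = \sum_i k i * v i ^+ 2 - \sum_i \sum_j W i j * (v i * v j).
    rewrite /quadf -sumrB; apply: eq_bigr => i _.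
    under eq_bigr do rewrite /Amat !mulrBl.
    rewrite sumrB; congr (_ - _); last by apply: eq_bigr => j _; rewrite mulrA.
    rewrite (bigD1 i)//= eqxx big1 ?addr0 => [|j ji]; first by rewrite mul1r expr2 mulrA.
    by rewrite eq_sym (negPf ji) !mul0r.
  have -> : \sum_i \sum_j W i j * (v i - v j) ^+ 2 =
     \sum_i \sum_j W i j * v i ^+ 2 + \sum_i \sum_j W i j * v j ^+ 2
     - (\sum_i \sum_j W i j * (v i * v j)) *+ 2.
    rewrite mulr2n opprD addrA -!sumrN -!big_split/=; apply: eq_bigr => i _.
    rewrite -!sumrN -!big_split/=; apply: eq_bigr => j _; ring.
  rewrite [X in _ + X - _](_ : _ = \sum_i \sum_j W i j * v i ^+ 2); last first.
    by rewrite exchange_big/=; apply: eq_bigr => i _; apply: eq_bigr => j _; rewrite (Wsym hG).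
  have -> : \sum_i (k i - \sum_j W i j) * v i ^+ 2 =
    \sum_i k i * v i ^+ 2 - \sum_i \sum_j W i j * v i ^+ 2.
    by rewrite -sumrB; apply: eq_bigr => i _; rewrite mulrBl mulr_suml.
  by rewrite -mulr_natr; field.
rewrite -[leLHS]addr0 lerD//.
  rewrite mulr_sumr; apply: ler_sum => i _; rewrite ler_wpM2r ?sqr_ge0//.
  exact: (@bigmin_le_cond _ _ _ _ i).
rewrite mulr_ge0 ?invr_ge0// sumr_ge0// => i _; rewrite sumr_ge0// => j _.
by rewrite mulr_ge0 ?(Wge0 hG) ?sqr_ge0.
Qed.

(* The boosted field with rapidity u; the value sg of the pinned x-component
   does not move with u. *)
Definition th u x y i : gr := cosh u *: zf a x y i + sinh u *: (x i)%:A.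
Definition x0 u x y i : gr := cosh u *: (x i)%:A + sinh u *: zf a x y i.
Definition xv u x y i : gr := if i == a then sg%:A else x0 u x y i.
Definition qs u x y : gr :=
  - 2^-1 *: \sum_i \sum_j A i j *: (xv u x y i * xv u x y j)
  + ((- 2^-1 * quadf A y)%:A + gquad (restr a A)).
Definition pr u x y : gr := \prod_(i <- U) (th u x y i * zi a x y i).
Definition pri i u x y : gr := \prod_(j <- U | j != i) (th u x y j * zi a x y j).
Definition js u x y : gr := pr u x y * gexp (qs u x y).
Definition ax u x y i : gr := \sum_j A i j *: xv u x y j.
(* The divergence term of vertex i: the x_i-derivative of z_i times js. *)
Definition dj i u x y : gr :=
  (zi a x y i * x0 u x y i) * pri i u x y * gexp (qs u x y) +
  th u x y i * pri i u x y * (- (zi a x y i * th u x y i * ax u x y i) * gexp (qs u x y)).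

Lemma geven_th u x y i : geven (th u x y i).
Proof. by apply: gevenD; apply: gevenZ; [exact: geven_zf|exact: geven_scalar]. Qed.
Lemma geven_x0 u x y i : geven (x0 u x y i).
Proof. by apply: gevenD; apply: gevenZ; [exact: geven_scalar|exact: geven_zf]. Qed.
Lemma geven_xv u x y i : geven (xv u x y i).
Proof. by rewrite /xv; case: ifP => _; [exact: geven_scalar|exact: geven_x0]. Qed.
Lemma geven_qs u x y : geven (qs u x y).
Proof.
apply: gevenD.
  by apply/gevenZ/geven_sum => i _; apply: geven_sum => j _; apply/gevenZ/gevenM; exact: geven_xv.
by apply: gevenD; [exact: geven_scalar|exact: geven_gquad].
Qed.
Lemma geven_thzi u x y i : geven (th u x y i * zi a x y i).
Proof. by apply: gevenM; [exact: geven_th|exact: geven_zi]. Qed.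

Lemma U_neq i : i \in U -> i != a.
Proof. by rewrite mem_enum !inE. Qed.
Lemma U_uniq : uniq U. Proof. exact: enum_uniq. Qed.
Lemma sum_U (F : V -> gr) : F a = 0 -> \sum_i F i = \sum_(i <- U) F i.
Proof.
move=> Fa; by rewrite (bigD1 a)//= Fa add0r [RHS]big_enum/=; apply: eq_bigl => i; rewrite !inE.
Qed.

Lemma pr_D1 u x y i : i \in U ->
  pr u x y = (th u x y i * zi a x y i) * pri i u x y.
Proof.
move=> iU; exact: (@prod_even_D1 R _ V U (fun j => th u x y j * zi a x y j) i U_uniq iU
  (fun j => geven_thzi u x y j)).
Qed.

Lemma gder_js_u u x y :
  gder (fun u => js u x y) u (\sum_(i <- U) dj i u x y).
Proof.
have hc := is_derive_cosh u; have hs := is_derive_sinh u.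
have dth i : gder (fun u => th u x y i) u (x0 u x y i).
  have := gderD (gder_scale hc (gder_cst (zf a x y i) u)) (gder_scale hs (gder_cst (x i)%:A u)).
  by rewrite !scaler0 !addr0 addrC.
have dx0 i : gder (fun u => x0 u x y i) u (th u x y i).
  have := gderD (gder_scale hc (gder_cst (x i)%:A u)) (gder_scale hs (gder_cst (zf a x y i) u)).
  by rewrite !scaler0 !addr0 addrC.
have dxv i : gder (fun u => xv u x y i) u (if i == a then 0 else th u x y i).
  by rewrite /xv; case: (i == a) => //; exact: gder_cst.
have dpr : gder (fun u => pr u x y) u (\sum_(i <- U) (x0 u x y i * zi a x y i) * pri i u x y).
  apply: (@gder_prod _ _ _ U (fun i u => th u x y i * zi a x y i)).
  - exact: U_uniq.
  - by move=> i; have := gderM (dth i) (gder_cst (zi a x y i) u); rewrite mulr0 addr0.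
  - by move=> i r; exact: geven_thzi.
have dqs : gder (fun u => qs u x y) u (- \sum_(i <- U) th u x y i * ax u x y i).
  have := gderD (gder_quad Amat_sym dxv (fun i r => geven_xv r x y i))
    (gder_cst ((- 2^-1 * quadf A y)%:A + gquad (restr a A)) u).
  rewrite addr0 (_ : \sum_i _ = \sum_(i <- U) th u x y i * ax u x y i)//.
  rewrite sum_U ?eqxx ?mul0r//.
  by rewrite big_seq [RHS]big_seq; apply: eq_bigr => i /U_neq/negPf ->.
have := gderM dpr (gder_gexp (fun r => geven_qs r x y) dqs).
rewrite (_ : _ * _ + _ = \sum_(i <- U) dj i u x y)//.
rewrite mulr_suml mulNr mulrN mulr_suml mulr_sumr -sumrN -big_split/= big_seq [RHS]big_seq.
apply: eq_bigr => i iU; rewrite /dj (geven_comm _ (geven_zi a x y i)) mulNr mulrN; congr (_ - _).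
rewrite (pr_D1 u x y iU) -!mulrA; congr (_ * _).
by rewrite mulrA (geven_comm _ (geven_zi a x y i)) -mulrA.
Qed.

Lemma is_derive_rr x y i (r : R) :
  is_derive r (1 : R) (fun r => rr (dfwith x i r) y i) (r / rr (dfwith x i r) y i).
Proof.
have p : 0 < 1 + r ^+ 2 + y i ^+ 2 by rewrite -addrA ltr_wpDr ?addr_ge0 ?sqr_ge0.
rewrite (_ : (fun r => _) = Num.sqrt \o (fun r => 1 + r ^+ 2 + y i ^+ 2)); last first.
  by apply/funext => q; rewrite /rr dfwithin.
have h1 : is_derive r (1 : R) (fun r : R => 1 + r ^+ 2 + y i ^+ 2) (2 * r).
  by apply: is_derive_eq; rewrite /GRing.scale/= ?expr1; ring.
have h2 := is_derive1_sqrt p.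
apply: is_derive_eq (@is_derive1_comp R Num.sqrt (fun r : R => 1 + r ^+ 2 + y i ^+ 2) r _ _ h2 h1) _.
rewrite /rr dfwithin; have : Num.sqrt (1 + r ^+ 2 + y i ^+ 2) != 0 by rewrite gt_eqF// sqrtr_gt0.
by move: (Num.sqrt _) => q q0; rewrite /GRing.scale/=; field.
Qed.

Lemma gder_zf_x x y i r :
  gder (fun r => zf a (dfwith x i r) y i) r (r *: zi a (dfwith x i r) y i).
Proof.
have d1 := is_derive_rr x y i r.
have r0 := rr_neq0 (dfwith x i r) y i.
have d2 := @is_deriveV R _ r _ 1 r0 d1.
have := gderD (gder_scale d1 (gder_cst 1 r)) (gder_scale d2 (gder_cst (nn R a i) r)).
rewrite !scaler0 !addr0.
rewrite (_ : _ + _ = r *: zi a (dfwith x i r) y i)//.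
rewrite /zi scalerBr !scalerA -scaleNr; congr (_ + _ *: _).
by move: (rr _ _ _) r0 => q q0; rewrite /GRing.scale/=; field.
Qed.

Lemma gdiff_zi_x x y i r : gdiff (fun r => zi a (dfwith x i r) y i) r.
Proof.
have d1 := is_derive_rr x y i r.
have r0 := rr_neq0 (dfwith x i r) y i.
have d2 := @is_deriveV R _ r _ 1 r0 d1.
have d3 : is_derive r (1 : R) (fun r => rr (dfwith x i r) y i ^+ 3) (3 * rr (dfwith x i r) y i ^+ 2 * (r / rr (dfwith x i r) y i)).
  by apply: is_derive_eq; rewrite /GRing.scale/=; ring.
have r3 : rr (dfwith x i r) y i ^+ 3 != 0 by rewrite expf_neq0.
have d4 := @is_deriveV R _ r _ 1 r3 d3.
apply: gdiffD; first by eexists; exact: gder_scale d2 (gder_cst 1 r).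
by apply: gdiffN; eexists; exact: gder_scale d4 (gder_cst (nn R a i) r).
Qed.

Lemma zf_dfwith x y i j r : i != j -> zf a (dfwith x i r) y j = zf a x y j.
Proof. by move=> ij; rewrite /zf /rr dfwithout. Qed.
Lemma zi_dfwith x y i j r : i != j -> zi a (dfwith x i r) y j = zi a x y j.
Proof. by move=> ij; rewrite /zi /rr dfwithout. Qed.
Lemma th_dfwith u x y i j r : i != j -> th u (dfwith x i r) y j = th u x y j.
Proof. by move=> ij; rewrite /th zf_dfwith// dfwithout. Qed.
Lemma x0_dfwith u x y i j r : i != j -> x0 u (dfwith x i r) y j = x0 u x y j.
Proof. by move=> ij; rewrite /x0 zf_dfwith// dfwithout. Qed.
Lemma pri_dfwith u x y i r : pri i u (dfwith x i r) y = pri i u x y.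
Proof.
by apply: eq_bigr => j ji; rewrite th_dfwith ?zi_dfwith// eq_sym.
Qed.

Lemma gder_xi x i j (r : R) :
  gder (fun r => (dfwith x i r j)%:A : gr) r ((i == j)%:R%:A).
Proof.
have [<-|ij] := eqVneq i j.
  apply: gder_scalar; rewrite (_ : (fun r => _) = id); first exact: is_derive_id.
  by apply/funext => q; rewrite dfwithin.
rewrite scale0r; apply: gder_ext (gder_cst (x j)%:A r) => q.
by rewrite dfwithout.
Qed.

Lemma zi_zf x y i : zi a x y i * zf a x y i = 1.
Proof. by rewrite (geven_comm _ (geven_zi a x y i)) zf_zi. Qed.

(* z_i times d/dx_i is the boost generator of vertex i. *)
Lemma gder_th_x u x y i r : gder (fun r => th u (dfwith x i r) y i) r
  (zi a (dfwith x i r) y i * x0 u (dfwith x i r) y i).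
Proof.
have h1 := gder_scale (is_derive_cst (cosh u) r 1) (gder_zf_x x y i r).
have h2 := gder_scale (is_derive_cst (sinh u) r 1) (gder_xi x i i r).
have := gderD h1 h2; rewrite !scale0r !add0r eqxx.
rewrite (_ : _ + _ = zi a (dfwith x i r) y i * x0 u (dfwith x i r) y i)//.
rewrite /x0 mulrDr -!scalerAr zi_zf mulr1 dfwithin.
by rewrite scale1r.
Qed.
Lemma gder_x0_x u x y i r : gder (fun r => x0 u (dfwith x i r) y i) r
  (zi a (dfwith x i r) y i * th u (dfwith x i r) y i).
Proof.
have h1 := gder_scale (is_derive_cst (sinh u) r 1) (gder_zf_x x y i r).
have h2 := gder_scale (is_derive_cst (cosh u) r 1) (gder_xi x i i r).
have := gderD h2 h1; rewrite !scale0r !add0r eqxx.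
rewrite (_ : _ + _ = zi a (dfwith x i r) y i * th u (dfwith x i r) y i)//.
rewrite /th mulrDr -!scalerAr zi_zf mulr1 dfwithin.
by rewrite ?scale1r.
Qed.

Lemma gder_xv_x u x y i j r : i \in U -> gder (fun r => xv u (dfwith x i r) y j) r
  ((i == j)%:R *: (zi a (dfwith x i r) y i * th u (dfwith x i r) y i)).
Proof.
move=> /U_neq ia; rewrite /xv; have [ja|ja] := eqVneq j a.
  by rewrite ja (negPf ia) scale0r; exact: gder_cst.
have [<-|ij] := eqVneq i j; first by rewrite scale1r; exact: gder_x0_x.
rewrite scale0r; apply: gder_ext (gder_cst (x0 u x y j) r) => q.
by rewrite x0_dfwith.
Qed.

Lemma gder_qs_x u x y i r : i \in U -> gder (fun r => qs u (dfwith x i r) y) r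
  (- (zi a (dfwith x i r) y i * th u (dfwith x i r) y i * ax u (dfwith x i r) y i)).
Proof.
move=> iU.
have := gderD (gder_quad Amat_sym (fun j => gder_xv_x u x y j r iU) (fun j q => geven_xv u (dfwith x i q) y j))
    (gder_cst ((- 2^-1 * quadf A y)%:A + gquad (restr a A)) r).
rewrite addr0 (bigD1 i)//= [X in - (_ + X)]big1 ?addr0; last first.
  by move=> j ji; rewrite eq_sym (negPf ji) scale0r mul0r.
by rewrite eqxx scale1r.
Qed.

Lemma gder_js_x u x y i r : i \in U ->
  gder (fun r => zf a (dfwith x i r) y i * js u (dfwith x i r) y) r (dj i u (dfwith x i r) y).
Proof.
move=> iU; have dE := gder_gexp (fun q => geven_qs u (dfwith x i q) y) (gder_qs_x u x y r iU).
have dP := gderM (gder_th_x u x y i r) (gder_cst (pri i u x y) r).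
have E q : zf a (dfwith x i q) y i * js u (dfwith x i q) y =
    th u (dfwith x i q) y i * pri i u x y * gexp (qs u (dfwith x i q) y).
  rewrite -(pri_dfwith u x y i q); move: (dfwith x i q) => x'.
  rewrite /js (pr_D1 u x' y iU) mulrA; congr (_ * _).
  rewrite mulrA; congr (_ * _).
  by rewrite (geven_comm (zi a x' y i) (geven_th u x' y i)) mulrA zf_zi mul1r.
rewrite (funext E) /dj pri_dfwith.
by have := gderM dP dE; rewrite mulr0 addr0.
Qed.

Lemma gdiff_dj_x u x y i r : i \in U -> gdiff (fun r => dj i u (dfwith x i r) y) r.
Proof.
move=> iU.
have hz := gdiff_zi_x x y i r.
have hth : gdiff (fun r => th u (dfwith x i r) y i) r by eexists; exact: gder_th_x.
have hx0 : gdiff (fun r => x0 u (dfwith x i r) y i) r by eexists; exact: gder_x0_x.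
have hp : gdiff (fun r => pri i u (dfwith x i r) y) r.
  by under eq_fun do rewrite pri_dfwith; exact: gdiff_cst.
have hE : gdiff (fun r => gexp (qs u (dfwith x i r) y)) r.
  by apply: gdiff_gexp; [move=> q; exact: geven_qs|eexists; exact: gder_qs_x].
have hax : gdiff (fun r => ax u (dfwith x i r) y i) r.
  by apply: gdiff_sum => j _; apply: gdiffZ; eexists; exact: gder_xv_x.
apply: gdiffD; apply: gdiffM => //.
  by do 2 apply: gdiffM => //.
  by apply: gdiffM.
by apply: gdiffM => //; apply: gdiffN; apply: gdiffM => //; exact: gdiffM.
Qed.
End Evaluation.

(** * Invariance of the Gaussian expectation under hyperbolic rotations *)
Section EvalBound.
Context (R : realType) (V : finType) (a : V) (e : rel V) (W : V -> V -> R).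
Hypothesis hG : weighted_graph e W.
Variables (k : V -> R) (sg : R).
Hypothesis hk : forall i, \sum_j W i j < k i.
Local Notation gr := (grassmann R (V + V)%type).
Local Notation mR := (measurableTypeR R).
Local Notation U := (unpinned a).
Local Notation A := (Amat W k).
Implicit Types (x y : V -> R) (i j : V) (u : R).
Local Notation js := (js a W k sg).
Local Notation dj := (dj a W k sg).
Local Notation qs := (qs a W k sg).
Local Notation xv := (xv a sg).

Section Bounded.
Variable s1 : R.
Definition uxy : Type := R * ((V -> R) * (V -> R)).
Definition ubound (t : uxy) := `|t.1| <= s1.
Definition rhot (t : uxy) : R := rhoU a t.2.
Local Notation pb := (pbd ubound rhot).
Local Notation gp := (gpbd ubound rhot).
Let r1 t : ubound t -> 1 <= rhot t. Proof. by move=> _; exact: rhoU_ge1. Qed.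

Lemma rr_le_rhoU_ne x y i : i != a -> rr x y i <= rhoU a (x, y).
Proof.
move=> ia; apply: (@le_trans _ _ (rr x y i ^+ 2)).
  by rewrite expr2 ler_peMl ?rr_ge1// (le_trans ler01)// rr_ge1.
rewrite rr_sq /rhoU (bigD1_seq i)/= ?enum_uniq ?mem_enum//.
rewrite ler_peMr//; first by rewrite ltW// rr_arg.
rewrite big_mkcond/=; elim: U => [|j s IHs]; first by rewrite big_nil.
rewrite big_cons; case: ifP => _; last by rewrite mul1r.
by rewrite mulr_ege1// -addrA lerDl addr_ge0 ?sqr_ge0.
Qed.

Lemma tpb_rr i : i != a -> pb (fun t => rr t.2.1 t.2.2 i).
Proof.
move=> ia; apply: pbd_le (pbd_rho r1) => -[u [x y]] _ /=.
rewrite [leRHS]ger0_norm ?(le_trans ler01 (rhoU_ge1 _ _))//.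
by rewrite ger0_norm ?(ltW (rr_gt0 _ _ _))//; exact: rr_le_rhoU_ne.
Qed.
Lemma tpb_rrV i n : pb (fun t => (rr t.2.1 t.2.2 i) ^- n).
Proof.
apply: pbd_le (pbd_cst _ _ 1) => -[u [x y]] _ /=.
rewrite normr1 ger0_norm ?invr_ge0 ?exprn_ge0 ?(ltW (rr_gt0 _ _ _))//.
by rewrite invf_le1 ?exprn_gt0 ?rr_gt0// exprn_ege1// rr_ge1.
Qed.
Lemma tpb_x i : i != a -> pb (fun t => t.2.1 i).
Proof.
move=> ia; apply: pbd_le (tpb_rr ia) => -[u [x y]] _ /=; rewrite [leRHS]ger0_norm ?(ltW (rr_gt0 _ _ _))//.
rewrite -ler_sqr ?nnegrE ?(ltW (rr_gt0 _ _ _))// real_normK ?num_real// rr_sq.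
by rewrite addrAC lerDr addr_ge0// sqr_ge0.
Qed.
Lemma tpb_cosh : pb (fun t => cosh t.1).
Proof.
apply: pbd_le (pbd_cst _ _ (expR s1)) => t ht.
by rewrite [leRHS]ger0_norm ?expR_ge0//; exact: cosh_bound.
Qed.
Lemma tpb_sinh : pb (fun t => sinh t.1).
Proof.
apply: pbd_le (pbd_cst _ _ (expR s1)) => t ht.
by rewrite [leRHS]ger0_norm ?expR_ge0//; exact: sinh_bound.
Qed.
Lemma tgp_zf i : i != a -> gp (fun t => zf a t.2.1 t.2.2 i).
Proof.
move=> ia; apply: (gpbdD r1); first exact/gpbd_scalar/tpb_rr.
by apply: gpbdZ (gpbd_cst _ _ _); apply: pbd_le (tpb_rrV i 1) => p _; rewrite expr1.
Qed.
Lemma tgp_zi i : gp (fun t => zi a t.2.1 t.2.2 i).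
Proof.
apply: (gpbdD r1).
  apply: gpbd_scalar; apply: pbd_le (tpb_rrV i 1) => p _; by rewrite expr1.
by apply: gpbdN; apply: gpbdZ (gpbd_cst _ _ _); exact: tpb_rrV.
Qed.
Lemma tgp_th i : i != a -> gp (fun t => th a t.1 t.2.1 t.2.2 i).
Proof.
move=> ia; apply: (gpbdD r1); apply: gpbdZ; first exact: tpb_cosh.
- exact: tgp_zf.
- exact: tpb_sinh.
- exact/gpbd_scalar/tpb_x.
Qed.
Lemma tgp_x0 i : i != a -> gp (fun t => x0 a t.1 t.2.1 t.2.2 i).
Proof.
move=> ia; apply: (gpbdD r1); apply: gpbdZ; first exact: tpb_cosh.
- exact/gpbd_scalar/tpb_x.
- exact: tpb_sinh.
- exact: tgp_zf.
Qed.
Lemma tgp_xv i : gp (fun t => xv t.1 t.2.1 t.2.2 i).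
Proof.
rewrite /xv; case: (eqVneq i a) => [_|ia]; first exact: gpbd_cst.
exact: tgp_x0.
Qed.
Lemma tgp_thzi i : i != a -> gp (fun t => th a t.1 t.2.1 t.2.2 i * zi a t.2.1 t.2.2 i).
Proof. by move=> ia; apply: gpbdM; [exact: tgp_th|exact: tgp_zi]. Qed.
Lemma tgp_pri i : gp (fun t => pri a i t.1 t.2.1 t.2.2).
Proof.
rewrite (_ : (fun t => _) = (fun t : uxy => \prod_(j <- U | (j \in U) && (j != i))
  (th a t.1 t.2.1 t.2.2 j * zi a t.2.1 t.2.2 j))); last first.
  by apply/funext => t; rewrite /pri big_seq_cond.
by apply: gpbd_prod => j /andP[jU _]; apply: tgp_thzi; exact: U_neq.
Qed.
Lemma tgp_pr : gp (fun t => pr a t.1 t.2.1 t.2.2).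
Proof.
rewrite (_ : (fun t => _) = (fun t : uxy => \prod_(j <- U | j \in U)
  (th a t.1 t.2.1 t.2.2 j * zi a t.2.1 t.2.2 j))); last first.
  by apply/funext => t; rewrite /pr big_seq.
by apply: gpbd_prod => j jU; apply: tgp_thzi; exact: U_neq.
Qed.
Lemma tgp_ax i : gp (fun t => ax a W k sg t.1 t.2.1 t.2.2 i).
Proof.
by apply: (gpbd_sum r1) => j _; apply: gpbdZ; [exact: pbd_cst|exact: tgp_xv].
Qed.

Definition xb u x y i : R := if i == a then sg else cosh u * x i + sinh u * rr x y i.

Lemma body_qs u x y : body (qs u x y) = - 2^-1 * quadf A (xb u x y) - 2^-1 * quadf A y.
Proof.
rewrite bodyD bodyZ bodyD body_scalar body_gquad addr0 mulNr -[in RHS]mulNr; congr (_ + _).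
rewrite mulNr; congr (- (_ * _)); rewrite body_sum; apply: eq_bigr => i _.
rewrite body_sum; apply: eq_bigr => j _; rewrite bodyZ bodyM -mulrA; congr (_ * (_ * _)).
  by rewrite /xv /xb; case: ifP => _; rewrite ?body_scalar// bodyD !bodyZ body1 mulr1 body_zf.
by rewrite /xv /xb; case: ifP => _; rewrite ?body_scalar// bodyD !bodyZ body1 mulr1 body_zf.
Qed.

Lemma rr_boost u x y i : `|u| <= s1 ->
  rr x y i ^+ 2 <= 4 * expR s1 ^+ 2 * (1 + (cosh u * x i + sinh u * rr x y i) ^+ 2 + y i ^+ 2).
Proof.
move=> us; have hc := cosh_bound us; have hs := sinh_bound us.
have r2 := rr_sq x y i; have cs := cosh2_sinh2 u.
move: (rr x y i) (x i) (y i) (cosh u) (sinh u) hc hs r2 cs => r p q c s hc hs r2 cs.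
set T := c * r + s * p; set X := c * p + s * r.
have hT : T ^+ 2 = 1 + X ^+ 2 + q ^+ 2.
  have -> : T ^+ 2 = X ^+ 2 + (r ^+ 2 - p ^+ 2) * (c ^+ 2 - s ^+ 2) by rewrite /T /X; ring.
  by rewrite cs mulr1 r2; ring.
have hr : r = c * T - s * X.
  have -> : c * T - s * X = r * (c ^+ 2 - s ^+ 2) by rewrite /T /X; ring.
  by rewrite cs mulr1.
have c2 : c ^+ 2 <= expR s1 ^+ 2.
  by rewrite -[c ^+ 2]real_normK ?num_real// lerXn2r ?nnegrE ?expR_ge0.
have s2 : s ^+ 2 <= expR s1 ^+ 2.
  by rewrite -[s ^+ 2]real_normK ?num_real// lerXn2r ?nnegrE ?expR_ge0.
apply: (@le_trans _ _ (2 * (c ^+ 2 * T ^+ 2) + 2 * (s ^+ 2 * X ^+ 2))).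
  rewrite hr -subr_ge0.
  rewrite (_ : _ - _ = (c * T + s * X) ^+ 2) ?sqr_ge0//; ring.
have X2 := sqr_ge0 X; have q2 := sqr_ge0 q; have T2 := sqr_ge0 T.
have h1 : c ^+ 2 * T ^+ 2 <= expR s1 ^+ 2 * T ^+ 2 by rewrite ler_wpM2r.
have h2 : s ^+ 2 * X ^+ 2 <= expR s1 ^+ 2 * T ^+ 2.
  by rewrite ler_pM ?sqr_ge0// hT; move: (X ^+ 2) (q ^+ 2) X2 q2 => ? ?; lra.
rewrite -hT; move: h1 h2; set P := expR s1 ^+ 2 * T ^+ 2.
rewrite -(mulrA 4) -/P; move: (c ^+ 2 * _) (s ^+ 2 * _) P => ? ? ?; lra.
Qed.

Lemma expR_qs_decay (M : nat) : exists K : R, 0 <= K /\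
  forall u x y, `|u| <= s1 -> expR (body (qs u x y)) * rhoU a (x, y) ^+ M <= K.
Proof.
have [lam [lam0 hlam]] := quadf_Amat_ge hG hk.
pose L := 4 * expR s1 ^+ 2; have L0 : 0 < L by rewrite mulr_gt0// exprn_gt0// expR_gt0.
pose w := lam / (2 * L); have w0 : 0 < w by rewrite divr_gt0// mulr_gt0.
have [K [K0 hK]] := expR_beats (size U * M) w0.
pose m : R := (size U)%:R.
exists (expR (2^-1 * lam * m) * K); split; first by rewrite mulr_ge0 ?expR_ge0.
move=> u x y us.
pose S := \sum_(i <- U) rr x y i ^+ 2.
have S0 : 0 <= S by rewrite sumr_ge0// => i _; exact: sqr_ge0.
have hS : S <= L * (m + (\sum_i xb u x y i ^+ 2 + \sum_i y i ^+ 2)).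
  have sub (F : V -> R) : (forall i, 0 <= F i) -> \sum_(i <- U) F i <= \sum_i F i.
    move=> F0; rewrite big_enum/= [leRHS](bigID (fun i => i \in predC1 a))/= lerDl.
    by rewrite sumr_ge0.
  apply: (@le_trans _ _ (L * \sum_(i <- U) (1 + xb u x y i ^+ 2 + y i ^+ 2))).
    rewrite mulr_sumr /S big_seq [leRHS]big_seq; apply: ler_sum => i /U_neq/negPf ia.
    by rewrite /xb ia; exact: rr_boost.
  rewrite ler_pM2l// !big_split/= -addrA lerD//.
    by rewrite big_const_seq count_predT iter_addr addr0.
  by rewrite lerD// sub// => i; exact: sqr_ge0.
pose E := w * S; have E0 : 0 <= E by rewrite mulr_ge0// ltW.
have hE : body (qs u x y) <= 2^-1 * lam * m - E.
  rewrite body_qs; have h1 := hlam (xb u x y); have h2 := hlam y.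
  move: hS h1 h2; set SX := \sum_i xb _ _ _ i ^+ 2; set SY := \sum_i y i ^+ 2.
  move=> hS h1 h2; have : w * S <= 2^-1 * lam * (m + (SX + SY)).
    apply: (@le_trans _ _ (w * (L * (m + (SX + SY))))); first by rewrite ler_pM2l.
    rewrite mulrA (_ : w * L = 2^-1 * lam)//.
    by rewrite /w; field; rewrite gt_eqF.
  rewrite /E; move: (w * S) h1 h2 => z; rewrite mulrDr mulrDr.
  move: (quadf _ _) (quadf _ _) => p q; rewrite -!mulrA; move: (lam * SX) (lam * SY) (lam * m) => b c d.
  lra.
have hrho : rhoU a (x, y) <= (1 + E / w) ^+ size U.
  rewrite /E mulrC mulKf ?gt_eqF// /rhoU.
  have h (s : seq V) : uniq s -> {subset s <= U} ->
      \prod_(i <- s) (1 + x i ^+ 2 + y i ^+ 2) <= (1 + S) ^+ size s.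
    elim: s => [|i s IHs] /=; first by rewrite big_nil.
    move=> /andP[iNs us'] sU; rewrite big_cons [leRHS]exprS ler_pM//.
    - by rewrite ltW// rr_arg.
    - by rewrite prodr_ge0// => j _; rewrite ltW// rr_arg.
    - rewrite -rr_sq /S (bigD1_seq i)/= ?U_uniq ?sU ?inE ?eqxx//.
      by rewrite addrCA lerDl addr_ge0// sumr_ge0// => j _; exact: sqr_ge0.
    - by apply: IHs => // j js'; apply: sU; rewrite inE js' orbT.
  by apply: h => //; exact: U_uniq.
have rho0 : 0 <= rhoU a (x, y) by exact: le_trans ler01 (rhoU_ge1 _ _).
apply: (@le_trans _ _ (expR (2^-1 * lam * m - E) * ((1 + E / w) ^+ (size U * M)))).
  rewrite ler_pM ?expR_ge0 ?exprn_ge0 ?ler_expR//.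
  by rewrite exprM lerXn2r ?nnegrE// exprn_ge0// addr_ge0// divr_ge0// ltW.
rewrite expRD -mulrA ler_wpM2l ?expR_ge0// mulrC; exact: hK.
Qed.

(* y is frozen at the pinned vertex *)
Lemma js_dom (P : uxy -> gr) : gp P -> exists K : R, 0 <= K /\
  forall u x y, `|u| <= s1 -> y a = 0 ->
    gnorm (P (u, (x, y)) * gexp (qs u x y)) <= K * (cauchyd U x * cauchyd U y).
Proof.
move=> hP.
pose D0 (t : uxy) := `|t.1| <= s1 /\ t.2.2 a = 0.
have r1' t : D0 t -> 1 <= rhot t by move=> _; exact: rhoU_ge1.
have hy i : pbd D0 rhot (fun t => t.2.2 i).
  apply: pbd_le (pbd_rho r1') => -[u [x y]] [_ ya] /=.
  rewrite [leRHS]ger0_norm ?(le_trans ler01 (rhoU_ge1 _ _))//.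
  have [->|ia] := eqVneq i a; first by rewrite /= in ya; rewrite ya normr0 (le_trans ler01 (rhoU_ge1 _ _)).
  rewrite (le_trans _ (rr_le_rhoU_ne x y ia))//.
  rewrite -ler_sqr ?nnegrE ?(ltW (rr_gt0 _ _ _))// real_normK ?num_real// rr_sq.
  by rewrite lerDr addr_ge0// sqr_ge0.
have sub F : pb F -> pbd D0 rhot F.
  by move=> [K [N [K0 h]]]; exists K, N; split => // t [ht _]; exact: h.
have gq : gpbd D0 rhot (fun t => qs t.1 t.2.1 t.2.2).
  apply: (gpbdD r1').
    apply: gpbdZ; first exact: pbd_cst.
    apply: (gpbd_sum r1') => i _; apply: (gpbd_sum r1') => j _.
    by apply: gpbdZ; [exact: pbd_cst|apply: gpbdM; apply: sub; exact: tgp_xv].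
  apply: (gpbdD r1'); last exact: gpbd_cst.
  apply: gpbd_scalar; apply: pbdM; first exact: pbd_cst.
  apply: (pbd_sum r1') => i _; apply: (pbd_sum r1') => j _.
  by do 2 (apply: pbdM; last exact: hy); exact: pbd_cst.
have [F [[K1 [N1 [K10 hF]]] hg]] := gpbd_gexp r1' gq.
have [K2 [N2 [K20 hP2]]] := hP.
have [K [K0 hK]] := expR_qs_decay (N1 + N2 + 2).
exists (K1 * K2 * K); split; first by rewrite !mulr_ge0.
move=> u x y us ya; have Dt : D0 (u, (x, y)) by [].
set r := rhoU a (x, y).
have rp : 0 < r by exact: lt_le_trans ltr01 (rhoU_ge1 _ _).
have h1 := hP2 (u, (x, y)) us; rewrite ger0_norm ?gnorm_ge0// /rhot/= -/r in h1.
have h2 := hg _ Dt; have h3 := hF _ Dt; rewrite /rhot/= -/r in h3.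
apply: (@le_trans _ _ (K1 * K2 * K * r ^- 2)); last first.
  by rewrite ler_wpM2l ?mulr_ge0// rhoU_cauchyd.
rewrite (le_trans (gnormM _ _))//.
apply: (@le_trans _ _ ((K2 * r ^+ N2) * (expR (body (qs u x y)) * (K1 * r ^+ N1)))).
  rewrite ler_pM ?gnorm_ge0// (le_trans h2)//= ler_wpM2l ?expR_ge0//.
rewrite ler_pdivlMr ?exprn_gt0//.
rewrite [leLHS](_ : _ = K1 * K2 * (expR (body (qs u x y)) * r ^+ (N1 + N2 + 2))).
  by rewrite ler_wpM2l ?mulr_ge0// hK.
by rewrite !exprD; ring.
Qed.

Lemma js_bounds : exists K : R, 0 <= K /\ forall u x y i, `|u| <= s1 -> y a = 0 -> i \in U ->
  [/\ gnorm (js u x y) <= K * (cauchyd U x * cauchyd U y),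
      gnorm (zf a x y i * js u x y) <= K * (cauchyd U x * cauchyd U y) &
      gnorm (dj i u x y) <= K * (cauchyd U x * cauchyd U y)].
Proof.
have [K1 [K10 h1]] := js_dom tgp_pr.
have h2 i : exists K : R, 0 <= K /\ forall u x y, `|u| <= s1 -> y a = 0 -> i \in U ->
   gnorm (zf a x y i * js u x y) <= K * (cauchyd U x * cauchyd U y) /\
   gnorm (dj i u x y) <= K * (cauchyd U x * cauchyd U y).
  have [iU|iU] := boolP (i \in U); last by exists 0.
  have ia := U_neq iU.
  have [L1 [L10 hL1]] := js_dom (gpbdM (tgp_zf ia) tgp_pr).
  have g1 : gp (fun t => zi a t.2.1 t.2.2 i * x0 a t.1 t.2.1 t.2.2 i * pri a i t.1 t.2.1 t.2.2 +
     th a t.1 t.2.1 t.2.2 i * pri a i t.1 t.2.1 t.2.2 *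
     (- (zi a t.2.1 t.2.2 i * th a t.1 t.2.1 t.2.2 i * ax a W k sg t.1 t.2.1 t.2.2 i))).
    apply: (gpbdD r1).
      apply: gpbdM; last exact: tgp_pri.
      by apply: gpbdM; [exact: tgp_zi|exact: tgp_x0].
    apply: gpbdM; first by apply: gpbdM; [exact: tgp_th|exact: tgp_pri].
    apply: gpbdN; apply: gpbdM; last exact: tgp_ax.
    by apply: gpbdM; [exact: tgp_zi|exact: tgp_th].
  have [L2 [L20 hL2]] := js_dom g1.
  exists (L1 + L2); split; first exact: addr_ge0.
  move=> u x y us ya _; split.
    rewrite /js mulrA (le_trans (hL1 u x y us ya))//.
    by rewrite ler_wpM2r ?lerDl// mulr_ge0 ?cauchyd_ge0.
  rewrite /dj (mulrA (th _ _ _ _ _ * _)) -mulrDl (le_trans (hL2 u x y us ya))//.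
  by rewrite ler_wpM2r ?lerDr// mulr_ge0 ?cauchyd_ge0.
have /choice[L hL] := h2.
exists (K1 + \sum_i L i); split.
  by rewrite addr_ge0// sumr_ge0// => i _; have [] := hL i.
move=> u x y i us ya iU; have c0 : 0 <= cauchyd U x * cauchyd U y by rewrite mulr_ge0 ?cauchyd_ge0.
have [_ /(_ u x y us ya iU)[b1 b2]] := hL i.
have Ls : L i <= K1 + \sum_i L i.
  rewrite (bigD1 i)//= addrCA lerDl addr_ge0// sumr_ge0// => j _.
  by have [] := hL j.
split.
- rewrite (le_trans (h1 u x y us ya))// ler_wpM2r// lerDl sumr_ge0// => j _.
  by have [] := hL j.
- by rewrite (le_trans b1)// ler_wpM2r.
- by rewrite (le_trans b2)// ler_wpM2r.
Qed.
End Bounded.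
End EvalBound.

Section UnderIntegral.
Context (R : realType) d (Y : measurableType d) (mu : {measure set Y -> \bar R}).

Lemma is_derive_integral (f f' : R -> Y -> R) (G : Y -> R) (a : R) :
  (forall x, `|x - a| < 1 -> mu.-integrable setT (EFin \o f x)) ->
  (forall x y, is_derive x (1 : R) (f ^~ y) (f' x y)) ->
  (forall y, 0 <= G y) -> mu.-integrable setT (EFin \o G) ->
  (forall x y, `|x - a| < 1 -> `|f' x y| <= G y) ->
  is_derive a (1 : R) (fun x => \int[mu]_(y in setT) f x y) (\int[mu]_(y in setT) f' a y).
Proof.
move=> intf df G0 intG fG.
have Ia : `]a - 1, a + 1[%classic a by rewrite /= in_itv/= ltrBlDr !ltrDl ltr01.
have I1 x : `]a - 1, a + 1[%classic x -> `|x - a| < 1.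
  by rewrite /= in_itv/= => /andP[h1 h2]; rewrite ltr_distl h1 h2.
have dE x y : partial1of2 f x y = f' x y.
  by rewrite partial1of2E; have [_ ->] := df x y.
have h1 x : `]a - 1, a + 1[%classic x -> mu.-integrable setT (EFin \o f x) by move/I1; exact: intf.
have h2 x y : `]a - 1, a + 1[%classic x -> setT y -> derivable (f ^~ y) x 1.
  by move=> _ _; have [] := df x y.
have h3 x y : `]a - 1, a + 1[%classic x -> setT y -> `|partial1of2 f x y| <= G y.
  by move=> /I1 hx _; rewrite dE fG.
apply: DeriveDef.
  exact: (@derivable_under_integral R _ Y mu f setT measurableT a _ _ Ia h1 h2 G G0 intG h3).
rewrite -derive1E (@differentiation_under_integral R _ Y mu f setT measurableT a _ _ Ia h1 h2 G G0 intG h3).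
by apply: eq_Rintegral => y _; exact: dE.
Qed.
End UnderIntegral.

Lemma size_pivots (R : realType) (V : finType) (s : seq V) (A : V -> V -> R) :
  size (pivots s A) = size s.
Proof. by elim: s => //= i s ->. Qed.

Section EvalIntegral.
Context (R : realType) (V : finType) (a : V) (e : rel V) (W : V -> V -> R).
Hypothesis hG : weighted_graph e W.
Variables (k : V -> R) (sg : R).
Hypothesis hk : forall i, \sum_j W i j < k i.
Local Notation gr := (grassmann R (V + V)%type).
Local Notation mR := (measurableTypeR R).
Local Notation U := (unpinned a).
Local Notation A := (Amat W k).
Implicit Types (x y : V -> R) (i j : V) (u : R).
Local Notation js := (js a W k sg).
Local Notation dj := (dj a W k sg).
Local Notation qs := (qs a W k sg).
Local Notation xv := (xv a sg).
Local Notation T2 := ((size U).-tuple mR * (size U).-tuple mR)%type.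
Local Notation leb2 := (@leb2 R V a).

Section Meas.
Context d (T : measurableType d) (x y : T -> V -> R).
Hypotheses (mx : forall i, measurable_fun setT (fun w => x w i))
           (my : forall i, measurable_fun setT (fun w => y w i)).
Variable u : R.
Lemma gmeas_sc (f : T -> R) : measurable_fun setT f -> gmeas (fun w => (f w)%:A : gr).
Proof. by move=> mf; apply: gmeasZ => //; exact: gmeas_cst. Qed.
Lemma gmeas_th i : gmeas (fun w => th a u (x w) (y w) i).
Proof.
apply: gmeasD; first by apply: gmeasZ; [exact: measurable_cst|exact: gmeas_zf].
by apply: gmeasZ; [exact: measurable_cst|exact: gmeas_sc].
Qed.
Lemma gmeas_x0 i : gmeas (fun w => x0 a u (x w) (y w) i).
Proof.
apply: gmeasD; first by apply: gmeasZ; [exact: measurable_cst|exact: gmeas_sc].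
by apply: gmeasZ; [exact: measurable_cst|exact: gmeas_zf].
Qed.
Lemma gmeas_xv i : gmeas (fun w => xv u (x w) (y w) i).
Proof. by rewrite /xv; case: (i == a); [exact: gmeas_cst|exact: gmeas_x0]. Qed.
Lemma gmeas_qs : gmeas (fun w => qs u (x w) (y w)).
Proof.
apply: gmeasD.
  apply: gmeasZ; first exact: measurable_cst.
  apply: gmeas_sum => i _; apply: gmeas_sum => j _.
  by apply: gmeasZ; [exact: measurable_cst|apply: gmeasM; exact: gmeas_xv].
apply: gmeasD; last exact: gmeas_cst.
apply: gmeas_sc.
apply: measurable_funM; first exact: measurable_cst.
apply: measurable_sum_seq => i _; apply: measurable_sum_seq => j _.
by do 2 (apply: measurable_funM => //).
Qed.
Lemma gmeas_pri i : gmeas (fun w => pri a i u (x w) (y w)).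
Proof. by apply: gmeas_prod => j _; apply: gmeasM; [exact: gmeas_th|exact: gmeas_zi]. Qed.
Lemma gmeas_js : gmeas (fun w => js u (x w) (y w)).
Proof.
apply: gmeasM (gmeas_gexp gmeas_qs).
by apply: gmeas_prod => j _; apply: gmeasM; [exact: gmeas_th|exact: gmeas_zi].
Qed.
Lemma gmeas_dj i : gmeas (fun w => dj i u (x w) (y w)).
Proof.
have mE := gmeas_gexp gmeas_qs; have mP := gmeas_pri i.
have mz := gmeas_zi a mx my i; have mt := gmeas_th i.
apply: gmeasD.
  by apply: gmeasM => //; apply: gmeasM => //; apply: gmeasM => //; exact: gmeas_x0.
apply: gmeasM; first exact: gmeasM.
apply: gmeasM => //; apply: gmeasN; apply: gmeasM; first exact: gmeasM.
apply: gmeas_sum => j _.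
by apply: gmeasZ; [exact: measurable_cst|exact: gmeas_xv].
Qed.
End Meas.

Definition jb u (p : T2) : R := berezin U (js u (px p) (py p)).
Definition djb i u (p : T2) : R := berezin U (dj i u (px p) (py p)).

Lemma measurable_jb u : measurable_fun setT (jb u).
Proof. by apply: measurable_berezin; apply: gmeas_js; [exact: measurable_px|exact: measurable_py]. Qed.
Lemma measurable_djb i u : measurable_fun setT (djb i u).
Proof. by apply: measurable_berezin; apply: gmeas_dj; [exact: measurable_px|exact: measurable_py]. Qed.

Lemma is_derive_jb u p :
  is_derive u (1 : R) (fun u => jb u p) (\sum_(i <- U) djb i u p).
Proof.
have := is_derive_berezin U (gder_js_u a hG k sg u (px p) (py p)).
rewrite (_ : berezin U (\sum_(i <- U) _) = \sum_(i <- U) djb i u p)//.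
have h s : berezin U (\sum_(i <- s) dj i u (px p) (py p)) = \sum_(i <- s) djb i u p.
  by elim: s => [|i s IHs]; rewrite ?big_nil ?berezin0// !big_cons berezinD IHs.
exact: h.
Qed.

Definition cdom (K : R) (p : T2) : R := K * (cauchyd U (px p) * cauchyd U (py p)).

Lemma integrable_cdom K : leb2.-integrable setT (EFin \o cdom K).
Proof.
rewrite (_ : _ \o _ = fun p : T2 => (K%:E * (cauchyd U (px p) * cauchyd U (py p))%:E)%E)//.
by apply: integrableZl => //; exact: integrable_cauchyd2.
Qed.

Lemma integrable_cdom_le K (f : T2 -> R) : 0 <= K -> measurable_fun setT f ->
  (forall p, `|f p| <= cdom K p) -> leb2.-integrable setT (EFin \o f).
Proof.
move=> K0 mf fK; apply: (le_integrable measurableT (g := EFin \o cdom K)) (integrable_cdom K).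
  exact/measurable_EFinP.
move=> p _ /=; rewrite lee_fin [leRHS]ger0_norm//.
exact: le_trans (normr_ge0 _) (fK p).
Qed.

Lemma integral_djb0 i u : i \in U -> (\int[leb2]_p (djb i u p)%:E = 0)%E.
Proof.
move=> iU; have [K [K0 hK]] := js_bounds a hG sg hk `|u|.
have bd p : `|djb i u p| <= cdom K p.
  rewrite (le_trans (berezin_le _ _))//.
  by have [_ _] := hK u (px p) (py p) i (lexx _) (py_a p) iU.
have intd := integrable_cdom_le K0 (measurable_djb i u) bd.
rewrite -(integral21_prod_meas1 intd).
rewrite (eq_integral (cst 0%E)) ?integral0// => t2 _.
set y := put U (fun=> 0 : R) t2.
have ya : y a = 0 by rewrite /y /put (negPf (a_notin a)).
have e1 := @integral_partial0 R V U i (fun x => berezin U (zf a x y i * js u x y))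
  (fun x => berezin U (dj i u x y)) K (fun=> 0) (U_uniq a) iU.
apply: e1.
- move=> d T x mx; apply: measurable_berezin; apply: gmeas_dj => // j; exact: measurable_cst.
- by move=> x r; exact: is_derive_berezin (gder_js_x hG k sg u x y r iU).
- move=> x r; have [D hD] := gdiff_dj_x hG k sg u x y r iU.
  have [dd _] := is_derive_berezin U hD.
  exact: (differentiable_continuous (proj1 (derivable1_diffP _ _) dd)).
- move=> x; rewrite (le_trans (berezin_le _ _))//.
  have [_ h _] := hK u x y i (lexx _) ya iU; rewrite (le_trans h)//.
  rewrite mulrA ler_piMr ?mulr_ge0 ?cauchyd_ge0//; exact: cauchyd_le1.
- move=> x; rewrite (le_trans (berezin_le _ _))//.
  have [_ _ h] := hK u x y i (lexx _) ya iU; rewrite (le_trans h)//.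
  rewrite mulrA ler_piMr ?mulr_ge0 ?cauchyd_ge0//; exact: cauchyd_le1.
Qed.

Lemma jb_bounds (s1 : R) : exists K : R, 0 <= K /\ forall u p, `|u| <= s1 ->
  `|jb u p| <= cdom K p /\ `|\sum_(i <- U) djb i u p| <= cdom K p.
Proof.
have [K1 [K10 h1]] := js_dom hG sg hk (@tgp_pr R V a s1).
have [K [K0 hK]] := js_bounds a hG sg hk s1.
exists (K1 + (size U)%:R * K); split; first by rewrite addr_ge0// mulr_ge0.
move=> u p us; have c0 : 0 <= cauchyd U (px p) * cauchyd U (py p) by rewrite mulr_ge0 ?cauchyd_ge0.
have s0 : 0 <= (size U)%:R * K by rewrite mulr_ge0.
split.
  rewrite (le_trans (berezin_le _ _))// (le_trans (h1 u _ _ us (py_a p)))//.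
  by rewrite ler_wpM2r// lerDl.
rewrite (le_trans (ler_norm_sum _ _ _))// /cdom mulrDl.
apply: (@le_trans _ _ (\sum_(i <- U) K * (cauchyd U (px p) * cauchyd U (py p)))).
  rewrite big_seq [leRHS]big_seq; apply: ler_sum => i iU.
  rewrite (le_trans (berezin_le _ _))//.
  by have [_ _] := hK u (px p) (py p) i us (py_a p) iU.
rewrite big_const_seq count_predT iter_addr addr0 -[leLHS]mulr_natl [leLHS]mulrA.
by rewrite lerDr mulr_ge0.
Qed.

(** The supersymmetric integral is invariant under the boost: its derivative
    is the integral of a divergence. *)
Lemma integral_jb u : (\int[leb2]_p (jb u p)%:E = \int[leb2]_p (jb 0 p)%:E)%E.
Proof.
have int_jb v : leb2.-integrable setT (EFin \o jb v).
  have [K [K0 hK]] := jb_bounds `|v|.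
  apply: (integrable_cdom_le K0 (measurable_jb v)) => p.
  by have [] := hK v p (lexx _).
suff h v : is_derive v (1 : R) (fun v => \int[leb2]_(p in setT) jb v p) 0.
  have fin_eq (X Z : \bar R) : X \is a fin_num -> Z \is a fin_num -> fine X = fine Z -> X = Z.
    by move=> hX hZ E; rewrite -(fineK hX) -(fineK hZ) E.
  exact: (fin_eq _ _ (integrable_fin_num measurableT (int_jb u))
    (integrable_fin_num measurableT (int_jb 0)) (is_derive_0_is_cst u 0 h)).
have [K [K0 hK]] := jb_bounds (`|v| + 1).
have near_v w : `|w - v| < 1 -> `|w| <= `|v| + 1.
  move=> h; rewrite -[w](subrK v) addrC (le_trans (ler_normD _ _))// lerD2l ltW//.
have cd0 p : 0 <= cdom K p.
  by rewrite /cdom mulr_ge0// mulr_ge0 ?cauchyd_ge0.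
have := @is_derive_integral R _ _ leb2 jb (fun v p => \sum_(i <- U) djb i v p) (cdom K) v
  (fun w _ => int_jb w) is_derive_jb cd0 (integrable_cdom K)
  (fun w p hw => (hK w p (near_v w hw)).2).
rewrite (_ : \int[leb2]_(p in setT) _ = 0 :> R)//.
have hd i : i \in U -> leb2.-integrable setT (EFin \o djb i v).
  move=> iU; have [L [L0 hL]] := js_bounds a hG sg hk `|v|.
  apply: (integrable_cdom_le L0 (measurable_djb i v)) => p.
  rewrite (le_trans (berezin_le _ _))//.
  by have [_ _] := hL v (px p) (py p) i (lexx _) (py_a p) iU.
rewrite /Rintegral (eq_integral (fun p =>
  \sum_(i <- U) if i \in U then (djb i v p)%:E else 0)%E); last first.
  by move=> p _; rewrite -sumEFin big_seq big_mkcond.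
rewrite integral_sum//; last first.
  by move=> i; case iU: (i \in U); [exact: hd|exact: integrable0].
rewrite big1// => i _; case iU: (i \in U); last by rewrite integral0.
exact: integral_djb0.
Qed.

Lemma jb0E (p : T2) : jb 0 p = (\prod_(q <- pivots U A) q) *
  (expR (- 2^-1 * quadf A (put U (fun=> sg) p.1)) * expR (- 2^-1 * quadf A (py p))).
Proof.
pose xs := put U (fun=> sg) p.1.
have thE i : th a 0 (px p) (py p) i = zf a (px p) (py p) i.
  by rewrite /th cosh0 sinh0 scale1r scale0r addr0.
have xE i : xv 0 (px p) (py p) i = (xs i)%:A.
  rewrite /xv /xs /put mem_enum !inE; have [->|ia] := eqVneq i a; first by [].
  by rewrite /x0 cosh0 sinh0 scale1r scale0r addr0 /px /put mem_enum !inE ia.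
have hp q : q \in pivots U A -> q != 0.
  by move=> /(mmatrix_pivots (U_uniq a) (Amat_mmatrix hG hk)) /gt_eqF ->.
have pvE : pivots U A = pivots U (restr a A).
  apply: (@pivots_ext _ _ _ _ _ (fun i => i != a)) => [i|i j ia ja]; first exact: U_neq.
  by rewrite /restr ia ja mul1r.
rewrite /jb /js /pr; under eq_bigr do rewrite thE zf_zi.
rewrite big1_eq mul1r.
rewrite (_ : qs _ _ _ = (- 2^-1 * quadf A xs + - 2^-1 * quadf A (py p))%:A + gquad (restr a A)).
  rewrite gexpD; last exact: geven_scalar.
  by rewrite gexp_scalar -scalerAl mul1r berezinZ berezin_gexp -?pvE// mulrC expRD.
rewrite /qs addrA; congr (_ + _); rewrite scalerDl; congr (_ + _).
rewrite -[in RHS]scalerA; congr (_ *: _); rewrite /quadf scaler_suml; apply: eq_bigr => i _.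
rewrite scaler_suml; apply: eq_bigr => j _.
by rewrite !xE -scalerAl mul1r !scalerA.
Qed.

Lemma integral_jb0 : (\int[leb2]_p (jb 0 p)%:E =
  ((2 * pi) ^+ size U * expR (- 2^-1 * (elim_on U A a a * sg ^+ 2)))%:E)%E.
Proof.
have pv0 := mmatrix_pivots (U_uniq a) (Amat_mmatrix hG hk).
have sA := Amat_sym hG k.
pose c := \prod_(q <- pivots U A) Num.sqrt (2 * pi / q) : R.
have c0 : 0 <= c by rewrite prodr_ge0// => q _; exact: sqrtr_ge0.
pose D := \prod_(q <- pivots U A) q : R.
have D0 : 0 <= D by rewrite /D big_seq prodr_ge0// => q /pv0/ltW.
have g1 := @integral_gauss_put R V U A (fun=> sg) (U_uniq a) sA pv0.
have g2 := @integral_gauss_put R V U A (fun=> 0) (U_uniq a) sA pv0.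
have q1 : quadf (elim_on U A) (fun=> sg) = elim_on U A a a * sg ^+ 2.
  rewrite /quadf (bigD1 a)//= (bigD1 a)//= !big1 ?addr0; first by rewrite expr2 mulrA.
    move=> i ia; rewrite big1// => j _.
    have [//|_ ->] := @elim_zero R V U A i j (U_uniq a) (Amat_mmatrix hG hk).
      by rewrite mem_enum !inE.
    by rewrite !mul0r.
  move=> j ja; have [//|-> _] := @elim_zero R V U A j a (U_uniq a) (Amat_mmatrix hG hk).
    by rewrite mem_enum !inE.
  by rewrite !mul0r.
have q2 : quadf (elim_on U A) (fun=> 0) = 0.
  by rewrite /quadf big1// => i _; rewrite big1// => j _; rewrite mulr0.
rewrite q2 mulr0 expR0 mulr1 in g2; rewrite q1 in g1.
rewrite (eq_integral (fun p : T2 => ((D * expR (- 2^-1 * quadf A (put U (fun=> sg) p.1))) *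
    expR (- 2^-1 * quadf A (put U (fun=> 0) p.2)))%:E)); last first.
  by move=> p _; rewrite jb0E mulrA.
rewrite fubini_tonelli1; last 2 first.
- apply/measurable_EFinP; apply: measurable_funM.
    apply: measurable_funM; first exact: measurable_cst.
    by apply: measurableV_quad => i; apply: measurable_put => // j; exact: measurable_cst.
  by apply: measurableV_quad => i; apply: measurable_put => // j; exact: measurable_cst.
- by move=> p; rewrite lee_fin !mulr_ge0// expR_ge0.
rewrite /fubini_F /=.
have mput (x : V -> R) : measurable_fun setT
    (fun t : (size U).-tuple mR => (expR (- 2^-1 * quadf A (put U x t)))%:E).
  apply/measurable_EFinP; apply: measurableV_quad => i.
  by apply: (@measurable_put _ _ _ _ U (fun=> x) id) => // j; exact: measurable_cst.
rewrite (eq_integral (fun t : (size U).-tuple mR =>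
   ((D * c)%:E * (expR (- 2^-1 * quadf A (put U (fun=> sg) t)))%:E)%E)); last first.
  move=> t _; under eq_integral do rewrite EFinM.
  rewrite (ge0_integralZl _ measurableT (mput (fun=> 0)) _ (k := (D * expR (- 2^-1 * quadf A (put U (fun=> sg) t)))%:E)).
  - by rewrite g2 -!EFinM; congr EFin; rewrite -/c; ring.
  - by move=> y _; rewrite lee_fin expR_ge0.
  - by rewrite lee_fin mulr_ge0// expR_ge0.
rewrite (ge0_integralZl _ measurableT (mput (fun=> sg)) _ (k := (D * c)%:E)); last 2 first.
- by move=> y _; rewrite lee_fin expR_ge0.
- by rewrite lee_fin mulr_ge0.
rewrite g1 -EFinM -/c; congr EFin; rewrite mulrA; congr (_ * _).
rewrite /D /c -mulrA -!big_split/= -(size_pivots U A).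
elim: (pivots U A) pv0 => [|q s IHs] h; first by rewrite big_nil expr0.
rewrite big_cons exprS IHs//; last by move=> r rs; apply: h; rewrite inE rs orbT.
congr (_ * _); have q0 : 0 < q by apply: h; rewrite inE eqxx.
rewrite -expr2 sqr_sqrtr; last by rewrite divr_ge0 ?mulr_ge0 ?pi_ge0// ltW.
by rewrite mulrC divfK// gt_eqF.
Qed.
End EvalIntegral.

Section EvenProd.
Context (R : realType) (V : finType).
Local Notation gr := (grassmann R (V + V)%type).
Lemma prod_even_split (I : Type) (r : seq I) (F G : I -> gr) :
  (forall i, geven (F i)) -> (forall i, geven (G i)) ->
  \prod_(i <- r) (F i * G i) = (\prod_(i <- r) F i) * \prod_(i <- r) G i.
Proof.
move=> eF eG; elim: r => [|i r IHr]; first by rewrite !big_nil mul1r.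
rewrite !big_cons IHr -!mulrA; congr (_ * _); rewrite !mulrA; congr (_ * _).
exact: (geven_comm _ (eG i)).
Qed.
Lemma prod_scale (I : Type) (r : seq I) (c : R) (G : I -> gr) :
  \prod_(i <- r) (c *: G i) = c ^+ size r *: \prod_(i <- r) G i.
Proof.
elim: r => [|i r IHr]; first by rewrite !big_nil scale1r.
by rewrite !big_cons IHr -scalerAl -scalerAr scalerA -exprS.
Qed.
Lemma gcoef_affine_mul (c b p q : R) (u v : gr) S :
  gcoef ((c *: u + b *: p%:A) * (c *: v + b *: q%:A)) S =
  c ^+ 2 * gcoef (u * v) S + c * b * (q * gcoef u S + p * gcoef v S)
  + b ^+ 2 * (p * q) * gcoef (1 : gr) S.
Proof.
transitivity (gcoef (c *: (c *: (u * v)) + c *: (b *: (q *: u))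
    + (b *: (p *: (c *: v)) + b *: (p *: (b *: (q *: (1 : gr)))))) S).
  by rewrite mulrDl !mulrDr -!scalerAl -!scalerAr !mulr1 !mul1r.
by rewrite !(gcoefD, gcoefZ); ring.
Qed.
End EvenProd.

Section GaussValue.
Context (R : realType) (V : finType) (a : V) (e : rel V) (W : V -> V -> R).
Hypothesis hG : weighted_graph e W.
Variables (k : V -> R) (s : R).
Hypothesis hk : forall i, \sum_j W i j < k i.
Local Notation gr := (grassmann R (V + V)%type).
Local Notation mR := (measurableTypeR R).
Local Notation U := (unpinned a).
Local Notation A := (Amat W k).
Implicit Types (x y : V -> R) (i j : V) (u : R).

Definition zconst : R := 2^-1 * \sum_i \sum_j W i j - 2^-1 * \sum_i k i.

Lemma sum_diag (F : V -> V -> R) (i : V) :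
  \sum_j (i == j)%:R * F i j = F i i.
Proof.
rewrite (bigD1 i)//= eqxx mul1r big1 ?addr0// => j ji.
by rewrite eq_sym (negPf ji) mul0r.
Qed.

Lemma sum_termwise (F1 F2 F3 F4 F5 F6 F7 F8 : V -> V -> R) (p q : R) :
  (forall i j, p * F1 i j + (q * F2 i j - q * F3 i j - F4 i j) =
    p * F5 i j + (p * F6 i j - F7 i j) + q * F8 i j) ->
  p * (\sum_i \sum_j F1 i j) + (q * (\sum_i \sum_j F2 i j)
    - q * (\sum_i \sum_j F3 i j) - \sum_i \sum_j F4 i j) =
  p * (\sum_i \sum_j F5 i j) + (p * (\sum_i \sum_j F6 i j)
    - \sum_i \sum_j F7 i j) + q * (\sum_i \sum_j F8 i j).
Proof.
move=> h; do 2 (rewrite !mulr_sumr -!sumrN -!big_split /=; apply: eq_bigr => ? _).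
exact: h.
Qed.

(** Completing the square in the exponent: on the hyperboloid, the products
    theta_i theta_j and x_i x_j transform into each other under the boost. *)
Lemma exponentE x y : x a = 0 -> y a = 0 ->
  - 2^-1 *: \sum_i \sum_j A i j *: (th a s x y i * th a s x y j) + en a W x y =
  qs a W k (sinh s) s x y + zconst%:A.
Proof.
move=> xa ya; have cs := cosh2_sinh2 s.
have zE : zconst = 2^-1 * \sum_i \sum_j (W i j - (i == j)%:R * k i).
  rewrite /zconst -mulrBr -sumrB; congr (_ * _); apply: eq_bigr => i _.
  by rewrite sumrB (sum_diag (fun i _ => k i)).
rewrite zE /en /qs /gquad /quadf.
have za : zf a x y a = 1.
  by rewrite /zf /rr nn_a xa ya expr0n/= !addr0 sqrtr1 scaler0 addr0 scale1r.
have xvE i : xv a (sinh s) s x y i = x0 a s x y i.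
  rewrite /xv /x0; have [->|//] := eqVneq i a.
  by rewrite za xa scale0r scaler0 add0r.
apply: grassmannP => S.
rewrite !(gcoefD, gcoefB, gcoefN, gcoefZ, gcoef_sum).
under eq_bigr do rewrite gcoef_sum.
under [X in _ + (_ - _ * X + _)]eq_bigr do rewrite gcoef_sum.
under [X in _ + (_ + - X)]eq_bigr do rewrite gcoef_sum.
under [X in _ = _ * X + _ + _]eq_bigr do rewrite gcoef_sum.
under [X in _ = _ + (_ + - X) + _]eq_bigr do rewrite gcoef_sum.
rewrite -!(mulrA 2^-1) -!(mulrA (- 2^-1)) ![(_ * gcoef 1 S) in RHS]mulr_suml.
rewrite [_ * gcoef 1 S]mulr_suml.
under [X in _ + (_ * X - _ - _)]eq_bigr do rewrite mulr_suml.
under [X in _ = _ + (_ * X - _) + _]eq_bigr do rewrite mulr_suml.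
under [X in _ = _ + _ * X]eq_bigr do rewrite mulr_suml.
apply: sum_termwise => i j.
rewrite !xvE !gcoefZ.
have thE : gcoef (th a s x y i * th a s x y j) S =
    cosh s ^+ 2 * gcoef (zf a x y i * zf a x y j) S + cosh s * sinh s * (x j * gcoef (zf a x y i) S + x i * gcoef (zf a x y j) S)
    + sinh s ^+ 2 * (x i * x j) * gcoef (1 : gr) S.
  exact: gcoef_affine_mul.
have x0E : gcoef (x0 a s x y i * x0 a s x y j) S =
    sinh s ^+ 2 * gcoef (zf a x y i * zf a x y j) S + cosh s * sinh s * (x j * gcoef (zf a x y i) S + x i * gcoef (zf a x y j) S)
    + cosh s ^+ 2 * (x i * x j) * gcoef (1 : gr) S.
  by rewrite /x0 ![cosh s *: _ + _]addrC gcoef_affine_mul (mulrC (sinh s)).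
have c2 : cosh s ^+ 2 = 1 + sinh s ^+ 2 by rewrite -cs subrK.
rewrite thE x0E c2; have [<-|ij] := eqVneq i j; last first.
  have AE : A i j = - W i j by rewrite /Amat (negPf ij) mul0r sub0r.
  by rewrite /restr AE mul0r; ring.
have nE B : restr a B i i * gcoef (gxi R i * geta R i : gr) S = B i i * gcoef (nn R a i) S.
  rewrite /restr /nn; case: (eqVneq i a) => _ /=; last by rewrite mul1r.
  by rewrite gcoef0 !mul0r mulr0.
have zz : gcoef (zf a x y i * zf a x y i) S =
    (1 + x i ^+ 2 + y i ^+ 2) * gcoef (1 : gr) S + 2 * gcoef (nn R a i) S.
  by rewrite zf_sq gcoefD gcoefZ mulr2n gcoefD; ring.
have AE : A i i = k i - W i i by rewrite /Amat eqxx mul1r.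
by rewrite !nE zz AE mul1r; field.
Qed.

Lemma th_split x y i : th a s x y i = (tb (cosh s) (sinh s) x y i)%:A + tn a (cosh s) x y i.
Proof. exact: theta_split. Qed.

Lemma jint_gauss x y : x a = 0 -> y a = 0 ->
  jint a W (cosh s) (sinh s) (jet (eval (gauss_obs W k))) x y =
  cosh s * (2 * pi) ^- size U * expR zconst * berezin U (js a W k (sinh s) s x y).
Proof.
move=> xa ya; rewrite -jintE.
rewrite (_ : (fun i => _) = (fun i => (tb (cosh s) (sinh s) x y i)%:A + tn a (cosh s) x y i)); last first.
  by apply/funext => i; exact: theta_split.
rewrite superfun_eval; last 4 first.
- exact: card_VV a.
- by move=> i; exact: geven_tn.
- by move=> i; exact: body_tn.
- by move=> i; exact: tn_sq0.
rewrite (_ : (fun i => _) = th a s x y); last by apply/funext => i; rewrite th_split.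
rewrite (_ : geval (gauss_obs W k) (th a s x y) = (\prod_(i <- enum V) th a s x y i) *
  gexp (- 2^-1 *: \sum_i \sum_j A i j *: (th a s x y i * th a s x y j))); last first.
  rewrite /gauss_obs [geval _ _]/= geval_EProd geval_ESum; congr (_ * gexp _).
  rewrite big_enum/= scaler_sumr; apply: eq_bigr => i _.
  rewrite geval_ESum big_enum/= scaler_sumr; apply: eq_bigr => j _.
  by rewrite -scalerAl mul1r scalerA.
have eth := geven_th a s x y; have ezi := geven_zi a x y.
have tha : th a s x y a = (cosh s)%:A.
  rewrite /th /zf /rr nn_a xa ya expr0n/= !addr0 sqrtr1 scaler0 addr0 scale1r.
  by rewrite scale0r scaler0 addr0.
have thV : \prod_(i <- enum V) th a s x y i = cosh s *: \prod_(i <- U) th a s x y i.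
  rewrite (@prod_even_D1 R _ V (enum V) (th a s x y) a (enum_uniq V) (mem_enum V a) eth).
  rewrite tha -scalerAl mul1r; congr (_ *: _); rewrite -big_filter; congr (\prod_(i <- _) _).
  by rewrite /unpinned -filter_predI; apply: eq_filter => i; rewrite !inE/= andbT.
rewrite thV /dens (_ : \prod_(i | i != a) _ = (2 * pi) ^- size U *: \prod_(i <- U) zi a x y i); last first.
  rewrite -exprVn -prod_scale /unpinned -big_filter; congr (\prod_(i <- _) _).
set Pt := \prod_(i <- U) th _ _ _ _ _; set Pz := \prod_(i <- U) zi _ _ _ _.
set E1 := gexp _; set E2 := gexp (en _ _ _ _).
have eE1 : geven E1.
  apply: geven_gexp; apply/gevenZ/geven_sum => i _; apply: geven_sum => j _.
  by apply/gevenZ/gevenM; exact: eth.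
have eE2 : geven E2 by apply: geven_gexp; exact: geven_en.
have EE : E1 * E2 = expR zconst *: gexp (qs a W k (sinh s) s x y).
  rewrite /E1 /E2 -gexpD; last first.
    apply/gevenZ/geven_sum => i _; apply: geven_sum => j _.
    by apply/gevenZ/gevenM; exact: eth.
  rewrite exponentE// gexpD; last exact: geven_qs.
  by rewrite gexp_scalar -scalerAr mulr1.
have PP : Pt * Pz = pr a s x y by rewrite /pr prod_even_split.
have PEE : Pt * E1 * (E2 * Pz) = expR zconst *: js a W k (sinh s) s x y.
  rewrite -mulrA (mulrA E1) EE -scalerAl -scalerAr; congr (_ *: _).
  rewrite /js -PP -mulrA; congr (_ * _).
  by rewrite (geven_comm Pz)//; apply: geven_gexp; exact: geven_qs.
set q := (2 * pi) ^- size U; move: (cosh s) (expR zconst) q PEE => c z q PEE.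
rewrite -berezinZ; congr (berezin _ _).
rewrite -!scalerAl -!scalerAr PEE !scalerA; congr (_ *: _); ring.
Qed.

(** The value of the field expectation on the Gaussian observables. *)
Lemma Lam_gauss : Lam a W (cosh s) (sinh s) (jet (eval (gauss_obs W k))) =
  (cosh s * expR zconst * expR (- 2^-1 * (elim_on U A a a * sinh s ^+ 2)))%:E.
Proof.
pose c := cosh s * (2 * pi) ^- size U * expR zconst.
rewrite /Lam (eq_integral (fun p => c%:E * (jb W k (sinh s) s p)%:E)%E); last first.
  by move=> p _; rewrite jint_gauss ?px_a ?py_a// EFinM.
have intj : (@leb2 R V a).-integrable setT (EFin \o @jb R V a W k (sinh s) s).
  have [K [K0 hK]] := jb_bounds a hG (sinh s) hk `|s|.
  apply: (integrable_cdom_le K0 (measurable_jb _ _ _ _)) => p.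
  by have [] := hK s p (lexx _).
rewrite (@integralZl _ _ _ _ _ measurableT _ intj) (integral_jb a hG _ hk) (integral_jb0 a hG _ hk).
rewrite -EFinM; congr EFin; rewrite /c.
have p0 : (2 * pi : R) ^+ size U != 0 by rewrite expf_neq0// mulf_neq0// gt_eqF// pi_gt0.
by move: (_ ^+ size U) p0 => q q0; move: (expR _) (expR _) => ? ?; field.
Qed.

End GaussValue.

(** * Measures on sequences of holding times *)
Section Transport.
Import HBNNSimple.
Context d1 d2 (T1 : measurableType d1) (T2 : measurableType d2) (R : realType).
Variables (mu : {measure set T1 -> \bar R}) (phi : T1 -> T2) (k : T1 -> R).
Hypotheses (mphi : measurable_fun setT phi) (mk : measurable_fun setT k)
           (k0 : forall x, 0 <= k x).

(** The image under phi of the measure of density k. *)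
Definition image_density (B : set T2) : \bar R :=
  (\int[mu]_(x in phi @^-1` B) (k x)%:E)%E.

Let mpre B : measurable B -> measurable (phi @^-1` B).
Proof. by move=> mB; rewrite -[X in measurable X]setTI; exact: mphi. Qed.
Let mkE D : measurable_fun D (EFin \o k).
Proof. by apply/measurable_EFinP; exact: measurable_funTS. Qed.

Lemma image_density0 : image_density set0 = 0%E.
Proof. by rewrite /image_density preimage_set0 integral_set0. Qed.
Lemma image_density_ge0 B : (0 <= image_density B)%E.
Proof. by apply: integral_ge0 => x _; rewrite lee_fin. Qed.
Lemma image_density_sigma : semi_sigma_additive image_density.
Proof.
move=> F mF tF mUF; rewrite /image_density preimage_bigcup ge0_integral_bigcup//.
- by apply: is_cvg_ereal_nneg_natsum_cond => n _ _; exact: image_density_ge0.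
- by move=> n; exact: mpre.
- by move=> x _; rewrite lee_fin.
- by apply/trivIsetP => i j _ _ ij; rewrite -preimage_setI ((trivIsetP.1 tF) i j)// preimage_set0.
Qed.
HB.instance Definition _ := isMeasure.Build _ _ _ image_density
  image_density0 image_density_ge0 image_density_sigma.

Lemma integral_image_density (f : T2 -> \bar R) :
  measurable_fun setT f -> (forall y, 0 <= f y)%E ->
  (\int[image_density]_y f y = \int[mu]_x (f (phi x) * (k x)%:E))%E.
Proof.
move=> mf f0; pose f_ := nnsfun_approx measurableT mf.
have nd y : nondecreasing_seq (fun n => (f_ n y)%:E).
  by move=> m n mn; rewrite lee_fin; exact/lefP/nd_nnsfun_approx.
have cf y : (f_ n y)%:E @[n --> \oo] --> f y by exact: cvg_nnsfun_approx.
have mfp n : measurable_fun setT (fun x => f_ n (phi x)).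
  by apply: measurableT_comp.
have step n : (\int[image_density]_y (f_ n y)%:E = \int[mu]_x ((f_ n (phi x))%:E * (k x)%:E))%E.
  rewrite integralT_nnsfun sintegralE.
  transitivity (\int[mu]_x (\sum_(r \in range (f_ n)) r%:E * ((\1_(f_ n @^-1` [set r]) (phi x) * k x)%:E)))%E.
    rewrite ge0_integral_fsum//; last 2 first.
    - move=> r; apply: measurable_funeM; apply/measurable_EFinP; apply: measurable_funM => //.
      by apply: measurableT_comp => //; exact: measurable_indic.
    - move=> r x _; rewrite -EFinM mulrA lee_fin mulr_ge0//.
      by have := nnfun_muleindic_ge0 (f_ n) r (phi x); rewrite lee_fin.
    apply: eq_fsbigr => r /[!inE] -[y _ <-].
    rewrite ge0_integralZl//; last 3 first.
    - apply/measurable_EFinP; apply: measurable_funM => //.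
      by apply: measurableT_comp => //; exact: measurable_indic.
    - by move=> x _; rewrite lee_fin mulr_ge0.
    - by rewrite lee_fin.
    congr (_ * _)%E; rewrite /= /image_density integral_mkcond; apply: eq_integral => x _.
    rewrite /patch indicE; case: ifPn => h.
      by rewrite mem_set ?mul1r//; exact: set_mem h.
    by rewrite memNset ?mul0r// => h'; move: h; rewrite mem_set.
  apply: eq_integral => x _.
  rewrite [in RHS]fimfunE -fsumEFin// ge0_mule_fsuml; last first.
    by move=> r; exact: nnfun_muleindic_ge0.
  by apply: eq_fsbigr => r _; rewrite !EFinM muleA.
transitivity (limn (fun n => \int[image_density]_x (f_ n x)%:E)%E).
  rewrite -monotone_convergence//.
  - by apply: eq_integral => y _; apply/esym/cvg_lim => //; exact: cf.
  - by move=> n; exact/measurable_EFinP/measurable_funP.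
  - by move=> n y _; rewrite lee_fin.
under eq_fun do rewrite step.
rewrite -monotone_convergence//.
- apply: eq_integral => x _; apply/cvg_lim => //.
  by apply: cvgeZr => //; exact: cf.
- by move=> n; apply: emeasurable_funM; exact/measurable_EFinP.
- by move=> n x _; rewrite mule_ge0 ?lee_fin.
- by move=> x _ m n mn; apply: lee_wpmul2r; [rewrite lee_fin|exact: nd].
Qed.
End Transport.

Section Rectangles.
Context (R : realType) (n : nat).
Implicit Types (r t : nat -> R).
Definition rect r : set (nat -> R) := [set t | forall m, (m <= n)%N -> t m <= r m].
Definition rects : set (set (nat -> R)) := range rect.
Definition rspace := g_sigma_algebraType rects.

Lemma rects_setI : setI_closed rects.
Proof.
move=> _ _ [r _ <-] [q _ <-]; exists (fun m => Num.min (r m) (q m)) => //.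
apply/seteqP; split=> t /=.
  by move=> h; split=> m mn; have := h m mn; rewrite le_min => /andP[].
by move=> [h1 h2] m mn; rewrite le_min h1 ?h2.
Qed.

Lemma measurable_coord m : (m <= n)%N ->
  measurable_fun setT (fun t : rspace => t m : measurableTypeR R).
Proof.
move=> mn; apply: (@measurability _ _ rspace (measurableTypeR R) setT (fun t : rspace => t m) _ (RGenOInfty.measurableE R)) => _ [_ [x ->] <-].
rewrite setTI (_ : _ @^-1` _ = ~` \bigcup_k rect (fun p => if p == m then x else k%:R)).
  apply: measurableC; apply: bigcup_measurable => k _.
  by apply: sub_sigma_algebra; exists (fun p => if p == m then x else k%:R).
apply/seteqP; split=> t /=; rewrite in_itv/= andbT.
  move=> xt [k _] /(_ m mn); rewrite eqxx leNgt; by rewrite xt.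
move=> h; rewrite ltNge; apply/negP => tx; apply: h.
have [k hk] : exists k : nat, forall p, (p <= n)%N -> t p <= k%:R.
  exists (\sum_(p < n.+1) (Num.truncn `|t p|).+1)%N => p pn.
  rewrite (le_trans (ler_norm _))// (le_trans (ltW (truncnS_gt _)))// ler_nat.
  have pn' : (p < n.+1)%N by [].
  by rewrite (bigD1 (Ordinal pn'))//= leq_addr.
by exists k => // p pn /=; case: eqP => [->//|_]; exact: hk.
Qed.
Lemma measurable_to_rspace d (T : measurableType d) (f : T -> nat -> R) :
  (forall m, measurable_fun setT (fun w => f w m)) ->
  measurable_fun setT (f : T -> rspace).
Proof.
move=> mf; apply: (@measurability _ _ T rspace setT f rects) => // _ [_ [r _ <-] <-].
rewrite setTI (_ : _ @^-1` _ = \bigcap_m (if (m <= n)%N then [set w | f w m <= r m] else setT)).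
  apply: bigcapT_measurable => m; case: ifP => // _.
  rewrite (_ : [set w | _] = (fun w => f w m) @^-1` `]-oo, r m]); last first.
    by apply/seteqP; split=> w /=; rewrite in_itv.
  by rewrite -[X in measurable X]setTI; exact: mf.
apply/seteqP; split=> w /=; first by move=> h m _; case: ifP => // /h.
by move=> h m mn; have := h m I; rewrite mn.
Qed.

Lemma rspace_unique (m1 m2 : {measure set rspace -> \bar R}) :
  (forall r, m1 (rect r) = m2 (rect r)) -> (forall r, m1 (rect r) < +oo)%E ->
  forall B, measurable B -> m1 B = m2 B.
Proof.
move=> h12 hoo B mB; apply: (@measure_unique _ R rspace rects (fun k => rect (fun=> k%:R)) erefl _ _ _ m1 m2 _ _ B mB) => //.
- exact: rects_setI.
- by move=> k; exists (fun=> k%:R).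
- apply/seteqP; split=> // t _.
  exists (\sum_(p < n.+1) (Num.truncn `|t p|).+1)%N => // p pn.
  rewrite (le_trans (ler_norm _))// (le_trans (ltW (truncnS_gt _)))// ler_nat.
  have pn' : (p < n.+1)%N by [].
  by rewrite (bigD1 (Ordinal pn'))//= leq_addr.
- by move=> _ [r _ <-].
Qed.
End Rectangles.

(** * The joint law of the holding times *)
Section JumpLaw.
Context (R : realType) (V : finType) (d : measure_display) (Omega : measurableType d).
Variables (P : probability Omega R) (W : V -> V -> R)
  (X : nat -> Omega -> V) (S : nat -> Omega -> \bar R).
Local Notation mR := (measurableTypeR R).
Local Notation leb := (@lebesgue_measure R).
Hypotheses (W0 : forall i j, 0 <= W i j)
  (mS : forall n, measurable_fun setT (S n))
  (mX : forall n i, measurable [set w | X n w = i])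
  (S_gt0 : forall n w, (0 < S n w)%E)
  (law : forall n v r j (t : R), 0 <= t ->
        P (history X S n v r `&` [set w | (S n w <= t%:E)%E /\ X n.+1 w = j]) =
        (\int[P]_(w in history X S n v r)
           (\int[lebesgue_measure]_(u in `[0, t])
              (W (v n) j * jump_local_time X S n j w *
               expR (- (\sum_k W (v n) k * jump_local_time X S n k w) * u))
           )%R%:E)%E).
Implicit Types (t : nat -> R) (w : Omega) (v : nat -> V) (i j : V).

Definition sv w : nat -> R := fun m => fine (S m w).
Lemma sv_ge0 w m : 0 <= sv w m. Proof. by rewrite fine_ge0// ltW. Qed.
Lemma measurable_sv m : measurable_fun setT (fun w => sv w m).
Proof. by apply: measurableT_comp => //; exact: fine_measurable. Qed.
Lemma S_le w m (r : R) : (S m w <= r%:E)%E <-> (S m w < +oo)%E /\ sv w m <= r.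
Proof.
rewrite /sv; have := S_gt0 m w; case: (S m w) => [q| |]//= q0; last by split=> // -[].
by rewrite lee_fin ltry; split=> // -[].
Qed.

Definition past n v : set Omega :=
  [set w | (forall m, (m <= n)%N -> X m w = v m) /\ (forall m, (m < n)%N -> (S m w < +oo)%E)].
Lemma measurable_Sfin m : measurable [set w | (S m w < +oo)%E].
Proof.
rewrite (_ : [set w | _] = ~` (S m @^-1` [set +oo%E])).
  by apply: measurableC; rewrite -[X in measurable X]setTI; apply: mS.
by apply/seteqP; split=> w /=; rewrite ltey => /eqP.
Qed.
Lemma measurable_past n v : measurable (past n v).
Proof.
rewrite (_ : past n v = (\bigcap_m (if (m <= n)%N then [set w | X m w = v m] else setT)) `&`
    \bigcap_m (if (m < n)%N then [set w | (S m w < +oo)%E] else setT)).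
  apply: measurableI; apply: bigcapT_measurable => m; case: ifP => // _.
  exact: measurable_Sfin.
apply/seteqP; split=> w /=.
  move=> [h1 h2]; split=> m _; case: ifP => // mn; first exact: h1.
  exact: h2.
move=> [h1 h2]; split=> m mn; first by have := h1 m I; rewrite mn.
by have := h2 m I; rewrite mn.
Qed.

Definition ltv v n j t : R := 1 + \sum_(m < n | v m == j) t m.
Definition rate v n t : R := \sum_k W (v n) k * ltv v n k t.
Definition upd t n (u : R) m : R := if m == n then u else t m.

Lemma jump_local_timeE n v j w : past n v w -> jump_local_time X S n j w = ltv v n j (sv w).
Proof.
move=> [h _]; rewrite /jump_local_time /ltv; congr (_ + _); apply: eq_bigl => m.
by rewrite h// ltnW.
Qed.
Lemma ltv_ge1 v n j w : 1 <= ltv v n j (sv w).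
Proof. by rewrite lerDl sumr_ge0// => m _; exact: sv_ge0. Qed.
Lemma ltv_upd v n j t u : ltv v n j (upd t n u) = ltv v n j t.
Proof.
rewrite /ltv; congr (_ + _); apply: eq_bigr => m _.
by rewrite /upd ltn_eqF.
Qed.
Lemma rate_ge0 v n w : 0 <= rate v n (sv w).
Proof. by rewrite sumr_ge0// => k _; rewrite mulr_ge0// (le_trans ler01)// ltv_ge1. Qed.

Lemma measurable_ltv d' (T : measurableType d') (x : T -> nat -> R) (n : nat) v (k : V) :
  (forall m, measurable_fun setT (fun z => x z m)) ->
  measurable_fun setT (fun z => ltv v n k (x z)).
Proof. by move=> mx; apply: measurable_funD => //; apply: measurable_sum_seq => m _. Qed.
Section Step.
Variables (n : nat) (v : nat -> V) (j : V).
Definition jd (w : Omega) (u : R) : R :=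
  W (v n) j * ltv v n j (sv w) * expR (- rate v n (sv w) * u).
Lemma jd_ge0 w u : 0 <= jd w u.
Proof. by rewrite mulr_ge0 ?expR_ge0// mulr_ge0// (le_trans ler01)// ltv_ge1. Qed.

Let D := past n v `&` [set w | (S n w < +oo)%E /\ X n.+1 w = j].
Let mD : measurable D.
Proof.
apply: measurableI; first exact: measurable_past.
rewrite (_ : [set w | _ /\ _] = [set w | (S n w < +oo)%E] `&` [set w | X n.+1 w = j])//.
by apply: measurableI => //; exact: measurable_Sfin.
Qed.
Let k1 w : R := \1_D w.
Let k2 (x : Omega * mR) : R := \1_(past n v) x.1 * \1_(`[0, +oo[%classic : set mR) x.2 * jd x.1 x.2.
Let phi1 (w : Omega) : rspace R n := sv w.
Let phi2 (x : Omega * mR) : rspace R n := upd (sv x.1) n x.2.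

Lemma measurable_jd : measurable_fun setT (fun x : Omega * mR => jd x.1 x.2).
Proof.
have ms m : measurable_fun setT (fun x : Omega * mR => sv x.1 m).
  by apply: (measurableT_comp (measurable_sv m)).
apply: measurable_funM.
  by apply: measurable_funM; [exact: measurable_cst|exact: measurable_ltv].
apply: measurableT_comp => //; apply: measurable_funM; last exact: measurable_snd.
apply: measurableT_comp => //; apply: measurable_sum_seq => k _.
by apply: measurable_funM; [exact: measurable_cst|exact: measurable_ltv].
Qed.
Let mk1 : measurable_fun setT k1. Proof. exact: measurable_indic. Qed.
Let mk2 : measurable_fun setT k2.
Proof.
apply: measurable_funM; last exact: measurable_jd.
apply: measurable_funM.
  have h : measurable_fun setT (\1_(past n v) : Omega -> R).
    by apply: measurable_indic; exact: measurable_past.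
  exact: (measurableT_comp h measurable_fst).
have h : measurable_fun setT (\1_(`[0, +oo[%classic : set mR) : mR -> R).
  exact: measurable_indic.
exact: (measurableT_comp h measurable_snd).
Qed.
Let k10 w : 0 <= k1 w. Proof. by rewrite /k1 indicE. Qed.
Let k20 x : 0 <= k2 x. Proof. by rewrite /k2 !indicE; apply: mulr_ge0; [apply: mulr_ge0; exact: ler0n|exact: jd_ge0]. Qed.
Let mphi1 : measurable_fun setT phi1.
Proof. by apply: measurable_to_rspace => m; exact: measurable_sv. Qed.
Let mphi2 : measurable_fun setT phi2.
Proof.
apply: measurable_to_rspace => m; rewrite /phi2 /upd; case: (m == n); first exact: (@measurable_snd _ _ Omega mR).
exact: (measurableT_comp (measurable_sv m)).
Qed.
Let PL : {measure set (Omega * mR) -> \bar R} := (P \x leb)%E.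

Lemma integral_jd w (t : R) : 0 <= t ->
  ((\int[leb]_(u in `[0, t]) jd w u)%R%:E = \int[leb]_(u in `[0%R, t]) (jd w u)%:E)%E.
Proof.
move=> t0; rewrite /Rintegral fineK//; apply: integrable_fin_num => //.
apply: continuous_compact_integrable; first exact: segment_compact.
apply: continuous_subspaceT => u; apply: cvgM; first exact: cvg_cst.
apply: (@continuous_comp _ _ _ (fun u => - rate v n (sv w) * u) expR); last exact: continuous_expR.
by apply: cvgM; [exact: cvg_cst|exact: cvg_id].
Qed.

Let rect_eq r : image_density P phi1 k1 (rect n r) = image_density PL phi2 k2 (rect n r).
Proof.
have mrect : measurable (rect n r : set (rspace R n)).
  by apply: sub_sigma_algebra; exists r.
have mpre1 : measurable (phi1 @^-1` rect n r).
  by rewrite -[X in measurable X]setTI; exact: mphi1.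
have mpre2 : measurable (phi2 @^-1` rect n r).
  by rewrite -[X in measurable X]setTI; exact: mphi2.
rewrite /image_density [LHS]integral_indic//.
have [rn|rn] := ltP (r n) 0.
  rewrite (_ : _ `&` _ = set0) ?measure0; last first.
    apply/seteqP; split=> // w [[_ _] /(_ n (leqnn n)) h].
    by move: (le_lt_trans h rn); rewrite ltNge sv_ge0.
  rewrite integral_mkcond; apply/esym/integral0_eq => x _; rewrite /patch; case: ifPn => // h.
  have {}h : x.2 <= r n.
    by have := set_mem h => /(_ n (leqnn n)); rewrite /phi2 /upd eqxx.
  rewrite /k2 [\1_(`[0, +oo[%classic) _]indicE memNset ?mulr0 ?mul0r//=.
  by rewrite in_itv/= andbT; apply/negP; rewrite -ltNge (le_lt_trans h).
pose v' := v; have := law n v r j rn.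
rewrite (_ : _ `&` _ = D `&` phi1 @^-1` rect n r); last first.
  apply/seteqP; split=> w /=.
    move=> [[h1 h2] [/S_le[h3 h4] h5]]; split.
      split; last by [].
      by split=> // m mn; have /S_le[] := h2 m mn.
    move=> m; rewrite leq_eqVlt => /orP[/eqP -> //|mn].
    by have /S_le[] := h2 m mn.
  move=> [[[h1 h2] [h3 h4]] h5]; split.
    by split=> // m mn; apply/S_le; split; [exact: h2|apply: h5; exact: ltnW].
  by split=> //; apply/S_le; split=> //; exact: h5.
move=> E; transitivity (P (D `&` phi1 @^-1` rect n r)); first by [].
rewrite E {E}.
rewrite [RHS]integral_mkcond fubini_tonelli1; last 2 first.
- by apply/(measurable_restrictT _ mpre2)/measurable_EFinP; exact: measurable_funTS.
- by move=> x; rewrite /patch; case: ifP => // _; rewrite lee_fin.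
rewrite integral_mkcond; apply: eq_integral => w _; rewrite /fubini_F.
rewrite /patch; case: ifPn => hw.
  have [h1 h2] := set_mem hw.
  have pw : past n v w by split=> // m mn; have /S_le[] := h2 m mn.
  have svr m : (m < n)%N -> sv w m <= r m by move=> mn; have /S_le[] := h2 m mn.
  rewrite (_ : (fun u => _) = jd w); last first.
    have jE k : jump_local_time X S n k w = ltv v n k (sv w) by exact: jump_local_timeE.
    apply/funext => u; rewrite jE.
    rewrite (eq_bigr (fun k => W (v n) k * ltv v n k (sv w))); last by move=> k _; rewrite jE.
    by [].
  rewrite integral_jd// [LHS]integral_mkcond; apply: eq_integral => u _; rewrite /patch.
  have E : ((w, u) \in phi2 @^-1` rect n r) = (u <= r n).
    apply/idP/idP => [/set_mem /(_ n (leqnn n))|ur]; first by rewrite /phi2 /upd eqxx.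
    apply/mem_set => m; rewrite /phi2 /upd/= leq_eqVlt; case: (eqVneq m n) => [-> //|mn] /=.
    exact: svr.
  rewrite E mem_setE in_itv/=; case: (leP u (r n)) => ur; last by rewrite andbF.
  rewrite andbT /k2 indicE (mem_set pw) mul1r indicE mem_setE in_itv/= andbT.
  by case: ifP; rewrite ?mul1r ?mul0r.
apply/esym; apply: integral0_eq => u _; case: ifPn => // h.
have {}h := set_mem h.
rewrite /k2 indicE; case: (boolP (w \in past n v)) => [pw|_]; last by rewrite !mul0r.
exfalso; move/negP : hw; apply; apply/mem_set.
have [h1 h2] := set_mem pw; split=> // m mn; apply/S_le; split; first exact: h2.
by have := h m (ltnW mn); rewrite /phi2 /upd/= ltn_eqF.
Qed.

(** The joint law of the first n + 1 holding times and of the next vertex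
    visited. *)
Lemma joint_law (F : rspace R n -> \bar R) : measurable_fun setT F -> (forall t, 0 <= F t)%E ->
  (\int[P]_w (F (sv w) * (k1 w)%:E) =
   \int[P]_w \int[leb]_u (F (phi2 (w, u)) * (k2 (w, u))%:E))%E.
Proof.
move=> mF F0.
transitivity (\int[PL]_x (F (phi2 x) * (k2 x)%:E))%E; last first.
  rewrite fubini_tonelli1//.
    by apply: emeasurable_funM; [exact: measurableT_comp|exact/measurable_EFinP].
  by move=> x; rewrite mule_ge0// lee_fin.
rewrite -(integral_image_density PL mphi2 mk2 k20 mF F0).
rewrite -(integral_image_density P mphi1 mk1 k10 mF F0).
apply: eq_measure_integral => B mB _; apply: rspace_unique => // r.
rewrite /= /image_density integral_indic//; last first.
  by rewrite -[X in measurable X]setTI; apply: mphi1 => //; apply: sub_sigma_algebra; exists r.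
rewrite (le_lt_trans (probability_le1 _ _)) ?ltry//; apply: measurableI => //.
by rewrite -[X in measurable X]setTI; apply: mphi1 => //; apply: sub_sigma_algebra; exists r.
Qed.
End Step.
End JumpLaw.

(** * Functions smooth on the positive orthant *)
Section Region.
Context (R : realType) (V : finType).
Local Notation mR := (measurableTypeR R).
Implicit Types (f g h : (V -> R) -> R) (i j : V) (l : V -> R) (s : seq V).

Definition pos l := forall i, 0 < l i.
Definition ge1 l := forall i, 1 <= l i.
Definition eqr f g := forall l, pos l -> f l = g l.
Definition drv i f := forall l, pos l -> derivable (fun t => f (dfwith l i t)) (l i) 1.

Lemma ge1_pos l : ge1 l -> pos l.
Proof. by move=> h i; exact: lt_le_trans ltr01 (h i). Qed.
Lemma dfwith_self l i : dfwith l i (l i) = l.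
Proof.
apply/funext => j; have [<-|ij] := eqVneq i j; first by rewrite dfwithin.
by rewrite dfwithout.
Qed.
Lemma pos_dfwith l i r : pos l -> 0 < r -> pos (dfwith l i r).
Proof.
move=> hl hr j; have [<-|ij] := eqVneq i j; first by rewrite dfwithin.
by rewrite dfwithout.
Qed.
Lemma ge1_dfwith l i r : ge1 l -> 1 <= r -> ge1 (dfwith l i r).
Proof.
move=> hl hr j; have [<-|ij] := eqVneq i j; first by rewrite dfwithin.
by rewrite dfwithout.
Qed.
Lemma near_dfwith l i f g : eqr f g -> pos l ->
  \forall r \near l i, f (dfwith l i r) = g (dfwith l i r).
Proof.
move=> fg hl; near=> r; apply: fg; apply: pos_dfwith => //.
by near: r; exact: (cvgr_gt (l i) cvg_id).
Unshelve. all: by end_near. Qed.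

Lemma eqr_drv i f g : eqr f g -> drv i f -> drv i g.
Proof. by move=> fg df l hl; apply: near_eq_derivable (df l hl); exact: near_dfwith. Qed.
Lemma eqr_partial i f g : eqr f g -> eqr (partial i f) (partial i g).
Proof. by move=> fg l hl; rewrite /partial !derive1E; apply: near_eq_derive; exact: near_dfwith. Qed.
Lemma eqr_partials s f g : eqr f g -> eqr (partials s f) (partials s g).
Proof. by move=> fg; elim: s => //= i s; exact: eqr_partial. Qed.
Lemma eqr_sym f g : eqr f g -> eqr g f. Proof. by move=> h l /h. Qed.
Lemma eqr_trans f g h : eqr f g -> eqr g h -> eqr f h.
Proof. by move=> h1 h2 l hl; rewrite h1 ?h2. Qed.

Lemma drv_is i f l : drv i f -> pos l ->
  is_derive (l i) (1 : R) (fun t => f (dfwith l i t)) (partial i f l).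
Proof. by move=> df hl; apply: DeriveDef; [exact: df|rewrite /partial derive1E]. Qed.
Lemma is_drv i f f' :
  (forall l, pos l -> is_derive (l i) (1 : R) (fun t => f (dfwith l i t)) (f' l)) ->
  drv i f /\ eqr (partial i f) f'.
Proof.
move=> h; split=> l hl; first by have [] := h l hl.
by rewrite /partial derive1E; have [_] := h l hl.
Qed.
Lemma drvD i f g : drv i f -> drv i g ->
  drv i (fun l => f l + g l) /\ eqr (partial i (fun l => f l + g l)) (fun l => partial i f l + partial i g l).
Proof. by move=> df dg; apply: is_drv => l hl; apply: is_deriveD; exact: drv_is. Qed.
Lemma drvM i f g : drv i f -> drv i g ->
  drv i (fun l => f l * g l) /\
  eqr (partial i (fun l => f l * g l)) (fun l => partial i f l * g l + f l * partial i g l).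
Proof.
move=> df dg; apply: is_drv => l hl.
apply: is_derive_eq (is_deriveM (drv_is df hl) (drv_is dg hl)) _.
by rewrite !dfwith_self /GRing.scale/= addrC mulrC.
Qed.
Lemma drvZ i (c : R) f : drv i f ->
  drv i (fun l => c * f l) /\ eqr (partial i (fun l => c * f l)) (fun l => c * partial i f l).
Proof.
by move=> df; apply: is_drv => l hl; exact: (is_deriveZ c (drv_is df hl)).
Qed.
Lemma drv_exp i f : drv i f ->
  drv i (fun l => expR (f l)) /\
  eqr (partial i (fun l => expR (f l))) (fun l => partial i f l * expR (f l)).
Proof.
move=> df; apply: is_drv => l hl.
apply: is_derive_eq (is_derive1_comp (is_derive_expR (f (dfwith l i (l i)))) (drv_is df hl)) _.
by rewrite dfwith_self mulrC.
Qed.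

(** Measurability of f along random points of [1, +oo[^V. *)
Definition mV1 f := forall d (T : measurableType d) (x : T -> V -> R),
  (forall i, measurable_fun setT (fun w => x w i)) -> (forall w, ge1 (x w)) ->
  measurable_fun setT (fun w => f (x w)).
Lemma mV1W f : measurableV f -> mV1 f. Proof. by move=> mf d T x mx _; exact: mf. Qed.

(** n times differentiable on the positive orthant, all derivatives being
    dominated on [1, +oo[^V by weights in B. *)
Fixpoint CB (B : set ((V -> R) -> R)) n f : Prop :=
  [/\ mV1 f, exists2 b, B b & forall l, ge1 l -> `|f l| <= b l &
      if n is n'.+1 then forall i, drv i f /\ CB B n' (partial i f) else True].

Lemma CB_ext B n f g : eqr f g -> CB B n f -> CB B n g.
Proof.
elim: n f g => [|n IHn] f g fg /= [mf [b Bb fb] hf].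
  split=> //; last by exists b => // l hl; rewrite -fg//; [exact: fb|exact: ge1_pos].
  move=> d T x mx x1; rewrite (_ : (fun w => _) = (fun w => f (x w))); first exact: mf.
  by apply/funext => w; rewrite fg//; exact: ge1_pos.
split.
- move=> d T x mx x1; rewrite (_ : (fun w => _) = (fun w => f (x w))); first exact: mf.
  by apply/funext => w; rewrite fg//; exact: ge1_pos.
- by exists b => // l hl; rewrite -fg//; [exact: fb|exact: ge1_pos].
- move=> i; have [df cf] := hf i; split; first exact: eqr_drv df.
  by apply: IHn cf; exact: eqr_partial.
Qed.
Lemma CB_sub B B' n f :
  (forall b, B b -> exists2 b', B' b' & forall l, ge1 l -> b l <= b' l) -> CB B n f -> CB B' n f.
Proof.
move=> BB; elim: n f => [|n IHn] f /= [mf [b /BB[b' Bb' bb] fb] hf]; split=> //.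
- by exists b' => // l hl; exact: le_trans (fb l hl) (bb l hl).
- by exists b' => // l hl; exact: le_trans (fb l hl) (bb l hl).
- by move=> i; have [df cf] := hf i; split=> //; exact: IHn.
Qed.
Lemma CBW B m n f : (m <= n)%N -> CB B n f -> CB B m f.
Proof.
elim: n m f => [|n IHn] [|m] f//= mn [mf hb hf]; split=> // i.
by have [df cf] := hf i; split=> //; exact: IHn cf.
Qed.
Lemma CB0 B n f : CB B n f -> mV1 f /\ exists2 b, B b & forall l, ge1 l -> `|f l| <= b l.
Proof. by case: n => [|n] /= []. Qed.

Lemma CBD B n f g :
  (forall b b', B b -> B b' -> exists2 c, B c & forall l, ge1 l -> b l + b' l <= c l) ->
  CB B n f -> CB B n g -> CB B n (fun l => f l + g l).
Proof.
move=> BD; elim: n f g => [|n IHn] f g /= [mf [b Bb fb] hf] [mg [b' Bb' gb] hg].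
  split=> //; first by move=> d T x mx x1; apply: measurable_funD; [exact: mf|exact: mg].
  have [c Bc hc] := BD _ _ Bb Bb'; exists c => // l hl.
  by rewrite (le_trans (ler_normD _ _))// (le_trans _ (hc l hl))// lerD ?fb ?gb.
split.
- by move=> d T x mx x1; apply: measurable_funD; [exact: mf|exact: mg].
- have [c Bc hc] := BD _ _ Bb Bb'; exists c => // l hl.
  by rewrite (le_trans (ler_normD _ _))// (le_trans _ (hc l hl))// lerD ?fb ?gb.
- move=> i; have [[df cf] [dg cg]] := (hf i, hg i); have [h1 h2] := drvD df dg.
  by split=> //; apply: CB_ext (eqr_sym h2) _; exact: IHn.
Qed.

Lemma CBM B1 B2 B n f g :
  (forall b b', B b -> B b' -> exists2 c, B c & forall l, ge1 l -> b l + b' l <= c l) ->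
  (forall b b', B1 b -> B2 b' -> exists2 c, B c & forall l, ge1 l -> b l * b' l <= c l) ->
  CB B1 n f -> CB B2 n g -> CB B n (fun l => f l * g l).
Proof.
move=> BD BM; elim: n f g => [|n IHn] f g cf cg.
  have [mf [b Bb fb]] := CB0 cf; have [mg [b' Bb' gb]] := CB0 cg; split=> //.
    by move=> d T x mx x1; apply: measurable_funM; [exact: mf|exact: mg].
  have [c Bc hc] := BM _ _ Bb Bb'; exists c => // l hl.
  by rewrite normrM (le_trans _ (hc l hl))// ler_pM ?fb ?gb.
have [mf [b Bb fb]] := CB0 cf; have [mg [b' Bb' gb]] := CB0 cg; split.
- by move=> d T x mx x1; apply: measurable_funM; [exact: mf|exact: mg].
- have [c Bc hc] := BM _ _ Bb Bb'; exists c => // l hl.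
  by rewrite normrM (le_trans _ (hc l hl))// ler_pM ?fb ?gb.
- move=> i; have [_ _ /(_ i)[df cf']] := cf; have [_ _ /(_ i)[dg cg']] := cg.
  have [h1 h2] := drvM df dg; split=> //; apply: CB_ext (eqr_sym h2) _.
  apply: CBD => //; apply: IHn => //; first exact: CBW cg.
  exact: CBW cf.
Qed.

(** Leibniz' rule. *)
Fixpoint masks n : seq bitseq :=
  if n is n'.+1 then map (cons true) (masks n') ++ map (cons false) (masks n') else [:: [::]].

Lemma partials_drv B n f s : CB B n f -> (size s <= n)%N ->
  (exists2 b, B b & forall l, ge1 l -> `|partials s f l| <= b l) /\ mV1 (partials s f) /\
  ((size s < n)%N -> forall i, drv i (partials s f)).
Proof.
elim/last_ind: s n f => [|s j IHs] n f cf.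
  move=> _; have [mf hb] := CB0 cf; split=> //; split=> // n0 i; case: n cf n0 {hb} => // n cf _.
  by case: cf => _ _ /(_ i)[].
rewrite size_rcons; case: n cf => // n [_ _ /(_ j)[df cf]] sn.
by rewrite /partials foldr_rcons -/(partials _ _); exact: IHs.
Qed.

Lemma leibniz B1 B2 n f g s : CB B1 n f -> CB B2 n g -> (size s <= n)%N ->
  eqr (partials s (fun l => f l * g l))
    (fun l => \sum_(m <- masks (size s)) partials (mask m s) f l * partials (mask (map negb m) s) g l).
Proof.
move=> cf cg; elim: s => [|i s IHs] sn l hl /=; first by rewrite big_seq1.
have {}IHs := IHs (ltnW sn).
rewrite big_cat/= !big_map.
have hd m : drv i (fun l => partials (mask m s) f l * partials (mask (map negb m) s) g l) /\
  eqr (partial i (fun l => partials (mask m s) f l * partials (mask (map negb m) s) g l))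
   (fun l => partials (mask (true :: m) (i :: s)) f l * partials (mask (map negb (true :: m)) (i :: s)) g l +
     partials (mask (false :: m) (i :: s)) f l * partials (mask (map negb (false :: m)) (i :: s)) g l).
  have sm (m' : bitseq) : (size (mask m' s) < n)%N.
    by apply: leq_ltn_trans sn; rewrite size_subseq// mask_subseq.
  have [_ [_ /(_ (sm _) i) df]] := partials_drv cf (ltnW (sm m)).
  have [_ [_ /(_ (sm _) i) dg]] := partials_drv cg (ltnW (sm (map negb m))).
  exact: drvM df dg.
rewrite (eqr_partial i IHs)//.
elim: (masks (size s)) => [|m ms IHm].
  rewrite !big_nil addr0; under eq_fun do rewrite big_nil.
  by rewrite /partial derive1E derive_cst.
have drvs r : drv i (fun l => \sum_(m <- r) partials (mask m s) f l * partials (mask (map negb m) s) g l).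
  elim: r => [|m' r IHr]; first by under eq_fun do rewrite big_nil; move=> l' hl'; exact: derivable_cst.
  under eq_fun do rewrite big_cons.
  exact: (drvD (hd m').1 IHr).1.
under eq_fun do rewrite big_cons.
rewrite (drvD (hd m).1 (drvs ms)).2// (hd m).2// IHm !big_cons.
by rewrite /= !addrA; congr (_ + _); rewrite -!addrA; congr (_ + _); rewrite addrC.
Qed.
End Region.

(** * A space-time harmonic function of the jump process *)
Section Harmonic.
Context (R : realType) (V : finType) (a : V) (e : rel V) (W : V -> V -> R).
Hypothesis hG : weighted_graph e W.
Variables (k c : V -> R).
Hypotheses (hk : forall i, \sum_j W i j < k i) (c0 : forall i, 0 <= c i) (ca : c a = 1)
  (cU : forall i, i != a -> \sum_j Amat W k i j * c j = 0).
Local Notation leb := (@lebesgue_measure R).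
Implicit Types (l x : V -> R) (i j : V).

Lemma Amat_sum (kk : V -> R) i x : \sum_j Amat W kk i j * x j = kk i * x i - \sum_j W i j * x j.
Proof.
rewrite /Amat (eq_bigr (fun j => (i == j)%:R * (kk i * x j) - W i j * x j)); last by move=> j _; ring.
by rewrite sumrB (sum_diag (fun i j => kk i * x j)).
Qed.

Definition bb i : R := \sum_j W i j * c j.
Definition KK i : R := if i == a then bb a else k i.
Definition qq l : R := expR (- 2^-1 * quadf (Amat W KK) l).
Definition hh i l : R := c i * (\prod_(j | j != i) l j) * qq l.
Definition pe l : R := (\prod_j l j) * qq l.
Definition Lr i l : R := \sum_j W i j * l j.

Lemma KKc i : KK i * c i = bb i.
Proof.
rewrite /KK; have [->|ia] := eqVneq i a; first by rewrite ca mulr1.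
by have := cU ia; rewrite Amat_sum => /eqP; rewrite subr_eq0 => /eqP.
Qed.
Lemma bb_ge0 i : 0 <= bb i.
Proof. by rewrite sumr_ge0// => j _; rewrite mulr_ge0// (Wge0 hG). Qed.

Lemma hh_sum i l l' : (forall j, j != i -> l' j = l j) ->
  \sum_j W i j * l j * hh j l' = bb i * pe l'.
Proof.
move=> ll; rewrite /bb mulr_suml; apply: eq_bigr => j _.
have [->|ji] := eqVneq j i; first by rewrite (Wdiag hG) !mul0r.
by rewrite /hh /pe -(ll j ji) [in RHS](bigD1 j)//=; ring.
Qed.

Lemma is_derive_quadf A l i (r : R) : (forall j m, A j m = A m j) ->
  is_derive r (1 : R) (fun r => quadf A (dfwith l i r)) (2 * \sum_j A i j * dfwith l i r j).
Proof.
move=> sA.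
have d1 j : is_derive r (1 : R) (fun r => dfwith l i r j) (i == j)%:R.
  have [<-|ij] := eqVneq i j.
    by rewrite (_ : (fun r => _) = id); [exact: is_derive_id|apply/funext => q; rewrite dfwithin].
  rewrite (_ : (fun r => _) = cst (l j)); first exact: is_derive_cst.
  by apply/funext => q; rewrite dfwithout.
have d2 j m : is_derive r (1 : R) (fun r => A j m * dfwith l i r j * dfwith l i r m)
    ((i == j)%:R * (A j m * dfwith l i r m) + (i == m)%:R * (A j m * dfwith l i r j)).
  apply: is_derive_eq (is_deriveM (is_deriveZ (A j m) (d1 j)) (d1 m)) _.
  by rewrite /GRing.scale/= /GRing.scale/=; ring.
have d3 j := is_derive_sum_seq (index_enum V) (P := xpredT) (fun m _ => d2 j m).
have d4 := is_derive_sum_seq (index_enum V) (P := xpredT) (fun j _ => d3 j).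
apply: is_derive_eq d4 _.
under eq_bigr do rewrite big_split/=.
rewrite big_split/= exchange_big/=.
rewrite (eq_bigr (fun m => A i m * dfwith l i r m)); last first.
  by move=> m _; rewrite (sum_diag (fun _ j => A j m * dfwith l i r m)).
rewrite [X in _ + X](eq_bigr (fun m => A i m * dfwith l i r m)); last first.
  by move=> m _; rewrite (sum_diag (fun _ j => A m j * dfwith l i r m)) sA.
by rewrite mulr_natl mulr2n.
Qed.

Section Flow.
Variables (i : V) (l : V -> R).
Definition flow (u : R) : V -> R := dfwith l i (l i + u).
Definition Fh (u : R) : R := - (expR (- Lr i l * u) * hh i (flow u)).
Definition fh (u : R) : R := expR (- Lr i l * u) * (bb i * pe (flow u)).

Lemma Lr_flow u : Lr i (flow u) = Lr i l.
Proof.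
apply: eq_bigr => j _; have [->|ij] := eqVneq i j; first by rewrite (Wdiag hG) !mul0r.
by rewrite /flow dfwithout.
Qed.

Lemma KK_sym j m : Amat W KK j m = Amat W KK m j. Proof. exact: (Amat_sym hG). Qed.

Lemma is_derive_Fh u : is_derive u (1 : R) Fh (fh u).
Proof.
have ds : is_derive u (1 : R) (fun u : R => l i + u) 1.
  by have := is_deriveD (is_derive_cst (l i) u 1) (is_derive_id u 1); rewrite add0r.
have dq := @is_derive1_comp R (fun r => quadf (Amat W KK) (dfwith l i r)) (fun u => l i + u) u _ _
  (is_derive_quadf l i (l i + u) KK_sym) ds.
have dE : is_derive u (1 : R) (fun u => - Lr i l * u - 2^-1 * quadf (Amat W KK) (flow u))
    (- (KK i * (l i + u))).
  have dl : is_derive u (1 : R) (fun u : R => - Lr i l * u) (- Lr i l).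
    by have := is_deriveZ (- Lr i l) (is_derive_id u 1); rewrite /GRing.scale/= mulr1.
  apply: is_derive_eq (is_deriveB dl (is_deriveZ 2^-1 dq)) _.
  rewrite Amat_sum -/(flow u) -/(Lr i (flow u)) Lr_flow {1}/flow dfwithin /GRing.scale/=; by field.
pose p := c i * \prod_(j | j != i) l j.
have FE v : Fh v = - p * expR (- Lr i l * v - 2^-1 * quadf (Amat W KK) (flow v)).
  rewrite /Fh /hh /qq expRD (_ : \prod_(j | j != i) flow v j = \prod_(j | j != i) l j); last first.
    by apply: eq_bigr => j ji; rewrite /flow dfwithout// eq_sym.
  by rewrite -/p !mulNr; ring.
have key := is_deriveZ (- p) (is_derive1_comp (is_derive_expR _) dE).
have E : \forall v \near u, ((- p) \*: (expR \o (fun v => - Lr i l * v - 2^-1 * quadf (Amat W KK) (flow v)))) v = Fh v.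
  by near=> v; rewrite FE.
apply: is_derive_eq (@near_eq_is_derive _ _ _ _ Fh u 1 _ E key) _.
have flow_i : flow u i = l i + u by rewrite /flow dfwithin.
rewrite /fh /pe -KKc (bigD1 i)//= flow_i /qq expRD.
rewrite (_ : \prod_(j | j != i) flow u j = \prod_(j | j != i) l j); last first.
  by apply: eq_bigr => j ji; rewrite /flow dfwithout// eq_sym.
by rewrite /p /GRing.scale/= /GRing.scale/= !mulNr; ring.
Unshelve. all: by end_near. Qed.

Lemma continuous_fh : continuous fh.
Proof.
move=> u.
have ds : is_derive u (1 : R) (fun u : R => l i + u) 1.
  by have := is_deriveD (is_derive_cst (l i) u 1) (is_derive_id u 1); rewrite add0r.
have dq := @is_derive1_comp R (fun r => quadf (Amat W KK) (dfwith l i r)) (fun u => l i + u) u _ _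
  (is_derive_quadf l i (l i + u) KK_sym) ds.
pose p := bb i * \prod_(j | j != i) l j.
have dl : is_derive u (1 : R) (fun u : R => - Lr i l * u) (- Lr i l).
  by have := is_deriveZ (- Lr i l) (is_derive_id u 1); rewrite /GRing.scale/= mulr1.
have dE := is_deriveB dl (is_deriveZ 2^-1 dq).
have fE v : fh v = p * (l i + v) * expR (- Lr i l * v - 2^-1 * quadf (Amat W KK) (flow v)).
  rewrite /fh /pe /qq (bigD1 i)//= {1}/flow dfwithin expRD.
  rewrite (_ : \prod_(j | j != i) flow v j = \prod_(j | j != i) l j); last first.
    by apply: eq_bigr => j ji; rewrite /flow dfwithout// eq_sym.
  by rewrite /p !mulNr; ring.
have key := is_deriveM (is_deriveZ p ds) (is_derive1_comp (is_derive_expR _) dE).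
have E : \forall v \near u, ((p \*: (fun v => l i + v)) * (expR \o (fun v => - Lr i l * v - 2^-1 * quadf (Amat W KK) (flow v)))) v = fh v.
  by near=> v; rewrite fE.
have [dd _] := @near_eq_is_derive _ _ _ _ fh u 1 _ E key.
exact: (differentiable_continuous (proj1 (derivable1_diffP _ _) dd)).
Unshelve. all: by end_near. Qed.

Lemma continuous_Fh : continuous Fh.
Proof.
move=> u; have [dd _] := is_derive_Fh u.
exact: (differentiable_continuous (proj1 (derivable1_diffP _ _) dd)).
Qed.

Lemma flow0 : flow 0 = l. Proof. by rewrite /flow addr0 dfwith_self. Qed.
Lemma Fh0 : Fh 0 = - hh i l. Proof. by rewrite /Fh mulr0 expR0 mul1r flow0. Qed.

Lemma integral_fh (t : R) : 0 < t ->
  (\int[leb]_(u in `[0%R, t]) (fh u)%:E =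
   (hh i l - expR (- Lr i l * t) * hh i (flow t))%:E)%E.
Proof.
move=> t0; rewrite (@continuous_FTC2 R fh Fh 0 t t0).
- by rewrite -EFinB Fh0 opprK addrC.
- exact/continuous_subspaceT/continuous_fh.
- split.
  + by move=> u _; have [] := is_derive_Fh u.
  + by apply: cvg_at_right_filter; exact: continuous_Fh.
  + by apply: cvg_at_left_filter; exact: continuous_Fh.
- by move=> u _; rewrite derive1E; have [_] := is_derive_Fh u.
Qed.
End Flow.

Lemma hh_ge0 i l : (forall j, 0 <= l j) -> 0 <= hh i l.
Proof. by move=> l0; rewrite /hh mulr_ge0 ?expR_ge0// mulr_ge0// prodr_ge0. Qed.

Lemma hh_bound (gam : R) : exists C, 0 <= C /\ exists2 dl, 0 < dl &
  forall i l, (forall j, 1 <= l j) -> l a <= gam -> hh i l <= C * expR (- (dl * \sum_j l j)).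
Proof.
have [lm [lm0 hlm]] := quadf_Amat_ge hG hk.
pose D := 4 / lm; pose cm := \sum_j c j; pose B := `|KK a - k a| * gam ^+ 2.
have D0 : 0 < D by rewrite divr_gt0.
have cm0 : 0 <= cm by rewrite sumr_ge0.
exists (cm * D ^+ #|V| * expR (2^-1 * B)); split.
  by rewrite !mulr_ge0 ?exprn_ge0 ?expR_ge0 ?(ltW D0).
exists (lm / 4) => [|i l l1 lg]; first by rewrite divr_gt0.
have l0 j : 0 <= l j by exact: le_trans ler01 (l1 j).
pose Q := \sum_j l j ^+ 2.
have hq : lm * Q - B <= quadf (Amat W KK) l.
  have -> : quadf (Amat W KK) l = quadf (Amat W k) l + (KK a - k a) * l a ^+ 2.
    rewrite /quadf; under eq_bigr => j _.
      under eq_bigr => m _ do rewrite mulrAC.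
      rewrite -mulr_suml Amat_sum; over.
    under [X in X + _]eq_bigr => j _.
      under eq_bigr => m _ do rewrite mulrAC.
      rewrite -mulr_suml Amat_sum; over.
    rewrite (bigD1 a)//= [X in _ = X + _](bigD1 a)//= [X in _ + X = _](eq_bigr (fun j => (k j * l j - \sum_m W j m * l m) * l j)).
      by move: (\sum_(_ | _) _) => z; ring.
    by move=> j ja; rewrite {1}/KK (negPf ja).
  have h1 := hlm l; have h2 : - B <= (KK a - k a) * l a ^+ 2.
    rewrite lerNl (le_trans (ler_norm _))// normrN normrM /B ler_wpM2l//.
    by rewrite ger0_norm ?sqr_ge0// lerXn2r ?nnegrE// (le_trans (l0 a)).
  by rewrite -/Q in h1; move: (lm * Q) h1 h2 => z; lra.
have hp : \prod_(j | j != i) l j <= D ^+ #|V| * expR (lm / 4 * Q).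
  apply: (@le_trans _ _ (\prod_j (D * expR (lm / 4 * l j ^+ 2)))).
    rewrite [leRHS](bigD1 i)//= -[leLHS]mul1r ler_pM ?prodr_ge0//.
      have h : 1 <= lm / 4 * l i ^+ 2 \/ True by right.
      have e1 : lm / 4 * l i ^+ 2 <= expR (lm / 4 * l i ^+ 2).
        by rewrite (le_trans _ (expR_ge1Dx _))// lerDr.
      rewrite (le_trans _ (ler_wpM2l (ltW D0) e1))// mulrA (_ : D * _ = 1).
        by rewrite mul1r exprn_ege1.
      by rewrite /D; field; rewrite gt_eqF.
    apply: ler_prod => j _; rewrite l0/=.
    have e1 : lm / 4 * l j ^+ 2 <= expR (lm / 4 * l j ^+ 2).
      by rewrite (le_trans _ (expR_ge1Dx _))// lerDr.
    rewrite (le_trans _ (ler_wpM2l (ltW D0) e1))// mulrA (_ : D * _ = 1).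
      by rewrite mul1r expr2 ler_peMr.
    by rewrite /D; field; rewrite gt_eqF.
  by rewrite big_split/= prodr_const -expR_sum mulr_sumr.
have ci : c i <= cm by rewrite /cm (bigD1 i)//= lerDl sumr_ge0.
have QS : \sum_j l j <= Q by apply: ler_sum => j _; rewrite expr2 ler_peMr.
rewrite /hh /qq.
apply: (@le_trans _ _ (cm * (D ^+ #|V| * expR (lm / 4 * Q)) * expR (- 2^-1 * (lm * Q - B)))).
  rewrite ler_pM ?expR_ge0 ?mulr_ge0 ?prodr_ge0//; first by rewrite ler_pM ?prodr_ge0.
  by rewrite ler_expR !mulNr lerN2 ler_wpM2l.
rewrite -!mulrA ler_wpM2l// ler_wpM2l ?exprn_ge0 ?(ltW D0)// -!expRD ler_expR.
have := ler_wpM2l (ltW lm0) QS; move: (\sum_j l j) => T.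
by rewrite ?(mulrCA lm 4^-1); move: (lm * Q) (lm * T) => x y; clearbody B; lra.
Qed.

Lemma integral_fh_infty i l : i != a -> (forall j, 1 <= l j) ->
  (\int[leb]_(u in `[0%R, +oo[) (fh i l u)%:E = (hh i l)%:E)%E.
Proof.
move=> ia l1; rewrite (@ge0_continuous_FTC2y R (fh i l) (Fh i l) 0 0).
- by rewrite Fh0 -EFinB sub0r opprK.
- move=> u u0; rewrite /fh mulr_ge0 ?expR_ge0// mulr_ge0 ?bb_ge0// mulr_ge0 ?expR_ge0//.
  rewrite prodr_ge0// => j _; rewrite /flow; have [<-|ij] := eqVneq i j.
    by rewrite dfwithin addr_ge0// (le_trans ler01).
  by rewrite dfwithout// (le_trans ler01).
- exact/continuous_subspaceT/continuous_fh.
- have [C [C0 [dl dl0 hC]]] := hh_bound (l a).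
  have lf u : 0 <= u -> forall j, 1 <= flow i l u j.
    move=> u0 j; rewrite /flow; have [<-|ij] := eqVneq i j; last by rewrite dfwithout.
    by rewrite dfwithin (le_trans (l1 i))// lerDl.
  have L0 : 0 <= Lr i l by rewrite sumr_ge0// => j _; rewrite mulr_ge0 ?(Wge0 hG)// (le_trans ler01).
  apply/cvgrPdist_le => eps eps0; near=> u.
  have u0 : 0 <= u by near: u; exact: nbhs_pinfty_ge.
  have hu : (eps * dl)^-1 * C <= u by near: u; apply: nbhs_pinfty_ge; exact: num_real.
  rewrite sub0r normrN /Fh normrN ger0_norm; last first.
    by rewrite mulr_ge0 ?expR_ge0// hh_ge0// => j; rewrite (le_trans ler01)// lf.
  have fa : flow i l u a <= l a by rewrite /flow dfwithout.
  apply: (@le_trans _ _ (C * expR (- (dl * u)))).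
    rewrite -[leRHS]mul1r ler_pM ?expR_ge0//.
    + by rewrite hh_ge0// => j; rewrite (le_trans ler01)// lf.
    + by rewrite -expR0 ler_expR mulNr oppr_le0 mulr_ge0.
    rewrite (le_trans (hC i _ (lf u u0) fa))// ler_wpM2l// ler_expR lerN2 ler_wpM2l ?(ltW dl0)//.
    rewrite (bigD1 i)//=; have fi : flow i l u i = l i + u by rewrite /flow dfwithin.
    have s0 : 0 <= \sum_(j | j != i) flow i l u j.
      by apply: sumr_ge0 => j _; rewrite (le_trans ler01)// lf.
    by rewrite fi; have := l1 i; move: (\sum_(_ | _) _) s0 => z; lra.
  have h : dl * u <= expR (dl * u) by rewrite (le_trans _ (expR_ge1Dx _))// lerDr.
  rewrite expRN ler_pdivrMr ?expR_gt0//.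
  rewrite (le_trans _ (ler_wpM2l (ltW eps0) h))// mulrA -ler_pdivrMl ?mulr_gt0//.
- by move=> u _; have [] := is_derive_Fh i l u.
- by apply: cvg_at_right_filter; exact: continuous_Fh.
- by move=> u _; rewrite derive1E; have [_] := is_derive_Fh i l u.
Unshelve. all: by end_near. Qed.
End Harmonic.

(** * Bernstein operators *)
Section Bernstein.
Context (R : realType).
Implicit Types (a b : nat -> R) (v : R) (N : nat).

Fixpoint bern N a v : R :=
  if N is N'.+1 then v * bern N' (a \o S) v + (1 - v) * bern N' a v else a 0%N.

Lemma bernD N a b v : bern N (fun j => a j + b j) v = bern N a v + bern N b v.
Proof. by elim: N a b => //= N IHN a b; rewrite !IHN; ring. Qed.
Lemma bernZ N (c : R) a v : bern N (fun j => c * a j) v = c * bern N a v.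
Proof. by elim: N a => //= N IHN a; rewrite !IHN; ring. Qed.
Lemma bern_cst N (c : R) v : bern N (fun=> c) v = c.
Proof. by elim: N => //= N ->; ring. Qed.
Lemma bern_ext N a b v : (forall j, (j <= N)%N -> a j = b j) -> bern N a v = bern N b v.
Proof.
elim: N a b => [|N IHN] a b ab /=; first exact: ab.
by rewrite (IHN a b) ?(IHN (a \o S) (b \o S))// => j jN; apply: ab => //; exact: leqW.
Qed.
Lemma bern_le N a b v : 0 <= v <= 1 -> (forall j, (j <= N)%N -> a j <= b j) ->
  bern N a v <= bern N b v.
Proof.
move=> /andP[v0 v1]; elim: N a b => [|N IHN] a b ab /=; first exact: ab.
rewrite lerD// ler_wpM2l ?subr_ge0// IHN// => j jN; apply: ab => //; exact: leqW.
Qed.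
Lemma bern_norm N a b v : 0 <= v <= 1 -> (forall j, (j <= N)%N -> `|a j| <= b j) ->
  `|bern N a v| <= bern N b v.
Proof.
move=> v01 ab; rewrite ler_norml; apply/andP; split; last first.
  by apply: bern_le => // j /ab; rewrite ler_norml => /andP[].
have -> : - bern N b v = bern N (fun j => - b j) v.
  by rewrite -mulN1r -bernZ; apply: bern_ext => j _; rewrite mulN1r.
by apply: bern_le => // j /ab; rewrite ler_norml => /andP[].
Qed.

Lemma bern1 N v : bern N (fun j => j%:R) v = N%:R * v.
Proof.
elim: N => [|N IHN] /=; first by rewrite mul0r.
rewrite (_ : (fun j => j%:R) \o S = fun j => j%:R + (1 : R)); last first.
  by apply/funext => j /=; rewrite -natr1.
by rewrite bernD bern_cst IHN -natr1; ring.
Qed.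
Lemma bern2 N v : bern N (fun j => j%:R ^+ 2) v = N%:R * v * (1 - v) + (N%:R * v) ^+ 2.
Proof.
elim: N => [|N IHN] /=; first by rewrite !mul0r expr0n/= addr0.
rewrite (_ : (fun j => j%:R ^+ 2) \o S = fun j => j%:R ^+ 2 + (2 * j%:R + (1 : R))); last first.
  by apply/funext => j /=; rewrite -natr1; ring.
by rewrite !bernD bernZ bern_cst bern1 IHN -natr1; ring.
Qed.
Lemma bern_var N v : (0 < N)%N ->
  bern N (fun j => (j%:R / N%:R - v) ^+ 2) v = v * (1 - v) / N%:R.
Proof.
move=> N0; have n0 : N%:R != 0 :> R by rewrite pnatr_eq0 -lt0n.
rewrite (@bern_ext _ _ (fun j => N%:R ^- 2 * (j%:R ^+ 2) + ((- 2 * v / N%:R) * j%:R + v ^+ 2))).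
  by rewrite !bernD !bernZ bern_cst bern1 bern2; field.
by move=> j _; field.
Qed.

Lemma is_derive_bern N a v :
  is_derive v (1 : R) (bern N.+1 a) (N.+1%:R * bern N (fun j => a j.+1 - a j) v).
Proof.
elim: N a => [|N IHN] a.
  rewrite (_ : bern 1 a = fun v => v * a 1%N + (1 - v) * a 0%N); last by apply/funext.
  apply: is_derive_eq; rewrite /GRing.scale/=; ring.
have d1 := IHN (a \o S); have d2 := IHN a.
have d0 : is_derive v (1 : R) (fun v : R => v) 1 by exact: is_derive_id.
have d3 : is_derive v (1 : R) (fun v : R => 1 - v) (- 1).
  by have h := is_deriveB (is_derive_cst (1 : R) v 1) d0; rewrite sub0r in h; exact: h.
rewrite (_ : bern N.+2 a = (fun v => v * bern N.+1 (a \o S) v) + (fun v => (1 - v) * bern N.+1 a v)); last by apply/funext.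
apply: is_derive_eq (is_deriveD (is_deriveM d0 d1) (is_deriveM d3 d2)) _.
have E : bern N.+1 (fun j => a j.+1 - a j) v = v * bern N (fun j => a j.+2 - a j.+1) v + (1 - v) * bern N (fun j => a j.+1 - a j) v by [].
have E2 : bern N.+1 (fun j => a j.+1 - a j) v = bern N.+1 (a \o S) v - bern N.+1 a v.
  rewrite -[- bern _ a v]mulN1r -bernZ -bernD; apply: bern_ext => j _ /=; by rewrite mulN1r.
have key (Dl A B p q n : R) : Dl = v * p + (1 - v) * q -> Dl = A - B ->
    v *: (n * p) + A *: 1 + ((1 - v) *: (n * q) + B *: -1) = (n + 1) * Dl.
  by move=> h1 h2; rewrite mulrDl mul1r {2}h2 h1 /GRing.scale/=; ring.
by rewrite -[N.+2%:R]natr1; exact: key E E2.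
Qed.

(** Bernstein's theorem, in a form that also yields the convergence of the
    derivatives: differences of consecutive samples are values of the
    derivative near j/N. The binomial law of parameters N and v concentrates
    at v. *)
Lemma bern_cvg (f : R -> R) (M v : R) (xi : nat -> nat -> R) : 0 <= v <= 1 -> 0 <= M ->
  (forall u, 0 <= u <= 1 -> `|f u| <= M) ->
  (forall eps, 0 < eps -> exists2 dl, 0 < dl &
     forall u, 0 <= u <= 1 -> `|u - v| < dl -> `|f u - f v| <= eps) ->
  (forall N j, (0 < N)%N -> (j <= N)%N ->
     0 <= xi N j <= 1 /\ `|xi N j - j%:R / N%:R| <= N%:R^-1) ->
  bern N (fun j => f (xi N j)) v @[N --> \oo] --> f v.
Proof.
move=> v01 M0 fM cf hxi.
apply/cvgrPdist_le => /= eps eps0.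
have [dl dl0 hd] := cf _ (divr_gt0 eps0 (ltr0Sn R 1)).
pose K := 8 * M / dl ^+ 2.
have K0 : 0 <= K by rewrite /K divr_ge0 ?sqr_ge0// mulr_ge0.
near=> N.
have N0 : (0 < N)%N by near: N; exact: nbhs_infty_gt.
have n0 : 0 < N%:R :> R by rewrite ltr0n.
have KN : K / N%:R <= eps / 2.
  rewrite ler_pdivrMr// -ler_pdivrMl ?divr_gt0//.
  by near: N; exact: nbhs_infty_ger.
rewrite distrC -[f v](bern_cst N _ v) -[X in `|_ - X|]mul1r -mulNr -bernZ -bernD.
have bd j : (j <= N)%N -> `|f (xi N j) + -1 * f v| <=
    eps / 2 + (2 * M / dl ^+ 2) * (2 * (j%:R / N%:R - v) ^+ 2 + 2 * N%:R ^- 2).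
  move=> jN; have [x01 xj] := hxi N j N0 jN; rewrite mulN1r.
  have c0 : 0 <= (2 * M / dl ^+ 2) * (2 * (j%:R / N%:R - v) ^+ 2 + 2 * N%:R ^- 2).
    apply: mulr_ge0; first by rewrite divr_ge0 ?sqr_ge0// mulr_ge0.
    by apply: addr_ge0; apply: mulr_ge0 => //; rewrite ?invr_ge0 sqr_ge0.
  have [near|far] := ltP `|xi N j - v| dl.
    by rewrite (le_trans (hd _ x01 near))// lerDl.
  apply: (@le_trans _ _ (2 * M)).
    by rewrite (le_trans (ler_normB _ _))// mulr_natl mulr2n lerD// fM.
  rewrite ler_wpDl ?divr_ge0 ?(ltW eps0)// -mulrA ler_peMr ?mulr_ge0//.
  rewrite mulrC ler_pdivlMr ?exprn_gt0// mul1r.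
  apply: (@le_trans _ _ ((xi N j - v) ^+ 2)).
    rewrite -[leRHS]real_normK ?num_real//; apply: lerXn2r; rewrite ?nnegrE//.
    exact: ltW.
  have h : (xi N j - j%:R / N%:R) ^+ 2 <= N%:R ^- 2.
    rewrite -[leLHS]real_normK ?num_real// -exprVn lerXn2r// nnegrE ?invr_ge0//.
  have -> : xi N j - v = (xi N j - j%:R / N%:R) + (j%:R / N%:R - v) by rewrite addrA subrK.
  move: (xi N j - _) (_ / _ - v) h => p q h.
  have -> : (p + q) ^+ 2 = 2 * p ^+ 2 + 2 * q ^+ 2 - (p - q) ^+ 2 by ring.
  by have := sqr_ge0 (p - q); move: (p ^+ 2) (q ^+ 2) ((p - q) ^+ 2) (N%:R ^- 2) h => ? ? ? ?; lra.
rewrite (le_trans (bern_norm v01 bd))// bernD bern_cst bernZ bernD bernZ bern_cst bern_var//.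
move/andP : v01 => [v0 v1].
have n1 : N%:R ^- 2 <= N%:R^-1 :> R.
  by rewrite lef_pV2 ?posrE ?exprn_gt0// expr2 ler_peMr ?(ltW n0)// ler1n.
have vv : v * (1 - v) / N%:R <= N%:R^-1.
  rewrite ler_piMl ?invr_ge0 ?(ltW n0)//; have := mulr_ge0 v0 v0; lra.
rewrite [leRHS](splitr eps) lerD2l (le_trans _ KN)// /K.
have -> : 8 * M / dl ^+ 2 / N%:R = 2 * M / dl ^+ 2 * (2 * N%:R^-1 + 2 * N%:R^-1) by field; rewrite !gt_eqF.
rewrite ler_wpM2l ?divr_ge0 ?mulr_ge0 ?sqr_ge0//; lra.
Unshelve. all: by end_near. Qed.
End Bernstein.

(** * Bernstein approximation in the variable exp(-(l^2 - 1)/2) *)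
Section OneVariable.
Context (R : realType).
Implicit Types (r u v : R) (N j : nat).

Definition vv r : R := expR (- (2^-1 * (r ^+ 2 - 1))).
Definition lam u : R := Num.sqrt (1 - 2 * ln u).

Lemma vv_gt0 r : 0 < vv r. Proof. exact: expR_gt0. Qed.
Lemma vv_le1 r : 1 <= r -> vv r <= 1.
Proof.
move=> r1; rewrite -expR0 ler_expR oppr_le0 mulr_ge0// subr_ge0.
by rewrite exprn_ege1.
Qed.
Lemma lam_arg u : 0 < u <= 1 -> 1 <= 1 - 2 * ln u.
Proof.
move=> /andP[u0 u1]; rewrite lerDl oppr_ge0 mulr_ge0_le0//.
exact: ln_le0.
Qed.
Lemma lam_sq u : 0 < u <= 1 -> lam u ^+ 2 = 1 - 2 * ln u.
Proof. by move=> hu; rewrite sqr_sqrtr// (le_trans ler01)// lam_arg. Qed.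
Lemma lam_ge1 u : 0 < u <= 1 -> 1 <= lam u.
Proof. by move=> hu; rewrite -[leLHS]sqrtr1 ler_wsqrtr// lam_arg. Qed.
Lemma lamK r : 1 <= r -> lam (vv r) = r.
Proof.
move=> r1; rewrite /lam /vv expRK (_ : 1 - 2 * _ = r ^+ 2); last by field.
by rewrite sqrtr_sqr ger0_norm// (le_trans ler01).
Qed.
Lemma expR_lam u : 0 < u <= 1 -> expR (- (2 * lam u ^+ 2)) <= u ^+ 2.
Proof.
move=> hu; have /andP[u0 u1] := hu; rewrite lam_sq//.
rewrite -[u in leRHS]lnK ?posrE// -expRM_natl ler_expR.
have := ln_le0 u1; move: (ln u) => q q0; lra.
Qed.
Lemma is_derive_lam u : 0 < u <= 1 -> is_derive u (1 : R) lam (- (u * lam u)^-1).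
Proof.
move=> hu; have /andP[u0 u1] := hu.
have a0 : 0 < 1 - 2 * ln u by exact: lt_le_trans ltr01 (lam_arg hu).
have h1 : is_derive u (1 : R) (fun u : R => 1 - 2 * ln u) (- (2 * u^-1)).
  have := is_deriveB (is_derive_cst (1 : R) u 1) (is_deriveZ 2 (is_derive1_ln u0)).
  by rewrite sub0r.
apply: is_derive_eq (@is_derive1_comp R Num.sqrt (fun u : R => 1 - 2 * ln u) u _ _
  (is_derive1_sqrt a0) h1) _; rewrite -/(lam u).
have l0 : lam u != 0 by rewrite gt_eqF// (lt_le_trans ltr01)// lam_ge1.
by move: (lam u) l0 => q q0; field; rewrite q0 gt_eqF.
Qed.
Lemma is_derive_vv r : is_derive r (1 : R) vv (- (r * vv r)).
Proof.
have h1 : is_derive r (1 : R) (fun r : R => - (2^-1 * (r ^+ 2 - 1))) (- r).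
  by apply: is_derive_eq; rewrite /GRing.scale/= ?expr1; field.
apply: is_derive_eq (is_derive1_comp (is_derive_expR _) h1) _.
by rewrite -/(vv r); ring.
Qed.

Section Approx.
Variables (phi dphi : R -> R) (C : R).
Hypotheses (C0 : 0 <= C)
  (dphiE : forall r, 0 < r -> is_derive r (1 : R) phi (dphi r))
  (cphi : forall r, 1 <= r -> {for r, continuous dphi})
  (phiC : forall r, 1 <= r -> `|phi r| <= C * expR (- (2 * r ^+ 2)))
  (dphiC : forall r, 1 <= r -> `|dphi r| <= C * expR (- (2 * r ^+ 2))).

Definition sample N j : R := if j == 0%N then 0 else phi (lam (j%:R / N%:R)).
Let f u : R := if u <= 0 then 0 else phi (lam u).
Let f' u : R := if u <= 0 then 0 else - dphi (lam u) / (u * lam u).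

Let fC u : 0 <= u <= 1 -> `|f u| <= C * u.
Proof.
move=> /andP[u0 u1]; rewrite /f; have [_|up] := leP u 0; first by rewrite normr0 mulr_ge0.
have hu : 0 < u <= 1 by rewrite up.
rewrite (le_trans (phiC (lam_ge1 hu)))// ler_wpM2l// (le_trans (expR_lam hu))//.
by rewrite expr2 ler_piMl.
Qed.
Let f'C u : 0 <= u <= 1 -> `|f' u| <= C.
Proof.
move=> /andP[u0 u1]; rewrite /f'; have [_|up] := leP u 0; first by rewrite normr0.
have hu : 0 < u <= 1 by rewrite up.
have l1 := lam_ge1 hu; have lp : 0 < lam u by exact: lt_le_trans ltr01 l1.
rewrite normrM normrN normfV [`|u * _|]ger0_norm ?mulr_ge0 ?(ltW lp)//.
rewrite ler_pdivrMr ?mulr_gt0// (le_trans (dphiC l1))// ler_wpM2l//.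
rewrite (le_trans (expR_lam hu))// expr2 ler_wpM2l// (le_trans u1)//.
Qed.
Let df u : 0 < u <= 1 -> is_derive u (1 : R) f (f' u).
Proof.
move=> hu; have /andP[up u1] := hu.
have l1 := lam_ge1 hu; have lp : 0 < lam u by exact: lt_le_trans ltr01 l1.
have h := @is_derive1_comp R phi lam u _ _ (dphiE lp) (is_derive_lam hu).
apply: (@near_eq_is_derive _ _ _ (phi \o lam)).
  near=> q; rewrite /f leNgt (_ : 0 < q)//.
  by near: q; exact: (cvgr_gt u cvg_id).
apply: is_derive_eq h _; rewrite /f' leNgt up/=; rewrite mulrN mulNr//.
Unshelve. all: by end_near. Qed.
Let cf u : 0 <= u <= 1 -> {for u, continuous f}.
Proof.
move=> /andP[u0 u1]; move: u0; rewrite le_eqVlt => /orP[/eqP <-|up]; last first.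
  have hu : 0 < u <= 1 by rewrite up.
  have [dd _] := df hu.
  exact: (differentiable_continuous (proj1 (derivable1_diffP _ _) dd)).
apply/cvgrPdist_le => eps eps0; have f0 : f 0 = 0 by rewrite /f lexx.
have c1 : 0 < C + 1 by rewrite ltr_wpDl.
near=> q; rewrite f0 sub0r normrN.
have [q0|q0] := leP q 0; first by rewrite /f q0 normr0 ltW.
have q1 : q <= 1 by near: q; exact: (cvgr_le 0 cvg_id).
rewrite (le_trans (fC _)) ?(ltW q0)//.
apply: (@le_trans _ _ ((C + 1) * q)); first by rewrite ler_wpM2r ?(ltW q0)// lerDl.
rewrite mulrC -ler_pdivlMr//; near: q; apply: (cvgr_le 0 cvg_id).
by rewrite divr_gt0.
Unshelve. all: by end_near. Qed.

Let modulus (g : R -> R) v : {for v, continuous g} -> forall eps : R, 0 < eps ->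
  exists2 dl : R, 0 < dl & forall u, 0 <= u <= 1 -> `|u - v| < dl -> `|g u - g v| <= eps.
Proof.
move=> /cvgrPdist_le cg eps /cg; rewrite near_simpl => -[dl /= dl0 h]; exists dl => // u _ uv.
by rewrite distrC; apply: h; rewrite /ball_/= distrC.
Qed.

Lemma sampleE N j : (0 < N)%N -> sample N j = f (j%:R / N%:R).
Proof.
move=> N0; rewrite /sample /f; case: j => [|j] /=; first by rewrite mul0r lexx.
by rewrite leNgt divr_gt0 ?ltr0n.
Qed.
Let unit_ratio N j : (j <= N)%N -> 0 <= (j%:R / N%:R : R) <= 1.
Proof.
move=> jN; rewrite divr_ge0//=; case: N jN => [|N] jN; first by rewrite invr0 mulr0.
by rewrite ler_pdivrMr ?ltr0n// mul1r ler_nat.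
Qed.

Lemma sample_cvg r : 1 <= r ->
  bern N.+1 (sample N.+1) (vv r) @[N --> \oo] --> phi r.
Proof.
move=> r1; have v01 : 0 <= vv r <= 1 by rewrite ltW ?vv_gt0//= vv_le1.
rewrite (_ : phi r = f (vv r)); last by rewrite /f leNgt vv_gt0/= lamK.
have := @bern_cvg R f C (vv r) (fun N j => j%:R / N%:R) v01 C0 _ (modulus (cf v01)) _.
rewrite -(cvg_shiftS (fun N => bern N _ _)).
have -> : [sequence bern N.+1 (fun j => f (j%:R / N.+1%:R)) (vv r)]_N =
    (fun N => bern N.+1 (sample N.+1) (vv r)).
  by apply/funext => N; apply: bern_ext => j _; rewrite sampleE.
apply.
- move=> u u01; rewrite (le_trans (fC u01))// ler_piMr//.
  by case/andP: u01.
- move=> N j N0 jN; split; first exact: unit_ratio.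
  by rewrite subrr normr0 invr_ge0.
Qed.
Lemma sample_bound r N : 1 <= r -> `|bern N.+1 (sample N.+1) (vv r)| <= C.
Proof.
move=> r1; have v01 : 0 <= vv r <= 1 by rewrite ltW ?vv_gt0//= vv_le1.
rewrite (le_trans (bern_norm (b := fun=> C) v01 _)) ?bern_cst// => j jN.
have u01 := unit_ratio jN.
by rewrite sampleE// (le_trans (fC u01))// ler_piMr//; case/andP: u01.
Qed.

Definition dsample N r : R :=
  - (r * vv r) * (N.+1%:R * bern N (fun j => sample N.+1 j.+1 - sample N.+1 j) (vv r)).
Lemma is_derive_sample N r :
  is_derive r (1 : R) (fun r => bern N.+1 (sample N.+1) (vv r)) (dsample N r).
Proof.
apply: is_derive_eq (is_derive1_comp (is_derive_bern N (sample N.+1) (vv r)) (is_derive_vv r)) _.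
by rewrite mulrC.
Qed.

Let mvt N j : (j <= N)%N -> exists2 xi, (j%:R / N.+1%:R < xi < j.+1%:R / N.+1%:R) &
  N.+1%:R * (sample N.+1 j.+1 - sample N.+1 j) = f' xi.
Proof.
move=> jN; rewrite !sampleE//.
have n0 : 0 < N.+1%:R :> R by rewrite ltr0n.
have ab : j%:R / N.+1%:R < j.+1%:R / N.+1%:R :> R by rewrite ltr_pM2r ?invr_gt0// ltr_nat.
have a01 : 0 <= (j%:R / N.+1%:R : R) <= 1 by apply: unit_ratio; exact: leqW.
have b01 : 0 <= (j.+1%:R / N.+1%:R : R) <= 1 by exact: unit_ratio.
have [||xi] := @MVT R f f' _ _ ab.
- move=> x; rewrite in_itv/= => /andP[ax xb]; apply: df.
  move/andP: a01 => [a0 _]; move/andP: b01 => [_ b1].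
  by rewrite (le_lt_trans a0 ax)/= ltW// (lt_le_trans xb).
- apply/continuous_in_subspaceT => x; rewrite inE/= in_itv/= => /andP[ax xb]; apply: cf.
  move/andP: a01 => [a0 _]; move/andP: b01 => [_ b1].
  by rewrite (le_trans a0 ax)/= (le_trans xb).
rewrite in_itv/= => xiI E; exists xi => //.
by rewrite E -mulrBl -natrB ?leqnSn// subSnn mul1r mulrCA mulfV ?mulr1// gt_eqF.
Qed.

Lemma dsample_cvg r : 1 <= r -> dsample N r @[N --> \oo] --> dphi r.
Proof.
move=> r1; have v01 : 0 <= vv r <= 1 by rewrite ltW ?vv_gt0//= vv_le1.
have v1 : 0 < vv r <= 1 by rewrite vv_gt0 vv_le1.
have r0 : 0 < r by exact: lt_le_trans ltr01 r1.
rewrite (_ : dphi r = - (r * vv r) * f' (vv r)); last first.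
  rewrite /f' leNgt vv_gt0/= lamK//; have := gt_eqF (vv_gt0 r); move: (vv r) => q q0.
  by field; rewrite q0 gt_eqF.
apply: cvgM; first exact: cvg_cst.
have /choice[xi0 hxi] : forall Nj : nat * nat, exists xi, (Nj.2 <= Nj.1)%N ->
   (Nj.2%:R / Nj.1.+1%:R < xi < Nj.2.+1%:R / Nj.1.+1%:R) /\
  Nj.1.+1%:R * (sample Nj.1.+1 Nj.2.+1 - sample Nj.1.+1 Nj.2) = f' xi.
  move=> [N j]; have [jN|jN] := leqP j N; last by exists 0.
  by have [xi h1 h2] := mvt jN; exists xi.
pose xi N j := xi0 (N, j).
rewrite (_ : (fun N => _) = (fun N => bern N (fun j => f' (xi N j)) (vv r))); last first.
  apply/funext => N; rewrite -bernZ; apply: bern_ext => j jN.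
  by have [_] := hxi (N, j) jN.
apply: (@bern_cvg R f' C (vv r) xi v01 C0 f'C).
- apply: modulus; have [dl _] := df v1.
  have cl : {for vv r, continuous lam}.
    have [dd _] := is_derive_lam v1.
    exact: (differentiable_continuous (proj1 (derivable1_diffP _ _) dd)).
  have E : \forall u \near vv r, - dphi (lam u) / (u * lam u) = f' u.
    near=> q; rewrite /f' leNgt (_ : 0 < q)//.
    by near: q; apply: (cvgr_gt (vv r) cvg_id); exact: vv_gt0.
  have -> : {for vv r, continuous f'} = (f' u @[u --> vv r] --> f' (vv r)) by [].
  apply: cvg_trans (near_eq_cvg E) _.
  rewrite /f' leNgt vv_gt0/=; apply: cvgM.
    apply: cvgN; apply: (@continuous_comp _ _ _ lam dphi) => //.
    by rewrite lamK//; exact: cphi.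
  apply: cvgV; first by rewrite mulf_neq0 ?gt_eqF ?vv_gt0// lamK.
  by apply: cvgM; [exact: cvg_id|exact: cl].
- move=> N j N0 jN; have [/= /andP[h1 h2] _] := hxi (N, j) jN.
  have /andP[a0 _] := unit_ratio (leqW jN).
  have /andP[_ b1] : 0 <= (j.+1%:R / N.+1%:R : R) <= 1 by exact: unit_ratio.
  split; first by rewrite /xi (le_trans a0 (ltW h1))/= (le_trans (ltW h2)).
  have n0 : 0 < N%:R :> R by rewrite ltr0n.
  have n1 : 0 < N.+1%:R :> R by rewrite ltr0n.
  have s1 : j%:R / N.+1%:R <= j%:R / N%:R :> R.
    by rewrite ler_wpM2l// lef_pV2 ?posrE// ler_nat.
  have s2 : j%:R / N%:R <= j.+1%:R / N.+1%:R :> R.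
    rewrite ler_pdivrMr// mulrAC ler_pdivlMr// -!natrM ler_nat.
    by rewrite mulnS mulSn leq_add2r.
  have s3 : j.+1%:R / N.+1%:R - j%:R / N.+1%:R <= N%:R^-1 :> R.
    by rewrite -mulrBl -natrB ?leqnSn// subSnn mul1r lef_pV2 ?posrE// ler_nat.
  rewrite -/(xi N j) in h1 h2; rewrite ler_norml.
  rewrite lerBlDr lerBrDl; apply/andP; split.
    rewrite lerBlDr (le_trans s2)// -lerBlDl (le_trans _ s3)// lerB// ltW//.
  rewrite (le_trans (ltW h2))// -lerBlDr (le_trans _ s3)// lerB//.
Unshelve. all: by end_near. Qed.

Lemma dsample_bound r N : 1 <= r -> `|dsample N r| <= r * C.
Proof.
move=> r1; have v01 : 0 <= vv r <= 1 by rewrite ltW ?vv_gt0//= vv_le1.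
have r0 : 0 <= r by exact: le_trans ler01 r1.
rewrite /dsample normrM normrN ler_pM//.
  by rewrite ger0_norm ?mulr_ge0 ?(ltW (vv_gt0 r))// ler_piMr ?vv_le1//.
rewrite -bernZ (le_trans (bern_norm (b := fun=> C) v01 _)) ?bern_cst// => j jN.
have [xi /andP[h1 h2] ->] := mvt jN; apply: f'C.
have /andP[a0 _] := unit_ratio (leqW jN).
have /andP[_ b1] : 0 <= (j.+1%:R / N.+1%:R : R) <= 1 by exact: unit_ratio.
by rewrite (le_trans a0 (ltW h1))/= (le_trans (ltW h2)).
Qed.
End Approx.
End OneVariable.

(** * Density of the Gaussian observables *)
Section Weights.
Context (R : realType) (V : finType).
Implicit Types (f g h F : (V -> R) -> R) (i j : V) (l : V -> R) (s p : seq V) (N n m : nat).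
Local Notation vec := (V -> R).
Local Notation P1 l := (\prod_i l i).

(** Weights growing at most like a power of the product of the coordinates
    times the reference weight. *)
Definition wt (E : vec -> R) : set (vec -> R) :=
  [set b | exists C N, 0 <= C /\ forall l, ge1 l -> 0 <= b l <= C * P1 l ^+ N * E l].
Definition wone : vec -> R := fun=> 1.

Lemma prod_ge1 l : ge1 l -> 1 <= P1 l.
Proof. by move=> h; elim/big_rec: _ => // i x _ x1; exact: mulr_ege1. Qed.
Lemma le_prod l j : ge1 l -> l j <= P1 l.
Proof.
move=> hl; rewrite (bigD1 j)//= ler_peMr ?(le_trans ler01)//.
by elim/big_rec: _ => // i x _ x1; exact: mulr_ege1.
Qed.
Lemma prodX_le l N N' : ge1 l -> (N <= N')%N -> P1 l ^+ N <= P1 l ^+ N'.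
Proof. by move=> hl; apply: ler_weXn2l; exact: prod_ge1. Qed.
Lemma prodX_ge0 l N : ge1 l -> 0 <= P1 l ^+ N.
Proof. by move=> hl; rewrite exprn_ge0// (le_trans ler01)// prod_ge1. Qed.

Lemma wt_ref E : (forall l, ge1 l -> 0 <= E l) -> wt E E.
Proof. by move=> E0; exists 1, 0%N; split=> // l hl; rewrite expr0 !mul1r E0 /=. Qed.
Lemma wtD E b b' : (forall l, ge1 l -> 0 <= E l) -> wt E b -> wt E b' ->
  exists2 c, wt E c & forall l, ge1 l -> b l + b' l <= c l.
Proof.
move=> E0 [C [N [C0 h]]] [C' [N' [C0' h']]]; exists (fun l => b l + b' l) => //.
exists (C + C'), (N + N')%N; split=> [|l hl]; first exact: addr_ge0.
have /andP[b0 b1] := h l hl; have /andP[b0' b1'] := h' l hl.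
rewrite addr_ge0//= !mulrDl lerD//.
  by rewrite (le_trans b1)// ler_wpM2r ?E0// ler_wpM2l// prodX_le// leq_addr.
by rewrite (le_trans b1')// ler_wpM2r ?E0// ler_wpM2l// prodX_le// leq_addl.
Qed.
Lemma wtM E E' E2 b b' : (forall l, ge1 l -> E l * E' l <= E2 l) -> (forall l, ge1 l -> 0 <= E l) ->
  wt E b -> wt E' b' -> exists2 c, wt E2 c & forall l, ge1 l -> b l * b' l <= c l.
Proof.
move=> EE E0 [C [N [C0 h]]] [C' [N' [C0' h']]]; exists (fun l => b l * b' l) => //.
exists (C * C'), (N + N')%N; split=> [|l hl]; first exact: mulr_ge0.
have /andP[b0 b1] := h l hl; have /andP[b0' b1'] := h' l hl.
rewrite mulr_ge0//= (le_trans (ler_pM b0 b0' b1 b1'))//.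
rewrite mulrACA exprD (mulrACA C) ler_wpM2l ?EE// !mulr_ge0 ?prodX_ge0//.
Qed.

Lemma CB_mul E E' E2 n f g : (forall l, ge1 l -> E l * E' l <= E2 l) ->
  (forall l, ge1 l -> 0 <= E l) -> (forall l, ge1 l -> 0 <= E2 l) ->
  CB (wt E) n f -> CB (wt E') n g -> CB (wt E2) n (fun l => f l * g l).
Proof.
move=> EE E0 E20; apply: CBM; first by move=> b b'; exact: wtD.
by move=> b b'; exact: wtM.
Qed.
Lemma CB_mul1 n f g : CB (wt wone) n f -> CB (wt wone) n g -> CB (wt wone) n (fun l => f l * g l).
Proof. by apply: CB_mul => // l _; rewrite /wone mulr1. Qed.
Lemma CB_add E n f g : (forall l, ge1 l -> 0 <= E l) ->
  CB (wt E) n f -> CB (wt E) n g -> CB (wt E) n (fun l => f l + g l).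
Proof. by move=> E0; apply: CBD => b b'; exact: wtD. Qed.

Lemma cst_drv i (c : R) : drv i (fun _ : vec => c) /\ eqr (partial i (fun _ : vec => c)) (fun=> 0).
Proof. by apply: is_drv => l _; exact: is_derive_cst. Qed.
Lemma CB_cst (c : R) n : CB (wt wone) n (fun _ : vec => c).
Proof.
have hb (r : R) : exists2 b, wt wone b & forall l : vec, ge1 l -> `|r| <= b l.
  exists (fun=> `|r|) => //; exists `|r|, 0%N; split=> // l _; by rewrite expr0 /wone !mulr1 lexx normr_ge0.
elim: n c => [|n IHn] c; first by split=> // d T x _ _; exact: measurable_cst.
split=> [d T x _ _||i]; [exact: measurable_cst|exact: hb|].
by have [h1 h2] := cst_drv i c; split=> //; apply: CB_ext (eqr_sym h2) (IHn 0).
Qed.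
Lemma CB0f E n : (forall l, ge1 l -> 0 <= E l) -> CB (wt E) n (fun _ : vec => 0).
Proof.
move=> E0; have hb : exists2 b, wt E b & forall l : vec, ge1 l -> `|0 : R| <= b l.
  by exists E; [exact: wt_ref|move=> l hl; rewrite normr0 E0].
elim: n => [|n IHn]; first by split=> // d T x _ _; exact: measurable_cst.
split=> [d T x _ _||i]; [exact: measurable_cst|exact: hb|].
by have [h1 h2] := cst_drv i 0; split=> //; apply: CB_ext (eqr_sym h2) IHn.
Qed.
Lemma CB_scale E n (c : R) f : (forall l, ge1 l -> 0 <= E l) ->
  CB (wt E) n f -> CB (wt E) n (fun l => c * f l).
Proof.
move=> E0; apply: (CB_mul (E := wone)) => //; last exact: CB_cst.
by move=> l _; rewrite /wone mul1r.
Qed.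
Lemma CB_sumf E n I (r : seq I) (f : I -> vec -> R) : (forall l, ge1 l -> 0 <= E l) ->
  (forall z, CB (wt E) n (f z)) -> CB (wt E) n (fun l => \sum_(z <- r) f z l).
Proof.
move=> E0 hf; elim: r => [|z r IHr]; first by under eq_fun do rewrite big_nil; exact: CB0f.
by under eq_fun do rewrite big_cons; exact: CB_add.
Qed.
Lemma CB_prodf n I (r : seq I) (f : I -> vec -> R) :
  (forall z, CB (wt wone) n (f z)) -> CB (wt wone) n (fun l => \prod_(z <- r) f z l).
Proof.
move=> hf; elim: r => [|z r IHr]; first by under eq_fun do rewrite big_nil; exact: CB_cst.
by under eq_fun do rewrite big_cons; exact: CB_mul1.
Qed.

Lemma coord_drv i j : drv i (fun l : vec => l j) /\ eqr (partial i (fun l : vec => l j)) (fun=> (i == j)%:R).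
Proof.
apply: is_drv => l _; have [<-|ij] := eqVneq i j.
  by rewrite (_ : (fun r => _) = id); [exact: is_derive_id|apply/funext => q; rewrite dfwithin].
rewrite (_ : (fun r => _) = cst (l j)); first exact: is_derive_cst.
by apply/funext => q; rewrite dfwithout.
Qed.
Lemma CB_coord j n : CB (wt wone) n (fun l : vec => l j).
Proof.
have hb : exists2 b, wt wone b & forall l : vec, ge1 l -> `|l j| <= b l.
  exists (fun l => l j); last by move=> l hl; rewrite ger0_norm// (le_trans ler01).
  exists 1, 1%N; split=> // l hl; rewrite expr1 mul1r mulr1 le_prod// andbT.
  exact: le_trans ler01 (hl j).
case: n => [|n]; first by split=> // d T x mx _; exact: mx.
split=> [d T x mx _||i]; [exact: mx|exact: hb|].
by have [h1 h2] := coord_drv i j; split=> //; apply: CB_ext (eqr_sym h2) (CB_cst _ _).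
Qed.
Lemma CB_coordX j n N : CB (wt wone) n (fun l : vec => l j ^+ N).
Proof.
elim: N => [|N IHN]; first exact: CB_cst.
by under eq_fun do rewrite exprS; apply: CB_mul1 IHN; exact: CB_coord.
Qed.
Lemma CB_coordV j n : CB (wt wone) n (fun l : vec => (l j)^-1).
Proof.
have hb : exists2 b, wt wone b & forall l : vec, ge1 l -> `|(l j)^-1| <= b l.
  exists wone; first exact: wt_ref.
  move=> l hl; have l0 : 0 < l j by exact: lt_le_trans ltr01 (hl j).
  by rewrite ger0_norm ?invr_ge0 ?(ltW l0)// invf_le1.
have mf : mV1 (fun l : vec => (l j)^-1).
  move=> d T x mx x1; rewrite (_ : (fun w => _) = (fun w => expR (- ln (x w j)))).
    apply: measurableT_comp => //; apply: measurableT_comp => //.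
    by apply: measurableT_comp (mx j); exact: measurable_ln.
  by apply/funext => w; rewrite expRN lnK// posrE (lt_le_trans ltr01)// x1.
elim: n => [|n IHn]; first by split.
split=> [//|//|i].
have [h1 h2] : drv i (fun l : vec => (l j)^-1) /\
    eqr (partial i (fun l : vec => (l j)^-1)) (fun l => - (i == j)%:R * ((l j)^-1 * (l j)^-1)).
  apply: is_drv => l hl; have [d1 d2] := coord_drv i j.
  have l0 : dfwith l i (l i) j != 0 by rewrite dfwith_self gt_eqF.
  apply: is_derive_eq (@is_deriveV R (fun r => dfwith l i r j) (l i) _ 1 l0 (drv_is d1 hl)) _.
  by rewrite d2// dfwith_self /GRing.scale/= -exprVn expr2; ring.
split=> //; apply: CB_ext (eqr_sym h2) _; apply: CB_scale => //; exact: CB_mul1.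
Qed.

(** All derivatives of exp q are exp q times a function of polynomial
    growth. *)
Lemma CB_exp n q : CB (wt wone) n q -> CB (wt (fun l => expR (q l))) n (fun l => expR (q l)).
Proof.
have e0 l : ge1 l -> 0 <= expR (q l) by rewrite expR_ge0.
have hb : exists2 b, wt (fun l => expR (q l)) b & forall l : vec, ge1 l -> `|expR (q l)| <= b l.
  exists (fun l => expR (q l)); first exact: wt_ref.
  by move=> l _; rewrite ger0_norm ?expR_ge0.
have mf m : CB (wt wone) m q -> mV1 (fun l => expR (q l)).
  by move=> /CB0[mq _] d T x mx x1; apply: measurableT_comp => //; exact: mq.
elim: n => [|n IHn] cq; first by split=> //; exact: mf cq.
split=> [|//|i]; first exact: mf cq.
have [_ _ /(_ i)[dq cqi]] := cq; have [h1 h2] := drv_exp dq.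
split=> //; apply: CB_ext (eqr_sym h2) _.
apply: (CB_mul (E := wone)) cqi (IHn (CBW (leqnSn n) cq)) => // l _.
by rewrite /wone mul1r.
Qed.
Lemma CB_expb n q : CB (wt wone) n q -> (forall l, ge1 l -> q l <= 0) -> CB (wt wone) n (fun l => expR (q l)).
Proof.
move=> cq q0; apply: CB_sub (CB_exp cq) => b [C [N [C0 h]]]; exists b => //.
exists C, N; split=> // l hl; have /andP[b0 b1] := h l hl; rewrite b0/= /wone mulr1.
rewrite (le_trans b1)// ler_piMr ?mulr_ge0 ?prodX_ge0// -expR0 ler_expR; exact: q0.
Qed.

Lemma CB_quad A n (c : R) : CB (wt wone) n (fun l => c * quadf A l).
Proof.
apply: CB_scale => //; apply: CB_sumf => // i; apply: CB_sumf => // j.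
by apply: CB_mul1; [apply: CB_scale => //; exact: CB_coord|exact: CB_coord].
Qed.

(** ** Freezing a coordinate *)
Definition frz i (r : R) F : vec -> R := fun l => F (dfwith l i r).
Definition ind j F := forall l r, F (dfwith l j r) = F l.

Lemma dfwithC i j l (r q : R) : i != j -> dfwith (dfwith l j q) i r = dfwith (dfwith l i r) j q.
Proof.
move=> ij; apply/funext => m; have [<-|im] := eqVneq i m.
  by rewrite dfwithin dfwithout ?dfwithin// eq_sym.
have [<-|jm] := eqVneq j m; first by rewrite dfwithout ?dfwithin.
by rewrite !dfwithout.
Qed.
Lemma dfwith_dfwith i l (r q : R) : dfwith (dfwith l i q) i r = dfwith l i r.
Proof.
apply/funext => m; have [<-|im] := eqVneq i m; first by rewrite !dfwithin.
by rewrite !dfwithout.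
Qed.
Lemma frz_slice i j (r : R) F l : i != j ->
  (fun t => frz i r F (dfwith l j t)) = (fun t => F (dfwith (dfwith l i r) j t)).
Proof. by move=> ij; apply/funext => t; rewrite /frz dfwithC. Qed.
Lemma partial_frz i j (r : R) F : i != j -> partial j (frz i r F) = frz i r (partial j F).
Proof.
move=> ij; apply/funext => l; rewrite /partial frz_slice// /frz.
by rewrite dfwithout.
Qed.
Lemma partials_frz i (r : R) F s : i \notin s -> partials s (frz i r F) = frz i r (partials s F).
Proof.
elim: s => //= j s IHs; rewrite inE negb_or => /andP[ij /IHs ->].
exact: partial_frz.
Qed.
Lemma ind_frz i r F : ind i (frz i r F).
Proof. by move=> l q; rewrite /frz dfwith_dfwith. Qed.
Lemma ind_frz' i j r F : ind j F -> ind j (frz i r F).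
Proof.
move=> h l q; rewrite /frz; have [<-|ij] := eqVneq i j; first by rewrite dfwith_dfwith.
by rewrite dfwithC// h.
Qed.
Lemma partial_ind j F l : ind j F -> partial j F l = 0.
Proof.
move=> h; rewrite /partial derive1E (_ : (fun t => _) = cst (F l)); first exact: derive_cst.
by apply/funext => t; exact: h.
Qed.
Lemma ind_partial i j F : ind j F -> ind j (partial i F).
Proof.
move=> h l q; have [->|ij] := eqVneq i j; first by rewrite !partial_ind.
rewrite /partial dfwithout 1?eq_sym// (_ : (fun t => F (dfwith _ _ t)) = (fun t => F (dfwith l i t)))//.
by apply/funext => t; rewrite dfwithC// h.
Qed.
Lemma ind_partials j F s : ind j F -> ind j (partials s F).
Proof. by move=> h; elim: s => //= i s; exact: ind_partial. Qed.
Lemma partials0 s : partials s (fun=> 0) = (fun _ : vec => 0 : R).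
Proof.
elim: s => //= i s ->; apply/funext => l.
by rewrite (partial_ind (j := i)).
Qed.
Lemma partials_ind j F s : ind j F -> j \in s -> partials s F = fun=> 0.
Proof.
move=> h; elim: s => //= i s IHs; rewrite inE; have [<-|ij] /= := eqVneq j i.
  by move=> _; apply/funext => l; apply: partial_ind; exact: ind_partials.
by move=> /IHs ->; rewrite -[RHS](partials0 [:: i]).
Qed.
Lemma drv_ind j F : ind j F -> drv j F /\ eqr (partial j F) (fun=> 0).
Proof.
move=> h; apply: is_drv => l _; rewrite (_ : (fun t => _) = cst (F l)); first exact: is_derive_cst.
by apply/funext => t; exact: h.
Qed.
End Weights.

Section BernsteinVertex.
Context (R : realType) (V : finType) (i : V).
Implicit Types (l : V -> R) (j : V) (N n m : nat) (b : nat -> (V -> R) -> R).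
Local Notation vec := (V -> R).

Definition Bf N b : vec -> R := fun l => bern N (fun m => b m l) (vv (l i)).

Lemma CB_vv n : CB (wt (@wone R V)) n (fun l : vec => vv (l i)).
Proof.
apply: CB_expb; last first.
  by move=> l hl; rewrite oppr_le0 mulr_ge0// subr_ge0 exprn_ege1.
rewrite (_ : (fun l => _) = (fun l : vec => - 2^-1 * (l i ^+ 2 + -1))); last first.
  by apply/funext => l; rewrite mulNr.
by apply: CB_scale => //; apply: CB_add => //; [exact: CB_coordX|exact: CB_cst].
Qed.
Lemma CB_Bf N b n : (forall m, CB (wt (@wone R V)) n (b m)) -> CB (wt (@wone R V)) n (Bf N b).
Proof.
elim: N b => [|N IHN] b hb; first exact: hb.
apply: CB_add => //; apply: CB_mul1; [exact: CB_vv|exact: (IHN (b \o S) (fun m => hb m.+1))| |exact: IHN].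
apply: CB_add => //; first exact: CB_cst.
rewrite (_ : (fun l => _) = (fun l : vec => -1 * vv (l i))); last by apply/funext => l; rewrite mulN1r.
by apply: CB_scale => //; exact: CB_vv.
Qed.
Lemma vv01 (r : R) : 1 <= r -> 0 <= vv r <= 1.
Proof. by move=> r1; rewrite ltW ?vv_gt0//= vv_le1. Qed.
Lemma Bf_bound N b C l : ge1 l -> (forall m, `|b m l| <= C) -> `|Bf N b l| <= C.
Proof.
move=> hl hb; rewrite -[leRHS](bern_cst N C (vv (l i))).
by apply: bern_norm => //; exact: vv01.
Qed.

Lemma is_derive_bern_coef N (phi : nat -> R -> R) (d : nat -> R) (v r : R) :
  (forall m, is_derive r (1 : R) (phi m) (d m)) ->
  is_derive r (1 : R) (fun r => bern N (fun m => phi m r) v) (bern N d v).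
Proof.
elim: N phi d => [|N IHN] phi d h; first exact: h.
have h1 := IHN (fun m => phi m.+1) (fun m => d m.+1) (fun m => h m.+1).
have h2 := IHN phi d h.
exact: (is_deriveD (is_deriveZ v h1) (is_deriveZ (1 - v) h2)).
Qed.
Lemma partial_Bf N b j : i != j -> (forall m, drv j (b m)) ->
  drv j (Bf N b) /\ eqr (partial j (Bf N b)) (Bf N (fun m => partial j (b m))).
Proof.
move=> ij hb; apply: is_drv => l hl.
rewrite (_ : (fun t => _) = (fun t => bern N (fun m => b m (dfwith l j t)) (vv (l i)))); last first.
  by apply/funext => t; rewrite /Bf dfwithout// eq_sym.
by apply: is_derive_bern_coef => m; exact: drv_is.
Qed.
Lemma partials_Bf B n N b s : i \notin s -> (size s <= n)%N -> (forall m, CB B n (b m)) ->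
  eqr (partials s (Bf N b)) (Bf N (fun m => partials s (b m))).
Proof.
move=> + + hb; elim: s => [//|j s IHs]; rewrite inE negb_or => /andP[ij si] sn /=.
apply: eqr_trans (eqr_partial j (IHs si (ltnW sn))) _.
by have [] := partial_Bf N ij (fun m => (partials_drv (hb m) (ltnW sn)).2.2 sn j).
Qed.
End BernsteinVertex.

Section Decay.
Context (R : realType) (V : finType).
Implicit Types (F : (V -> R) -> R) (i j : V) (l : V -> R) (s p t : seq V) (N n m : nat).
Local Notation vec := (V -> R).

(** Bounded weights with Gaussian decay in the coordinates in s. *)
Definition wdec s : set (vec -> R) := [set b | exists2 C, 0 <= C &
  forall l, ge1 l -> 0 <= b l <= C /\ forall i, i \in s -> b l <= C * expR (- (2 * l i ^+ 2))].

Lemma wdec0 s : wdec s (fun=> 0).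
Proof. by exists 0 => // l _; rewrite lexx; split=> // i _; rewrite mul0r. Qed.
Lemma CB_wdec0 s n : CB (wdec s) n (fun _ : vec => 0).
Proof.
have hb : exists2 b, wdec s b & forall l : vec, ge1 l -> `|0 : R| <= b l.
  by exists (fun=> 0); [exact: wdec0|move=> l hl; rewrite normr0].
elim: n => [|n IHn]; first by split=> // d T x _ _; exact: measurable_cst.
split=> [d T x _ _||i]; [exact: measurable_cst|exact: hb|].
by have [h1 h2] := @cst_drv R V i 0; split=> //; apply: CB_ext (eqr_sym h2) IHn.
Qed.
Lemma wdec_wt s n F : CB (wdec s) n F -> CB (wt (@wone R V)) n F.
Proof.
apply: CB_sub => b [C C0 h]; exists (fun=> C); last by move=> l /h[/andP[]].
by exists C, 0%N; split=> // l _; rewrite expr0 /wone !mulr1 lexx C0.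
Qed.

Lemma CB_frz i s n F (r : R) : i \notin s -> 1 <= r ->
  CB (wdec (i :: s)) n F -> CB (wdec s) n (frz i r F).
Proof.
move=> si r1; elim: n F => [|n IHn] F cF; have [mF [b [C C0 hC] hb]] := CB0 cF.
  have mf : mV1 (frz i r F).
    move=> d T x mx x1; apply: (mF d T (fun w => dfwith (x w) i r)) => [j|w].
      by apply: measurable_dfwith => //; exact: measurable_cst.
    exact: ge1_dfwith.
  split=> //; exists (fun l => b (dfwith l i r)); last by move=> l hl; apply: hb; exact: ge1_dfwith.
  exists C => // l hl; have [h1 h2] := hC _ (ge1_dfwith i hl r1); split=> // j js.
  have ij : i != j by apply: contraNneq si => ->.
  by have := h2 j; rewrite inE js orbT dfwithout//; apply.
have mf : mV1 (frz i r F).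
  move=> d T x mx x1; apply: (mF d T (fun w => dfwith (x w) i r)) => [j|w].
    by apply: measurable_dfwith => //; exact: measurable_cst.
  exact: ge1_dfwith.
split=> //.
  exists (fun l => b (dfwith l i r)); last by move=> l hl; apply: hb; exact: ge1_dfwith.
  exists C => // l hl; have [h1 h2] := hC _ (ge1_dfwith i hl r1); split=> // j js.
  have ij : i != j by apply: contraNneq si => ->.
  by have := h2 j; rewrite inE js orbT dfwithout//; apply.
move=> j; have [_ _ /(_ j)[dF cF']] := cF.
have [<-|ij] := eqVneq i j.
  have [h1 h2] := drv_ind (@ind_frz R V i r F); split=> //.
  by apply: CB_ext (eqr_sym h2) _; exact: CB_wdec0.
split; last by rewrite partial_frz//; exact: IHn.
move=> l hl; rewrite frz_slice//.
have := dF _ (pos_dfwith i hl (lt_le_trans ltr01 r1)).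
by rewrite dfwithout.
Qed.

Lemma ind_all F l : (forall j, ind j F) -> F l = F (fun=> 1).
Proof.
move=> h; have E s : F (foldr (fun j l => dfwith l j 1) l s) = F l.
  by elim: s => //= j s <-; exact: h.
rewrite -(E (enum V)); congr F; apply/funext => m.
have : m \in enum V by rewrite mem_enum.
elim: (enum V) => //= j s IHs; rewrite inE; have [->|jm] /= := eqVneq m j.
  by rewrite dfwithin.
by rewrite dfwithout 1?eq_sym.
Qed.

Section FreezeApprox.
Variables (i : V) (s : seq V) (F : vec -> R) (n : nat).
Hypotheses (si : i \notin s) (cF : CB (wdec (i :: s)) n.+2 F).

Definition samples N m : vec -> R :=
  if (m == 0)%N || (N.+1 < m)%N then fun=> 0 else frz i (lam (m%:R / N.+1%:R)) F.
Definition approx N : vec -> R := Bf i N.+1 (samples N).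

Lemma CB_samples N m : CB (wdec s) n.+2 (samples N m).
Proof.
rewrite /samples; case: ifPn => [_|]; first exact: CB_wdec0.
rewrite negb_or -lt0n -leqNgt => /andP[m0 mN]; apply: CB_frz => //.
by apply: lam_ge1; rewrite divr_gt0 ?ltr0n//= ler_pdivrMr ?ltr0n// mul1r ler_nat.
Qed.
Lemma ind_approx N j : j != i -> ind j F -> ind j (approx N).
Proof.
move=> ji h l q; rewrite /approx /Bf dfwithout//; apply: bern_ext => m _.
rewrite /samples; case: ifP => // _; exact: ind_frz'.
Qed.

Variable t : seq V.
Hypotheses (ti : i \notin t) (tn : (size t <= n)%N).
Let tn2 : (size t <= n.+2)%N. Proof. by rewrite (leq_trans tn)// ltnW. Qed.
Let tn1 : (size t < n.+2)%N. Proof. by rewrite ltnS (leq_trans tn). Qed.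
Let Phi := partials t F.
Let phi l (r : R) := Phi (dfwith l i r).
Let dphi l (r : R) := partial i Phi (dfwith l i r).

Lemma partials_approx N : eqr (partials t (approx N))
  (fun l => bern N.+1 (sample (phi l) N.+1) (vv (l i))).
Proof.
move=> l hl; rewrite (partials_Bf _ ti tn2 (CB_samples N) hl).
rewrite /Bf; apply: bern_ext => m mN; rewrite /samples /sample ltnNge mN orbF.
by case: ifP => _; [rewrite partials0|rewrite partials_frz].
Qed.

Lemma slice_dphi l (r : R) : pos l -> 0 < r -> is_derive r (1 : R) (phi l) (dphi l r).
Proof.
move=> hl r0; have dP : drv i Phi.
  by have [_ [_]] := partials_drv cF tn2; apply.
have := drv_is dP (pos_dfwith i hl r0); rewrite dfwithin.
by under eq_fun do rewrite dfwith_dfwith.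
Qed.
Lemma slice_ddphi l (r : R) : pos l -> 0 < r -> {for r, continuous (dphi l)}.
Proof.
move=> hl r0; have dP : drv i (partial i Phi).
  by have [_ [_]] := partials_drv cF (tn1 : size (i :: t) <= n.+2)%N; apply.
have := dP _ (pos_dfwith i hl r0); rewrite dfwithin.
under eq_fun do rewrite dfwith_dfwith.
by move=> dd; exact: (differentiable_continuous (proj1 (derivable1_diffP _ _) dd)).
Qed.
Lemma slice_bounds : exists2 C, 0 <= C & forall l, ge1 l ->
  (forall r, 1 <= r -> `|phi l r| <= C * expR (- (2 * r ^+ 2))) /\
  (forall r, 1 <= r -> `|dphi l r| <= C * expR (- (2 * r ^+ 2))).
Proof.
have [[b1 [C1 C10 h1] hb1] _] := partials_drv cF tn2.
have [[b2 [C2 C20 h2] hb2] _] := partials_drv cF (tn1 : size (i :: t) <= n.+2)%N.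
exists (C1 + C2) => [|l hl]; first exact: addr_ge0.
split=> r r1; have hr := ge1_dfwith i hl r1.
  rewrite (le_trans (hb1 _ hr))//; have [_ /(_ i)] := h1 _ hr.
  rewrite inE eqxx dfwithin => /(_ isT)/le_trans; apply; by rewrite ler_wpM2r ?expR_ge0// lerDl.
rewrite (le_trans (hb2 _ hr))//; have [_ /(_ i)] := h2 _ hr.
rewrite inE eqxx dfwithin => /(_ isT)/le_trans; apply; by rewrite ler_wpM2r ?expR_ge0// lerDr.
Qed.

Lemma approx_cvg : (forall l, ge1 l -> partials t (approx N) l @[N --> \oo] --> partials t F l) /\
  exists C M, 0 <= C /\ forall N l, ge1 l -> `|partials t (approx N) l| <= C * (\prod_j l j) ^+ M.
Proof.
have [C C0 hC] := slice_bounds; split=> [l hl|]; last first.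
  exists C, 0%N; split=> // N l hl; rewrite expr0 mulr1 partials_approx; last exact: ge1_pos.
  have [h1 h2] := hC l hl.
  exact: (@sample_bound R (phi l) C C0 h1 (l i) N (hl i)).
have [h1 h2] := hC l hl; have hp := ge1_pos hl.
under eq_fun do rewrite partials_approx//.
have := @sample_cvg R (phi l) (dphi l) C C0 (fun r => @slice_dphi l r hp) h1 (l i) (hl i).
by rewrite /phi dfwith_self.
Qed.

Lemma dapprox_cvg : (forall l, ge1 l -> partials (i :: t) (approx N) l @[N --> \oo] --> partials (i :: t) F l) /\
  exists C M, 0 <= C /\ forall N l, ge1 l -> `|partials (i :: t) (approx N) l| <= C * (\prod_j l j) ^+ M.
Proof.
have [C C0 hC] := slice_bounds.
have E N l : pos l -> partials (i :: t) (approx N) l = dsample (phi l) N (l i).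
  move=> hl; have [_ /(_ l hl) <-] : drv i (fun l => bern N.+1 (sample (phi l) N.+1) (vv (l i))) /\
     eqr (partial i (fun l => bern N.+1 (sample (phi l) N.+1) (vv (l i)))) (fun l => dsample (phi l) N (l i)).
    apply: is_drv => l' hl'.
    rewrite (_ : (fun r => _) = (fun r => bern N.+1 (sample (phi l') N.+1) (vv r))).
      exact: is_derive_sample.
    apply/funext => r; rewrite dfwithin; apply: bern_ext => m _; rewrite /sample; case: ifP => // _.
    by rewrite /phi dfwith_dfwith.
  by rewrite /= (eqr_partial i (partials_approx N)).
split=> [l hl|]; last first.
  exists C, 1%N; split=> // N l hl; rewrite expr1 E; last exact: ge1_pos.
  have [h1 h2] := hC l hl.
  rewrite (le_trans (@dsample_bound R (phi l) (dphi l) C C0 (fun r => @slice_dphi l r (ge1_pos hl)) h1 h2 (l i) N (hl i)))//.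
  by rewrite mulrC ler_wpM2l// le_prod.
have [h1 h2] := hC l hl; have hp := ge1_pos hl.
under eq_fun do rewrite E//.
have := @dsample_cvg R (phi l) (dphi l) C C0 (fun r => @slice_dphi l r hp)
  (fun r r1 => slice_ddphi hp (lt_le_trans ltr01 r1)) h1 h2 (l i) (hl i).
by rewrite /dphi dfwith_self.
Qed.
End FreezeApprox.
End Decay.

(** * Density of the Gaussian observables *)
Section VertexInduction.
Context (R : realType) (V : finType) (e : rel V) (W : V -> V -> R).
Hypothesis hG : weighted_graph e W.
Implicit Types (f g F : (V -> R) -> R) (i j : V) (l : V -> R) (s p t : seq V) (N n m : nat) (k : V -> R).
Local Notation vec := (V -> R).
Local Notation nV := #|V|.
Local Notation hk k := (forall i, \sum_j W i j < k i).
Local Notation G k := (eval (gauss_obs W k) : vec -> R).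

Definition bnd f := exists C, forall l, ge1 l -> `|f l| <= C.
Definition reg f := CB (wt (@wone R V)) nV f /\ bnd f.

Lemma prod_gauss_bound (dl : R) M : 0 < dl -> exists2 C, 0 <= C &
  forall l, ge1 l -> (\prod_i l i) ^+ M * expR (- (dl * \sum_i l i ^+ 2)) <= C.
Proof.
move=> dl0; have [K [K0 hK]] := expR_beats M dl0.
exists (K ^+ nV) => [|l hl]; first exact: exprn_ge0.
rewrite mulr_sumr -sumrN expR_sum -prodrXl -big_split/= -[leRHS]prodr_const.
apply: ler_prod => i _; have l1 := hl i; have l0 : 0 <= l i by exact: le_trans ler01 l1.
rewrite mulr_ge0 ?exprn_ge0 ?expR_ge0//=.
have e0 : 0 <= dl * l i ^+ 2 by rewrite mulr_ge0 ?sqr_ge0// ltW.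
have := hK _ e0; rewrite mulrAC mulfV ?gt_eqF// mul1r => /(le_trans _); apply.
rewrite ler_wpM2r ?expR_ge0// lerXn2r ?nnegrE ?addr_ge0 ?sqr_ge0//.
by rewrite (@le_trans _ _ (l i ^+ 2))// ?lerDr// expr2 ler_peMr.
Qed.

Lemma G_E k : eqr (fun l => (\prod_(i <- index_enum V) l i) * expR (- 2^-1 * quadf (Amat W k) l)) (G k).
Proof. by move=> l _; rewrite eval_gauss_obs. Qed.
Lemma CB_G k n : hk k -> CB (wt (@wone R V)) n (G k).
Proof.
move=> hk; apply: CB_ext (@G_E k) _; apply: CB_mul1; first by apply: CB_prodf => i; exact: CB_coord.
apply: CB_expb; first exact: CB_quad.
move=> l _; have [lm [lm0 h]] := quadf_Amat_ge hG hk.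
rewrite mulNr oppr_le0 mulr_ge0// (le_trans _ (h l))// mulr_ge0 ?(ltW lm0)// sumr_ge0// => i _.
exact: sqr_ge0.
Qed.
Lemma bnd_G k : hk k -> bnd (G k).
Proof.
move=> hk; have [lm [lm0 h]] := quadf_Amat_ge hG hk.
have p0 : 0 < 2^-1 * lm by rewrite mulr_gt0// invr_gt0.
have [C C0 hC] := prod_gauss_bound 1 p0.
exists C => l hl; rewrite eval_gauss_obs ger0_norm; last first.
  by rewrite mulr_ge0 ?expR_ge0// (le_trans ler01)// prod_ge1.
apply: le_trans (hC l hl); rewrite expr1 ler_wpM2l//; first by rewrite (le_trans ler01)// prod_ge1.
by rewrite ler_expR mulNr lerN2 -mulrA ler_wpM2l.
Qed.
Lemma bndM f g : bnd f -> bnd g -> bnd (fun l => f l * g l).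
Proof.
move=> [C hC] [D hD]; exists (C * D) => l hl; rewrite normrM ler_pM ?hC ?hD//.
Qed.
Lemma bndZ f (c : R) : bnd f -> bnd (fun l => c * f l).
Proof. by move=> [C hC]; exists (`|c| * C) => l hl; rewrite normrM ler_wpM2l ?hC. Qed.
Lemma bndD f g : bnd f -> bnd g -> bnd (fun l => f l + g l).
Proof. by move=> [C hC] [D hD]; exists (C + D) => l hl; rewrite (le_trans (ler_normD _ _))// lerD ?hC ?hD. Qed.
Lemma regM k F : hk k -> reg F -> reg (fun l => G k l * F l).
Proof. by move=> hk [h1 h2]; split; [apply: CB_mul1 => //; exact: CB_G|apply: bndM => //; exact: bnd_G]. Qed.

Lemma quadf_AmatE k l : quadf (Amat W k) l = \sum_i k i * l i ^+ 2 - \sum_i \sum_j W i j * l i * l j.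
Proof.
rewrite /quadf -sumrB; apply: eq_bigr => i _.
rewrite (eq_bigr (fun j => (i == j)%:R * (k i * l i * l j) - W i j * l i * l j)); last first.
  by move=> j _; rewrite /Amat; ring.
by rewrite sumrB (sum_diag (fun i j => k i * l i * l j)) expr2 mulrA.
Qed.
Lemma G_vv k i l : G k l * vv (l i) = expR 2^-1 * G (fun j => k j + (i == j)%:R) l.
Proof.
rewrite !eval_gauss_obs !quadf_AmatE /vv.
have kE : \sum_j (k j + (i == j)%:R) * l j ^+ 2 = \sum_j k j * l j ^+ 2 + l i ^+ 2.
  rewrite -(sum_diag (fun _ j => l j ^+ 2)) -big_split/=.
  by apply: eq_bigr => j _; rewrite mulrDl.
rewrite kE [RHS]mulrCA -mulrA -!expRD; congr (_ * expR _).
by field.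
Qed.

Variable E : (vec -> R) -> Prop.
Hypotheses (EG : forall k, hk k -> E (G k))
 (ED : forall f g, reg f -> reg g -> E f -> E g -> E (fun l => f l + g l))
 (EZ : forall (c : R) f, reg f -> E f -> E (fun l => c * f l))
 (Eext : forall f g, eqr f g -> E f -> E g)
 (Elim : forall (f_ : nat -> vec -> R) f, (forall n, reg (f_ n)) -> reg f ->
   (forall t, subseq t (enum V) ->
     (forall l, ge1 l -> partials t (f_ n) l @[n --> \oo] --> partials t f l) /\
     exists C M, 0 <= C /\ forall n l, ge1 l -> `|partials t (f_ n) l| <= C * (\prod_i l i) ^+ M) ->
   (exists C, forall n l, ge1 l -> `|f_ n l| <= C) -> (forall n, E (f_ n)) -> E f).

Lemma E_Bf i N b : (forall m, reg (b m)) -> (exists C, forall m l, ge1 l -> `|b m l| <= C) ->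
  (forall m k, hk k -> E (fun l => G k l * b m l)) ->
  forall k, hk k -> E (fun l => G k l * Bf i N b l).
Proof.
move=> rb [C hC]; elim: N b rb hC => [|N IHN] b rb hC Eb k hkk; first exact: Eb.
pose k' j := k j + (i == j)%:R.
have hk' : hk k' by move=> j; rewrite (lt_le_trans (hkk j))// lerDl.
have rBf M b' : (forall m, reg (b' m)) -> (forall m l, ge1 l -> `|b' m l| <= C) -> reg (Bf i M b').
  move=> rb' hb'; split; first by apply: CB_Bf => m; have [] := rb' m.
  by exists C => l hl; apply: Bf_bound => // m; exact: hb'.
have rS m : reg ((b \o S) m) by exact: rb.
have hS m l : ge1 l -> `|(b \o S) m l| <= C by exact: hC.
have E1 := IHN (b \o S) rS hS (fun m => Eb m.+1) k' hk'.
have E2 := IHN b rb hC Eb k hkk; have E3 := IHN b rb hC Eb k' hk'.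
have r1 := regM hk' (rBf N _ rS hS); have r2 := regM hkk (rBf N _ rb hC); have r3 := regM hk' (rBf N _ rb hC).
have rZ c f : reg f -> reg (fun l => c * f l).
  by move=> [h1 h2]; split; [exact: CB_scale|exact: bndZ].
have rD f g : reg f -> reg g -> reg (fun l => f l + g l).
  by move=> [h1 h2] [h3 h4]; split; [exact: CB_add|exact: bndD].
apply: Eext (ED (rZ (expR 2^-1) _ r1) (rD _ _ r2 (rZ (- expR 2^-1) _ r3)) (EZ _ r1 E1)
  (ED r2 (rZ _ _ r3) E2 (EZ _ r3 E3))) => l _.
have h := G_vv k i l; rewrite -/k' in h.
have HB : Bf i N.+1 b l = vv (l i) * Bf i N (b \o S) l + (1 - vv (l i)) * Bf i N b l by [].
rewrite HB; move: h.
move: (G k l) (G k' l) (vv (l i)) (Bf i N (b \o S) l) (Bf i N b l) => x y z p q h.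
by rewrite mulNr !(mulrA (expR 2^-1)) -h [in RHS]mulrDr [in RHS]mulrBl mul1r [in RHS]mulrBr !mulrA.
Qed.

Lemma mask_subseqs (t : seq V) (m : bitseq) : subseq t (enum V) -> subseq (mask m t) (enum V).
Proof. by move=> h; exact: subseq_trans (mask_subseq m t) h. Qed.

Lemma subseq_split p i s t : uniq (p ++ i :: s) -> subseq t (p ++ i :: s) ->
  (exists2 j, j \in p & j \in t) \/
  (exists2 t', {subset t' <= s} & t = t' \/ t = i :: t').
Proof.
move=> us /(subseq_uniqP us) tE.
have [/hasP[j jp jt]|/hasPn hp] := boolP (has (mem t) p); first by left; exists j.
right; exists [seq x <- s | x \in t] => [j|]; first by rewrite mem_filter => /andP[].
move: tE; rewrite filter_cat (_ : [seq x <- p | x \in t] = [::]); last first.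
  by apply/eqP; rewrite -(negbK (_ == _)) -has_filter; apply/hasPn.
rewrite /=; case: ifP => _ tE; [right|left]; exact: tE.
Qed.

(** Induction on the set s of the vertices that the factor F may depend on: for
    i in s, Bernstein approximation in the variable exp (- (l_i^2 - 1) / 2)
    replaces F by combinations of functions that no longer depend on l_i,
    multiplied by powers which [G_vv] absorbs into G_k. *)
Lemma dens_step s : (exists p, enum V = p ++ s) -> forall k F, hk k ->
  CB (wdec s) nV.+2 F -> (forall j, j \notin s -> ind j F) -> E (fun l => G k l * F l).
Proof.
elim: s => [|i s IHs] [p ep] k F hkk cF iF.
  apply: Eext (EZ (F (fun=> 1)) (conj (CB_G nV hkk) (bnd_G hkk)) (EG hkk)) => l _.
  by rewrite (ind_all l (fun j => iF j isT)) mulrC.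
have us : uniq (p ++ i :: s) by rewrite -ep enum_uniq.
have si : i \notin s by move: us; rewrite cat_uniq /= => /and3P[_ _ /andP[]].
have regF f s' : CB (wdec s') nV.+2 f -> reg f.
  move=> cf; split; first by apply: CBW (wdec_wt cf); rewrite ltnW// ltnW.
  have [_ [b [C C0 h] hb]] := CB0 cf; exists C => l hl; rewrite (le_trans (hb l hl))//.
  by have [/andP[]] := h l hl.
have cS N m := CB_samples si cF N m.
have bS : exists C, forall N m l, ge1 l -> `|samples i F N m l| <= C.
  have [_ [b [C C0 h] hb]] := CB0 cF; exists C => N m l hl; rewrite /samples.
  case: ifPn => [_|]; first by rewrite normr0.
  rewrite negb_or -lt0n -leqNgt => /andP[m0 mN].
  have r1 : 1 <= lam (m%:R / N.+1%:R : R).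
    by apply: lam_ge1; rewrite divr_gt0 ?ltr0n//= ler_pdivrMr ?ltr0n// mul1r ler_nat.
  have hl' := ge1_dfwith i hl r1; rewrite /frz (le_trans (hb _ hl'))//.
  by have [/andP[]] := h _ hl'.
have [C hC] := bS.
have Ea N k' : hk k' -> E (fun l => G k' l * approx i F N l).
  move=> hk'; apply: (@E_Bf i N.+1 (samples i F N) _ _ _ k' hk');
    [by move=> m; exact: regF (cS N m)|by exists C; exact: hC|move=> m k'' hk''].
  apply: (IHs _ k'' _ hk'' (cS N m)); first by exists (rcons p i); rewrite cat_rcons.
  move=> j js; rewrite /samples; case: ifP => // _.
  have [->|ji] := eqVneq j i; first exact: ind_frz.
  by apply: ind_frz'; apply: iF; rewrite inE negb_or ji.
have ra N : reg (approx i F N).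
  split; first by apply: CB_Bf => m; have [] := regF _ _ (cS N m).
  by exists C => l hl; apply: Bf_bound => // m; exact: hC.
have rF := regF _ _ cF.
have conv t : subseq t (enum V) ->
  (forall l, ge1 l -> partials t (approx i F N) l @[N --> \oo] --> partials t F l) /\
  exists C M, 0 <= C /\ forall N l, ge1 l -> `|partials t (approx i F N) l| <= C * (\prod_j l j) ^+ M.
  rewrite ep => st; have [[j jp jt]|[t' t's tE]] := subseq_split us st.
    have ji : j \notin i :: s.
      by move: us; rewrite cat_uniq => /and3P[_ /hasPn h _]; apply/negP => /h; rewrite /= jp.
    have iA N : ind j (approx i F N).
      by apply: ind_approx; [by move: ji; rewrite inE negb_or => /andP[]|exact: iF].
    split=> [l hl|].
      rewrite (partials_ind (iF _ ji) jt); under eq_fun do rewrite (partials_ind (iA _) jt).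
      exact: cvg_cst.
    by exists 0, 0%N; split=> // N l hl; rewrite (partials_ind (iA _) jt) normr0 mul0r.
  have it' : i \notin t' by apply: contra si => /t's.
  have ut : uniq t by rewrite (subseq_uniq st).
  have nt' : (size t' <= nV)%N.
    have ut' : uniq t' by case: tE ut => -> //= /andP[].
    by rewrite cardE uniq_leq_size// => j _; rewrite mem_enum.
  case: tE => ->; [exact: approx_cvg si cF _ it' nt'|exact: dapprox_cvg si cF _ it' nt'].
have sz t : subseq t (enum V) -> (size t <= nV)%N by move=> /size_subseq; rewrite -cardE.
have lb N t l : subseq t (enum V) -> ge1 l -> partials t (fun l => G k l * approx i F N l) l =
    \sum_(m <- masks (size t)) partials (mask m t) (G k) l * partials (mask (map negb m) t) (approx i F N) l.
  by move=> st hl; apply: (leibniz (CB_G nV hkk) (ra N).1 (sz _ st)); exact: ge1_pos.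
apply: (Elim (f_ := fun N l => G k l * approx i F N l)).
- by move=> N; exact: regM.
- exact: regM.
- move=> t st; split=> [l hl|].
    rewrite (_ : (fun N => partials t _ l) = (fun N => \sum_(m <- masks (size t))
      partials (mask m t) (G k) l * partials (mask (map negb m) t) (approx i F N) l)); last first.
      by apply/funext => N; exact: lb.
    rewrite (leibniz (CB_G nV hkk) rF.1 (sz _ st)); last exact: ge1_pos.
    elim: (masks (size t)) => [|m ms IHm].
      rewrite big_nil (_ : (fun N => _) = (fun=> 0)); first exact: cvg_cst.
      by apply/funext => N; rewrite big_nil.
    rewrite big_cons (_ : (fun N => _) = (fun N => partials (mask m t) (G k) l * partials (mask (map negb m) t) (approx i F N) l +
      \sum_(m <- ms) partials (mask m t) (G k) l * partials (mask (map negb m) t) (approx i F N) l)); last first.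
      by apply/funext => N; rewrite big_cons.
    apply: cvgD => //; apply: cvgM; first exact: cvg_cst.
    by have [h _] := conv _ (mask_subseqs (map negb m) st); exact: h.
  suff [D [M [D0 hD]]] : exists D M, 0 <= D /\ forall N l, ge1 l ->
     `|\sum_(m <- masks (size t)) partials (mask m t) (G k) l * partials (mask (map negb m) t) (approx i F N) l| <= D * (\prod_i l i) ^+ M.
    by exists D, M; split=> // N l hl; rewrite lb// hD.
  elim: (masks (size t)) => [|m ms [D [M [D0 hD]]]].
    by exists 0, 0%N; split=> // N l hl; rewrite big_nil normr0 mul0r.
  have [_ [D' [M' [D'0 hD']]]] := conv _ (mask_subseqs (map negb m) st).
  have [[b [D2 [M2 [D20 hb]]] hG2] _] := partials_drv (CB_G nV hkk) (sz _ (mask_subseqs m st)).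
  exists (D2 * D' + D), (M2 + M' + M)%N; split=> [|N l hl]; first by rewrite addr_ge0 ?mulr_ge0.
  rewrite big_cons (le_trans (ler_normD _ _))// mulrDl lerD//.
    have hb2 := le_trans (hG2 l hl) (proj2 (andP (hb l hl))); rewrite /wone mulr1 in hb2.
    rewrite normrM (le_trans (ler_pM _ _ hb2 (hD' N l hl)))// mulrACA -exprD.
    by rewrite ler_wpM2l ?mulr_ge0// prodX_le// leq_addr.
  by rewrite (le_trans (hD N l hl))// ler_wpM2l// prodX_le// leq_addl.
- have [D hD] := bnd_G hkk; exists (D * C) => N l hl.
  rewrite normrM ler_pM ?hD//; apply: Bf_bound => // m; exact: hC.
- by move=> N; exact: Ea.
Qed.
End VertexInduction.

(** * The expectation at the inverse local time *)
Section Stopping.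
Context (R : realType) (V : finType) (a : V) (e : rel V) (W : V -> V -> R).
Hypothesis hG : weighted_graph e W.
Context (d : measure_display) (Omega : measurableType d).
Variables (P : probability Omega R) (X : nat -> Omega -> V) (S : nat -> Omega -> \bar R).
Local Notation mR := (measurableTypeR R).
Local Notation leb := (@lebesgue_measure R).
Hypotheses (mS : forall n, measurable_fun setT (S n))
  (mX : forall n i, measurable [set w | X n w = i])
  (S_gt0 : forall n w, (0 < S n w)%E)
  (law : forall n v r j (t : R), 0 <= t ->
        P (history X S n v r `&` [set w | (S n w <= t%:E)%E /\ X n.+1 w = j]) =
        (\int[P]_(w in history X S n v r)
           (\int[lebesgue_measure]_(u in `[0, t])
              (W (v n) j * jump_local_time X S n j w *
               expR (- (\sum_k W (v n) k * jump_local_time X S n k w) * u))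
           )%R%:E)%E)
  (S_infty : forall w, jump_time S n w @[n --> \oo] --> +oo%E)
  (X0 : forall w, X 0%N w = a).
Let W0 := Wge0 hG.
Variables (k c : V -> R) (gam : R).
Hypotheses (hk : forall i, \sum_j W i j < k i) (c0 : forall i, 0 <= c i) (ca : c a = 1)
  (cU : forall i, i != a -> \sum_j Amat W k i j * c j = 0) (gam1 : 1 < gam).
Implicit Types (w : Omega) (v : nat -> V) (i j : V) (l : V -> R) (n m : nat).
Local Notation hh := (hh a W k c).
Local Notation jl n w := (fun j => jump_local_time X S n j w).
Local Notation past := (past X S).
Local Notation sv := (sv S).

Lemma jl_ge1 n w : ge1 (jl n w).
Proof. by move=> j; rewrite lerDl sumr_ge0// => m _; exact: sv_ge0. Qed.

Definition finS n : set Omega := [set w | forall m, (m < n)%N -> (S m w < +oo)%E].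
Definition alive n : set Omega := finS n `&` [set w | jl n w a < gam].
Definition stopped n : set Omega :=
  alive n `&` [set w | X n w = a /\ (gam%:E <= (jl n w a)%:E + S n w)%E].

Lemma measurable_jl n j : measurable_fun setT (fun w => jl n w j).
Proof.
apply: measurable_funD => //.
rewrite (_ : (fun w => _) = (fun w => \sum_(m < n) (\1_[set w | X m w = j] w * sv w m))).
  apply: measurable_sum_seq => m _; apply: measurable_funM; last exact: measurable_sv.
  exact: measurable_indic.
apply/funext => w; rewrite big_mkcond/=; apply: eq_bigr => m _; rewrite indicE.
have [E|E] := eqVneq (X m w) j; first by rewrite mem_set// mul1r.
by rewrite memNset ?mul0r// => /= E'; rewrite E' eqxx in E.
Qed.
Lemma measurable_fin n : measurable (finS n).
Proof.
rewrite (_ : finS n = \bigcap_m (if (m < n)%N then [set w | (S m w < +oo)%E] else setT)).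
  by apply: bigcapT_measurable => m; case: ifP => // _; exact: measurable_Sfin.
apply/seteqP; split=> w /= h m; first by move=> _; case: ifP => // /h.
by move=> mn; have := h m I; rewrite mn.
Qed.
Lemma measurable_alive n : measurable (alive n).
Proof.
apply: measurableI; first exact: measurable_fin.
rewrite (_ : [set w | _] = (fun w => jl n w a) @^-1` `]-oo, gam[); last first.
  by apply/seteqP; split=> w /=; rewrite in_itv.
by rewrite -[X in measurable X]setTI; exact: measurable_jl.
Qed.
Lemma measurable_stopped n : measurable (stopped n).
Proof.
apply: measurableI; first exact: measurable_alive.
rewrite (_ : [set w | _ /\ _] = [set w | X n w = a] `&`
    (fun w => ((jl n w a)%:E + S n w)%E) @^-1` `[gam%:E, +oo%E]); last first.
  apply/seteqP; split=> w /=; rewrite in_itv/= leey andbT//.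
apply: measurableI => //; rewrite -[X in measurable X]setTI.
apply: emeasurable_funD => //; first exact/measurable_EFinP/measurable_jl.
exact: emeasurable_itv.
Qed.

Lemma measurable_hh d' (T : measurableType d') (x : T -> V -> R) i :
  (forall j, measurable_fun setT (fun z => x z j)) -> measurable_fun setT (fun z => hh i (x z)).
Proof.
move=> mx; apply: measurable_funM; last by apply: (measurableV_quad _ _ mx).
by apply: measurable_funM; [exact: measurable_cst|apply: measurable_prod_seq => j _; exact: mx].
Qed.

(* the values of the process before and at the stopping time *)
Definition running n w : R := \1_(alive n) w * hh (X n w) (jl n w).
Definition final n w : R := \1_(stopped n) w * hh a (dfwith (jl n w) a gam).

Lemma running_ge0 n w : 0 <= running n w.
Proof. by rewrite /running indicE mulr_ge0// hh_ge0// => j; rewrite (le_trans ler01)// jl_ge1. Qed.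
Lemma final_ge0 n w : 0 <= final n w.
Proof.
rewrite /final indicE mulr_ge0// hh_ge0// => j; have [<-|aj] := eqVneq a j.
  by rewrite dfwithin (le_trans ler01)// ltW.
by rewrite dfwithout// (le_trans ler01)// jl_ge1.
Qed.
Lemma measurable_running n : measurable_fun setT (running n).
Proof.
apply: measurable_funM; first by apply: measurable_indic; exact: measurable_alive.
rewrite (_ : (fun w => _) = (fun w => \sum_i \1_[set w | X n w = i] w * hh i (jl n w))).
  apply: measurable_sum_seq => i _; apply: measurable_funM; first exact: measurable_indic.
  by apply: measurable_hh => j; exact: measurable_jl.
apply/funext => w; rewrite (bigD1 (X n w))//= indicE mem_set// mul1r big1 ?addr0// => i iX.
by rewrite indicE memNset ?mul0r// => /= E; rewrite E eqxx in iX.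
Qed.
Lemma measurable_final n : measurable_fun setT (final n).
Proof.
apply: measurable_funM; first by apply: measurable_indic; exact: measurable_stopped.
by apply: measurable_hh => j; apply: measurable_dfwith => [i|]; [exact: measurable_jl|exact: measurable_cst].
Qed.

Section OneHistory.
Variables (n : nat) (v : nat -> V).
Local Notation i := (v n).
Local Notation L w := (fun j => ltv v n j (sv w)).
Local Notation pi w := (\1_(past n v) w : R).
Local Notation k1 j w := (\1_(past n v `&` [set z | (S n z < +oo)%E /\ X n.+1 z = j]) w : R).

Lemma past_jl w j : past n v w -> jl n w j = ltv v n j (sv w).
Proof. by move=> h; exact: jump_local_timeE. Qed.
Lemma past_jlS w j : past n v w -> jl n.+1 w j = ltv v n.+1 j (sv w).
Proof.
move=> [h _]; rewrite /jump_local_time /ltv; congr (_ + _); apply: eq_bigl => m.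
by rewrite h// -ltnS.
Qed.
Lemma past_k1 j w : k1 j w = pi w * (\1_[set w | (S n w < +oo)%E] w * (X n.+1 w == j)%:R).
Proof.
rewrite !indicE; have [h1|h1] := pselect (past n v w); last first.
  by rewrite (memNset (A := past n v))// mul0r memNset// => -[].
rewrite (mem_set (A := past n v))// mul1r; have [h2|h2] := pselect (S n w < +oo)%E; last first.
  by rewrite (memNset (A := [set w | (S n w < +oo)%E]))// mul0r memNset// => -[_ []].
rewrite (mem_set (A := [set w | (S n w < +oo)%E]))// mul1r.
have [E|E] := eqVneq (X n.+1 w) j; first by rewrite mem_set.
by rewrite memNset// => -[_ [_ /= E']]; rewrite E' eqxx in E.
Qed.

Let Fj j (t : nat -> R) : \bar R :=
  (((ltv v n.+1 a t < gam)%R%:R * hh j (fun j => ltv v n.+1 j t)))%:E.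
Let Gt (t : nat -> R) : \bar R :=
  (((ltv v n a t < gam)%R%:R * (t n < gam - ltv v n a t)%R%:R * hh a (dfwith (fun j => ltv v n j t) a gam)))%:E.

Lemma ltvS_upd t (u : R) : (fun j => ltv v n.+1 j (upd t n u)) = flow i (fun j => ltv v n j t) u.
Proof.
apply/funext => j; rewrite /ltv /flow big_mkcond big_ord_recr/= -big_mkcond/= addrA.
have E : 1 + \sum_(m < n | v m == j) upd t n u m = 1 + \sum_(m < n | v m == j) t m.
  by congr (_ + _); apply: eq_bigr => m _; rewrite /upd ltn_eqF.
rewrite E /upd eqxx; have [<-|ij] := eqVneq i j; first by rewrite dfwithin.
by rewrite dfwithout// addr0.
Qed.

Lemma ltvS_updj t (u : R) j : ltv v n.+1 j (upd t n u) = flow i (fun j => ltv v n j t) u j.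
Proof. by rewrite -ltvS_upd. Qed.

Lemma rateE t : rate W v n t = Lr W i (fun j => ltv v n j t). Proof. by []. Qed.
Lemma L_ge1 w : ge1 (L w). Proof. by move=> j; exact: ltv_ge1. Qed.

Let T0 w : R := pi w * (ltv v n a (sv w) < gam)%R%:R.
Let ph w : R := hh a (dfwith (L w) a gam).
Let ex w : R := expR (- rate W v n (sv w) * (gam - ltv v n a (sv w))).
Let mpi : measurable_fun setT (fun w => pi w).
Proof. by apply: measurable_indic; exact: measurable_past. Qed.
Let mltv j : measurable_fun setT (fun w => ltv v n j (sv w)).
Proof. by apply: measurable_ltv => m; exact: measurable_sv. Qed.
Let mT0 : measurable_fun setT T0.
Proof.
apply: measurable_funM => //.
rewrite (_ : (fun w => _) = (fun w => \1_((fun w => ltv v n a (sv w)) @^-1` `]-oo, gam[) w)).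
  apply: measurable_indic; rewrite -[X in measurable X]setTI; exact: mltv.
apply/funext => w; rewrite indicE; congr (_%:R); congr nat_of_bool.
by apply/idP/idP => [h|/set_mem]; [apply/mem_set; rewrite /= in_itv|rewrite /= in_itv].
Qed.
Let mph : measurable_fun setT ph.
Proof. by apply: measurable_hh => j; apply: measurable_dfwith => //; exact: measurable_cst. Qed.
Let T0_ge0 w : 0 <= T0 w. Proof. by rewrite /T0 indicE mulr_ge0. Qed.
Let ph_ge0 w : 0 <= ph w.
Proof.
rewrite hh_ge0// => j; have [<-|aj] := eqVneq a j; first by rewrite dfwithin ltW// (lt_trans ltr01).
by rewrite dfwithout// (le_trans ler01)// L_ge1.
Qed.

Lemma hh_ge0' j l : ge1 l -> 0 <= hh j l.
Proof. by move=> hl; rewrite hh_ge0// => m; rewrite (le_trans ler01). Qed.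

(* the integral of the jump density against the harmonic function *)
Let J w : R := if i == a then hh i (L w) - ex w * ph w else hh i (L w).

(** Summing over the target of the jump, the jump density integrates h along
    the flow; when i = a the flow is cut where l_a reaches gam. *)
Lemma integral_Fj w : past n v w ->
  (\sum_j \int[leb]_u (Fj j (upd (sv w) n u) *
     (\1_(past n v) w * \1_(`[0, +oo[%classic : set mR) u * jd W S n v j w u)%:E) =
   (T0 w * J w)%:E)%E.
Proof.
move=> pw; have L0 j : 0 <= L w j by rewrite (le_trans ler01)// L_ge1.
have mfl (m : V) : measurable_fun setT (fun u : mR => flow i (L w) u m).
  rewrite /flow; have [<-|im] := eqVneq i m.
    rewrite (_ : (fun u => _) = (fun u => L w i + u)); last by apply/funext => u; rewrite dfwithin.
    by apply: measurable_funD; [exact: measurable_cst|exact: measurable_id].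
  rewrite (_ : (fun u => _) = (fun=> L w m)); last by apply/funext => u; rewrite dfwithout.
  exact: measurable_cst.
rewrite -ge0_integral_sum//; last 2 first.
- move=> j; rewrite /Fj; apply: emeasurable_funM.
    apply/measurable_EFinP; apply: measurable_funM.
      rewrite (_ : (fun u => _) = (fun u : mR => \1_((fun u => flow i (L w) u a) @^-1` `]-oo, gam[) u)).
        by apply: measurable_indic; rewrite -[X in measurable X]setTI; exact: mfl.
      apply/funext => u; rewrite indicE ltvS_updj; congr (_%:R); congr nat_of_bool.
      by apply/idP/idP => [h|/set_mem]; [apply/mem_set; rewrite /= in_itv|rewrite /= in_itv].
    apply: measurable_hh => m; rewrite (_ : (fun u => _) = (fun u => flow i (L w) u m)); first exact: mfl.
    by apply/funext => u; rewrite ltvS_updj.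
  apply/measurable_EFinP; apply: measurable_funM.
    by apply: measurable_funM; [exact: measurable_cst|exact: measurable_indic].
  apply: measurable_funM; first exact: measurable_cst.
  by apply: measurableT_comp => //; apply: measurable_funM => //; exact: measurable_cst.
- move=> j u _; rewrite /Fj ltvS_upd -EFinM lee_fin.
  have [u0|u0] := leP 0 u; last first.
    by rewrite [\1_(`[0, +oo[%classic) u]indicE memNset ?mulr0 ?mul0r ?mulr0//= in_itv/= leNgt u0.
  apply: mulr_ge0; last by rewrite !indicE mulr_ge0// jd_ge0.
  rewrite mulr_ge0// hh_ge0' // => m; rewrite /flow; have [<-|im] := eqVneq i m.
    by rewrite dfwithin (le_trans (L_ge1 w i))// lerDl.
  by rewrite dfwithout// L_ge1.
have E u : (\sum_j Fj j (upd (sv w) n u) *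
     (\1_(past n v) w * \1_(`[0, +oo[%classic : set mR) u * jd W S n v j w u)%:E =
     (\1_(`[0, +oo[%classic : set mR) u * (flow i (L w) u a < gam)%R%:R * fh a W k c i (L w) u)%:E)%E.
  rewrite indicE mem_set// mul1r.
  under eq_bigr => j _ do rewrite /Fj (ltvS_upd (sv w) u) -EFinM.
  rewrite sumEFin; congr EFin; rewrite /fh -(@hh_sum R V a e W hG k c i (L w) (flow i (L w) u)); last first.
    by move=> j ji; rewrite /flow dfwithout// eq_sym.
  rewrite !mulr_sumr; apply: eq_bigr => j _; rewrite /jd rateE (_ : ltv v n.+1 a (upd (sv w) n u) = flow i (L w) u a); last first.
    by rewrite -(ltvS_upd (sv w) u).
  by ring.
rewrite (eq_integral (fun u : mR => (\1_(`[0, +oo[%classic : set mR) u * (flow i (L w) u a < gam)%R%:R * fh a W k c i (L w) u)%:E)); last by move=> u _; exact: E.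
have mfh : measurable_fun setT (fun u : mR => (fh a W k c i (L w) u)%:E).
  by apply/measurable_EFinP; apply: continuous_measurable_fun; first [exact: continuous_fh|exact: (continuous_fh hG)|exact: (continuous_fh hG ca cU)|exact: (continuous_fh a hG)].
rewrite /T0 /J [in RHS]indicE mem_set// mul1r.
have [ia|ia] := eqVneq i a; last first.
  rewrite (eq_integral (fun u : mR => ((ltv v n a (sv w) < gam)%R%:R)%:E *
      ((fun u : mR => (fh a W k c i (L w) u)%:E) \_ `[0%R, +oo[) u)%E); last first.
    move=> u _; rewrite /flow dfwithout// patchE indicE; case: ifP => _.
      by rewrite mul1r EFinM.
    by rewrite !mul0r mule0.
  case: (ltv v n a (sv w) < gam)%R; last first.
    by under eq_integral do rewrite mul0e; rewrite integral0 mul0r.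
  under eq_integral do rewrite mul1e.
  by rewrite -integral_mkcond mul1r (integral_fh_infty hG hk c0 ca cU ia (L_ge1 w)).
have La : L w i = ltv v n a (sv w) by rewrite ia.
have [lt|ge] := ltP (ltv v n a (sv w)) gam; last first.
  rewrite mul0r; apply: integral0_eq => u _; rewrite indicE.
  have [u0|u0] := leP 0 u; last by rewrite memNset ?mul0r//= in_itv/= leNgt u0.
  by rewrite ia /flow dfwithin ltNge (le_trans ge)/= ?mulr0 ?mul0r// lerDl.
rewrite mul1r (eq_integral (fun x : mR => ((fun u : mR => (fh a W k c i (L w) u)%:E) \_ `[0%R, (gam - ltv v n a (sv w))%R[) x)); last first.
  move=> u _; rewrite patchE indicE.
  have [u0|u0] := leP 0 u; last first.
    by rewrite memNset ?mul0r//= ?in_itv/= ?leNgt ?u0// memNset//= in_itv/= leNgt u0.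
  rewrite mem_set/= ?in_itv/= ?u0// mul1r {1}ia /flow dfwithin.
  have [h|h] := ltP (ltv v n a (sv w) + u) gam.
    by rewrite mul1r mem_set//= in_itv/= u0 ltrBrDl.
  by rewrite mul0r memNset//= in_itv/= u0 ltNge lerBlDl h.
rewrite -integral_mkcond integral_itv_bndo_bndc; last exact: measurable_funTS.
first [rewrite (integral_fh hG ca cU) ?subr_gt0//|rewrite (integral_fh hG) ?subr_gt0//|rewrite integral_fh ?subr_gt0//]; congr (_ - _)%:E; rewrite /ex /ph rateE mulNr; congr (_ * _).
by rewrite /flow La -ia subrKC.
Qed.

Lemma exp_law (r t : R) : 0 < t ->
  (\int[leb]_(u in `[0%R, t]) (r * expR (- r * u))%:E = (1 - expR (- r * t))%:E)%E.
Proof.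
move=> t0; have dF u : is_derive u (1 : R) (fun u => - expR (- r * u)) (r * expR (- r * u)).
  have d1 : is_derive u (1 : R) (fun u : R => - r * u) (- r).
    by apply: is_derive_eq (is_deriveZ (- r) (is_derive_id u 1)) _; rewrite /GRing.scale/= mulr1.
  apply: is_derive_eq; rewrite /GRing.scale/= /GRing.scale/=; ring.
have cF : continuous (fun u : R => expR (- r * u)).
  move=> u; apply: (@continuous_comp _ _ _ (fun u => - r * u) expR); last exact: continuous_expR.
  by apply: cvgM; [exact: cvg_cst|exact: cvg_id].
have cF' : continuous (fun u : R => - expR (- r * u)) by move=> u; apply: cvgN; exact: cF.
rewrite (@continuous_FTC2 R _ (fun u => - expR (- r * u)) 0 t t0).
- by rewrite -EFinB mulr0 expR0 opprK addrC.
- by apply: continuous_subspaceT => u; apply: cvgM; [exact: cvg_cst|exact: cF].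
- split.
  + by move=> u _; have [] := dF u.
  + by apply: cvg_at_right_filter; exact: cF'.
  + by apply: cvg_at_left_filter; exact: cF'.
- by move=> u _; rewrite derive1E; have [_] := dF u.
Qed.

Let phi w : R := (i == a)%:R * ph w.
Let Ga (t : nat -> R) : \bar R := ((i == a)%:R%:E * Gt t)%E.

Lemma integral_Gt w : past n v w ->
  (\sum_j \int[leb]_u (Ga (upd (sv w) n u) *
     (\1_(past n v) w * \1_(`[0, +oo[%classic : set mR) u * jd W S n v j w u)%:E) =
   (T0 w * (phi w * (1 - ex w)))%:E)%E.
Proof.
move=> pw; have Lu u : (fun m : V => ltv v n m (upd (sv w) n u)) = L w by apply/funext => m; exact: ltv_upd.
pose B (u : R) : R := (ltv v n a (sv w) < gam)%R%:R * (u < gam - ltv v n a (sv w))%R%:R.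
have GE u : Ga (upd (sv w) n u) = (phi w * B u)%:E.
  rewrite /Ga /Gt Lu (_ : ltv v n a (upd (sv w) n u) = ltv v n a (sv w)); last exact: ltv_upd.
  by rewrite -EFinM /phi /B /ph /upd eqxx; congr EFin; ring.
have phi0 : 0 <= phi w by rewrite mulr_ge0.
have mB : measurable_fun setT B.
  apply: measurable_funM; first exact: measurable_cst.
  rewrite (_ : (fun u => _) = (\1_`]-oo, gam - ltv v n a (sv w)[ : mR -> R)); first exact: measurable_indic.
  apply/funext => u; rewrite indicE; congr (_%:R); congr nat_of_bool.
  by apply/idP/idP => [h|/set_mem]; [apply/mem_set; rewrite /= in_itv|rewrite /= in_itv].
have mj j : measurable_fun setT (fun u : mR => jd W S n v j w u).
  apply: measurable_funM; first exact: measurable_cst.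
  by apply: measurableT_comp => //; apply: measurable_funM => //; exact: measurable_cst.
rewrite -ge0_integral_sum//; last 2 first.
- move=> j; under eq_fun do rewrite GE; apply: emeasurable_funM.
    by apply/measurable_EFinP; apply: measurable_funM => //; exact: measurable_cst.
  apply/measurable_EFinP; apply: measurable_funM => //.
  by apply: measurable_funM; [exact: measurable_cst|exact: measurable_indic].
- move=> j u _; rewrite GE -EFinM lee_fin !indicE /B.
  apply: mulr_ge0; first by apply: mulr_ge0 => //; apply: mulr_ge0.
  by apply: mulr_ge0; [apply: mulr_ge0|apply: jd_ge0].
rewrite /T0 [in RHS]indicE mem_set// mul1r.
have E u : (\sum_j Ga (upd (sv w) n u) * (1 * \1_(`[0, +oo[%classic : set mR) u * jd W S n v j w u)%:E =
   (phi w)%:E * (B u * (\1_(`[0, +oo[%classic : set mR) u * (rate W v n (sv w) * expR (- rate W v n (sv w) * u))))%:E)%E.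
  under eq_bigr => j _ do rewrite GE -EFinM mul1r.
  rewrite sumEFin -EFinM; congr EFin; rewrite {2}/rate !mulr_suml !mulr_sumr.
  by apply: eq_bigr => j _; rewrite /jd; ring.
rewrite indicE mem_set//.
rewrite (eq_integral (fun u : mR => (phi w)%:E * (B u * (\1_(`[0, +oo[%classic : set mR) u * (rate W v n (sv w) * expR (- rate W v n (sv w) * u))))%:E)%E); last by move=> u _; exact: E.
rewrite ge0_integralZl//; last 2 first.
- apply/measurable_EFinP; apply: measurable_funM => //; apply: measurable_funM; first exact: measurable_indic.
  apply: measurable_funM; first exact: measurable_cst.
  by apply: measurableT_comp => //; apply: measurable_funM => //; exact: measurable_cst.
- by move=> u _; rewrite lee_fin /B indicE !mulr_ge0 ?expR_ge0//; apply: rate_ge0.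
rewrite [RHS](_ : _ = ((phi w)%:E * (((ltv v n a (sv w) < gam)%R%:R * (1 - ex w))%:E))%E); last by rewrite -EFinM mulrCA.
congr (_ * _)%E.
have [lt|ge] := ltP (ltv v n a (sv w)) gam; last first.
  by rewrite mul0r; apply: integral0_eq => u _; rewrite /B ltNge ge !mul0r.
rewrite mul1r -exp_law ?subr_gt0// -integral_itv_bndo_bndc; last first.
  apply/measurable_EFinP/measurable_funTS; apply: measurable_funM; first exact: measurable_cst.
  by apply: measurableT_comp => //; apply: measurable_funM => //; exact: measurable_cst.
rewrite [RHS]integral_mkcond; apply: eq_integral => u _; rewrite patchE /B lt mul1r indicE.
have [u0|u0] := leP 0 u; last first.
  rewrite memNset ?mul0r ?mulr0//= ?in_itv/= ?leNgt ?u0//.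
  by rewrite memNset//= in_itv/= leNgt u0.
rewrite mem_set/= ?in_itv/= ?u0// mul1r.
have [h|h] := ltP u (gam - ltv v n a (sv w)).
  by rewrite mul1r mem_set//= in_itv/= u0 h.
by rewrite mul0r memNset//= in_itv/= u0 ltNge h.
Qed.

Let PL : {measure set (Omega * mR) -> \bar R} := (P \x leb)%E.
Lemma joint_sum (F : V -> rspace R n -> \bar R) : (forall j, measurable_fun setT (F j)) ->
  (forall j t, (0 <= F j t)%E) ->
  (\int[P]_w \sum_j (F j (sv w) * (k1 j w)%:E) =
   \int[P]_w \sum_j \int[leb]_u (F j (upd (sv w) n u) *
     (\1_(past n v) w * \1_(`[0, +oo[%classic : set mR) u * jd W S n v j w u)%:E))%E.
Proof.
move=> mF F0.
have ms : measurable_fun setT (fun w => (sv w : rspace R n)).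
  by apply: measurable_to_rspace => m; exact: measurable_sv.
have mu : measurable_fun setT (fun x : Omega * mR => (upd (sv x.1) n x.2 : rspace R n)).
  apply: measurable_to_rspace => m; rewrite /upd; case: (m == n); first exact: (@measurable_snd _ _ Omega mR).
  exact: (measurableT_comp (measurable_sv mS m)).
have mk1 j : measurable_fun setT (fun w => k1 j w).
  apply: measurable_indic; apply: measurableI; first exact: measurable_past.
  rewrite (_ : [set w | _ /\ _] = [set w | (S n w < +oo)%E] `&` [set w | X n.+1 w = j])//.
  by apply: measurableI => //; exact: measurable_Sfin.
have mk2 j : measurable_fun setT (fun x : Omega * mR =>
    (\1_(past n v) x.1 * \1_(`[0, +oo[%classic : set mR) x.2 * jd W S n v j x.1 x.2)).
  apply: measurable_funM; last exact: measurable_jd.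
  apply: measurable_funM.
    have h : measurable_fun setT (\1_(past n v) : Omega -> R).
      by apply: measurable_indic; exact: measurable_past.
    exact: (measurableT_comp h measurable_fst).
  have h : measurable_fun setT (\1_(`[0, +oo[%classic : set mR) : mR -> R) by exact: measurable_indic.
  exact: (measurableT_comp h measurable_snd).
have k20 j w (u : R) : 0 <= \1_(past n v) w * \1_(`[0, +oo[%classic : set mR) u * jd W S n v j w u.
  by rewrite !indicE mulr_ge0//; apply: jd_ge0.
rewrite [LHS]ge0_integral_sum//; last 2 first.
- move=> j; apply: emeasurable_funM; last exact/measurable_EFinP.
  exact: (measurableT_comp (mF j) ms).
- by move=> j w _; rewrite mule_ge0// lee_fin indicE.
rewrite [RHS]ge0_integral_sum//; last 2 first.
- move=> j; apply: (@measurable_fun_fubini_tonelli_F _ _ Omega mR R leb (fun x : Omega * mR =>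
    (F j (upd (sv x.1) n x.2) * (\1_(past n v) x.1 * \1_(`[0, +oo[%classic : set mR) x.2 * jd W S n v j x.1 x.2)%:E)%E)).
    apply: emeasurable_funM; first exact: (measurableT_comp (mF j) mu).
    exact/measurable_EFinP.
  by move=> x; rewrite mule_ge0// lee_fin.
- by move=> j w _; apply: integral_ge0 => u _; rewrite mule_ge0// lee_fin.
by apply: eq_bigr => j _; apply: (joint_law W0 mS mX S_gt0 law v j (mF j)) => t; exact: F0.
Qed.

Lemma past_alive w : past n v w -> \1_(alive n) w = (ltv v n a (sv w) < gam)%R%:R :> R.
Proof.
move=> pw; have [_ fw] := pw; rewrite indicE; congr (_%:R); congr nat_of_bool.
by apply/idP/idP => [/set_mem[_ /=]|h]; [rewrite past_jl|apply/mem_set; split; rewrite //= past_jl].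
Qed.
Lemma pi_running w : pi w * running n w = T0 w * hh i (L w).
Proof.
rewrite /T0; have [pw|pw] := pselect (past n v w); last by rewrite indicE memNset// !mul0r.
rewrite /running past_alive// (pw.1 n (leqnn n)) (_ : jl n w = L w) ?mulrA//.
by apply/funext => j; exact: past_jl.
Qed.
Lemma sum_k1 (F : V -> \bar R) w :
  (\sum_j F j * (k1 j w)%:E = F (X n.+1 w) * (pi w * \1_[set w | (S n w < +oo)%E] w)%:E)%E.
Proof.
rewrite (bigD1 (X n.+1 w))//= big1 => [|j jX]; last first.
  by rewrite past_k1 eq_sym (negPf jX) !mulr0 mule0.
by rewrite adde0 past_k1 eqxx mulr1.
Qed.
Lemma pi_runningS w : ((pi w * running n.+1 w)%:E = \sum_j Fj j (sv w) * (k1 j w)%:E)%E.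
Proof.
rewrite sum_k1; have [pw|pw] := pselect (past n v w); last by rewrite indicE memNset// !mul0r mule0.
rewrite /Fj -EFinM; congr EFin; rewrite /running (_ : jl n.+1 w = (fun j => ltv v n.+1 j (sv w))); last first.
  by apply/funext => j; exact: past_jlS.
rewrite (_ : \1_(alive n.+1) w = \1_[set w | (S n w < +oo)%E] w * (ltv v n.+1 a (sv w) < gam)%R%:R); last first.
  rewrite !indicE; have [h|h] := pselect (S n w < +oo)%E; last first.
    by rewrite !memNset ?mul0r//= => -[/(_ n (ltnSn n))].
  rewrite (mem_set (A := [set w | (S n w < +oo)%E]))// mul1r; congr (_%:R); congr nat_of_bool.
  apply/idP/idP => [/set_mem[_ /=]|h']; first by rewrite past_jlS.
  apply/mem_set; split; rewrite /= ?past_jlS// => m; rewrite ltnS leq_eqVlt => /predU1P[->//|mn].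
  exact: pw.2.
by ring.
Qed.
(* The stopping event is complementary, on the event that X_n = a, to a jump
   before the local time at a reaches gam. *)
Lemma pi_final w : ((pi w * final n w)%:E + \sum_j Ga (sv w) * (k1 j w)%:E = (T0 w * phi w)%:E)%E.
Proof.
rewrite (sum_k1 (fun=> Ga (sv w))) /T0; have [pw|pw] := pselect (past n v w); last first.
  by rewrite indicE memNset// !mul0r mule0 adde0.
rewrite /Ga /Gt -!EFinM -EFinD; congr EFin; rewrite /final /phi /ph (_ : jl n w = L w); last first.
  by apply/funext => j; exact: past_jl.
set h := hh a _; rewrite [pi w]indicE mem_set// !mul1r.
have [Xn _] := pw; rewrite (_ : \1_(stopped n) w = (ltv v n a (sv w) < gam)%R%:R * (i == a)%:R *
    (gam%:E <= (ltv v n a (sv w))%:E + S n w)%E%:R); last first.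
  rewrite -past_alive// !indicE; have [aw|aw] := pselect (alive n w); last first.
    rewrite (memNset (A := stopped n)) ?(memNset (A := alive n)) ?mul0r//.
    by move=> [/aw].
  rewrite (mem_set (A := alive n))// mul1r -natrM mulnb; congr (_%:R); congr nat_of_bool.
  apply/idP/andP => [/set_mem[_ /= []]|[/eqP ia h']].
    by rewrite Xn// past_jl// => -> ->; rewrite eqxx.
  by apply/mem_set; split=> //=; rewrite Xn// past_jl.
have mS' : (w \in [set z | (S n z < +oo)%E]) = (S n w < +oo)%E.
  by apply/idP/idP => [/set_mem|h']; [|apply/mem_set].
have S0 := S_gt0 n w; rewrite [\1_[set z | (S n z < +oo)%E] w]indicE mS' (_ : sv w n = fine (S n w))//.
move: (ltv v n a (sv w)) => x; case: (S n w) S0 => [r| |]// S0.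
  rewrite ltry mulr1 -[(x%:E + r%:E)%E]/((x + r)%:E) lee_fin ltrBrDl.
  by have [|] := leP gam (x + r) => _; rewrite /=; ring.
have -> : (gam%:E <= x%:E + +oo)%E by rewrite addey// leey.
have -> : (+oo < +oo :> \bar R)%E = false by rewrite ltxx.
by rewrite /= !mulr0 addr0 mulr1; ring.
Qed.

Let mrate : measurable_fun setT (fun w => rate W v n (sv w)).
Proof.
by apply: measurable_sum_seq => j _; apply: measurable_funM; [exact: measurable_cst|exact: mltv].
Qed.
Let mex : measurable_fun setT ex.
Proof.
apply: measurableT_comp => //; apply: measurable_funM; first exact: measurableT_comp.
by apply: measurable_funB => //; exact: measurable_cst.
Qed.
Let mphi : measurable_fun setT phi.
Proof. by apply: measurable_funM => //; exact: measurable_cst. Qed.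
Let phi_ge0 w : 0 <= phi w. Proof. by rewrite mulr_ge0. Qed.
Let ex_le1 w : T0 w != 0 -> ex w <= 1.
Proof.
rewrite /T0; have [h|h] := ltP (ltv v n a (sv w)) gam; last by rewrite mulr0 eqxx.
move=> _; rewrite -expR0 ler_expR mulNr oppr_le0 mulr_ge0//; first exact: rate_ge0.
by rewrite subr_ge0 ltW.
Qed.
Let T0Ge w : 0 <= T0 w * (phi w * (1 - ex w)).
Proof.
have [->|h] := eqVneq (T0 w) 0; first by rewrite mul0r.
by rewrite mulr_ge0// mulr_ge0// subr_ge0 ex_le1.
Qed.
Let mFj j : measurable_fun setT (Fj j : rspace R n -> \bar R).
Proof.
have ml (m : V) : measurable_fun setT (fun t : rspace R n => ltv v n.+1 m t).
  apply: measurable_funD => //.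
  rewrite (_ : (fun t => _) = (fun t : rspace R n => \sum_(k < n.+1 | v k == m) t k))//.
  have mk (q : 'I_n.+1) : measurable_fun setT (fun t : rspace R n => t q : mR).
    by apply: measurable_coord; rewrite -ltnS.
  by apply: measurable_sum_seq => q _; exact: mk.
apply/measurable_EFinP; apply: measurable_funM; last exact: measurable_hh.
rewrite (_ : (fun t => _) = (\1_((fun t : rspace R n => ltv v n.+1 a t) @^-1` `]-oo, gam[) : rspace R n -> R)).
  by apply: measurable_indic; rewrite -[X in measurable X]setTI; exact: ml.
apply/funext => t; rewrite indicE; congr (_%:R); congr nat_of_bool.
by apply/idP/idP => [h|/set_mem]; [apply/mem_set; rewrite /= in_itv|rewrite /= in_itv].
Qed.
Let mGa : measurable_fun setT (Ga : rspace R n -> \bar R).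
Proof.
have mk q : (q <= n)%N -> measurable_fun setT (fun t : rspace R n => t q : mR) by exact: measurable_coord.
have ml (m : V) : measurable_fun setT (fun t : rspace R n => ltv v n m t).
  apply: measurable_funD => //.
  rewrite (_ : (fun t => _) = (fun t : rspace R n => \sum_(k < n | v k == m) t k))//.
  by apply: measurable_sum_seq => q _; apply: mk; exact: ltnW.
apply: emeasurable_funM; first exact: measurable_cst.
apply/measurable_EFinP; apply: measurable_funM; last first.
  by apply: measurable_hh => j; apply: measurable_dfwith => //; exact: measurable_cst.
apply: measurable_funM.
  rewrite (_ : (fun t => _) = (\1_((fun t : rspace R n => ltv v n a t) @^-1` `]-oo, gam[) : rspace R n -> R)).
    by apply: measurable_indic; rewrite -[X in measurable X]setTI; exact: ml.
  apply/funext => t; rewrite indicE; congr (_%:R); congr nat_of_bool.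
  by apply/idP/idP => [h|/set_mem]; [apply/mem_set; rewrite /= in_itv|rewrite /= in_itv].
have md : measurable_fun setT (fun t : rspace R n => gam - ltv v n a t - t n).
  apply: measurable_funB; last exact: mk.
  by apply: measurable_funB => //; exact: measurable_cst.
rewrite (_ : (fun t => _) = (\1_((fun t : rspace R n => gam - ltv v n a t - t n) @^-1` `]0, +oo[) : rspace R n -> R)).
  by apply: measurable_indic; rewrite -[X in measurable X]setTI; exact: md.
apply/funext => t; rewrite indicE; congr (_%:R); congr nat_of_bool.
apply/idP/idP => [h|/set_mem]; last by rewrite /= in_itv/= andbT subr_gt0.
by apply/mem_set; rewrite /= in_itv/= andbT subr_gt0.
Qed.
Let sum_past (F : V -> (nat -> R) -> \bar R) w : ~ past n v w ->
  (\sum_j \int[leb]_u (F j (upd (sv w) n u) *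
     (\1_(past n v) w * \1_(`[0, +oo[%classic : set mR) u * jd W S n v j w u)%:E) = 0)%E.
Proof.
move=> pw; rewrite big1// => j _; apply: integral0_eq => u _.
by rewrite indicE memNset// !mul0r mule0.
Qed.

Let mL w : ge1 (dfwith (L w) a gam).
Proof. by move=> j; have [<-|aj] := eqVneq a j; [rewrite dfwithin ltW|rewrite dfwithout// L_ge1]. Qed.
(** One jump of the chain on a given past: what h loses in expectation between
    two jumps is exactly what the stopped process collects in between. *)
Lemma history_step : (\int[P]_w (pi w * running n w)%:E =
  \int[P]_w (pi w * final n w)%:E + \int[P]_w (pi w * running n.+1 w)%:E)%E.
Proof.
have mk1 j : measurable_fun setT (fun w => (k1 j w)%:E).
  apply/measurable_EFinP/measurable_indic; apply: measurableI; first exact: measurable_past.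
  rewrite (_ : [set w | _ /\ _] = [set w | (S n w < +oo)%E] `&` [set w | X n.+1 w = j])//.
  by apply: measurableI => //; exact: measurable_Sfin.
have ms : measurable_fun setT (fun w => (sv w : rspace R n)).
  by apply: measurable_to_rspace => m; exact: measurable_sv.
have mTG : measurable_fun setT (fun w => (T0 w * (phi w * (1 - ex w)))%:E).
  apply/measurable_EFinP; apply: measurable_funM => //; apply: measurable_funM => //.
  by apply: measurable_funB => //; exact: measurable_cst.
have [C [C0 [dl dl0 hC]]] := hh_bound a hG hk c0 gam.
set Cc := (\int[P]_w (T0 w * (phi w * (1 - ex w)))%:E)%E.
have fC : Cc \is a fin_num.
  rewrite ge0_fin_numE; last by apply: integral_ge0 => w _; rewrite lee_fin.
  apply: le_lt_trans (ltry C); rewrite -[leRHS]mule1 -(@probability_setT _ _ _ P) -integral_cst//.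
  apply: ge0_le_integral => //= [w _|w _]; first by rewrite lee_fin.
  rewrite lee_fin; have [->|T0n] := eqVneq (T0 w) 0; first by rewrite mul0r.
  have e1 := ex_le1 T0n; have e0 : 0 <= ex w by exact: expR_ge0.
  have t1 : T0 w <= 1 by rewrite /T0 indicE; case: (w \in _); case: (_ < gam); rewrite ?mul1r ?mul0r.
  have p1 : phi w <= C.
    rewrite (@le_trans _ _ (ph w))//; first by rewrite ler_piMl//; case: (i == a).
    apply: le_trans (hC a _ (mL w) _) _; first by rewrite dfwithin.
    rewrite ler_piMr// -expR0 ler_expR oppr_le0 mulr_ge0 ?(ltW dl0)// sumr_ge0// => j _.
    by rewrite (le_trans ler01)// mL.
  rewrite -[leRHS]mul1r ler_pM//; first by rewrite mulr_ge0// subr_ge0.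
  by rewrite (le_trans _ p1)// ler_piMr// lerBlDr lerDl.
have tp (F : V -> rspace R n -> \bar R) (Q : Omega -> R) : (forall j, measurable_fun setT (F j)) ->
   (forall j t, (0 <= F j t)%E) ->
   (forall w, past n v w -> (\sum_j \int[leb]_u (F j (upd (sv w) n u) *
     (\1_(past n v) w * \1_(`[0, +oo[%classic : set mR) u * jd W S n v j w u)%:E) = (T0 w * Q w)%:E)%E) ->
   (\int[P]_w \sum_j (F j (sv w) * (k1 j w)%:E) = \int[P]_w (T0 w * Q w)%:E)%E.
  move=> mF F0 FQ; rewrite joint_sum//; apply: eq_integral => w _.
  have [pw|pw] := pselect (past n v w); first exact: FQ.
  by rewrite sum_past// /T0 indicE memNset// !mul0r.
pose Fp j (t : rspace R n) := maxe (Fj j t) 0.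
pose Gp (t : rspace R n) := maxe (Ga t) 0.
have Fpos j t : (forall m, 0 <= t m) -> Fp j t = Fj j t.
  move=> t0; rewrite /Fp max_l// lee_fin mulr_ge0// hh_ge0// => m.
  by rewrite addr_ge0// sumr_ge0.
have Gpos t : (forall m, 0 <= t m) -> Gp t = Ga t.
  move=> t0; rewrite /Gp max_l// /Ga /Gt mule_ge0// lee_fin; apply: mulr_ge0; first exact: mulr_ge0.
  rewrite hh_ge0// => m; have [<-|am] := eqVneq a m; first by rewrite dfwithin (le_trans ler01)// ltW.
  by rewrite dfwithout// addr_ge0// sumr_ge0.
have Epos (F F' : V -> rspace R n -> \bar R) w : (forall j t, (forall m, 0 <= t m) -> F' j t = F j t) ->
  past n v w ->
  (\sum_j \int[leb]_u (F' j (upd (sv w) n u) *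
     (\1_(past n v) w * \1_(`[0, +oo[%classic : set mR) u * jd W S n v j w u)%:E) =
   \sum_j \int[leb]_u (F j (upd (sv w) n u) *
     (\1_(past n v) w * \1_(`[0, +oo[%classic : set mR) u * jd W S n v j w u)%:E))%E.
  move=> FF _; apply: eq_bigr => j _; apply: eq_integral => u _.
  have [u0|u0] := leP 0 u; last first.
    by rewrite [\1_(`[0, +oo[%classic) u]indicE memNset ?mulr0 ?mul0r ?mule0//= in_itv/= leNgt u0.
  by rewrite FF// => m; rewrite /upd; case: eqP => // _; exact: sv_ge0.
have sp w : forall m, 0 <= sv w m by move=> m; exact: sv_ge0.
have EF : (\int[P]_w (pi w * running n.+1 w)%:E = \int[P]_w (T0 w * J w)%:E)%E.
  rewrite -(tp Fp); first by apply: eq_integral => w _; rewrite pi_runningS; apply: eq_bigr => j _; rewrite Fpos.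
  - by move=> j; apply: measurable_maxe; [exact: mFj|exact: measurable_cst].
  - by move=> j t; rewrite /Fp le_max lexx orbT.
  - by move=> w pw; rewrite (Epos Fj)//; exact: integral_Fj.
have EGG : (\int[P]_w (\sum_j Ga (sv w) * (k1 j w)%:E) = Cc)%E.
  rewrite /Cc -(tp (fun=> Gp) (fun w => phi w * (1 - ex w))); first by apply: eq_integral => w _; apply: eq_bigr => j _; rewrite Gpos.
  - by move=> j; apply: measurable_maxe; [exact: mGa|exact: measurable_cst].
  - by move=> j t; rewrite /Gp le_max lexx orbT.
  - by move=> w pw; rewrite (Epos (fun=> Ga) (fun=> Gp) w (fun j t => Gpos t) pw); exact: integral_Gt.
have TJ0 w : 0 <= T0 w * J w.
  have [pw|pw] := pselect (past n v w); last by rewrite /T0 indicE memNset// !mul0r.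
  rewrite -lee_fin -integral_Fj// -(Epos Fj Fp w Fpos pw) sume_ge0// => j _.
  apply: integral_ge0 => u _; rewrite mule_ge0//; first by rewrite /Fp le_max lexx orbT.
  by rewrite lee_fin !indicE mulr_ge0//; apply: jd_ge0.
have mhL : measurable_fun setT (fun w => hh i (L w)) by apply: measurable_hh.
have mJ : measurable_fun setT J.
  rewrite /J; case: (i == a) => //; apply: measurable_funB => //.
  exact: measurable_funM.
have pr0 m w : 0 <= pi w * running m w by rewrite mulr_ge0 ?running_ge0// indicE.
have pf0 w : 0 <= pi w * final n w by rewrite mulr_ge0 ?final_ge0// indicE.
have mGk : measurable_fun setT (fun w => \sum_j Ga (sv w) * (k1 j w)%:E)%E.
  apply: emeasurable_sum => j; apply: emeasurable_funM => //.
  exact: (measurableT_comp mGa ms).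
have E1 : (\int[P]_w (pi w * final n w)%:E + Cc = \int[P]_w (T0 w * phi w)%:E)%E.
  rewrite -EGG -ge0_integralD//.
  - by apply: eq_integral => w _; exact: pi_final.
  - by move=> w _; rewrite lee_fin.
  - by apply/measurable_EFinP; apply: measurable_funM => //; exact: measurable_final.
  - move=> w _; rewrite sume_ge0// => j _; apply: mule_ge0; last by rewrite lee_fin indicE.
    by rewrite -Gpos// /Gp le_max lexx orbT.
have E2 : (\int[P]_w (T0 w * J w)%:E + \int[P]_w (T0 w * phi w)%:E = \int[P]_w (pi w * running n w)%:E + Cc)%E.
  rewrite /Cc -!ge0_integralD//.
  - apply: eq_integral => w _; rewrite pi_running -!EFinD; congr EFin; rewrite /J /phi.
    by case: (i == a); rewrite /=; ring.
  - by move=> w _; rewrite lee_fin.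
  - by apply/measurable_EFinP; apply: measurable_funM => //; exact: measurable_running.
  - by move=> w _; rewrite lee_fin.
  - by move=> w _; rewrite lee_fin.
  - by apply/measurable_EFinP; exact: measurable_funM.
  - by move=> w _; rewrite lee_fin mulr_ge0.
  - by apply/measurable_EFinP; exact: measurable_funM.
by rewrite -[LHS](@addeK _ Cc _ fC) -E2 -E1 -EF addeA (@addeK _ Cc _ fC) addeC.
Qed.
End OneHistory.

Lemma jl0 w : jl 0 w = fun=> 1.
Proof. by apply/funext => j; rewrite /jump_local_time big_ord0 addr0. Qed.

(* extension of a finite history *)
Let ext n (r : {ffun 'I_n.+1 -> V}) (m : nat) : V := r (inord m).
Let hist n w : {ffun 'I_n.+1 -> V} := [ffun m : 'I_n.+1 => X m w].
Lemma sum_histories n (f : Omega -> R) : (forall w, 0 <= f w) -> measurable_fun setT f ->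
  (forall w, ~ finS n w -> f w = 0) ->
  (\int[P]_w (f w)%:E = \sum_(r : {ffun 'I_n.+1 -> V}) \int[P]_w (\1_(past n (ext r)) w * f w)%:E)%E.
Proof.
move=> f0 mf fz; rewrite -ge0_integral_sum//; last 2 first.
- move=> r; apply/measurable_EFinP; apply: measurable_funM => //.
  by apply: measurable_indic; exact: measurable_past.
- by move=> r w _; rewrite lee_fin mulr_ge0// indicE.
apply: eq_integral => w _; rewrite sumEFin; congr EFin.
have [fw|fw] := pselect (finS n w); last by rewrite fz// big1// => r _; rewrite mulr0.
rewrite (bigD1 (hist n w))//= indicE mem_set ?mul1r; last first.
  by split=> // m mn; rewrite /ext ffunE inordK.
rewrite big1 ?addr0// => r rw; rewrite indicE memNset ?mul0r// => -[h _].
case/eqP: rw; apply/ffunP => m; rewrite ffunE h ?/ext ?inord_val//.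
by rewrite -ltnS.
Qed.

Lemma step n : (\int[P]_w (running n w)%:E =
  \int[P]_w (final n w)%:E + \int[P]_w (running n.+1 w)%:E)%E.
Proof.
rewrite (@sum_histories n (running n)); last 3 first.
- exact: running_ge0.
- exact: measurable_running.
- by move=> w fw; rewrite /running indicE memNset ?mul0r// => -[].
rewrite (@sum_histories n (final n)); last 3 first.
- exact: final_ge0.
- exact: measurable_final.
- by move=> w fw; rewrite /final indicE memNset ?mul0r// => -[[]].
rewrite (@sum_histories n (running n.+1)); last 3 first.
- exact: running_ge0.
- exact: measurable_running.
- move=> w fw; rewrite /running indicE memNset ?mul0r// => -[h _]; apply: fw => m mn.
  by apply: h; rewrite ltnW// ltnS.
by rewrite -big_split/=; apply: eq_bigr => r _; exact: history_step.
Qed.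

Lemma running_le : exists C, 0 <= C /\ exists2 dl, 0 < dl &
  forall n w, running n w <= C /\ forall A, (A%:E <= jump_time S n w)%E -> running n w <= C * expR (- (dl * A)).
Proof.
have [C [C0 [dl dl0 hC]]] := hh_bound a hG hk c0 gam; exists C; split=> //; exists dl => // n w.
have [[fw aw]|h] := pselect (alive n w); last first.
  by rewrite /running indicE memNset// mul0r; split=> // A _; rewrite mulr_ge0// expR_ge0.
have rE : running n w = hh (X n w) (jl n w) by rewrite /running indicE mem_set// mul1r.
have h1 : running n w <= C * expR (- (dl * \sum_j jl n w j)).
  by rewrite rE; apply: hC; [exact: jl_ge1|exact: ltW].
split.
  rewrite (le_trans h1)// ler_piMr// -expR0 ler_expR oppr_le0 mulr_ge0 ?(ltW dl0)// sumr_ge0// => j _.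
  by rewrite (le_trans ler01)// jl_ge1.
move=> A; rewrite /jump_time (_ : (\sum_(m < n) S m w)%E = (\sum_(m < n) sv w m)%:E); last first.
  rewrite -sumEFin; apply: eq_bigr => m _; rewrite /sv fineK// ge0_fin_numE ?fw//.
  exact: ltW.
rewrite lee_fin => hA; rewrite (le_trans h1)// ler_wpM2l// ler_expR lerN2 ler_wpM2l ?(ltW dl0)//.
rewrite (le_trans hA)// /jump_local_time big_split/= ler_wpDl ?sumr_ge0//.
by rewrite (partition_big (fun m : 'I_n => X m w) predT).
Qed.

Lemma running_cvg : (\int[P]_w (running n w)%:E)%E @[n --> \oo] --> 0%E.
Proof.
have [C [C0 [dl dl0 hC]]] := running_le.
have hc w : running n w @[n --> \oo] --> (0 : R).
  apply/cvgrPdist_lt => ep ep0; pose A := C / (ep * dl).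
  have /cvgeyPge/(_ A) := S_infty w; apply: filterS => n hA.
  rewrite sub0r normrN ger0_norm ?running_ge0//.
  have [_ /(_ _ hA) h] := hC n w; rewrite (le_lt_trans h)//.
  have e1 : 1 + dl * A <= expR (dl * A) by exact: expR_ge1Dx.
  rewrite expRN ltr_pdivrMr ?expR_gt0// (lt_le_trans _ (ler_wpM2l (ltW ep0) e1))//.
  by rewrite mulrDr mulr1 /A (_ : ep * (dl * (C / (ep * dl))) = C) ?ltrDr//; field; rewrite !gt_eqF.
rewrite -(integral0 P setT).
apply: (@dominated_cvg _ _ _ P setT measurableT (fun n w => (running n w)%:E) _ (fun=> C%:E)) => //.
- by move=> n; apply/measurable_EFinP; exact: measurable_running.
- by move=> w _; apply: cvg_EFin; [exact: nearW|exact: hc].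
- by apply/integrableP; split; [exact: measurable_cst|rewrite integral_cst//= probability_setT mule1 ltry].
- by move=> n w _; rewrite lee_fin ger0_norm ?running_ge0//; have [] := hC n w.
Qed.

(** No mass escapes: h decays exponentially in the total local time, which
    tends to infinity, so the mass of the running process vanishes. *)
Lemma final_sum : (\sum_(m <oo) \int[P]_w (final m w)%:E = (hh a (fun=> 1))%:E)%E.
Proof.
have r0 : (\int[P]_w (running 0 w)%:E = (hh a (fun=> 1))%:E)%E.
  rewrite (eq_integral (fun=> (hh a (fun=> 1))%:E)); first by rewrite integral_cst//= probability_setT mule1.
  move=> w _; rewrite /running jl0 X0 indicE mem_set ?mul1r//; split=> //=.
  by rewrite /jump_local_time big_ord0 addr0.
have fr m : (0 <= \int[P]_w (running m w)%:E)%E by apply: integral_ge0 => w _; rewrite lee_fin running_ge0.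
have ff m : (0 <= \int[P]_w (final m w)%:E)%E by apply: integral_ge0 => w _; rewrite lee_fin final_ge0.
have ps n : ((hh a (fun=> 1))%:E = \sum_(0 <= m < n) \int[P]_w (final m w)%:E + \int[P]_w (running n w)%:E)%E.
  elim: n => [|n IHn]; first by rewrite big_geq// add0e r0.
  by rewrite big_nat_recr//= -addeA -step.
have fin1 m : (\int[P]_w (running m w)%:E)%E \is a fin_num.
  rewrite ge0_fin_numE//; apply: le_lt_trans (ltry (hh a (fun=> 1))).
  by rewrite (ps m) leeDr// sume_ge0.
apply: cvg_lim => //; rewrite (_ : (fun n => _) = (fun n => (hh a (fun=> 1))%:E - \int[P]_w (running n w)%:E)%E); last first.
  by apply/funext => n; rewrite (ps n) addeK.
rewrite -[X in _ --> X]sube0; apply: cvgeB => //; [exact: cvg_cst|exact: running_cvg].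
Qed.
End Stopping.

(** * The process at the inverse local time *)
Lemma pieces (R : realType) (b : nat -> R) N r : b 0%N <= r < b N ->
  exists2 m, (m < N)%N & b m <= r < b m.+1.
Proof.
elim: N => [/andP[h1 h2]|N IHN /andP[h1 h2]]; first by have := le_lt_trans h1 h2; rewrite ltxx.
have [h|h] := ltP r (b N); last by exists N; rewrite ?ltnSn// h h2.
by have [|m mN hm] := IHN; [rewrite h1 h|exists m => //; rewrite ltnW].
Qed.
Lemma homo_steps (R : realType) (b : nat -> R) : (forall m, b m <= b m.+1) ->
  forall p q, (p <= q)%N -> b p <= b q.
Proof.
by move=> h p q /subnK <-; elim: (q - p)%N => // m IH; rewrite addSn (le_trans IH).
Qed.
Lemma sum_pieces (R : realType) (b : nat -> R) N r (cc : nat -> R) m : (forall m, b m <= b m.+1) ->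
  (m < N)%N -> b m <= r < b m.+1 -> \sum_(q < N) cc q * \1_(`[b q, b q.+1[%classic) r = cc m.
Proof.
move=> hb mN hm; rewrite (bigD1 (Ordinal mN))//= indicE mem_set ?mulr1; last by rewrite /= in_itv.
rewrite big1 ?addr0// => q qm; rewrite indicE memNset ?mulr0//= in_itv/= => /andP[h1 h2].
have {}qm : q != m :> nat by [].
have /andP[h3 h4] := hm; move: qm; rewrite neq_ltn => /orP[qm|qm].
  by have := lt_le_trans h2 (homo_steps hb qm); rewrite ltNge h3.
by have := lt_le_trans h4 (homo_steps hb qm); rewrite ltNge h1.
Qed.
Lemma integral_cst_indic (R : realType) (D A : set (measurableTypeR R)) (c : R) :
  measurable D -> measurable A -> 0 <= c ->
  (\int[@lebesgue_measure R]_(r in D) (c * \1_A r)%:E = c%:E * @lebesgue_measure R (A `&` D))%E.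
Proof.
move=> mD mA c0; under eq_integral do rewrite EFinM.
rewrite ge0_integralZl//; first by rewrite integral_indic.
by apply/measurable_EFinP; exact: measurable_indic.
Qed.

Section StoppedLocalTime.
Context (R : realType) (V : finType) (a : V) (d : measure_display) (Omega : measurableType d).
Variables (X : nat -> Omega -> V) (S : nat -> Omega -> \bar R) (Y : R -> Omega -> V) (gam : R).
Local Notation mR := (measurableTypeR R).
Local Notation leb := (@lebesgue_measure R).
Hypotheses (S_gt0 : forall n w, (0 < S n w)%E)
  (S_infty : forall w, jump_time S n w @[n --> \oo] --> +oo%E)
  (hY : forall w n t, (jump_time S n w <= t%:E < jump_time S n.+1 w)%E -> Y t w = X n w)
  (X0 : forall w, X 0%N w = a) (gam1 : 1 < gam).
Local Notation jl n w := (fun j => jump_local_time X S n j w).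
Local Notation sv := (sv S).
Local Notation finS := (finS S).
Local Notation stopped := (stopped a X S gam).
Implicit Types (w : Omega) (n m : nat) (j : V).

Let sv0 w m : 0 <= sv w m. Proof. exact: sv_ge0. Qed.
Definition Tn n w : R := \sum_(m < n) sv w m.
Lemma Tn_ge0 n w : 0 <= Tn n w. Proof. exact: sumr_ge0. Qed.
Lemma TnS n w : Tn n.+1 w = Tn n w + sv w n. Proof. by rewrite /Tn big_ord_recr. Qed.
Lemma jump_timeE n w : finS n w -> jump_time S n w = (Tn n w)%:E.
Proof.
move=> fw; rewrite /jump_time /Tn -sumEFin; apply: eq_bigr => m _.
by rewrite /sv fineK// ge0_fin_numE ?fw// ltW.
Qed.
Lemma finSW n m w : (m <= n)%N -> finS n w -> finS m w.
Proof. by move=> mn h k km; apply: h; exact: leq_trans mn. Qed.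
Lemma jlS n w j : jump_local_time X S n.+1 j w = jump_local_time X S n j w + (X n w == j)%:R * sv w n.
Proof.
rewrite /jump_local_time big_mkcond big_ord_recr/= -big_mkcond/= addrA; congr (_ + _).
by case: eqP => _; rewrite ?mul1r ?mul0r.
Qed.
Lemma jl_mono n m w j : (n <= m)%N -> jump_local_time X S n j w <= jump_local_time X S m j w.
Proof.
apply: (homo_steps (b := fun n => jump_local_time X S n j w)) => q.
by rewrite jlS lerDl mulr_ge0.
Qed.

(** The path is constant between jumps, so its occupation integral is a finite
    sum of lengths of intervals; the end point t is split off, as Y t is not
    determined by the first n jumps there. *)
Lemma local_timeE n w j t : finS n w -> Tn n w <= t -> (t%:E <= jump_time S n.+1 w)%E ->
  local_time Y j t w = jump_local_time X S n j w + (t - Tn n w) * (X n w == j)%:R.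
Proof.
move=> fw Tt tT; have t0 : 0 <= t by rewrite (le_trans (Tn_ge0 n w)).
pose b m := if (m <= n)%N then Tn m w else t.
have hb m : b m <= b m.+1.
  rewrite /b; case: (ltngtP m n) => mn; rewrite ?lexx//; last by rewrite mn.
  by rewrite TnS lerDl.
have b0 : b 0%N = 0 by rewrite /b /Tn big_ord0.
have bN : b n.+1 = t by rewrite /b ltnn.
have E (r : R) : 0 <= r <= t -> ((Y r w == j)%:R = \sum_(q < n.+1) (X q w == j)%:R * \1_(`[b q, b q.+1[%classic) r +
    (Y t w == j)%:R * \1_[set t] r :> R).
  move=> /andP[r0]; rewrite le_eqVlt => /predU1P[->|rt].
    rewrite [X in _ = _ + _ * X]indicE mem_set// mulr1 big1 ?add0r// => q _.
    rewrite indicE memNset ?mulr0//= in_itv/= => /andP[_]; rewrite ltNge => /negP; apply.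
    by rewrite -[leRHS]bN; apply: (homo_steps hb).
  have [m mn hm] : exists2 m, (m < n.+1)%N & b m <= r < b m.+1.
    by apply: pieces; rewrite b0 bN r0 rt.
  rewrite (_ : \sum_(q < n.+1) _ = (X m w == j)%:R); last first.
    exact: (@sum_pieces _ b n.+1 r (fun q => (X q w == j)%:R) m hb mn hm).
  rewrite [in RHS]indicE memNset ?mulr0; last by move=> /= rt'; rewrite rt' ltxx in rt.
  rewrite addr0 (@hY w m)//; have mn' : (m <= n)%N by rewrite -ltnS.
  rewrite (jump_timeE (finSW mn' fw)) lee_fin; move: hm; rewrite /b mn' => /andP[-> /=].
  case: ifPn => h hr; first by rewrite (jump_timeE (finSW h fw)) lte_fin.
  have -> : m = n by apply/eqP; rewrite eqn_leq mn' leqNgt.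
  by apply: lt_le_trans tT; rewrite lte_fin.
have mpt : measurable ([set t] : set mR) by exact: measurable_set1.
rewrite /local_time /Rintegral.
have hE (r : mR) : r \in (`[0, t]%classic : set mR) -> 0 <= (r : R) <= t.
  by move=> /set_mem; rewrite /= in_itv.
under eq_integral => r hr do rewrite (E r (hE r hr)) EFinD -sumEFin.
rewrite ge0_integralD; [|first [by []|by move=> r _; rewrite sume_ge0// => q _; rewrite lee_fin mulr_ge0// indicE|by move=> r _; rewrite lee_fin mulr_ge0// indicE|by move=> q r _; rewrite lee_fin mulr_ge0// indicE|(apply: emeasurable_sum => q; apply/measurable_EFinP; apply: measurable_funM; [exact: measurable_cst|exact: measurable_indic])|(apply/measurable_EFinP; apply: measurable_funM; [exact: measurable_cst|exact: measurable_indic])|(move=> q; apply/measurable_EFinP; apply: measurable_funM; [exact: measurable_cst|exact: measurable_indic])]|first [by []|by move=> r _; rewrite sume_ge0// => q _; rewrite lee_fin mulr_ge0// indicE|by move=> r _; rewrite lee_fin mulr_ge0// indicE|by move=> q r _; rewrite lee_fin mulr_ge0// indicE|(apply: emeasurable_sum => q; apply/measurable_EFinP; apply: measurable_funM; [exact: measurable_cst|exact: measurable_indic])|(apply/measurable_EFinP; apply: measurable_funM; [exact: measurable_cst|exact: measurable_indic])|(move=> q; apply/measurable_EFinP; apply: measurable_funM; [exact: measurable_cst|exact: measurable_indic])]|first [by []|by move=> r _; rewrite sume_ge0// => q _; rewrite lee_fin mulr_ge0// indicE|by move=> r _; rewrite lee_fin mulr_ge0// indicE|by move=> q r _; rewrite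 lee_fin mulr_ge0// indicE|(apply: emeasurable_sum => q; apply/measurable_EFinP; apply: measurable_funM; [exact: measurable_cst|exact: measurable_indic])|(apply/measurable_EFinP; apply: measurable_funM; [exact: measurable_cst|exact: measurable_indic])|(move=> q; apply/measurable_EFinP; apply: measurable_funM; [exact: measurable_cst|exact: measurable_indic])]|first [by []|by move=> r _; rewrite sume_ge0// => q _; rewrite lee_fin mulr_ge0// indicE|by move=> r _; rewrite lee_fin mulr_ge0// indicE|by move=> q r _; rewrite lee_fin mulr_ge0// indicE|(apply: emeasurable_sum => q; apply/measurable_EFinP; apply: measurable_funM; [exact: measurable_cst|exact: measurable_indic])|(apply/measurable_EFinP; apply: measurable_funM; [exact: measurable_cst|exact: measurable_indic])|(move=> q; apply/measurable_EFinP; apply: measurable_funM; [exact: measurable_cst|exact: measurable_indic])]|first [by []|by move=> r _; rewrite sume_ge0// => q _; rewrite lee_fin mulr_ge0// indicE|by move=> r _; rewrite lee_fin mulr_ge0// indicE|by move=> q r _; rewrite lee_fin mulr_ge0// indicE|(apply: emeasurable_sum => q; apply/measurable_EFinP; apply: measurable_funM; [exact: measurable_cst|exact: measurable_indic])|(apply/measurable_EFinP; apply: measurable_funM; [exact: measurable_cst|exact: measurable_indic])|(move=> q; apply/measurable_EFinP; apply: measurable_funM; [exact: measurable_cst|exact: measurable_indic])]].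
rewrite ge0_integral_sum; [|first [by []|by move=> r _; rewrite sume_ge0// => q _; rewrite lee_fin mulr_ge0// indicE|by move=> r _; rewrite lee_fin mulr_ge0// indicE|by move=> q r _; rewrite lee_fin mulr_ge0// indicE|(apply: emeasurable_sum => q; apply/measurable_EFinP; apply: measurable_funM; [exact: measurable_cst|exact: measurable_indic])|(apply/measurable_EFinP; apply: measurable_funM; [exact: measurable_cst|exact: measurable_indic])|(move=> q; apply/measurable_EFinP; apply: measurable_funM; [exact: measurable_cst|exact: measurable_indic])]|first [by []|by move=> r _; rewrite sume_ge0// => q _; rewrite lee_fin mulr_ge0// indicE|by move=> r _; rewrite lee_fin mulr_ge0// indicE|by move=> q r _; rewrite lee_fin mulr_ge0// indicE|(apply: emeasurable_sum => q; apply/measurable_EFinP; apply: measurable_funM; [exact: measurable_cst|exact: measurable_indic])|(apply/measurable_EFinP; apply: measurable_funM; [exact: measurable_cst|exact: measurable_indic])|(move=> q; apply/measurable_EFinP; apply: measurable_funM; [exact: measurable_cst|exact: measurable_indic])]|first [by []|by move=> r _; rewrite sume_ge0// => q _; rewrite lee_fin mulr_ge0// indicE|by move=> r _; rewrite lee_fin mulr_ge0// indicE|by move=> q r _; rewrite lee_fin mulr_ge0// indicE|(apply: emeasurable_sum => q; apply/measurable_EFinP; apply: measurable_funM; [exact: measurable_cst|exact: measurable_indic])|(apply/measurable_EFinP; apply: measurable_funM; [exact: measurable_cst|exact: measurable_indic])|(move=> q; apply/measurable_EFinP; apply: measurable_funM; [exact: measurable_cst|exact: measurable_indic])]].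
rewrite integral_cst_indic// (_ : leb (_ `&` _) = 0%E) ?mule0 ?adde0; last first.
  apply/eqP; rewrite -measure_le0; apply: le_trans (le_measure _ _ _ (@subIsetl _ _ _)) _; rewrite ?inE//.
    exact: measurableI.
  by apply: (@le_trans _ _ (leb [set t])) => //; rewrite lebesgue_measure_set1.
rewrite (eq_bigr (fun q : 'I_n.+1 => ((X q w == j)%:R * (b q.+1 - b q))%:E)); last first.
  move=> q _; rewrite integral_cst_indic// EFinM; congr (_ * _)%E.
  rewrite setIidl; last first.
    move=> r /=; rewrite !in_itv/= => /andP[h1 h2]; apply/andP; split.
      by rewrite (le_trans _ h1)// -b0; exact: (homo_steps hb).
    by rewrite (le_trans (ltW h2))// -[leRHS]bN; exact: (homo_steps hb).
  rewrite lebesgue_measure_itv/= lte_fin; case: ltP => // h.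
  by rewrite (_ : b q.+1 = b q) ?subrr//; apply/le_anti; rewrite h hb.
rewrite sumEFin/= big_ord_recr/= bN /jump_local_time addrA; congr (_ + _); last first.
  by rewrite {1}/b leqnn mulrC.
congr (_ + _); rewrite [RHS]big_mkcond/=; apply: eq_bigr => q _.
by rewrite /b ltn_ord ltnW ?ltn_ord// TnS addrC addKr; case: eqP => _; rewrite ?mul1r ?mul0r.
Qed.

Lemma jump_timeS n w : jump_time S n.+1 w = (jump_time S n w + S n w)%E.
Proof. by rewrite /jump_time big_ord_recr. Qed.

Lemma local_time_lt n w t : finS n w -> jump_local_time X S n a w < gam -> 0 <= t <= Tn n w ->
  local_time Y a t w < gam.
Proof.
move=> fw ag /andP[t0]; rewrite le_eqVlt => /predU1P[->|tT].
  rewrite (@local_timeE n)//; first by rewrite subrr mul0r addr0.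
  by rewrite jump_timeS (jump_timeE fw) leeDl// ltW.
have [m mn /andP[h1 h2]] : exists2 m, (m < n)%N & Tn m w <= t < Tn m.+1 w.
  by apply: (pieces (b := fun m => Tn m w)); rewrite {1}/Tn big_ord0 t0 tT.
rewrite (@local_timeE m)//; last 2 first.
- by apply: finSW fw; exact: ltnW.
- by rewrite (jump_timeE (finSW mn fw)) lee_fin ltW.
apply: le_lt_trans ag; apply: le_trans (jl_mono w a mn); rewrite jlS lerD2l mulrC ler_wpM2l//.
by move: h2; rewrite TnS => /ltW; rewrite lerBlDl.
Qed.

Lemma stop_time n w : stopped n w ->
  inverse_local_time Y a gam w = Tn n w + (gam - jump_local_time X S n a w) /\
  (fun i => local_time Y i (inverse_local_time Y a gam w) w) = dfwith (jl n w) a gam.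
Proof.
move=> [[fw ag] [Xa hS]]; rewrite /= in ag.
set tau := Tn n w + _.
have tT : (tau%:E <= jump_time S n.+1 w)%E.
  rewrite jump_timeS (jump_timeE fw) /tau EFinD leeD2lE//.
  by rewrite EFinB leeBlDl.
have Tt : Tn n w <= tau by rewrite lerDl subr_ge0 ltW.
have lE j : local_time Y j tau w = jump_local_time X S n j w + (gam - jump_local_time X S n a w) * (a == j)%:R.
  by rewrite (local_timeE j fw Tt tT) Xa /tau [Tn n w + _]addrC addrK.
have st : [set t | 0 < t /\ gam <= local_time Y a t w] tau.
  split; first by rewrite /tau ltr_wpDl ?Tn_ge0// subr_gt0.
  by rewrite lE eqxx mulr1 addrC subrK.
have tE : inverse_local_time Y a gam w = tau.
  apply/le_anti/andP; split; first by apply: ge_inf => //; exists 0 => z [/ltW].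
  apply: lb_le_inf; first by exists tau.
  move=> z [z0 hz]; rewrite leNgt; apply/negP => zt.
  have [h|h] := leP z (Tn n w).
    by have := local_time_lt fw ag; move=> /(_ z); rewrite (ltW z0) h ltNge hz => /(_ isT).
  move: hz; rewrite (@local_timeE n)// ?(ltW h)//; last first.
    by apply: le_trans tT; rewrite lee_fin ltW.
  rewrite Xa eqxx mulr1 leNgt; move/negP; apply.
  by move: zt; rewrite /tau; lra.
split=> //; rewrite tE; apply/funext => j; rewrite lE.
have [<-|aj] := eqVneq a j; first by rewrite dfwithin mulr1 addrC subrK.
by rewrite dfwithout// mulr0 addr0.
Qed.

(** If the local time at a never reaches gam then the infimum is that of the
    empty set, which is 0, and all local times are still equal to 1. *)
Lemma unstopped w : (forall n, ~ stopped n w) ->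
  (fun i => local_time Y i (inverse_local_time Y a gam w) w) = fun=> 1.
Proof.
move=> ns.
have ag n : finS n w -> jump_local_time X S n a w < gam.
  elim: n => [_|n IHn fw]; first by rewrite /jump_local_time big_ord0 addr0.
  have fn : finS n w by exact: finSW fw.
  rewrite jlS; case: eqP => [Xa|_]; last by rewrite mul0r addr0 IHn.
  rewrite mul1r ltNge; apply/negP => h; apply: (ns n); split; first by split => //; exact: IHn.
  split=> //=; rewrite -[S n w]fineK ?ge0_fin_numE ?fw// ?ltW//.
have -> : inverse_local_time Y a gam w = 0.
  rewrite /inverse_local_time (_ : [set t | _] = set0) ?inf0//.
  apply/seteqP; split=> // z [z0 hz].
  have [N hN] : exists N, (z%:E < jump_time S N w)%E.
    have /cvgeyPgt/(_ z) := S_infty w; case=> N _ hN; exists N; exact: (hN N (leqnn N)).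
  have [[|n] hn nmin] := ex_minnP (ex_intro (fun N => z%:E < jump_time S N w)%E N hN).
    by move: hn; rewrite /jump_time big_ord0 lte_fin ltNge (ltW z0).
  have nz : (jump_time S n w <= z%:E)%E.
    by rewrite leNgt; apply/negP => /nmin; rewrite ltnn.
  have fw : finS n w.
    move=> m mn; apply: le_lt_trans (ltry z); apply: le_trans nz.
    by rewrite /jump_time (bigD1 (Ordinal mn))//= leeDl// sume_ge0// => q _; rewrite ltW.
  have Tz : Tn n w <= z by rewrite -lee_fin -jump_timeE.
  move: hz; rewrite (@local_timeE n)//; last exact: ltW.
  have [Xa|_] := eqVneq (X n w) a; last first.
    by rewrite mulr0 addr0 leNgt ag.
  rewrite mulr1 => h; apply: (ns n); split; first by split=> //; exact: ag.
  split=> //=; have : ((z - Tn n w)%:E <= S n w)%E.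
    by rewrite EFinB leeBlDl// -jump_timeE// -jump_timeS ltW.
  move=> h2; apply: (@le_trans _ _ ((jump_local_time X S n a w)%:E + (z - Tn n w)%:E)%E); first by rewrite -EFinD lee_fin.
  by rewrite leeD2lE.
apply/funext => j; rewrite (@local_timeE 0%N)//; last 2 first.
- by rewrite /Tn big_ord0.
- by rewrite jump_timeS /jump_time big_ord0 add0e ltW.
by rewrite /Tn /jump_local_time !big_ord0 subrr mul0r !addr0.
Qed.

Lemma stopped_trivIset : trivIset setT stopped.
Proof.
have h n m w : (n < m)%N -> stopped n w -> stopped m w -> False.
  move=> nm [[_ _] [Xn hn]] [[fm am] _]; have := le_lt_trans (jl_mono w a nm) am.
  rewrite jlS Xn eqxx mul1r ltNge => /negP; apply; rewrite -lee_fin EFinD /sv fineK//.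
  by rewrite ge0_fin_numE ?fm// ltW.
apply/trivIsetP => n m _ _; rewrite neq_ltn => /orP[nm|nm]; apply/seteqP; split=> // w [h1 h2].
  exact: h nm h1 h2.
exact: h nm h2 h1.
Qed.
End StoppedLocalTime.

Section LocalTimeLaw.
Context (R : realType) (V : finType) (a : V) (e : rel V) (W : V -> V -> R).
Hypothesis hG : weighted_graph e W.
Context (d : measure_display) (Omega : measurableType d).
Variables (P : probability Omega R) (X : nat -> Omega -> V) (S : nat -> Omega -> \bar R) (Y : R -> Omega -> V).
Local Notation leb := (@lebesgue_measure R).
Hypotheses (mS : forall n, measurable_fun setT (S n))
  (mX : forall n i, measurable [set w | X n w = i])
  (S_gt0 : forall n w, (0 < S n w)%E)
  (law : forall n v r j (t : R), 0 <= t ->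
        P (history X S n v r `&` [set w | (S n w <= t%:E)%E /\ X n.+1 w = j]) =
        (\int[P]_(w in history X S n v r)
           (\int[lebesgue_measure]_(u in `[0, t])
              (W (v n) j * jump_local_time X S n j w *
               expR (- (\sum_k W (v n) k * jump_local_time X S n k w) * u))
           )%R%:E)%E)
  (S_infty : forall w, jump_time S n w @[n --> \oo] --> +oo%E)
  (hY : forall w n t, (jump_time S n w <= t%:E < jump_time S n.+1 w)%E -> Y t w = X n w)
  (X0 : forall w, X 0%N w = a).
Variables (gam : R).
Hypothesis gam1 : 1 < gam.
Implicit Types (w : Omega) (n : nat) (i j : V).
Local Notation jl n w := (fun j => jump_local_time X S n j w).
Local Notation stopped := (stopped a X S gam).

Definition ST : set Omega := \bigcup_n stopped n.
Definition Lt w i : R := local_time Y i (inverse_local_time Y a gam w) w.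

Let mst n : measurable (stopped n). Proof. by apply: measurable_stopped. Qed.
Lemma measurable_ST : measurable ST. Proof. exact: bigcupT_measurable. Qed.
Lemma Lt_stopped n w : stopped n w -> Lt w = dfwith (jl n w) a gam.
Proof. move=> h; first [exact: (proj2 (stop_time S_gt0 hY h))|exact: (proj2 (stop_time S_gt0 hY gam1 h))|exact: (proj2 (stop_time S_gt0 hY X0 h))|exact: (proj2 (stop_time S_gt0 hY X0 gam1 h))|exact: (proj2 (stop_time S_gt0 S_infty hY h))|exact: (proj2 (stop_time S_gt0 S_infty hY gam1 h))|exact: (proj2 (stop_time S_gt0 S_infty hY X0 h))|exact: (proj2 (stop_time S_gt0 S_infty hY X0 gam1 h))]. Qed.
Lemma Lt_unstopped w : ~ ST w -> Lt w = fun=> 1.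
Proof. by move=> h; first [apply: (unstopped S_gt0 S_infty hY gam1)|apply: (unstopped S_gt0 S_infty hY X0 gam1)] => n hn; apply: h; exists n. Qed.
Lemma Lt_ge1 w : ge1 (Lt w).
Proof.
have [[n _ h]|h] := pselect (ST w) => i; last by rewrite Lt_unstopped.
rewrite (Lt_stopped h); have [<-|ai] := eqVneq a i; first by rewrite dfwithin ltW.
by rewrite dfwithout// lerDl sumr_ge0// => m _; rewrite fine_ge0// ltW.
Qed.
Lemma measurable_Lt i : measurable_fun setT (fun w => Lt w i).
Proof.
rewrite -(setUv ST) measurable_funU//; [split|exact: measurable_ST|exact/measurableC/measurable_ST].
  apply/measurable_fun_bigcup => // n.
  apply: (eq_measurable_fun (fun w => dfwith (jl n w) a gam i)) => [w /set_mem h|].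
    by rewrite (Lt_stopped h).
  apply: measurable_funTS; apply: measurable_dfwith => [j|]; last exact: measurable_cst.
  exact: measurable_jl.
apply: (eq_measurable_fun (fun _ : Omega => 1 : R)) => [w /set_mem h|]; first by rewrite Lt_unstopped.
exact: measurable_cst.
Qed.

(** On the stopping event G_k is a constant multiple of h, hence the value at
    the starting point of the conserved quantity. *)
Lemma ST_gauss (k : V -> R) : (forall i, \sum_j W i j < k i) ->
  (\int[P]_(w in ST) (eval (gauss_obs W k) (Lt w))%:E =
   (gam * expR (zconst W k) * expR (- 2^-1 * (elim_on (enum (predC1 a)) (Amat W k) a a * (gam ^+ 2 - 1))))%:E)%E.
Proof.
move=> hk; have uU : uniq (enum (predC1 a)) by exact: enum_uniq.
have hA := Amat_mmatrix hG hk.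
have [c [c0 cb cU']] := mmatrix_solve (b := fun=> 1) uU hA (fun=> ler01).
have ca : c a = 1 by apply: cb; rewrite mem_enum !inE eqxx.
have cU i : i != a -> \sum_j Amat W k i j * c j = 0.
  by move=> ia; apply: cU'; rewrite mem_enum !inE.
have eE : elim_on (enum (predC1 a)) (Amat W k) a a = k a - bb W c a.
  have := elim_apply a uU hA cU'; rewrite (Amat_sum W k) ca mulr1 -/(bb W c a) => <-.
  rewrite (bigD1 a)//= big1 ?addr0 ?ca ?mulr1// => j ja.
  have jU : j \in enum (predC1 a) by rewrite mem_enum !inE.
  by have [-> _] := elim_zero a uU hA jU; rewrite mul0r.
have fs := final_sum hG mS mX S_gt0 law S_infty X0 hk c0 ca cU gam1.
pose kap := gam * expR (2^-1 * (bb W c a - k a) * gam ^+ 2).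
have qE l : quadf (Amat W k) l = quadf (Amat W (KK a W k c)) l + (k a - bb W c a) * l a ^+ 2.
  have E kk : quadf (Amat W kk) l = \sum_i kk i * l i ^+ 2 - \sum_i \sum_j W i j * l i * l j.
    exact: quadf_AmatE.
  rewrite !E (bigD1 a)//= [X in _ = X - _ + _](bigD1 a)//= /KK eqxx.
  rewrite (eq_bigr (fun i => KK a W k c i * l i ^+ 2)); last by move=> i ia; rewrite /KK (negPf ia).
  by rewrite /KK; ring.
have GE n w : stopped n w -> eval (gauss_obs W k) (Lt w) = kap * final a W X S k c gam n w.
  move=> h; rewrite /final indicE mem_set// mul1r (Lt_stopped h) eval_gauss_obs qE dfwithin.
  rewrite /hh /qq ca mul1r (bigD1 a)//= dfwithin /kap.
  rewrite mulrDr expRD (_ : - 2^-1 * ((k a - bb W c a) * gam ^+ 2) = 2^-1 * (bb W c a - k a) * gam ^+ 2); last by ring.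
  set x := \prod_(i | _) _; set y := expR (2^-1 * _ * _); set z := expR _; ring.
have kap0 : 0 <= kap by rewrite mulr_ge0 ?expR_ge0// (le_trans ler01)// ltW.
have mG : measurable_fun setT (fun w => (eval (gauss_obs W k) (Lt w))%:E).
  apply/measurable_EFinP; rewrite (_ : (fun w => _) = (fun w => (\prod_i Lt w i) * expR (- 2^-1 * quadf (Amat W k) (Lt w)))).
    apply: measurable_funM; first by apply: measurable_prod_seq => i _; exact: measurable_Lt.
    by apply: (measurableV_quad _ _ measurable_Lt).
  by apply/funext => w; rewrite eval_gauss_obs.
have G0 w : 0 <= eval (gauss_obs W k) (Lt w).
  by rewrite eval_gauss_obs mulr_ge0 ?expR_ge0// prodr_ge0// => i _; rewrite (le_trans ler01)// Lt_ge1.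
rewrite /ST ge0_integral_bigcup//; last 3 first.
- exact: measurable_funTS.
- by move=> w _; rewrite lee_fin.
- by apply: stopped_trivIset.
rewrite (eq_eseriesr (g := fun n => kap%:E * \int[P]_w (final a W X S k c gam n w)%:E)%E); last first.
  move=> n _; rewrite -ge0_integralZl//; last 2 first.
  - by apply/measurable_EFinP; apply: measurable_final.
  - by move=> w _; rewrite lee_fin; apply: final_ge0.
  rewrite integral_mkcond; apply: eq_integral => w _; rewrite patchE.
  case: ifPn => [/set_mem h|h]; first by rewrite (GE n).
  by rewrite /final indicE (negPf h) mul0r mule0.
rewrite nneseriesZl//; last by move=> n _; apply: integral_ge0 => w _; rewrite lee_fin; apply: final_ge0.
rewrite fs -EFinM; congr EFin; rewrite /hh /qq ca mul1r big1 ?mul1r// eE /kap.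
have q1 : quadf (Amat W (KK a W k c)) (fun=> 1) = \sum_i k i - \sum_i \sum_j W i j - (k a - bb W c a).
  have := qE (fun=> 1); rewrite expr1n mulr1 => h.
  have : quadf (Amat W k) (fun=> 1) = \sum_i k i - \sum_i \sum_j W i j.
    rewrite quadf_AmatE; congr (_ - _); first by apply: eq_bigr => i _; rewrite expr1n mulr1.
    by apply: eq_bigr => i _; apply: eq_bigr => j _; rewrite !mulr1.
  by rewrite h => <-; ring.
rewrite q1 /zconst -!mulrA -!expRD; congr (_ * expR _); ring.
Qed.

(** Staying at a for a time gam - 1 from the start is enough. *)
Lemma ST_lower : (1 - (\sum_j W a j * (gam - 1))%:E <= P ST)%E.
Proof.
set t := gam - 1; have t0 : 0 <= t by rewrite subr_ge0 ltW.
have hs : [set w | (t%:E < S 0 w)%E] `<=` ST.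
  move=> w /= h; exists 0%N => //; split; first by split => //=; rewrite /jump_local_time big_ord0 addr0.
  split; first exact: X0.
  by rewrite /jump_local_time big_ord0 addr0 -leeBlDl// -EFinB ltW.
have mt : measurable [set w | (t%:E < S 0 w)%E].
  rewrite (_ : [set w | _] = S 0%N @^-1` `]t%:E, +oo%E]%classic); last first.
    by apply/seteqP; split=> w /=; rewrite in_itv/= leey andbT.
  by rewrite -[X in measurable X]setTI; apply: mS => //; exact: emeasurable_itv.
pose A j : set Omega := [set w | (S 0 w <= t%:E)%E /\ X 1%N w = j].
have mA j : measurable (A j).
  rewrite (_ : A j = S 0%N @^-1` `[-oo%E, t%:E]%classic `&` [set w | X 1%N w = j]); last first.
    by apply/seteqP; split=> w /=; rewrite /A/= in_itv/= leNye.
  apply: measurableI => //; rewrite -[X in measurable X]setTI; apply: mS => //; exact: emeasurable_itv.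
have hc : ~` [set w | (t%:E < S 0 w)%E] `<=` \big[setU/set0]_j A j.
  move=> w /= /negP; rewrite -leNgt => h.
  by rewrite (bigD1 (X 1%N w))//=; left.
have RI (cc r : R) : 0 <= cc -> 0 <= r ->
    (\int[leb]_(u in `[0, t]) (cc * expR (- r * u)))%R <= cc * t.
  move=> cc0 r0; have mE : measurable_fun (`[0, t]%classic : set (measurableTypeR R)) (fun u => (cc * expR (- r * u))%:E).
    apply/measurable_EFinP/measurable_funTS; apply: measurable_funM; first exact: measurable_cst.
    by apply: measurableT_comp => //; apply: measurable_funM => //; exact: measurable_cst.
  have h : (\int[leb]_(u in `[0%R, t]) (cc * expR (- r * u))%:E <= (cc * t)%:E)%E.
    rewrite (_ : (cc * t)%:E = (\int[leb]_(u in `[0%R, t]) cc%:E)%E); last first.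
      have lt : leb (`[0, t]%classic : set (measurableTypeR R)) = t%:E.
        rewrite lebesgue_measure_itv/= lte_fin; case: ltP => h; first by rewrite sube0.
        by congr EFin; apply/le_anti; rewrite h t0.
      by rewrite integral_cst// EFinM -lt.
    apply: ge0_le_integral => //; first by move=> u _; rewrite lee_fin mulr_ge0// expR_ge0.
    move=> u; rewrite /= in_itv/= => /andP[u0 _]; rewrite lee_fin ler_piMr// -expR0 ler_expR.
    by rewrite mulNr oppr_le0 mulr_ge0.
  rewrite /Rintegral -lee_fin fineK// ge0_fin_numE; first exact: le_lt_trans h (ltry _).
  by apply: integral_ge0 => u _; rewrite lee_fin mulr_ge0// expR_ge0.
have hj j : (P (A j) <= (W a j * t)%:E)%E.
  have hT : history X S 0 (fun=> a) (fun=> 0) = setT.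
    by apply/seteqP; split=> // w _; split=> // m; rewrite leqn0 => /eqP ->.
  have := @law 0%N (fun=> a) (fun=> 0) j t t0; rewrite hT setTI => ->.
  have j1 q w : jump_local_time X S 0 q w = 1 by rewrite /jump_local_time big_ord0 addr0.
  rewrite (eq_integral (fun=> ((\int[leb]_(u in `[0, t]) (W a j * expR (- (\sum_k W a k) * u)))%R)%:E)); last first.
    move=> w _; congr (_%:E); apply: eq_Rintegral => u _; rewrite j1 mulr1.
    by rewrite -(_ : \sum_q W a q * jump_local_time X S 0 q w = \sum_q W a q)//; apply: eq_bigr => q _; rewrite j1 mulr1.
  rewrite integral_cst//= probability_setT mule1 lee_fin; apply: RI; first exact: (Wge0 hG).
  by rewrite sumr_ge0// => q _; exact: (Wge0 hG).
have hs2 (s : seq V) : measurable (\big[setU/set0]_(j <- s) A j) /\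
    (P (\big[setU/set0]_(j <- s) A j) <= (\sum_(j <- s) W a j * t)%:E)%E.
  elim: s => [|j s [m IHs]]; first by rewrite !big_nil measure0.
  rewrite !big_cons; split; first exact: measurableU.
  rewrite EFinD; apply: (@le_trans _ _ (P (A j) + P (\big[setU/set0]_(j <- s) A j))%E); last exact: leeD.
  by apply: measureU2.
have [mU hU] := hs2 (index_enum V).
apply: (@le_trans _ _ (P [set w | (t%:E < S 0 w)%E])); last by apply: le_measure => //; rewrite inE//; exact: measurable_ST.
rewrite -[X in (_ <= P X)%E]setCK probability_setC; last exact: measurableC.
rewrite leeB//; apply: le_trans hU; apply: le_measure; rewrite ?inE//; exact: measurableC.
Qed.

End LocalTimeLaw.

(** * From Gaussian observables to suitable observables *)
Section Uniqueness.
Context (R : realType) (V : finType) (a : V) (e : rel V) (W : V -> V -> R).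
Hypothesis hG : weighted_graph e W.
Variables (c sg : R).
Hypotheses (c_ge1 : 1 <= c) (cs1 : c ^+ 2 - sg ^+ 2 = 1).
Context (d : measure_display) (Omega : measurableType d) (P : probability Omega R).
Variables (ST : set Omega) (L : Omega -> V -> R).
Hypotheses (mST : measurable ST) (mL : forall i, measurable_fun setT (fun w => L w i))
  (L1 : forall w, ge1 (L w)).
Implicit Types (f g F : (V -> R) -> R) (i j : V) (l x y : V -> R) (s t : seq V) (A : {set V}) (n N M : nat).
Local Notation vec := (V -> R).
Local Notation nV := #|V|.
Local Notation jint := (jint a W c sg).
Local Notation Lam := (Lam a W c sg).
Local Notation CB1 := (CB (wt (@wone R V))).
Local Notation px := (@px R V a).
Local Notation py := (@py R V a).
Local Notation leb2 := (@leb2 R V a).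
Local Notation hk k := (forall i, \sum_j W i j < k i).
Local Notation G k := (eval (gauss_obs W k) : vec -> R).

Let clip l : vec := fun i => Num.max 1 (l i).
Let clipE l : ge1 l -> clip l = l.
Proof. by move=> h; apply/funext => i; rewrite /clip max_r. Qed.
Lemma jint_clip J x y : jint J x y = jint (fun A l => J A (clip l)) x y.
Proof.
rewrite /jint; congr (berezin _ (_ * _)); apply: eq_bigr => A _; rewrite clipE// => i.
exact: tb_ge1.
Qed.
Lemma jint_ext J J' x y : (forall A l, ge1 l -> J A l = J' A l) -> jint J x y = jint J' x y.
Proof.
move=> JJ; rewrite /jint; congr (berezin _ (_ * _)); apply: eq_bigr => A _; rewrite JJ// => i.
exact: tb_ge1.
Qed.

Lemma choose_bound (T : Type) (J : T -> {set V} -> vec -> R) :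
  (forall A, exists C M, 0 <= C /\ forall z l, ge1 l -> `|J z A l| <= C * (\prod_i l i) ^+ M) ->
  exists C M, 0 <= C /\ forall z A l, ge1 l -> `|J z A l| <= C * (\prod_i l i) ^+ M.
Proof.
move=> h; have /boolp.choice[cm hcm] : forall A, exists cm : R * nat, 0 <= cm.1 /\
    forall z l, ge1 l -> `|J z A l| <= cm.1 * (\prod_i l i) ^+ cm.2.
  by move=> A; have [C [M hCM]] := h A; exists (C, M).
exists (\sum_A (cm A).1), (\sum_A (cm A).2)%N; split=> [|z A l hl].
  by rewrite sumr_ge0// => A _; have [] := hcm A.
have [_ hA] := hcm A; rewrite (le_trans (hA z l hl))// ler_pM//.
- by have [] := hcm A.
- exact: prodX_ge0.
- by rewrite (bigD1 A)//= lerDl sumr_ge0// => B _; have [] := hcm B.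
- by apply: prodX_le => //; rewrite (bigD1 A)//= leq_addr.
Qed.

Let tA A : seq V := [seq i <- enum V | i \in A].
Let tA_sub A : subseq (tA A) (enum V). Proof. exact: filter_subseq. Qed.
Let tA_size A : (size (tA A) <= nV)%N.
Proof. by rewrite cardE; exact: size_subseq. Qed.

Lemma jet_bound f : CB1 nV f -> exists C M, 0 <= C /\
  forall A l, ge1 l -> `|jet f A l| <= C * (\prod_i l i) ^+ M.
Proof.
move=> cf; have [|C [M [C0 h]]] := @choose_bound unit (fun=> jet f).
  move=> A; have [[b [C [M [C0 hb]]] hf] _] := partials_drv cf (tA_size A).
  exists C, M; split=> // _ l hl; rewrite (le_trans (hf l hl))//.
  by have /andP[_] := hb l hl; rewrite /wone mulr1.
by exists C, M; split=> // A l hl; exact: (h tt).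
Qed.
Let mclip f : mV1 f -> measurableV (fun l => f (clip l)).
Proof.
move=> mf d' T x mx; apply: (mf d' T (fun w => clip (x w))) => [i|w i].
  by apply: measurable_maxr => //; exact: measurable_cst.
by rewrite /clip le_max lexx.
Qed.
Let mjet f A : CB1 nV f -> measurableV (fun l => jet f A (clip l)).
Proof. by move=> cf; have [_ [m _]] := partials_drv cf (tA_size A); exact: mclip. Qed.

Let J f p := jint (jet f) (px p) (py p).
Lemma measurable_J f : CB1 nV f -> measurable_fun setT (fun p => (J f p)%:E).
Proof.
move=> cf; apply/measurable_EFinP; rewrite (_ : J f = fun p => jint (fun A l => jet f A (clip l)) (px p) (py p)).
  by apply: measurable_jint => [i|i|A]; [exact: measurable_px|exact: measurable_py|exact: mjet].
by apply/funext => p; rewrite /J jint_clip.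
Qed.
Lemma integrable_J f : CB1 nV f -> leb2.-integrable setT (fun p => (J f p)%:E).
Proof.
move=> cf; have [C [M [C0 hC]]] := jet_bound cf.
rewrite (_ : (fun p => _) = (fun p => (jint (fun A l => jet f A (clip l)) (px p) (py p))%:E)).
  have h1 A : measurableV (fun l => jet f A (clip l)) by exact: mjet.
  have h2 A l : ge1 l -> `|jet f A (clip l)| <= C * (\prod_i l i) ^+ M.
    by move=> hl; rewrite clipE//; exact: hC.
  exact: (integrable_jint a hG c_ge1 cs1 C0 h1 h2).
by apply/funext => p; rewrite /J jint_clip.
Qed.
Lemma fin_Lam f : CB1 nV f -> Lam (jet f) \is a fin_num.
Proof. by move=> cf; apply: (integrable_fin_num measurableT (integrable_J cf)). Qed.

Lemma partials_add n f g s : CB1 n f -> CB1 n g -> (size s <= n)%N ->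
  eqr (partials s (fun l => f l + g l)) (fun l => partials s f l + partials s g l).
Proof.
move=> cf cg; elim: s => [_ //|i s IHs] /= sn l hl.
rewrite (eqr_partial i (IHs (ltnW sn)) hl).
have [_ [_ /(_ sn i) h1]] := partials_drv cf (ltnW sn).
have [_ [_ /(_ sn i) h2]] := partials_drv cg (ltnW sn).
by have [_ /(_ l hl)] := drvD h1 h2.
Qed.
Lemma partials_scale n (r : R) f s : CB1 n f -> (size s <= n)%N ->
  eqr (partials s (fun l => r * f l)) (fun l => r * partials s f l).
Proof.
move=> cf; elim: s => [_ //|i s IHs] /= sn l hl.
rewrite (eqr_partial i (IHs (ltnW sn)) hl).
have [_ [_ /(_ sn i) h1]] := partials_drv cf (ltnW sn).
by have [_ /(_ l hl)] := drvZ r h1.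
Qed.
Lemma jintZ (r : R) JJ x y : jint (fun A l => r * JJ A l) x y = r * jint JJ x y.
Proof.
rewrite /jint -berezinZ scalerAl scaler_sumr; congr (berezin _ (_ * _)).
by apply: eq_bigr => A _; rewrite scalerA.
Qed.
Lemma jintD JJ J' x y : jint (fun A l => JJ A l + J' A l) x y = jint JJ x y + jint J' x y.
Proof.
rewrite (_ : (fun A l => _) = (fun A l => JJ A l - (-1) * J' A l)); last first.
  by apply/funext => A; apply/funext => l; rewrite mulN1r opprK.
by rewrite jintB jintZ mulN1r opprK.
Qed.

Definition nu f : \bar R := (\int[P]_(w in ST) (f (L w))%:E)%E.
Definition E f := nu f = Lam (jet f).

Let mfL f : mV1 f -> measurable_fun ST (fun w => (f (L w))%:E).
Proof. by move=> mf; apply: measurable_funTS; apply/measurable_EFinP; exact: (mf _ _ L). Qed.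
Lemma integrable_nu f : mV1 f -> bnd f -> P.-integrable ST (fun w => (f (L w))%:E).
Proof.
move=> mf [C hC]; apply: (@le_integrable _ _ _ P ST mST _ (fun=> C%:E)) => //.
- exact: mfL.
- by move=> w _; rewrite /= lee_fin (le_trans (hC _ (L1 w)))// ler_norm.
- apply/integrableP; split; first exact: measurable_cst.
  rewrite integral_cst//= (le_lt_trans (y := `|C%:E| * 1)%E) ?mule1 ?ltry//.
  by rewrite -[leRHS]mule1; apply: lee_wpmul2l => //; exact: probability_le1.
Qed.
Let reg_mV1 f : reg f -> mV1 f. Proof. by move=> [/CB0[]]. Qed.

Lemma E_add f g : reg f -> reg g -> E f -> E g -> E (fun l => f l + g l).
Proof.
move=> rf rg Ef Eg; rewrite /E /nu.
under eq_integral do rewrite EFinD.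
rewrite (integralD mST (integrable_nu (reg_mV1 rf) rf.2) (integrable_nu (reg_mV1 rg) rg.2)).
rewrite -/(nu f) -/(nu g) Ef Eg /Lam -(integralD measurableT (integrable_J rf.1) (integrable_J rg.1)).
apply: eq_integral => p _; rewrite -EFinD /J -jintD; congr EFin; apply: jint_ext => A l hl.
by rewrite /jet (partials_add rf.1 rg.1 (tA_size A))//; exact: ge1_pos.
Qed.
Lemma E_scale (r : R) f : reg f -> E f -> E (fun l => r * f l).
Proof.
move=> rf Ef; rewrite /E /nu.
under eq_integral do rewrite EFinM.
rewrite (integralZl mST (integrable_nu (reg_mV1 rf) rf.2)) -/(nu f) Ef /Lam.
rewrite -(integralZl measurableT (integrable_J rf.1)).
apply: eq_integral => p _; rewrite -EFinM /J -jintZ; congr EFin; apply: jint_ext => A l hl.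
by rewrite /jet (partials_scale _ rf.1 (tA_size A))//; exact: ge1_pos.
Qed.
Lemma E_ext f g : eqr f g -> E f -> E g.
Proof.
move=> fg h; have h2 : (\int[P]_(w in ST) (g (L w))%:E = \int[P]_(w in ST) (f (L w))%:E)%E.
  by apply: eq_integral => w _; rewrite fg//; exact/ge1_pos/L1.
rewrite /E /nu h2 -/(nu f) h; apply: eq_integral => p _; congr EFin; apply: jint_ext => A l hl.
by apply: eqr_partials => //; exact: ge1_pos.
Qed.

Lemma Lam_lim (f_ : nat -> vec -> R) f : (forall n, CB1 nV (f_ n)) -> CB1 nV f ->
  (forall t, subseq t (enum V) ->
     (forall l, ge1 l -> partials t (f_ n) l @[n --> \oo] --> partials t f l) /\
     exists C M, 0 <= C /\ forall n l, ge1 l -> `|partials t (f_ n) l| <= C * (\prod_i l i) ^+ M) ->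
  Lam (jet (f_ n)) @[n --> \oo] --> Lam (jet f).
Proof.
move=> cfn cf h.
have [|C [M [C0 hC]]] := @choose_bound nat (fun n => jet (f_ n)).
  by move=> A; have [_ [C [M [C0 hC]]]] := h _ (tA_sub A); exists C, M; split=> // n l; exact: hC.
have [K [K0 hK]] := jint_bound a hG c_ge1 cs1 M.
have [K2 [K20 hK2]] := jint_bound a hG c_ge1 cs1 0.
have icd : leb2.-integrable setT (fun p => (C * K * (cauchyd (enum (predC1 a)) (px p) * cauchyd (enum (predC1 a)) (py p)))%:E).
  under eq_fun do rewrite EFinM.
  by apply: integrableZl => //; exact: integrable_cauchyd2.
apply: (@dominated_cvg _ _ _ leb2 setT measurableT (fun n p => (J (f_ n) p)%:E) _
  (fun p => (C * K * (cauchyd (enum (predC1 a)) (px p) * cauchyd (enum (predC1 a)) (py p)))%:E)) => //.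
- by move=> n; exact: measurable_J.
- move=> p _; apply: cvg_EFin; first exact: nearW.
  pose b := tb c sg (px p) (py p); have hb : ge1 b by move=> i; exact: tb_ge1.
  have E0 g : J g p = jint (fun A _ => jet g A b) (px p) (py p) by [].
  pose D n := \sum_A `|jet f A b - jet (f_ n) A b|.
  have D0 : D n @[n --> \oo] --> (0 : R).
    rewrite -(_ : \sum_(A : {set V}) (0 : R) = 0); last by rewrite big1.
    rewrite /D; elim: (index_enum _) => [|A r IHr].
      rewrite big_nil (_ : (fun n => _) = (fun=> 0)); first exact: cvg_cst.
      by apply/funext => n; rewrite big_nil.
    rewrite big_cons (_ : (fun n => _) = (fun n => `|jet f A b - jet (f_ n) A b| + \sum_(A <- r) `|jet f A b - jet (f_ n) A b|)); last first.
      by apply/funext => n; rewrite big_cons.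
    apply: cvgD => //; have [/(_ _ hb) hc _] := h _ (tA_sub A).
    rewrite -(normr0 R) -(subrr (jet f A b)); apply: cvg_norm; apply: cvgB => //; exact: cvg_cst.
  have key n : `|J (f_ n) p - J f p| <= D n * K2 * (cauchyd (enum (predC1 a)) (px p) * cauchyd (enum (predC1 a)) (py p)).
    rewrite distrC (E0 f) (E0 (f_ n)) -jintB.
    apply: (hK2 (D n) _ _ _ (px p) (py p)); first by rewrite sumr_ge0.
    - by move=> A l _; rewrite expr0 mulr1 /D (bigD1 A)//= lerDl sumr_ge0.
    - exact: px_a.
    - exact: py_a.
  apply/subr_cvg0; apply: (@norm_cvg0 _ R); apply: (@squeeze_cvgr _ _ _ _ (fun=> 0) (fun n => D n * K2 * (cauchyd (enum (predC1 a)) (px p) * cauchyd (enum (predC1 a)) (py p)))).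
  + near=> n; rewrite normr_ge0/=; exact: key.
  + exact: cvg_cst.
  + rewrite -(mul0r (K2 * (cauchyd (enum (predC1 a)) (px p) * cauchyd (enum (predC1 a)) (py p)))).
    under eq_fun do rewrite -mulrA.
    by apply: cvgM => //; exact: cvg_cst.
- move=> n p _; rewrite /= lee_fin; apply: hK => //; [|exact: px_a|exact: py_a].
  by move=> A l hl; exact: hC.
Unshelve. all: by end_near. Qed.

Lemma nu_lim (f_ : nat -> vec -> R) f (b : vec -> R) : (forall n, mV1 (f_ n)) -> mV1 f ->
  P.-integrable ST (fun w => (b (L w))%:E) ->
  (forall n l, ge1 l -> `|f_ n l| <= b l) ->
  (forall l, ge1 l -> f_ n l @[n --> \oo] --> f l) ->
  nu (f_ n) @[n --> \oo] --> nu f.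
Proof.
move=> mfn mf ib hb hc.
apply: (@dominated_cvg _ _ _ P ST mST (fun n w => (f_ n (L w))%:E) _ (fun w => (b (L w))%:E)) => //.
- by move=> n; exact: mfL.
- by move=> w _; apply: cvg_EFin; [exact: nearW|exact: hc].
- by move=> n w _; rewrite /= lee_fin hb.
Qed.

Lemma E_lim (f_ : nat -> vec -> R) f (b : vec -> R) :
  (forall n, CB1 nV (f_ n)) -> CB1 nV f ->
  (forall t, subseq t (enum V) ->
     (forall l, ge1 l -> partials t (f_ n) l @[n --> \oo] --> partials t f l) /\
     exists C M, 0 <= C /\ forall n l, ge1 l -> `|partials t (f_ n) l| <= C * (\prod_i l i) ^+ M) ->
  P.-integrable ST (fun w => (b (L w))%:E) ->
  (forall n l, ge1 l -> `|f_ n l| <= b l) -> (forall n, E (f_ n)) -> E f.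
Proof.
move=> cfn cf h ib hb En; have [m _] := CB0 cf.
have mn n : mV1 (f_ n) by have [] := CB0 (cfn n).
have h1 := nu_lim mn m ib hb (h [::] (sub0seq _)).1.
have h2 := Lam_lim cfn cf h.
have l1 := cvg_lim (@ereal_hausdorff R) h1; have l2 := cvg_lim (@ereal_hausdorff R) h2.
rewrite /E -l1 -l2; congr (lim (_ @ \oo)); apply/funext => n; exact: En.
Qed.

Hypothesis EG : forall k, hk k -> E (G k).

Lemma E_dens k F : hk k -> CB (wdec (enum V)) nV.+2 F -> E (fun l => G k l * F l).
Proof.
move=> hkk cF; have Elim (f_ : nat -> vec -> R) f : (forall n, reg (f_ n)) -> reg f ->
    (forall t, subseq t (enum V) ->
     (forall l, ge1 l -> partials t (f_ n) l @[n --> \oo] --> partials t f l) /\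
     exists C M, 0 <= C /\ forall n l, ge1 l -> `|partials t (f_ n) l| <= C * (\prod_i l i) ^+ M) ->
    (exists C, forall n l, ge1 l -> `|f_ n l| <= C) -> (forall n, E (f_ n)) -> E f.
  move=> rn rf h [C hC] En.
  have ib : P.-integrable ST (fun w => ((fun _ : vec => C) (L w))%:E).
    by apply: (integrable_nu (f := fun=> C)); [move=> *; exact: measurable_cst|exists `|C|].
  exact: (E_lim (fun n => (rn n).1) rf.1 h ib hC En).
have ep : exists p, enum V = p ++ enum V by exists [::].
have iF j : j \notin enum V -> ind j F by rewrite mem_enum.
exact: (dens_step hG EG E_add E_scale E_ext Elim ep hkk cF iF).
Qed.
End Uniqueness.

Section Regularisation.
Context (R : realType) (V : finType).
Implicit Types (f g F : (V -> R) -> R) (i j : V) (l : V -> R) (s t : seq V) (n N M : nat) (eps : R).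
Local Notation vec := (V -> R).
Local Notation nV := #|V|.
Local Notation CB1 := (CB (wt (@wone R V))).

(** A product of observables inherits the convergence and the bounds of the
    mixed partial derivatives. *)
Definition tame_lim (f_ : nat -> vec -> R) f :=
  forall t, subseq t (enum V) ->
     (forall l, ge1 l -> partials t (f_ n) l @[n --> \oo] --> partials t f l) /\
     exists C M, 0 <= C /\ forall n l, ge1 l -> `|partials t (f_ n) l| <= C * (\prod_i l i) ^+ M.

Lemma tame_limM f (g_ : nat -> vec -> R) g : CB1 nV f -> (forall n, CB1 nV (g_ n)) -> CB1 nV g ->
  tame_lim g_ g -> tame_lim (fun n l => f l * g_ n l) (fun l => f l * g l).
Proof.
move=> cf cgn cg conv t st.
have sz s : subseq s (enum V) -> (size s <= nV)%N by move=> /size_subseq; rewrite -cardE.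
have lb n l : ge1 l -> partials t (fun l => f l * g_ n l) l =
    \sum_(m <- masks (size t)) partials (mask m t) f l * partials (mask (map negb m) t) (g_ n) l.
  by move=> hl; apply: (leibniz cf (cgn n) (sz _ st)); exact: ge1_pos.
split=> [l hl|].
  rewrite (_ : (fun n => partials t _ l) = (fun n => \sum_(m <- masks (size t))
    partials (mask m t) f l * partials (mask (map negb m) t) (g_ n) l)); last first.
    by apply/funext => n; exact: lb.
  rewrite (leibniz cf cg (sz _ st)); last exact: ge1_pos.
  elim: (masks (size t)) => [|m ms IHm].
    rewrite big_nil (_ : (fun n => _) = (fun=> 0)); first exact: cvg_cst.
    by apply/funext => n; rewrite big_nil.
  rewrite big_cons (_ : (fun n => _) = (fun n => partials (mask m t) f l * partials (mask (map negb m) t) (g_ n) l +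
    \sum_(m <- ms) partials (mask m t) f l * partials (mask (map negb m) t) (g_ n) l)); last first.
    by apply/funext => n; rewrite big_cons.
  apply: cvgD => //; apply: cvgM; first exact: cvg_cst.
  by have [h _] := conv _ (mask_subseqs (map negb m) st); exact: h.
suff [D [M [D0 hD]]] : exists D M, 0 <= D /\ forall n l, ge1 l ->
   `|\sum_(m <- masks (size t)) partials (mask m t) f l * partials (mask (map negb m) t) (g_ n) l| <= D * (\prod_i l i) ^+ M.
  by exists D, M; split=> // n l hl; rewrite lb// hD.
elim: (masks (size t)) => [|m ms [D [M [D0 hD]]]].
  by exists 0, 0%N; split=> // n l hl; rewrite big_nil normr0 mul0r.
have [_ [D' [M' [D'0 hD']]]] := conv _ (mask_subseqs (map negb m) st).
have [[b [D2 [M2 [D20 hb]]] hG2] _] := partials_drv cf (sz _ (mask_subseqs m st)).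
exists (D2 * D' + D), (M2 + M' + M)%N; split=> [|n l hl]; first by rewrite addr_ge0 ?mulr_ge0.
rewrite big_cons (le_trans (ler_normD _ _))// mulrDl lerD//.
  have hb2 := le_trans (hG2 l hl) (proj2 (andP (hb l hl))); rewrite /wone mulr1 in hb2.
  rewrite normrM (le_trans (ler_pM _ _ hb2 (hD' n l hl)))// mulrACA -exprD.
  by rewrite ler_wpM2l ?mulr_ge0// prodX_le// leq_addr.
by rewrite (le_trans (hD n l hl))// ler_wpM2l// prodX_le// leq_addl.
Qed.

Definition damp eps l : R := expR (- eps * \sum_i l i ^+ 4).

Let sum4_ge0 l : 0 <= \sum_i l i ^+ 4.
Proof. by rewrite sumr_ge0// => i _; rewrite exprn_even_ge0. Qed.
Lemma damp_le1 eps l : 0 <= eps -> damp eps l <= 1.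
Proof. by move=> e0; rewrite -expR0 ler_expR mulNr oppr_le0 mulr_ge0. Qed.
Lemma CB_sum4 (r : R) n : CB1 n (fun l => r * \sum_i l i ^+ 4).
Proof. by apply: CB_scale => //; apply: CB_sumf => // i; exact: CB_coordX. Qed.
Lemma CB_damp eps n : 0 <= eps -> CB1 n (damp eps).
Proof.
move=> e0; apply: CB_expb; first exact: CB_sum4.
by move=> l _; rewrite mulNr oppr_le0 mulr_ge0.
Qed.

Lemma partials_damp eps t l : uniq t ->
  partials t (damp eps) l = (\prod_(i <- t) (- eps * (4 * l i ^+ 3))) * damp eps l.
Proof.
elim: t l => [|i t IHt] l /=; first by rewrite big_nil mul1r.
move=> /andP[it ut]; rewrite /partial derive1E big_cons.
pose cc := \prod_(j <- t) (- eps * (4 * l j ^+ 3)); pose b := \sum_(j | j != i) l j ^+ 4.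
have dE u : damp eps (dfwith l i u) = expR (- eps * (u ^+ 4 + b)).
  rewrite /damp (bigD1 i)//= dfwithin; congr (expR (_ * (_ + _))).
  by apply: eq_bigr => j ji; rewrite dfwithout// eq_sym.
have E u : partials t (damp eps) (dfwith l i u) = cc * expR (- eps * (u ^+ 4 + b)).
  rewrite IHt// dE; congr (_ * _); apply: eq_big_seq => j jt.
  by rewrite dfwithout//; apply: contraNneq it => ->.
rewrite (_ : (fun u => _) = (fun u => cc * expR (- eps * (u ^+ 4 + b)))); last exact/funext.
have d4 : is_derive (l i) (1 : R) (fun u : R => u ^+ 4) (4 * l i ^+ 3).
  have did := is_derive_id (l i) (1 : R).
  have dsq : is_derive (l i) (1 : R) (fun u : R => u * u) (l i + l i).
    by apply: is_derive_eq (is_deriveM did did) _; rewrite /GRing.scale/= !mulr1.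
  rewrite (_ : (fun u : R => u ^+ 4) = (fun u : R => (u * u) * (u * u))); last by apply/funext => u; ring.
  by apply: is_derive_eq (is_deriveM dsq dsq) _; rewrite /GRing.scale/=; ring.
have d1 : is_derive (l i) (1 : R) (fun u : R => - eps * (u ^+ 4 + b)) (- eps * (4 * l i ^+ 3)).
  apply: is_derive_eq (is_deriveZ (- eps) (is_deriveD d4 (is_derive_cst b (l i) 1))) _.
  by rewrite addr0.
have d3 : is_derive (l i) (1 : R) (fun u : R => cc * expR (- eps * (u ^+ 4 + b)))
    (- eps * (4 * l i ^+ 3) * cc * expR (- eps * (l i ^+ 4 + b))).
  rewrite (_ : (fun u : R => _) = (cc \*: (expR \o (fun u => - eps * (u ^+ 4 + b))) : R -> R)); last exact/funext.
  by apply: is_derive_eq; rewrite /GRing.scale/=; ring.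
by rewrite (@derive_val _ _ _ _ _ _ _ d3) -(dE (l i)) dfwith_self.
Qed.

Lemma damp_tame (eps_ : nat -> R) : (forall n, 0 <= eps_ n <= 1) ->
  eps_ n @[n --> \oo] --> (0 : R) -> tame_lim (fun n => damp (eps_ n)) (fun=> 1).
Proof.
move=> he e0 t st; have ut : uniq t by rewrite (subseq_uniq st) ?enum_uniq.
have d0 : damp 0 = (fun=> 1) by apply/funext => l; rewrite /damp oppr0 mul0r expR0.
have cm (r : R) : (- eps_ n * r) @[n --> \oo] --> - 0 * r.
  by apply: cvgM; [exact: cvgN|exact: cvg_cst].
split=> [l hl|].
  rewrite -d0 partials_damp// (_ : (fun n => _) = (fun n => (\prod_(i <- t) (- eps_ n * (4 * l i ^+ 3))) * damp (eps_ n) l)); last first.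
    by apply/funext => n; rewrite partials_damp.
  apply: cvgM; last first.
    by rewrite /damp; apply: (cvg_comp _ _ (cm _)); exact: continuous_expR.
  elim: (t) => [|i s IHs].
    rewrite big_nil (_ : (fun n => _) = (fun=> 1)); first exact: cvg_cst.
    by apply/funext => n; rewrite big_nil.
  rewrite big_cons (_ : (fun n => _) = (fun n => (- eps_ n * (4 * l i ^+ 3)) * \prod_(i <- s) (- eps_ n * (4 * l i ^+ 3)))); last first.
    by apply/funext => n; rewrite big_cons.
  by apply: cvgM => //; exact: cm.
exists (4 ^+ size t), (3 * size t)%N; split=> [|n l hl]; first exact: exprn_ge0.
have /andP[en0 en1] := he n.
rewrite partials_damp// normrM (@le_trans _ _ (`|\prod_(i <- t) (- eps_ n * (4 * l i ^+ 3))| * 1))//.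
  by rewrite ler_wpM2l// ger0_norm ?expR_ge0// damp_le1.
rewrite mulr1 exprM -exprMn; elim: (t) => [|i s IHs]; first by rewrite big_nil normr1 expr0.
rewrite big_cons normrM [size _]/= [X in _ <= X]exprS ler_pM//.
have l0 : 0 <= l i by rewrite (le_trans ler01).
rewrite mulNr normrN ger0_norm ?mulr_ge0 ?exprn_ge0// -[leRHS]mul1r ler_pM ?mulr_ge0 ?exprn_ge0//.
by rewrite ler_wpM2l// lerXn2r ?nnegrE// ?le_prod// (le_trans l0)// le_prod.
Qed.
End Regularisation.

Section Conclusion.
Context (R : realType) (V : finType) (a : V) (e : rel V) (W : V -> V -> R).
Hypothesis hG : weighted_graph e W.
Variables (c sg : R).
Hypotheses (c_ge1 : 1 <= c) (cs1 : c ^+ 2 - sg ^+ 2 = 1).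
Context (d : measure_display) (Omega : measurableType d) (P : probability Omega R).
Variables (ST : set Omega) (L : Omega -> V -> R).
Hypotheses (mST : measurable ST) (mL : forall i, measurable_fun setT (fun w => L w i))
  (L1 : forall w, ge1 (L w)).
Implicit Types (f g F : (V -> R) -> R) (i j : V) (l : V -> R) (n N M : nat).
Local Notation vec := (V -> R).
Local Notation nV := #|V|.
Local Notation CB1 := (CB (wt (@wone R V))).
Local Notation hk k := (forall i, \sum_j W i j < k i).
Local Notation G k := (eval (gauss_obs W k) : vec -> R).
Local Notation E := (E a W c sg P ST L).
Local Notation nu := (nu P ST L).
Local Notation Lam := (Lam a W c sg).
Hypothesis EG : forall k, hk k -> E (G k).

Lemma gauss_damp_bound k eps N : 0 < eps -> hk k -> exists2 K, 0 <= K & forall l, ge1 l ->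
  (\prod_i l i) ^+ N * expR (2^-1 * quadf (Amat W k) l + - eps * \sum_i l i ^+ 4) <=
  K * expR (- (2 * \sum_i l i ^+ 2)).
Proof.
move=> e0 hkk; have W0 := Wge0 hG.
have k0 i : 0 <= k i by rewrite (le_trans _ (ltW (hkk i)))// sumr_ge0.
pose B := N%:R + 2^-1 * (\sum_i k i) + 2.
exists (expR (nV%:R * (B ^+ 2 / (4 * eps)))) => [|l hl]; first exact: expR_ge0.
have l0 i : 0 <= l i by rewrite (le_trans ler01).
have T0 : 0 <= \sum_i l i ^+ 2 by rewrite sumr_ge0// => i _; exact: sqr_ge0.
have p1 : (\prod_i l i) ^+ N <= expR (N%:R * \sum_i l i ^+ 2).
  rewrite expRM_natl lerXn2r ?nnegrE ?expR_ge0 ?prodr_ge0//.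
  rewrite expR_sum; apply: ler_prod => i _; rewrite l0/= (@le_trans _ _ (1 + l i ^+ 2)) ?expR_ge1Dx//.
  by rewrite (@le_trans _ _ (l i ^+ 2)) ?lerDr// expr2 ler_peMr.
have q1 : quadf (Amat W k) l <= (\sum_i k i) * \sum_i l i ^+ 2.
  rewrite quadf_AmatE (@le_trans _ _ (\sum_i k i * l i ^+ 2))//.
    by rewrite gerBl sumr_ge0// => i _; rewrite sumr_ge0// => j _; rewrite !mulr_ge0.
  rewrite mulr_suml ler_sum// => i _; rewrite ler_wpM2l// (bigD1 i)//= lerDl sumr_ge0// => j _.
  exact: sqr_ge0.
rewrite (le_trans (ler_wpM2r (expR_ge0 _) p1))// -!expRD ler_expR.
have s4 : B * (\sum_i l i ^+ 2) - eps * \sum_i l i ^+ 4 <= nV%:R * (B ^+ 2 / (4 * eps)).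
  rewrite !mulr_sumr -sumrB (_ : nV%:R * _ = \sum_(i : V) B ^+ 2 / (4 * eps)); last first.
    by rewrite sumr_const mulr_natl.
  apply: ler_sum => i _; rewrite ler_pdivlMr ?mulr_gt0// -subr_ge0.
  rewrite (_ : _ - _ = (B - 2 * eps * l i ^+ 2) ^+ 2) ?sqr_ge0//; ring.
move: q1 s4; rewrite /B !mulrDl.
move: (quadf _ _) (\sum_i l i ^+ 2) (\sum_i l i ^+ 4) (\sum_i k i) (nV%:R * _) => q T S4 kk D.
by move=> q1 s4; lra.
Qed.

Lemma E_damp f eps : 0 < eps -> CB1 nV.+2 f -> E (fun l => f l * damp eps l).
Proof.
move=> e0 cf; pose k i := \sum_j W i j + 1.
have hkk : hk k by move=> i; rewrite ltrDl.
pose q l : R := 2^-1 * quadf (Amat W k) l + - eps * \sum_i l i ^+ 4.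
pose Fe l : R := (f l * \prod_i (l i)^-1) * expR (q l).
have cq n : CB1 n q by apply: CB_add; [by move=> l _; exact: ler01|exact: CB_quad|exact: CB_sum4].
have c2 n : CB1 n f -> CB (wt (fun l => expR (q l))) n Fe.
  move=> h; have c1 : CB1 n (fun l => f l * \prod_i (l i)^-1).
    by apply: CB_mul1; [exact: h|apply: CB_prodf => i; exact: CB_coordV].
  apply: CB_mul c1 (CB_exp (cq n)) => l _; first by rewrite /wone mul1r.
    exact: ler01.
  exact: expR_ge0.
have c3 : CB (wdec (enum V)) nV.+2 Fe.
  apply: CB_sub (c2 _ cf) => b [C [N [C0 hb]]]; exists b; last by [].
  have [K K0 hK] := gauss_damp_bound N e0 hkk; exists (C * K) => [|l hl]; first exact: mulr_ge0.
  have /andP[b0 b1] := hb l hl.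
  have b2 : b l <= C * K * expR (- (2 * \sum_i l i ^+ 2)).
    by rewrite (le_trans b1)// -!mulrA ler_wpM2l//; exact: hK.
  split=> [|i _]; rewrite ?b0/= (le_trans b2)//.
    rewrite ler_piMr ?mulr_ge0// -expR0 ler_expR oppr_le0 mulr_ge0// sumr_ge0// => i _.
    exact: sqr_ge0.
  rewrite ler_wpM2l ?mulr_ge0// ler_expR lerN2 ler_wpM2l// (bigD1 i)//= lerDl sumr_ge0// => j _.
  exact: sqr_ge0.
have h := E_dens hG c_ge1 cs1 mST mL L1 EG hkk c3.
move: h; apply: E_ext => // l hl.
rewrite eval_gauss_obs /Fe /q /damp expRD mulNr expRN.
have p1 : (\prod_i l i) * \prod_i (l i)^-1 = 1.
  by rewrite -big_split/= big1// => i _; rewrite mulfV// gt_eqF.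
have e1 : expR (2^-1 * quadf (Amat W k) l) != 0 by rewrite gt_eqF ?expR_gt0.
move: p1 e1; move: (\prod_i l i) (\prod_i (l i)^-1) (expR (2^-1 * quadf (Amat W k) l)) (expR (- eps * \sum_i l i ^+ 4)) (f l) => p p' x y z pp x0.
by transitivity ((p * p') * (x^-1 * x) * (z * y)); [ring|rewrite pp mulVf// !mul1r].
Qed.

Let ep n : R := harmonic n.
Let ep0 n : 0 < ep n. Proof. by rewrite /ep /harmonic invr_gt0. Qed.
Let ep1 n : 0 <= ep n <= 1.
Proof. by rewrite ltW//= /ep /harmonic invf_le1// ler1n. Qed.
Let tame f : CB1 nV.+2 f -> tame_lim (fun n l => f l * damp (ep n) l) f.
Proof.
move=> cf; have cf' : CB1 nV f by apply: CBW cf; rewrite ltnW.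
rewrite -[X in tame_lim _ X](_ : (fun l => f l * 1) = f); last by apply/funext => l; rewrite mulr1.
apply: tame_limM => //; [by move=> n; apply: CB_damp; rewrite ltW|exact: CB_cst|].
by apply: damp_tame => //; exact: cvg_harmonic.
Qed.
Let CBfd f n m : (m <= nV.+2)%N -> CB1 nV.+2 f -> CB1 m (fun l => f l * damp (ep n) l).
Proof. by move=> mn cf; apply: CB_mul1; [apply: CBW cf|apply: CB_damp; rewrite ltW]. Qed.

Lemma E_dominated f b : CB1 nV.+2 f -> P.-integrable ST (fun w => (b (L w))%:E) ->
  (forall l, ge1 l -> `|f l| <= b l) -> E f.
Proof.
move=> cf ib hb; apply: (E_lim hG c_ge1 cs1 mST mL L1 _ _ (tame cf) ib).
- by move=> n; apply: CBfd => //; rewrite ltnW.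
- by apply: CBW cf; rewrite ltnW.
- move=> n l hl; rewrite normrM (le_trans _ (hb l hl))// ler_piMr// ger0_norm ?expR_ge0//.
  by rewrite damp_le1// ltW.
- by move=> n; exact: E_damp.
Qed.

Lemma CB_prodX N n : CB1 n (fun l => (\prod_i l i) ^+ N).
Proof.
elim: N => [|N IHN]; first exact: CB_cst.
under eq_fun do rewrite exprS.
by apply: CB_mul1 IHN; apply: CB_prodf => i; exact: CB_coord.
Qed.

(** All the moments of the local times are finite, being limits of moments
    which the field controls. *)
Lemma moments N : P.-integrable ST (fun w => ((\prod_i L w i) ^+ N)%:E).
Proof.
pose m l : R := (\prod_i l i) ^+ N.
have cm : CB1 nV.+2 m by exact: CB_prodX.
have m0 w : 0 <= m (L w) by rewrite prodX_ge0.
have mm : measurable_fun setT (fun w => m (L w)) by have [h _] := CB0 cm; exact: (h _ _ L).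
have md n : measurable_fun setT (fun w => damp (ep n) (L w)).
  have h0 : 0 <= ep n by rewrite ltW.
  by have [h _] := CB0 (CB_damp V 0 h0); exact: (h _ _ L).
pose g n w : \bar R := (m (L w) * damp (ep n) (L w))%:E.
have mg n : measurable_fun ST (g n).
  by apply: measurable_funTS; apply/measurable_EFinP; exact: measurable_funM.
have g0 n w : ST w -> (0 <= g n w)%E by move=> _; rewrite lee_fin mulr_ge0 ?expR_ge0.
have ndg w : ST w -> nondecreasing_seq (g^~ w).
  move=> _ p q pq; rewrite lee_fin ler_wpM2l// ler_expR ler_wpM2r ?sumr_ge0// => [i _|].
    by rewrite exprn_even_ge0.
  by rewrite lerN2 /ep /harmonic lef_pV2 ?posrE// ler_nat.
have h1 := cvg_monotone_convergence mST mg g0 ndg.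
have gl w : limn (g^~ w) = (m (L w))%:E.
  apply: cvg_lim => //; apply: cvg_EFin; first exact: nearW.
  by have [h _] := tame cm (sub0seq _); exact: h.
have cm' : CB1 nV m by apply: CBW cm; rewrite ltnW.
have h2 : Lam (jet (fun l => m l * damp (ep n) l)) @[n --> \oo] --> Lam (jet m).
  apply: (Lam_lim hG c_ge1 cs1 _ cm' (tame cm)) => n.
  by apply: CBfd => //; rewrite ltnW.
have eL : (\int[P]_(w in ST) (m (L w))%:E = Lam (jet m))%E.
  have l1 := cvg_lim (@ereal_hausdorff R) (h1 P); have l2 := cvg_lim (@ereal_hausdorff R) h2.
  have gE : (\int[P]_(w in ST) limn (g^~ w) = \int[P]_(w in ST) (m (L w))%:E)%E.
    by apply: eq_integral => w _; exact: gl.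
  rewrite -l2 -gE -l1; congr (lim (_ @ \oo)); apply/funext => n.
  exact: (E_damp (ep0 n) cm).
apply/integrableP; split; first by apply: measurable_funTS; exact/measurable_EFinP.
rewrite (eq_integral (fun w => (m (L w))%:E)); last by move=> w _; rewrite gee0_abs// lee_fin; exact: m0.
rewrite eL ltey_eq; apply/orP; left; first [exact: (fin_Lam a hG c_ge1 cs1 cm')|exact: (fin_Lam hG a c_ge1 cs1 cm')|by apply: (fin_Lam hG)|by apply: fin_Lam].
Qed.

Lemma E_poly f : CB1 nV.+2 f -> E f.
Proof.
move=> cf; have [_ [b [C [N [C0 hb]]] fb]] := CB0 cf.
apply: (E_dominated (b := fun l => C * (\prod_i l i) ^+ N) cf).
  by under eq_fun do rewrite EFinM; apply: integrableZl => //; exact: moments.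
move=> l hl; rewrite (le_trans (fb l hl))//; have /andP[_] := hb l hl.
by rewrite /wone mulr1.
Qed.
End Conclusion.

Section Suitable.
Context (R : realType) (V : finType).
Implicit Types (g : (V -> R) -> R) (i j : V) (l : V -> R) (n N : nat).
Local Notation CB1 := (CB (wt (@wone R V))).

Lemma measurable_continuous g : continuous (g : {ptws V -> R} -> R) -> measurableV g.
Proof.
move=> cg d T x mx.
pose z n w i : R := (Num.floor (n.+1%:R * x w i))%:~R / n.+1%:R.
apply: (@measurable_fun_cvg _ _ _ setT (fun n w => g (z n w))) => [n|w _].
  have mf i (p : int) : measurable [set w | Num.floor (n.+1%:R * x w i) = p].
    rewrite (_ : [set w | _] = (fun w => n.+1%:R * x w i) @^-1` `[p%:~R, (p + 1)%:~R[%classic); last first.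
      apply/seteqP; split=> w /=; rewrite in_itv/=; last exact: floor_def.
      by move=> <-; exact: floor_itv.
    rewrite -[X in measurable X]setTI.
    have mm : measurable_fun setT (fun w => n.+1%:R * x w i).
      by apply: measurable_funM; [exact: measurable_cst|exact: mx].
    by apply: mm => //; exact: measurable_itv.
  have mq (p : {ffun V -> int}) : measurable [set w | forall i, Num.floor (n.+1%:R * x w i) = p i].
    rewrite (_ : [set w | _] = \bigcap_m (if unpickle m is Some i then [set w | Num.floor (n.+1%:R * x w i) = p i] else setT)).
      by apply: bigcapT_measurable => m; case: (unpickle m).
    apply/seteqP; split=> w /= h; first by move=> m _; case: (unpickle m).
    by move=> i; have := h (pickle i) I; rewrite pickleK.
  move=> _ B mB; rewrite setTI.
  pose F (p : {ffun V -> int}) : set T := if `[< B (g (fun i => (p i)%:~R / n.+1%:R)) >]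
    then [set w | forall i, Num.floor (n.+1%:R * x w i) = p i] else set0.
  rewrite (_ : _ @^-1` B = \bigcup_m (if unpickle m is Some p then F p else set0)).
    apply: bigcupT_measurable => m; case: (unpickle m) => // p.
    by rewrite /F; case: ifP => _; [exact: mq|exact: measurable0].
  apply/seteqP; split=> w /=.
    move=> hB; exists (pickle [ffun i => Num.floor (n.+1%:R * x w i)]) => //.
    rewrite pickleK /F; case: asboolP => /= [_ i|nB]; first by rewrite ffunE.
    exfalso; apply: nB; move: hB; rewrite (_ : (fun i => _) = z n w)//.
    by apply/funext => i; rewrite ffunE.
  move=> [m _]; case: (unpickle m) => // p; rewrite /F; case: asboolP => //= hB h.
  rewrite (_ : z n w = (fun i => (p i)%:~R / n.+1%:R))//.
  by apply/funext => i; rewrite /z h.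
have hi i : (fun n => z n w i) @ \oo --> x w i.
  have h0 : (fun n => x w i - harmonic n) @ \oo --> x w i.
    by rewrite -[X in _ --> X]subr0; apply: cvgB; [exact: cvg_cst|exact: cvg_harmonic].
  apply: (@squeeze_cvgr _ _ _ _ (fun n => x w i - harmonic n) (fun=> x w i)) => //; last exact: cvg_cst.
  near=> n; have n0 : 0 < n.+1%:R :> R by [].
  have /andP[h1 h2] := floor_itv (n.+1%:R * x w i); rewrite /z /harmonic; apply/andP; split; last first.
    by rewrite ler_pdivrMr// [X in _ <= X]mulrC.
  rewrite /= ler_pdivlMr// mulrBl mulVf ?gt_eqF// [X in X - _]mulrC lerBlDr ltW//.
  by rewrite (lt_le_trans h2)// intrD.
have hz : (fun n => z n w : {ptws V -> R}) @ \oo --> (x w : {ptws V -> R}).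
  apply/cvg_sup => i.
  have sj : @proj V (fun=> R) i @` setT = setT by apply/seteqP; split=> // r _; exists (fun=> r).
  apply/cvg_image; try exact: sj.
  move=> B /(hi i) hB; exists (@proj V (fun=> R) i @^-1` B); first exact: hB.
  by rewrite image_preimage.
exact: (cvg_comp _ _ hz (cg (x w))).
Unshelve. all: by end_near. Qed.

Lemma wt_poly (K : R) N : 0 <= K -> wt (@wone R V) (fun l => K * (\prod_i l i) ^+ N * wone l).
Proof.
move=> K0; exists K, N; split=> // l hl; rewrite lexx andbT /wone mulr1 mulr_ge0//.
exact: prodX_ge0.
Qed.

Lemma suitable_CB g n : suitable g -> CB1 n g.
Proof.
elim: n g => [|n IHn] g hg.
all: have [sg bg] := hg; have [cg dg] := sg [::]; have [C [N hC]] := bg [::].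
all: have hb : exists2 b, wt (@wone R V) b & forall l, ge1 l -> `|g l| <= b l.
1,3: exists (fun l => (`|C| * (1 + #|V|%:R) ^+ N) * (\prod_i l i) ^+ N * wone l).
1,3: by apply: wt_poly; rewrite mulr_ge0// exprn_ge0// addr_ge0.
1,2: move=> l hl; rewrite (le_trans (hC l hl))// /wone mulr1 -mulrA -exprMn.
1,2: have s0 : 0 <= 1 + \sum_i l i by rewrite addr_ge0// sumr_ge0// => i _; rewrite (le_trans ler01).
1,2: rewrite (@le_trans _ _ (`|C| * (1 + \sum_i l i) ^+ N)) ?ler_wpM2r ?exprn_ge0 ?ler_norm// ler_wpM2l// lerXn2r ?nnegrE//.
1,3: by rewrite mulr_ge0 ?addr_ge0 ?prodr_ge0// => i _; rewrite (le_trans ler01).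
1,2: rewrite mulrDl mul1r lerD ?prod_ge1// mulr_natl -sumr_const ler_sum// => i _; exact: le_prod.
all: split=> //; first by apply: mV1W; exact: measurable_continuous.
move=> i; split; first by move=> l _; exact: dg.
apply: IHn; split=> [s|s]; have e f : partials s (partial i f) = partials (rcons s i) f by rewrite /partials foldr_rcons.
  by rewrite e; exact: sg.
by have [C' [N' h]] := bg (rcons s i); exists C', N'; rewrite e.
Qed.

End Suitable.

Section TotalMass.
Context (R : realType) (V : finType).

Lemma partials_one (s : seq V) : partials s (fun _ : V -> R => 1) = fun=> (s == [::])%:R.
Proof.
elim: s => [//|i s IHs] /=; apply/funext => l; rewrite IHs /partial.
by rewrite (_ : (fun t => _) = cst (s == [::])%:R)// derive1_cst.
Qed.
Lemma suitable_one : suitable (fun _ : V -> R => 1).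
Proof.
split=> s.
  split=> [|i l]; first by rewrite partials_one; exact: cst_continuous.
  by rewrite partials_one; exact: derivable_cst.
by exists 1, 0%N => l _; rewrite partials_one expr0 mulr1; case: (s == _); rewrite ?normr1// normr0.
Qed.

Lemma sum_jet_one (M : lmodType R) (T : {set V} -> M) l :
  \sum_(A : {set V}) jet (fun=> 1) A l *: T A = T finset.set0.
Proof.
rewrite (bigD1 finset.set0)//= big1 ?addr0 => [|A].
  rewrite /jet partials_one (_ : [seq i <- _ | _] = [::]) ?scale1r//.
  by rewrite -(filter_pred0 (enum V)); apply: eq_filter => i; rewrite inE.
case/finset.set0Pn => i iA; rewrite /jet partials_one; case: eqP => [h|_]; last by rewrite scale0r.
have : i \in [seq i <- enum V | i \in A] by rewrite mem_filter iA mem_enum.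
by rewrite h.
Qed.
(** Only the term without partial derivatives remains, and the angle enters the
    others only. *)
Lemma Lam_one (a : V) (W : V -> V -> R) (c sg : R) :
  Lam a W c sg (jet (fun=> 1)) = Lam a W 1 0 (jet (fun=> 1)).
Proof.
apply: eq_integral => p _; congr EFin; rewrite /jint !sum_jet_one; congr (berezin _ (_ * _)).
by rewrite !big_pred0// => i; rewrite inE.
Qed.

Lemma cosh_near1 (p L : R) : p < 1 -> 0 <= L -> exists2 s : R, s != 0 & L * (cosh s - 1) < 1 - p.
Proof.
move=> p1 L0; have eta0 : 0 < 1 - p by rewrite subr_gt0.
pose dl := Num.min 1 ((1 - p) / (L + 1)); have L10 : 0 < L + 1 by lra.
have dl0 : 0 < dl by rewrite lt_min ltr01 divr_gt0.
have dl1 : dl <= 1 by rewrite ge_min lexx.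
have dlL : dl * (L + 1) <= 1 - p by rewrite -ler_pdivlMr// ge_min lexx orbT.
have d1 : 0 < 1 + dl by lra.
exists (ln (1 + dl)); first by rewrite gt_eqF// ln_gt0//; lra.
have cE : cosh (ln (1 + dl)) - 1 = dl ^+ 2 / (2 * (1 + dl)).
  rewrite /cosh expRN lnK ?posrE//; field.
  by rewrite gt_eqF.
rewrite cE; apply: (@le_lt_trans _ _ (L * (dl / 2))).
  rewrite ler_wpM2l// ler_pdivrMr ?mulr_gt0// expr2; nra.
nra.
Qed.
End TotalMass.

Theorem corollary3 (R : realType) (V : finType) (e : rel V) (W : V -> V -> R)
    (hG : weighted_graph e W) (a : V)
    (d : measure_display) (Omega : measurableType d) (P : probability Omega R)
    (Y : R -> Omega -> V) (hY : VRJP P W a Y)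
    (s : R) (hs : s != 0) (g : (V -> R) -> R) (hg : suitable g) :
  'E_P[fun w => g (fun i =>
         local_time Y i (inverse_local_time Y a (cosh s) w) w)]%E =
  h22_expectation e W a (fun Phi =>
    superfun g (fun i => cosh s *: sz (Phi i) + sinh s *: sx (Phi i))).
Proof.
have [X [S [[mS mX] [S_gt0 S_infty] hYX X0 law]]] := hY.
pose ST' u := ST a X S (cosh u); pose L u := Lt a Y (cosh u).
have mST u : measurable (ST' u) by exact: (measurable_ST a mS mX).
have mL u : u != 0 -> forall i, measurable_fun setT (fun w => L u w i).
  by move=> u0; exact: (measurable_Lt a mS mX S_gt0 S_infty hYX (cosh_gt1 u0)).
have L1 u : u != 0 -> forall w, ge1 (L u w).
  by move=> u0; exact: (Lt_ge1 a S_gt0 S_infty hYX (cosh_gt1 u0)).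
have main u f : u != 0 -> suitable f ->
    (\int[P]_(w in ST' u) (f (L u w))%:E = Lam a W (cosh u) (sinh u) (jet f))%E.
  move=> u0 sf; have EG k : (forall i, \sum_j W i j < k i) ->
      E a W (cosh u) (sinh u) P (ST' u) (L u) (eval (gauss_obs W k)).
    move=> hk; have g1 := cosh_gt1 u0; have sg' : (\int[P]_(w in ST' u) (eval (gauss_obs W k) (L u w))%:E = (cosh u * expR (zconst W k) * expR (- 2^-1 * (elim_on (enum (predC1 a)) (Amat W k) a a * (cosh u ^+ 2 - 1))))%:E)%E.
      exact: (ST_gauss hG mS mX S_gt0 law S_infty hYX X0 g1 hk).
    rewrite /E /nu sg'.
    rewrite (Lam_gauss a hG u hk); congr (_ * expR (_ * (_ * _)))%:E.
    by rewrite -(cosh2_sinh2 u) opprB addrC subrK.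
  exact: (E_poly hG (cosh_ge1 u) (cosh2_sinh2 u) (mST u) (mL u u0) (L1 u u0) EG (suitable_CB _ sf)).
have pST u : u != 0 -> P (ST' u) = Lam a W 1 0 (jet (fun=> 1)).
  move=> u0; rewrite -(Lam_one a W (cosh u) (sinh u)) -(main u _ u0 (suitable_one R V)).
  by rewrite integral_cst ?mul1e.
have P1 : P (ST' s) = 1%E.
  have f1 : P (ST' s) \is a fin_num by exact: fin_num_measure.
  have le1 : (P (ST' s) <= 1)%E by exact: probability_le1.
  apply/eqP; rewrite eq_le le1/= leNgt; apply/negP => lt1.
  have [|u u0 hu] := @cosh_near1 R (fine (P (ST' s))) (\sum_j W a j) _ (sumr_ge0 _ (fun j _ => Wge0 hG a j)).
    by rewrite -lte_fin fineK.
  have := ST_lower hG mS mX law X0 (cosh_gt1 u0).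
  rewrite -/(ST' u) pST// -(pST s)// -(fineK f1) -EFinB lee_fin -mulr_suml; lra.
have PN : P (~` ST' s) = 0%E by rewrite probability_setC; [rewrite P1 subee|exact: mST].
rewrite unlock (h22_Lam a hG (cosh s) (sinh s) g) -main// [RHS]integral_mkcond.
have [mg _] := CB0 (suitable_CB 0 hg).
have mf : measurable_fun setT (fun w => (g (L s w))%:E).
  by apply/measurable_EFinP; apply: mg; [exact: mL|exact: L1].
apply: ae_eq_integral => //.
  by apply/(measurable_restrictT _ (mST s)); exact: measurable_funTS.
exists (~` ST' s); split; first exact: measurableC.
  exact: PN.
move=> w /= h hST; apply: h => _; rewrite patchE mem_set//.
Qed.
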